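(* Let $X$ be a normal algebraic variety over an algebraically closed field $k$ of characteristic zero. Let $\mathcal{I} \subseteq \mathcal{O}_{X \times_k X}$ be the ideal sheaf given by the diagonal embedding $\Delta: X \longrightarrow X \times_k X$, and let $j$ be the inclusion map of the non-singular locus of $X \times_k X$ into $X \times_k X$. Then the Kähler differential sheaf $\Omega_{X/k}$ is torsion-free if and only if the natural morphism of sheaves on $X \times_k X$ $$\mathcal{I}^2 \longrightarrow j_* j^* \mathcal{I}^2$$ is surjective.
   Context: An algebraic variety over $k$ is an integral separated scheme of finite type over $k$. The sheaf $\mathcal{I}$ is the ideal sheaf of the closed subscheme $\Delta(X) \subseteq X \times_k X$. The natural morphism $\mathcal{F} \to j_*j^*\mathcal{F}$ is the unit of the adjunction between $j^*$ and $j_*$; since $j$ is an open immersion, $j^*$ is restriction to the open subset, and the morphism sends a section to its restriction to that open subset. A coherent sheaf on the integral scheme $X$ is torsion-free if its torsion subsheaf is zero; for $\Omega_{X/k}$ the torsion subsheaf is the kernel of the natural map $\Omega_{X/k} \to \Omega_{X/k}^{\vee\vee}$ to the double dual. *)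

(* Defs.v *)
From HB Require Import structures.
From mathcomp Require Import all_boot all_order all_algebra generic_quotient.
From mathcomp Require Import boolp classical_sets functions topology.

Set Implicit Arguments.
Unset Strict Implicit.
Unset Printing Implicit Defensive.

Import GRing.Theory.
Local Open Scope ring_scope.
Local Open Scope classical_set_scope.
Local Open Scope quotient_scope.

(* The ring of sections over the empty open set is zero, hence [comPzRingType]
   throughout. *)

Section CommutativeAlgebra.
Variable A : comPzRingType.
Implicit Types (I : set A) (a b f : A).

Definition invertible a : Prop := exists b, a * b = 1.

Definition is_ideal I : Prop :=
  [/\ I 0, forall a b, I a -> I b -> I (a + b) & forall a b, I b -> I (a * b)].

Definition prime_ideal (P : set A) : Prop :=
  [/\ is_ideal P, ~ P 1 & forall a b, P (a * b) -> P a \/ P b].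

Definition ideal_gen n (x : 'I_n -> A) : set A :=
  [set a | exists c : 'I_n -> A, a = \sum_i c i * x i].

Definition noetherian : Prop :=
  forall I, is_ideal I -> exists n (x : 'I_n -> A), I = ideal_gen x.

Definition nonunits : set A := [set a | ~ invertible a].

Definition is_local : Prop := is_ideal nonunits.

Definition is_domain : Prop :=
  (1 : A) <> 0 /\ forall a b, a * b = 0 -> a = 0 \/ b = 0.

Definition prime_chain n (P : nat -> set A) : Prop :=
  (forall i, (i <= n)%N -> prime_ideal (P i)) /\
  (forall i, (i < n)%N -> P i `<` P i.+1).

Definition krull_dim d : Prop :=
  (exists P, prime_chain d P) /\
  (forall n P, prime_chain n P -> (n <= d)%N).

Definition regular_local : Prop :=
  [/\ noetherian, is_local &
      exists d, krull_dim d /\ exists x : 'I_d -> A, nonunits = ideal_gen x].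

(* The equation says that the fraction a / b is a root of the monic polynomial
   X^n + \sum_(i < n) c_i X^i, after multiplication by b^n; the conclusion
   says that a / b lies in A. *)
Definition integrally_closed_domain : Prop :=
  is_domain /\
  forall a b, b <> 0 ->
    (exists n (c : 'I_n -> A),
        a ^+ n + \sum_(i < n) c i * a ^+ i * b ^+ (n - i) = 0) ->
    exists q, a = q * b.

End CommutativeAlgebra.

Definition is_localization (A B : comPzRingType) (f : A)
    (theta : A -> B) : Prop :=
  [/\ invertible (theta f),
      forall b, exists a n, theta f ^+ n * b = theta a &
      forall a, theta a = 0 -> exists n, f ^+ n * a = 0].

Definition finitely_generated_algebra (k A : comPzRingType)
    (kappa : k -> A) : Prop :=
  exists n (x : 'I_n -> A), forall S : set A,
    (forall c, S (kappa c)) -> (forall i, S (x i)) ->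
    (forall a b, S a -> S b -> S (a - b)) ->
    (forall a b, S a -> S b -> S (a * b)) ->
    forall a, S a.

Record opens (T : topologicalType) := Opens {
  oset :> set T;
  oset_open : open oset }.

Definition omem (T : topologicalType) (U : opens T) (x : T) : Prop := oset U x.
Coercion omem : opens >-> Funclass.

Definition otop (T : topologicalType) : opens T := Opens (@openT T).

Definition ocap (T : topologicalType) (U V : opens T) : opens T :=
  Opens (openI (oset_open U) (oset_open V)).

Lemma ocapl (T : topologicalType) (U V : opens T) : ocap U V `<=` U.
Proof. by move=> x []. Qed.

Lemma ocapr (T : topologicalType) (U V : opens T) : ocap U V `<=` V.
Proof. by move=> x []. Qed.

Definition preim (S T : topologicalType) (f : S -> T) (cf : continuous f)
    (U : opens T) : opens S :=
  Opens (open_comp (fun x _ => cf x) (oset_open U)).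

(* The case of the empty cover of the empty set is included. *)
Definition sheaf_axiom (T : topologicalType) (F : opens T -> Type)
    (res : forall U V : opens T, V `<=` U -> F U -> F V) : Prop :=
  forall (U : opens T) (J : Type) (V : J -> opens T)
    (VU : forall j, V j `<=` U), (forall x, U x -> exists j, V j x) ->
  forall s : (forall j, F (V j)),
    (forall i j (W : opens T) (Wi : W `<=` V i) (Wj : W `<=` V j),
        res _ _ Wi (s i) = res _ _ Wj (s j)) ->
  exists! t : F U, forall j, res _ _ (VU j) t = s j.

(* A ringed space over Spec k, for k a field: a topological space with a sheaf
   of k-algebras. *)
Record kringed (k : fieldType) := KRinged {
  space :> topologicalType;
  sec : opens space -> comPzRingType;
  res : forall U V : opens space, V `<=` U -> {rmorphism sec U -> sec V};
  kst : forall U : opens space, {rmorphism k -> sec U};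
  res_id : forall (U : opens _) (UU : U `<=` U) (s : sec U), res UU s = s;
  res_res : forall (U V W : opens _) (VU : V `<=` U) (WV : W `<=` V)
    (WU : W `<=` U) (s : sec U), res WV (res VU s) = res WU s;
  res_kst : forall (U V : opens _) (VU : V `<=` U) c,
    res VU (kst U c) = kst V c;
  sec_sheaf : sheaf_axiom res }.

Arguments sec {k} X U : rename.
Arguments res {k X U V} VU : rename.
Arguments kst {k} X U : rename.

Section Stalk.
Variables (k : fieldType) (X : kringed k) (x : X).

Record pregerm := Pregerm {
  pg_open : opens X;
  pg_mem : pg_open x;
  pg_sec : sec X pg_open }.

HB.instance Definition _ := gen_eqMixin pregerm.
HB.instance Definition _ := gen_choiceMixin pregerm.

Definition same_germ (s t : pregerm) : Prop :=
  exists (W : opens X) (Ws : W `<=` pg_open s) (Wt : W `<=` pg_open t),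
    W x /\ res Ws (pg_sec s) = res Wt (pg_sec t).

Lemma same_germ_refl s : same_germ s s.
Proof.
exists (pg_open s), (fun _ h => h), (fun _ h => h); split=> //; exact: pg_mem.
Qed.

Lemma same_germ_sym s t : same_germ s t -> same_germ t s.
Proof. by move=> [W [Ws [Wt [Wx e]]]]; exists W, Wt, Ws. Qed.

Lemma same_germ_trans s t u : same_germ s t -> same_germ t u -> same_germ s u.
Proof.
move=> [W [Ws [Wt [Wx e]]]] [W' [Wt' [Wu [Wx' e']]]].
pose Y := ocap W W'.
have YW : Y `<=` W by move=> y [].
have YW' : Y `<=` W' by move=> y [].
exists Y, (subset_trans YW Ws), (subset_trans YW' Wu); split=> //.
rewrite -(res_res Ws YW) e (res_res _ _ (subset_trans YW Wt)).
by rewrite -(res_res Wu YW') -e' (res_res _ _ (subset_trans YW Wt)).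
Qed.

Definition germ_rel (s t : pregerm) : bool := `[< same_germ s t >].

Lemma germ_rel_refl : reflexive germ_rel.
Proof. by move=> s; apply/asboolP/same_germ_refl. Qed.
Lemma germ_rel_sym : symmetric germ_rel.
Proof.
by move=> s t; apply/asboolP/asboolP => /same_germ_sym.
Qed.
Lemma germ_rel_trans : transitive germ_rel.
Proof.
move=> t s u /asboolP st /asboolP tu; apply/asboolP; exact: same_germ_trans tu.
Qed.

Canonical germ_equiv :=
  EquivRel germ_rel germ_rel_refl germ_rel_sym germ_rel_trans.

Definition stalk : Type := {eq_quot germ_equiv}.
HB.instance Definition _ := Choice.on stalk.

Definition germ (U : opens X) (Ux : U x) (s : sec X U) : stalk :=
  \pi_{eq_quot germ_equiv} (Pregerm Ux s).

Lemma germ_eq (U : opens X) (Ux : U x) (s : sec X U)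
    (V : opens X) (Vx : V x) (t : sec X V) :
  germ Ux s = germ Vx t <->
  exists (W : opens X) (WU : W `<=` U) (WV : W `<=` V),
    W x /\ res WU s = res WV t.
Proof.
split.
  move=> /eqP; rewrite /germ eqmodE => /asboolP [W [WU [WV h]]].
  by exists W, WU, WV.
by move=> h; apply/eqP; rewrite /germ eqmodE; apply/asboolP.
Qed.

Lemma germ_res (U V : opens X) (VU : V `<=` U) (Vx : V x) (Ux : U x) s :
  germ Vx (res VU s) = germ Ux s.
Proof.
apply/germ_eq; exists V, (fun _ h => h), VU; split=> //.
by rewrite res_id.
Qed.

Lemma stalk_ind (P : stalk -> Prop) :
  (forall (U : opens X) (Ux : U x) s, P (germ Ux s)) -> forall a, P a.
Proof. by move=> h; elim/quotW => -[U Ux s]; exact: h. Qed.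

Definition stalk_op2 (op : forall U, sec X U -> sec X U -> sec X U)
    (a b : stalk) : stalk :=
  let s := repr a in let t := repr b in
  let W := ocap (pg_open s) (pg_open t) in
  @germ W (conj (pg_mem s) (pg_mem t))
    (op W (res (@ocapl _ _ _) (pg_sec s)) (res (@ocapr _ _ _) (pg_sec t))).

Definition stalk_add := stalk_op2 (fun U => +%R).
Definition stalk_mul := stalk_op2 (fun U => *%R).
Definition stalk_opp (a : stalk) : stalk :=
  germ (pg_mem (repr a)) (- pg_sec (repr a)).
Definition stalk_zero : stalk := @germ (otop X) I 0.
Definition stalk_one : stalk := @germ (otop X) I 1.

Lemma stalk_op2E op (op_res : forall (U V : opens X) (VU : V `<=` U) s t,
    res VU (op U s t) = op V (res VU s) (res VU t))
    (U : opens X) (Ux : U x) s t :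
  stalk_op2 op (germ Ux s) (germ Ux t) = germ Ux (op U s t).
Proof.
rewrite /stalk_op2.
set s' := repr (germ Ux s); set t' := repr (germ Ux t).
have es : germ (pg_mem s') (pg_sec s') = germ Ux s.
  by rewrite -[RHS](@reprK _ {eq_quot germ_equiv}) /germ -/s'; case: s'.
have et : germ (pg_mem t') (pg_sec t') = germ Ux t.
  by rewrite -[RHS](@reprK _ {eq_quot germ_equiv}) /germ -/t'; case: t'.
move/germ_eq: es => [W [Ws [WU [Wx es]]]].
move/germ_eq: et => [W' [Wt [WU' [Wx' et]]]].
apply/germ_eq.
pose Y := ocap W W'.
have YW : Y `<=` W by move=> y [].
have YW' : Y `<=` W' by move=> y [].
have Yc : Y `<=` ocap (pg_open s') (pg_open t').
  by move=> y [/Ws ? /Wt ?].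
have YU : Y `<=` U by move=> y /YW /WU.
exists Y, Yc, YU; split=> //.
rewrite !op_res; congr (op Y _ _).
  rewrite (res_res _ _ (subset_trans YW Ws)) -(res_res Ws YW) es.
  by rewrite (res_res _ _ YU).
rewrite (res_res _ _ (subset_trans YW' Wt)) -(res_res Wt YW') et.
by rewrite (res_res _ _ YU).
Qed.

Lemma germD (U : opens X) (Ux : U x) s t :
  stalk_add (germ Ux s) (germ Ux t) = germ Ux (s + t).
Proof. by apply: stalk_op2E => *; rewrite rmorphD. Qed.

Lemma germM (U : opens X) (Ux : U x) s t :
  stalk_mul (germ Ux s) (germ Ux t) = germ Ux (s * t).
Proof. by apply: stalk_op2E => *; rewrite rmorphM. Qed.

Lemma germN (U : opens X) (Ux : U x) s : stalk_opp (germ Ux s) = germ Ux (- s).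
Proof.
rewrite /stalk_opp; set s' := repr (germ Ux s).
have es : germ (pg_mem s') (pg_sec s') = germ Ux s.
  by rewrite -[RHS](@reprK _ {eq_quot germ_equiv}) /germ -/s'; case: s'.
move/germ_eq: es => [W [Ws [WU [Wx es]]]].
by apply/germ_eq; exists W, Ws, WU; split=> //; rewrite !rmorphN es.
Qed.

Lemma germ0 (U : opens X) (Ux : U x) : germ Ux 0 = stalk_zero.
Proof.
by apply/germ_eq; exists U, (fun _ h => h), (fun _ _ => I); rewrite !rmorph0.
Qed.

Lemma germ1 (U : opens X) (Ux : U x) : germ Ux 1 = stalk_one.
Proof.
by apply/germ_eq; exists U, (fun _ h => h), (fun _ _ => I); rewrite !rmorph1.
Qed.

Lemma germ_common2 (U : opens X) (Ux : U x) (s : sec X U)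
    (V : opens X) (Vx : V x) (t : sec X V) :
  exists (W : opens X) (Wx : W x) s' t',
    germ Ux s = @germ W Wx s' /\ germ Vx t = germ Wx t'.
Proof.
exists (ocap U V), (conj Ux Vx), (res (@ocapl _ _ _) s),
  (res (@ocapr _ _ _) t).
by rewrite !germ_res.
Qed.

Lemma stalk_common2 (a b : stalk) :
  exists (W : opens X) (Wx : W x) s t, a = @germ W Wx s /\ b = germ Wx t.
Proof.
elim/stalk_ind: a => U Ux s; elim/stalk_ind: b => V Vx t.
exact: germ_common2.
Qed.

Lemma stalk_common3 (a b c : stalk) :
  exists (W : opens X) (Wx : W x) s t u,
    [/\ a = @germ W Wx s, b = germ Wx t & c = germ Wx u].
Proof.
have [W [Wx [s [t [-> ->]]]]] := stalk_common2 a b.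
elim/stalk_ind: c => V Vx u.
exists (ocap W V), (conj Wx Vx), (res (@ocapl _ _ _) s),
  (res (@ocapl _ _ _) t), (res (@ocapr _ _ _) u).
by rewrite !germ_res.
Qed.

Fact stalk_addA : associative stalk_add.
Proof.
move=> a b c; have [W [Wx [s [t [u [-> -> ->]]]]]] := stalk_common3 a b c.
by rewrite !germD addrA.
Qed.
Fact stalk_addC : commutative stalk_add.
Proof.
move=> a b; have [W [Wx [s [t [-> ->]]]]] := stalk_common2 a b.
by rewrite !germD addrC.
Qed.
Fact stalk_add0 : left_id stalk_zero stalk_add.
Proof. by elim/stalk_ind => U Ux s; rewrite -(germ0 Ux) germD add0r. Qed.
Fact stalk_addN : left_inverse stalk_zero stalk_opp stalk_add.
Proof. by elim/stalk_ind => U Ux s; rewrite germN germD addNr germ0. Qed.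
Fact stalk_mulA : associative stalk_mul.
Proof.
move=> a b c; have [W [Wx [s [t [u [-> -> ->]]]]]] := stalk_common3 a b c.
by rewrite !germM mulrA.
Qed.
Fact stalk_mulC : commutative stalk_mul.
Proof.
move=> a b; have [W [Wx [s [t [-> ->]]]]] := stalk_common2 a b.
by rewrite !germM mulrC.
Qed.
Fact stalk_mul1 : left_id stalk_one stalk_mul.
Proof. by elim/stalk_ind => U Ux s; rewrite -(germ1 Ux) germM mul1r. Qed.
Fact stalk_mulD : left_distributive stalk_mul stalk_add.
Proof.
move=> a b c; have [W [Wx [s [t [u [-> -> ->]]]]]] := stalk_common3 a b c.
by rewrite !(germM, germD) mulrDl.
Qed.

HB.instance Definition _ :=
  GRing.isZmodule.Build stalk stalk_addA stalk_addC stalk_add0 stalk_addN.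
HB.instance Definition _ :=
  GRing.Zmodule_isComPzRing.Build stalk
    stalk_mulA stalk_mulC stalk_mul1 stalk_mulD.

Lemma germ_is_zmod_morphism (U : opens X) (Ux : U x) :
  zmod_morphism (@germ U Ux).
Proof. by move=> s t; rewrite -germD -germN. Qed.
Lemma germ_is_monoid_morphism (U : opens X) (Ux : U x) :
  monoid_morphism (@germ U Ux).
Proof. by split; [exact: germ1 | move=> s t; rewrite -germM]. Qed.
HB.instance Definition _ U Ux :=
  GRing.isZmodMorphism.Build (sec X U) stalk (@germ U Ux)
    (@germ_is_zmod_morphism U Ux).
HB.instance Definition _ U Ux :=
  GRing.isMonoidMorphism.Build (sec X U) stalk (@germ U Ux)
    (@germ_is_monoid_morphism U Ux).

End Stalk.

Arguments germ {k X} x {U} Ux s.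

Section Schemes.
Variable k : fieldType.

(* (U, O_X|_U) is isomorphic to Spec A: phi is a homeomorphism of U onto the
   set of primes of A with the Zariski topology (whose opens are the
   complements of the V(E), E a subset of A), and theta identifies the sections
   over the distinguished open set D(f) with A_f. As the D(f) form a basis,
   this determines the structure sheaf, and the stalk at x is A_(phi x). *)
Definition affine_open (X : kringed k) (U : opens X) : Prop :=
  exists (A : comPzRingType) (phi : X -> set A)
         (theta : {rmorphism A -> sec X U}),
  [/\ set_bij U (@prime_ideal A) phi,
      (forall W : set X, W `<=` U ->
         open W <-> exists E : set A, W = [set x | U x /\ ~ (E `<=` phi x)]) &
      (forall (f : A) (W : opens X) (WU : W `<=` U),
         W = [set x | U x /\ ~ phi x f] :> set X ->
         is_localization f (res WU \o theta))].

Record scheme := Scheme {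
  scheme_space :> kringed k;
  locally_affine : forall x : scheme_space,
    exists U : opens scheme_space, U x /\ affine_open U }.

(* Morphisms over Spec k; [mor_local] says that the maps on stalks are local. *)
Record mor (X Y : kringed k) := Mor {
  mor_fun :> X -> Y;
  mor_cont : continuous mor_fun;
  comor : forall U : opens Y, {rmorphism sec Y U -> sec X (preim mor_cont U)};
  comor_res : forall (U V : opens Y) (VU : V `<=` U)
    (VU' : preim mor_cont V `<=` preim mor_cont U) s,
    res VU' (comor U s) = comor V (res VU s);
  comor_kst : forall U c, comor U (kst Y U c) = kst X (preim mor_cont U) c;
  mor_local : forall (x : X) (U : opens Y) (Ux : U (mor_fun x)) (s : sec Y U),
    invertible (germ x (Ux : preim mor_cont U x) (comor U s)) ->
    invertible (germ (mor_fun x) Ux s) }.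

Arguments comor {X Y} f U : rename.

Definition mor_id (X : kringed k) : mor X X.
Proof.
pose c : continuous (@idfun X) := fun x => cvg_id.
unshelve refine (@Mor X X idfun c
  (fun U => @res k X U (preim c U) (fun _ h => h)) _ _ _).
- by move=> U V VU VU' s; rewrite !(res_res _ _ (VU' : preim c V `<=` U)).
- by move=> U a; rewrite res_kst.
- by move=> x U Ux s; rewrite (germ_res _ _ (Ux : U x)).
Defined.

Definition mor_comp (X Y Z : kringed k) (g : mor Y Z) (f : mor X Y) : mor X Z.
Proof.
pose c : continuous (g \o f) :=
  fun x => continuous_comp (@mor_cont _ _ f x) (@mor_cont _ _ g (f x)).
pose sub (U : opens Z) :
  preim c U `<=` preim (@mor_cont _ _ f) (preim (@mor_cont _ _ g) U) :=
  fun _ h => h.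
unshelve refine (@Mor X Z (g \o f) c
  (fun U => res (sub U) \o comor f (preim (@mor_cont _ _ g) U) \o comor g U)
  _ _ _).
- move=> U V VU VU' s /=.
  pose gVU : preim (@mor_cont _ _ g) V `<=` preim (@mor_cont _ _ g) U :=
    fun y h => VU _ h.
  pose fVU : preim (@mor_cont _ _ f) (preim (@mor_cont _ _ g) V) `<=`
      preim (@mor_cont _ _ f) (preim (@mor_cont _ _ g) U) := fun y h => VU _ h.
  pose h := fun t (y : preim c V t) => sub U t (VU' t y).
  rewrite -(comor_res VU gVU) -(comor_res gVU fVU).
  by rewrite (res_res _ _ h) (res_res _ _ h).
- by move=> U a /=; rewrite !comor_kst res_kst.
- move=> x U Ux s /= inv.
  apply: (@mor_local _ _ g (f x) U Ux s).
  apply: (@mor_local _ _ f x (preim (@mor_cont _ _ g) U) Ux (comor g U s)).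
  have e := germ_res (sub U) Ux Ux (comor f _ (comor g U s)).
  by move: inv; rewrite e.
Defined.

Definition is_fibre_product (X Y Z : scheme) (p : mor Z X) (q : mor Z Y) :
    Prop :=
  forall (T : scheme) (f : mor T X) (g : mor T Y),
    exists! h : mor T Z, mor_comp p h = f /\ mor_comp q h = g.

Definition is_diagonal (X Z : kringed k) (p q : mor Z X) (D : mor X Z) : Prop :=
  mor_comp p D = mor_id X /\ mor_comp q D = mor_id X.

Definition closed_immersion (X Y : kringed k) (f : mor X Y) : Prop :=
  [/\ injective f,
      (forall C : set X, closed C -> closed (f @` C)) &
      (forall (U : opens Y) (s : sec X (preim (@mor_cont _ _ f) U)) y, U y ->
         exists (W : opens Y) (_ : W `<=` U)
           (WU' : preim (@mor_cont _ _ f) W `<=` preim (@mor_cont _ _ f) U)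
           (t : sec Y W), W y /\ comor f W t = res WU' s)].

Definition separated (X : scheme) : Prop :=
  forall (Z : scheme) (p q : mor Z X) (D : mor X Z),
    is_fibre_product p q -> is_diagonal p q D -> closed_immersion D.

Definition integral_scheme (X : scheme) : Prop :=
  [set: X] !=set0 /\ forall U : opens X, U !=set0 -> is_domain (sec X U).

Definition finite_type (X : scheme) : Prop :=
  exists n (U : 'I_n -> opens X),
    (forall x, exists i, U i x) /\
    forall i, affine_open (U i) /\ finitely_generated_algebra (kst X (U i)).

Definition variety (X : scheme) : Prop :=
  [/\ integral_scheme X, separated X & finite_type X].

Definition normal_scheme (X : scheme) : Prop :=
  forall x : X, integrally_closed_domain (stalk x).

Definition nonsingular_locus (X : scheme) : set X :=
  [set x | regular_local (stalk x)].

End Schemes.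

Arguments nonsingular_locus {k} X _.

Section Modules.
Variables (k : fieldType) (X : kringed k).

Record omod := OMod {
  msec : forall U : opens X, lmodType (sec X U);
  mres : forall U V : opens X, V `<=` U -> {additive msec U -> msec V};
  mres_scale : forall (U V : opens _) (VU : V `<=` U)
    (a : sec X U) (m : msec U),
    mres VU (a *: m) = res VU a *: mres VU m;
  mres_id : forall (U : opens _) (UU : U `<=` U) (m : msec U), mres UU m = m;
  mres_mres : forall (U V W : opens _) (VU : V `<=` U) (WV : W `<=` V)
    (WU : W `<=` U) (m : msec U), mres WV (mres VU m) = mres WU m;
  msec_sheaf : sheaf_axiom mres }.

Arguments mres F {U V} VU : rename.

Definition structure_omod : omod :=
  @OMod (fun U => (sec X U)^o) (fun U V VU => res VU)
    (fun U V VU a m => rmorphM (res VU) a m)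
    (@res_id k X) (@res_res k X) (@sec_sheaf k X).

(* Morphisms F|_U -> G|_U. *)
Record omod_hom (F G : omod) (U : opens X) := OModHom {
  happ : forall W : opens X, W `<=` U -> {linear msec F W -> msec G W};
  happ_res : forall (W W' : opens X) (WU : W `<=` U) (WU' : W' `<=` U)
    (W'W : W' `<=` W) m,
    mres G W'W (happ WU m) = happ WU' (mres F W'W m) }.

Definition dual (F : omod) (U : opens X) := omod_hom F structure_omod U.

(* Kernel of the natural map from F to its double dual: this map sends m in
   F(U) to the morphism dual F|_U -> O_X|_U given over W by
   phi |-> phi(m|_W). *)
Definition torsion (F : omod) (U : opens X) : set (msec F U) :=
  [set m | forall (W : opens X) (WU : W `<=` U) (phi : dual F W),
     happ phi (fun _ h => h) (mres F WU m) = 0].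

Definition torsion_free (F : omod) : Prop :=
  forall (U : opens X) (m : msec F U), torsion m -> m = 0.

Record derivation (M : omod) := Derivation {
  dapp : forall U : opens X, {additive sec X U -> msec M U};
  dapp_leibniz : forall U (a b : sec X U),
    dapp U (a * b) = a *: dapp U b + b *: dapp U a;
  dapp_kst : forall U c, dapp U (kst X U c) = 0;
  dapp_res : forall (U V : opens _) (VU : V `<=` U) a,
    mres M VU (dapp U a) = dapp V (res VU a) }.

(* d is the universal k-derivation of O_X into a sheaf of O_X-modules, so Om is
   the sheaf of Kähler differentials. *)
Definition is_kahler (Om : omod) (d : derivation Om) : Prop :=
  forall (M : omod) (e : derivation M),
    exists! phi : omod_hom Om M (otop X),
      forall (U : opens X) (UX : U `<=` otop X) (a : sec X U),
        happ phi UX (dapp d U a) = dapp e U a.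

End Modules.

(* Sheaves of ideals are given by their sections, as subsets of the sections of
   the structure sheaf. *)

Section Ideals.
Variable k : fieldType.

Definition kernel_ideal (X Y : kringed k) (f : mor X Y) (U : opens Y) :
    set (sec Y U) :=
  [set s | comor f U s = 0].

(* The image of I (x) I in the structure sheaf: sections that are locally
   finite sums of products of two sections of I. *)
Definition ideal_square (X : kringed k) (I : forall U : opens X, set (sec X U))
    (U : opens X) : set (sec X U) :=
  [set s | forall x, U x ->
     exists (W : opens X) (WU : W `<=` U) n (a b : 'I_n -> sec X W),
       [/\ W x, forall i, I W (a i), forall i, I W (b i) &
           res WU s = \sum_i a i * b i]].

(* For V open in X with inclusion j, the sections of j_* j^* F over U are those
   of F over the intersection of U and V, and the unit F -> j_* j^* F is
   restriction. Surjectivity is that of a morphism of sheaves. *)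
Definition unit_surjective (X : kringed k) (V : opens X)
    (F : forall U : opens X, set (sec X U)) : Prop :=
  forall (U : opens X) (s : sec X (ocap U V)), F (ocap U V) s ->
  forall x, U x ->
    exists (W : opens X) (_ : W `<=` U) (WVUV : ocap W V `<=` ocap U V)
      (t : sec X W),
      [/\ W x, F W t & res (@ocapl _ W V) t = res WVUV s].

End Ideals.

(* Main.v *)
(**
Near a point of the diagonal let X be given by the ring A and X x X by
R = A (x) A, with I the kernel of the multiplication R -> A. The map
a (x) b |-> a db induces I / I^2 = Omega, so that a differential
m = sum a_l db_l comes from some u in I, and m vanishes locally if and only if u
lies locally in I^2.

The ring R is normal, and every point of codimension at most one is
non-singular. So a section of I^2 over the non-singular locus V extends to a
section t = u / v of the structure sheaf, and surjectivity asks whether u lies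
in I^2. As the generic point of the diagonal is a non-singular point of X x X
(characteristic zero), u lies in I^2 there, that is, the differential m of u is
torsion. If Omega is torsion-free, then m = 0, so u lies in I^2 locally.

Conversely let m be torsion. Then all derivations of A kill it, so u lies in I^2
at the generic point of the diagonal. If z is a closed point of the diagonal in
V, then the elements x_i (x) 1 - 1 (x) x_i, for generators x_i of the maximal
ideal, are part of a regular system of parameters and generate I_z, so w u in I^2
for some w outside I implies u in I_z^2. By the Nullstellensatz u is a section of
I^2 over V. Surjectivity then puts u in I^2 everywhere, and m = 0.

No dimension theory of varieties enters: the ring R is realized as a ring of
functions on pairs of k-points, its normality is proved along a tower of subfields
L of Frac A, by interpolation in A L, and the regularity at the generic point of
the diagonal comes from derivations dual to generators of the maximal ideal.
*)

Require Import Defs.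
From HB Require Import structures.
From mathcomp Require Import all_boot all_order all_algebra generic_quotient.
From mathcomp Require Import boolp classical_sets functions topology.
From mathcomp Require fieldext separable.
From mathcomp Require Import ring_quotient.
From mathcomp Require Import ring zify.

Set Implicit Arguments.
Unset Strict Implicit.
Unset Printing Implicit Defensive.

Import GRing.Theory fieldext.FieldExt.Exports.
Local Open Scope ring_scope.
Local Open Scope classical_set_scope.


(** * Ideals and noetherian rings *)

(** [XX] and [Omega] are given only by universal properties, and this shapes the geometric half.
    Charts of [XX] come from comparing an explicit spectrum of the tensor product with an open
    subscheme of [XX], the uniqueness of induced morphisms doing the identification. [Omega] is
    probed by skyscraper sheaves, which turn a derivation of one stalk into a functional on
    sections.

    Surjectivity also has to be proved at points off the diagonal. There the ideal is the unit
    ideal, so that an extended section is automatically in the square; separatedness makes this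
    region open.

    Torsion is tested by functionals on open sets, whereas derivations live on one ring [A]; the
    bridge between them is that a section of the structure sheaf over a chart is one element of a
    fraction field lying in all the local rings.

    Normality of the tensor product is obtained from both sides: the tower shows that an integral
    fraction has a denominator from the second factor, the same tower with the factors exchanged
    gives one from the first, and the two denominators cancel. *)

Lemma idomain_frac_exists (D : idomainType) :
  exists (K : fieldType) (i : {rmorphism D -> K}),
    injective i /\ forall x, exists a b, b <> 0 /\ x = i a / i b.
Proof.
exists {fraction D}, [the {rmorphism D -> {fraction D}} of @FracField.tofrac D].
split; first by move=> x y /eqP; rewrite /= tofrac_eq => /eqP.
elim/quotW => r; exists (\n_r), (\d_r); split; first exact/eqP/denom_ratioP.
have nz : FracField.tofrac \d_r != 0 by rewrite tofrac_eq0 denom_ratioP.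
apply: (mulIf nz); rewrite /= mulfVK //.
rewrite /FracField.tofrac; unlock FracField.tofrac.
rewrite -[LHS]FracField.pi_mul; apply/eqmodP => /=.
rewrite FracField.equivfE /FracField.mulf !numden_Ratio ?oner_eq0 ?mulr1 //=.
  by rewrite mulrC.
 all: exact: denom_ratioP.
Qed.

(** [is_domain] is a proposition, while [{fraction}] takes an [idomainType]; the structure is packed
    onto [A], with inverses chosen classically. *)
Lemma frac_exists (A : comPzRingType) : is_domain A ->
  exists (K : fieldType) (i : {rmorphism A -> K}),
    injective i /\ forall x, exists a b, b <> 0 /\ x = i a / i b.
Proof.
move=> [one0 dom].
have o0 : (1 : A) != 0 by apply/eqP.
pose An : comNzRingType := HB.pack A (GRing.PzSemiRing_isNonZero.Build A o0).
pose u (x : An) : bool := `[< invertible (x : A) >].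
(* By the convention of unit rings a non-unit is its own inverse. *)
pose v (x : An) : An := if pselect (invertible (x : A)) is left h
  then projT1 (cid h) else x.
have vl : {in u, left_inverse 1 v *%R}.
  move=> x; rewrite /in_mem/= /u => /asboolP h; rewrite /v.
  by case: pselect => // h'; case: cid => y /=; rewrite mulrC.
have ui (x y : An) : y * x = 1 -> u x.
  by move=> e; apply/asboolP; exists y; rewrite mulrC.
have vo : {in [predC u], v =1 id}.
  move=> x; rewrite inE/= /u => /asboolPn h; rewrite /v.
  by case: pselect.
pose Au : comUnitRingType :=
  HB.pack An (GRing.ComNzRing_hasMulInverse.Build An vl ui vo).
have dA : GRing.integral_domain_axiom Au.
  by move=> x y /dom [->|->]; rewrite eqxx ?orbT.
pose Ai : idomainType :=
  HB.pack Au (GRing.ComUnitRing_isIntegral.Build Au dA).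
have [K [i H]] := idomain_frac_exists Ai.
by exists K, i.
Qed.

Section Ideals.
Variable C : comPzRingType.
Implicit Types (I J K : set C) (a b : C).

Lemma ideal0 I : is_ideal I -> I 0. Proof. by case. Qed.
Lemma idealD I a b : is_ideal I -> I a -> I b -> I (a + b).
Proof. by case=> _ + _; apply. Qed.
Lemma idealMl I a b : is_ideal I -> I b -> I (a * b).
Proof. by case=> _ _; apply. Qed.
Lemma idealMr I a b : is_ideal I -> I a -> I (a * b).
Proof. by rewrite mulrC; exact: idealMl. Qed.
Lemma idealN I a : is_ideal I -> I a -> I (- a).
Proof. by move=> h; rewrite -mulN1r; exact: idealMl. Qed.
Lemma idealB I a b : is_ideal I -> I a -> I b -> I (a - b).
Proof. by move=> h Ia Ib; apply: idealD => //; exact: idealN. Qed.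
Lemma ideal_sum I (T : Type) (r : seq T) (P : pred T) (F : T -> C) :
  is_ideal I -> (forall i, P i -> I (F i)) -> I (\sum_(i <- r | P i) F i).
Proof.
move=> h hF; apply: big_ind => //; first exact: ideal0.
by move=> x y; exact: idealD.
Qed.
Lemma idealDl I a b : is_ideal I -> I b -> I (a + b) -> I a.
Proof. by move=> h Ib Iab; rewrite -(addrK b a); exact: idealB. Qed.
Lemma ideal1 I a : is_ideal I -> I 1 -> I a.
Proof. by move=> h I1; rewrite -(mulr1 a); exact: idealMl. Qed.
Lemma prime_ideal_ideal I : prime_ideal I -> is_ideal I. Proof. by case. Qed.
Lemma prime_expr I a n : prime_ideal I -> I (a ^+ n) -> I a.
Proof.
case=> h I1 pr; elim: n => [|n IH]; first by rewrite expr0.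
by rewrite exprS => /pr[].
Qed.

Definition igen (S : set C) : set C :=
  [set a | forall I, is_ideal I -> S `<=` I -> I a].

Lemma igen_ideal S : is_ideal (igen S).
Proof.
split=> [I h _|a b ha hb I h s|a b hb I h s]; first exact: ideal0.
  by apply: idealD => //; [exact: ha|exact: hb].
by apply: idealMl => //; exact: hb.
Qed.

Lemma sub_igen S : S `<=` igen S. Proof. by move=> a Sa I h; exact. Qed.

Lemma igen_sub S I : is_ideal I -> S `<=` I -> igen S `<=` I.
Proof. by move=> h s a; exact. Qed.

Definition isum I J : set C :=
  [set a | exists b c, [/\ I b, J c & a = b + c]].

Lemma isum_ideal I J : is_ideal I -> is_ideal J -> is_ideal (isum I J).
Proof.
move=> hI hJ; split.
- by exists 0, 0; rewrite addr0; split=> //; exact: ideal0.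
- move=> _ _ [a [b [Ia Jb ->]]] [a' [b' [Ia' Jb' ->]]].
  by exists (a + a'), (b + b'); rewrite addrACA; split=> //; exact: idealD.
- move=> a _ [b [c [Ib Jc ->]]]; exists (a * b), (a * c).
  by rewrite mulrDr; split=> //; exact: idealMl.
Qed.

Lemma isuml I J : is_ideal J -> I `<=` isum I J.
Proof. by move=> h a Ia; exists a, 0; rewrite addr0; split=> //; exact: ideal0. Qed.
Lemma isumr I J : is_ideal I -> J `<=` isum I J.
Proof. by move=> h a Ia; exists 0, a; rewrite add0r; split=> //; exact: ideal0. Qed.
Lemma isum_sub I J K : is_ideal K -> I `<=` K -> J `<=` K -> isum I J `<=` K.
Proof. by move=> h s t _ [a [b [/s Ia /t Jb ->]]]; exact: idealD. Qed.

Definition pgen a : set C := [set b | exists c, b = c * a].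

Lemma pgen_ideal a : is_ideal (pgen a).
Proof.
split; first by exists 0; rewrite mul0r.
  by move=> _ _ [b ->] [c ->]; exists (b + c); rewrite mulrDl.
by move=> b _ [c ->]; exists (b * c); rewrite mulrA.
Qed.
Lemma pgen_id a : pgen a a. Proof. by exists 1; rewrite mul1r. Qed.
Lemma pgen_sub I a : is_ideal I -> I a -> pgen a `<=` I.
Proof. by move=> h Ia _ [c ->]; exact: idealMl. Qed.

Definition iprod I J : set C :=
  igen [set c | exists a b, [/\ I a, J b & c = a * b]].

Lemma iprod_ideal I J : is_ideal (iprod I J). Proof. exact: igen_ideal. Qed.
Lemma iprodM I J a b : I a -> J b -> iprod I J (a * b).
Proof. by move=> Ia Jb; apply: sub_igen; exists a, b. Qed.
Lemma iprod_sub I J K : is_ideal K -> (forall a b, I a -> J b -> K (a * b)) ->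
  iprod I J `<=` K.
Proof. by move=> h H; apply: igen_sub => // _ [a [b [Ia Jb ->]]]; exact: H. Qed.
Lemma iprod_mono I J I' J' : I `<=` I' -> J `<=` J' -> iprod I J `<=` iprod I' J'.
Proof.
move=> s t; apply: iprod_sub; first exact: iprod_ideal.
by move=> a b /s Ia /t Jb; exact: iprodM.
Qed.
Lemma iprod_subr I J : is_ideal J -> iprod I J `<=` J.
Proof. by move=> h; apply: iprod_sub => // a b _; exact: idealMl. Qed.
Lemma iprod_subl I J : is_ideal I -> iprod I J `<=` I.
Proof. by move=> h; apply: iprod_sub => // a b Ia _; exact: idealMr. Qed.

Lemma iprodE I J a : is_ideal I -> is_ideal J -> iprod I J a <->
  exists n (b c : 'I_n -> C),
    [/\ forall i, I (b i), forall i, J (c i) & a = \sum_i b i * c i].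
Proof.
move=> hI hJ; split; last first.
  move=> [n [b [c [hb hc ->]]]]; apply: ideal_sum; first exact: iprod_ideal.
  by move=> i _; exact: iprodM.
apply: (@igen_sub _ [set a | exists n (b c : 'I_n -> C),
    [/\ forall i, I (b i), forall i, J (c i) & a = \sum_i b i * c i]]); last first.
  move=> _ [b [c [Ib Jc ->]]]; exists 1%N, (fun _ => b), (fun _ => c).
  by rewrite big_ord1.
split.
- by exists 0%N, (fun _ => 0), (fun _ => 0); rewrite big_ord0; split=> // -[].
- move=> _ _ [n [b [c [hb hc ->]]]] [m [b' [c' [hb' hc' ->]]]].
  exists (n + m)%N, (fun i : 'I_(n + m) => match fintype.split i with inl j => b j | inr j => b' j end).
  exists (fun i : 'I_(n + m) => match fintype.split i with inl j => c j | inr j => c' j end).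
  split; [by move=> i; case: fintype.split|by move=> i; case: fintype.split|].
  rewrite big_split_ord/=; congr (_ + _); apply: eq_bigr => i _.
    by case: split_ordP => j; [move/lshift_inj ->|move/eqP; rewrite eq_lrshift].
  by case: split_ordP => j; [move/eqP; rewrite eq_rlshift|move/rshift_inj ->].
- move=> a0 _ [n [b [c [hb hc ->]]]].
  exists n, (fun i => a0 * b i), c; split=> //; first by move=> i; exact: idealMl.
  by rewrite mulr_sumr; apply: eq_bigr => i _; rewrite mulrA.
Qed.

Lemma ideal_gen_ideal n (x : 'I_n -> C) : is_ideal (ideal_gen x).
Proof.
split.
- by exists (fun _ => 0); rewrite big1// => i _; rewrite mul0r.
- move=> _ _ [c ->] [d ->]; exists (fun i => c i + d i).
  by rewrite -big_split; apply: eq_bigr => i _; rewrite mulrDl.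
- move=> a _ [c ->]; exists (fun i => a * c i).
  by rewrite mulr_sumr; apply: eq_bigr => i _; rewrite mulrA.
Qed.
Lemma ideal_gen_in n (x : 'I_n -> C) i : ideal_gen x (x i).
Proof.
exists (fun j => (j == i)%:R); rewrite (bigD1 i)//= eqxx mul1r big1 ?addr0//.
by move=> j /negbTE ->; rewrite mul0r.
Qed.
Lemma ideal_gen_sub n (x : 'I_n -> C) I : is_ideal I ->
  (forall i, I (x i)) -> ideal_gen x `<=` I.
Proof.
by move=> h H _ [c ->]; apply: ideal_sum => // i _; apply: idealMl.
Qed.

Lemma noetherian_fg I : noetherian C -> is_ideal I ->
  exists n (x : 'I_n -> C), I = ideal_gen x.
Proof. by move=> h; exact: h. Qed.

Lemma noetherian_acc (F : nat -> set C) : noetherian C ->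
  (forall n, is_ideal (F n)) -> (forall n, F n `<=` F n.+1) ->
  exists N, forall n, (N <= n)%N -> F n `<=` F N.
Proof.
move=> noe hF inc.
have mono m n : (m <= n)%N -> F m `<=` F n.
  move=> /subnK <-; elim: (n - m)%N => [|d IH]; first by rewrite add0n.
  by rewrite addSn => a /IH/inc.
pose U := [set a | exists n, F n a].
have hU : is_ideal U.
  split; first by exists 0%N; exact: ideal0.
    move=> a b [n ha] [m hb]; exists (maxn n m).
    by apply: idealD => //; [exact: (mono _ _ (leq_maxl n m))
      |exact: (mono _ _ (leq_maxr n m))].
  by move=> a b [n hb]; exists n; exact: idealMl.
have [m [x Ux]] := noe U hU.
have hx i : exists n, F n (x i) by have : U (x i) by rewrite Ux; exact: ideal_gen_in.
pose k i := projT1 (cid (hx i)).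
have kP i : F (k i) (x i) by rewrite /k; case: cid.
exists (\max_i k i)%N => n _ a Fna.
have : ideal_gen x a by rewrite -Ux; exists n.
apply: ideal_gen_sub => // i; apply: (mono (k i)); last exact: kP.
exact: leq_bigmax.
Qed.

(** Without a maximal member each member could be properly enlarged within [P], and iterating a
    choice of enlargements would give a chain that never stops. *)
Lemma noetherian_max (P : set (set C)) : noetherian C ->
  (forall I, P I -> is_ideal I) -> P !=set0 ->
  exists I, P I /\ forall J, P J -> I `<=` J -> J `<=` I.
Proof.
move=> noe hP [I0 PI0]; apply: contrapT => no.
have ne (I : {I | P I}) : exists J : {I | P I},
    sval I `<=` sval J /\ ~ (sval J `<=` sval I).
  apply: contrapT => nn; apply: no; exists (sval I); split; first exact: svalP.
  move=> J PJ IJ; apply: contrapT => nJI; apply: nn.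
  by exists (exist _ J PJ).
pose nx (I : {I : set C | P I}) := projT1 (cid (ne I)).
pose F n := sval (iter n nx (exist _ I0 PI0)).
have FP n : F n `<=` F n.+1 /\ ~ (F n.+1 `<=` F n).
  by rewrite /F iterS /nx; case: cid.
have [N hN] := @noetherian_acc F noe (fun n => hP _ (svalP _)) (fun n => (FP n).1).
by case: (FP N) => _; apply; exact: hN.
Qed.

End Ideals.

Lemma noetherian_surj (A B : comPzRingType) (f : {rmorphism A -> B}) :
  (forall b, exists a, f a = b) -> noetherian A -> noetherian B.
Proof.
move=> sf noe I hI.
have hJ : is_ideal [set a | I (f a)].
  split; first by rewrite /= rmorph0; exact: ideal0.
    by move=> a b /= *; rewrite rmorphD; exact: idealD.
  by move=> a b /= *; rewrite rmorphM; exact: idealMl.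
have [n [x E]] := noe _ hJ.
exists n, (f \o x); apply/seteqP; split=> b; last first.
  apply: ideal_gen_sub => // i /=.
  by have : [set a | I (f a)] (x i) by rewrite E; exact: ideal_gen_in.
have [a <-] := sf b => Ia.
have : [set a | I (f a)] a by [].
rewrite E => -[c ->]; exists (f \o c); rewrite rmorph_sum.
by apply: eq_bigr => i _; rewrite rmorphM.
Qed.

(** * Hilbert's basis theorem and finitely generated algebras *)

Section HilbertBasis.
Variable P : comNzRingType.

Definition fin_gen (C : comPzRingType) (I : set C) :=
  exists n (x : 'I_n -> C), I = ideal_gen x.

Lemma fin_gen_isum (C : comPzRingType) (I J : set C) :
  fin_gen I -> fin_gen J -> fin_gen (isum I J).
Proof.
move=> [n [x ->]] [m [y ->]]; exists (n + m)%N.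
pose z (i : 'I_(n + m)) :=
  match fintype.split i with inl j => x j | inr j => y j end.
exists z.
have zl i : z (lshift m i) = x i by rewrite /z; case: split_ordP => j;
  [move/lshift_inj ->|move/eqP; rewrite eq_lrshift].
have zr i : z (rshift n i) = y i by rewrite /z; case: split_ordP => j;
  [move/eqP; rewrite eq_rlshift|move/rshift_inj ->].
apply/seteqP; split.
  apply: isum_sub; [exact: ideal_gen_ideal| |];
    apply: ideal_gen_sub; try exact: ideal_gen_ideal.
    by move=> i; rewrite -zl; exact: ideal_gen_in.
  by move=> i; rewrite -zr; exact: ideal_gen_in.
apply: ideal_gen_sub.
  by apply: isum_ideal; exact: ideal_gen_ideal.
move=> i; rewrite /z; case: fintype.split => j.
  by apply: isuml; [exact: ideal_gen_ideal|exact: ideal_gen_in].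
by apply: isumr; [exact: ideal_gen_ideal|exact: ideal_gen_in].
Qed.

(** The coefficients of degree [n] of members of degree at most [n] form ascending ideals [L n],
    stationary from some [N] on; generators are then needed only for the members of size at most
    [N.+1]. *)
Lemma hilbert_basis : noetherian P -> noetherian {poly P}.
Proof.
move=> noe I hI.
pose L n : set P := [set a | exists f : {poly P}, [/\ I f, (size f <= n.+1)%N & f`_n = a]].
have hL n : is_ideal (L n).
  split; first by exists 0; rewrite size_poly0 coef0; split=> //; exact: ideal0.
    move=> _ _ [f [If sf <-]] [g [Ig sg <-]]; exists (f + g); split.
    - exact: idealD.
    - by rewrite (leq_trans (size_polyD _ _))// geq_max sf.
    - by rewrite coefD.
  move=> a _ [f [If sf <-]]; exists (a%:P * f); split.
  - exact: idealMl.
  - by rewrite mul_polyC (leq_trans (size_scale_leq _ _)).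
  - by rewrite coefCM.
have incL n : L n `<=` L n.+1.
  move=> _ [f [If sf <-]]; exists (f * 'X); split.
  - exact: idealMr.
  - by rewrite (leq_trans (size_polyMleq _ _))// size_polyX addn2/=.
  - by rewrite coefMX.
have [N hN] := noetherian_acc noe hL incL.
(* In bounded degree finitely many generators suffice: each degree adds polynomials realizing
   generators of [L n]. *)
have hJ n : exists J : set {poly P}, [/\ fin_gen J, J `<=` I &
    forall f, I f -> (size f <= n)%N -> J f].
  elim: n => [|n [J [fJ JI hJ]]].
    exists (pgen 0); split.
    - exists 0%N, (fun _ => 0); apply/seteqP; split=> f.
        by move=> [c ->]; exists (fun _ => 0); rewrite big_ord0 mulr0.
      by move=> [c ->]; rewrite big_ord0; exists 0; rewrite mulr0.
    - by apply: pgen_sub => //; exact: ideal0.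
    - by move=> f _; rewrite leqn0 size_poly_eq0 => /eqP ->; exists 0; rewrite mulr0.
  have [m [a La]] := noe _ (hL n).
  have ha i : L n (a i) by rewrite La; exact: ideal_gen_in.
  pose g i := projT1 (cid (ha i)).
  have gP i : [/\ I (g i), (size (g i) <= n.+1)%N & (g i)`_n = a i].
    by rewrite /g; case: cid.
  exists (isum J (ideal_gen g)); split.
  - by apply: fin_gen_isum => //; exists m, g.
  - apply: isum_sub => //; apply: ideal_gen_sub => // i; by case: (gP i).
  - move=> f If sf.
    have [c ec] : ideal_gen a f`_n by rewrite -La; exists f.
    exists (f - \sum_i (c i)%:P * g i), (\sum_i (c i)%:P * g i).
    rewrite subrK; split=> //; last by exists (fun i => (c i)%:P).
    apply: hJ.
      apply: idealB => //; apply: ideal_sum => // i _; apply: idealMl => //.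
      by case: (gP i).
    apply/leq_sizeP => j; rewrite leq_eqVlt => /orP[/eqP <-|nj].
      rewrite coefB ec coef_sum -sumrB big1// => i _.
      by rewrite coefCM; case: (gP i) => _ _ ->; rewrite subrr.
    have cf (h : {poly P}) : (size h <= n.+1)%N -> h`_j = 0.
      by move=> sh; apply: nth_default; exact: leq_trans sh nj.
    rewrite coefB cf// coef_sum sub0r big1 ?oppr0// => i _.
    by rewrite coefCM cf ?mulr0//; case: (gP i).
have [J [fJ JI JN]] := hJ N.+1.
suff -> : I = J by [].
apply/seteqP; split=> // f.
have hJi : is_ideal J by case: fJ => m [x ->]; exact: ideal_gen_ideal.
move: {2}(size f) (leqnn (size f)) => n; elim: n f => [|n IH] f sf If.
  by apply: JN => //; exact: leq_trans sf _.
have [nN|Nn] := leqP n N.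
  by apply: JN => //; exact: leq_trans sf _.
(* Above degree [N] the top coefficient of [f] already occurs in degree [N], so a shift of [g]
   cancels the leading term. *)
have [g [Ig sg eg]] : L N f`_n by apply: (hN n); [exact: ltnW|exists f].
have sub1 : I (f - g * 'X^(n - N)) by apply: idealB => //; exact: idealMr.
rewrite -(subrK (g * 'X^(n - N)) f); apply: idealD => //; last first.
  by apply: idealMr => //; exact: JN.
apply: IH => //; apply/leq_sizeP => j; rewrite leq_eqVlt => /orP[/eqP <-|nj].
  by rewrite coefB coefMXn ltnNge leq_subr/= subKn 1?ltnW// eg subrr.
rewrite coefB nth_default; last exact: leq_trans sf nj.
rewrite coefMXn; case: ifP; rewrite ?subr0// => /negbT; rewrite -leqNgt => h.
rewrite (nth_default _ (leq_trans sg _)) ?subr0//.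
by rewrite ltn_subRL subnK// ltnW.
Qed.

End HilbertBasis.

(** Iterated univariate polynomials let the basis theorem and the Nullstellensatz treat one variable
    at a time. *)
Fixpoint polyn (k : comNzRingType) n : comNzRingType :=
  if n is m.+1 then {poly (polyn k m)} else k.

Fixpoint polync (k : comNzRingType) n : {rmorphism k -> polyn k n} :=
  if n is m.+1 then [the {rmorphism k -> {poly (polyn k m)}} of
    (polyC \o polync k m)] else [the {rmorphism k -> k} of idfun].

Lemma polyn_noetherian (k : fieldType) n : noetherian (polyn k n).
Proof.
elim: n => [|n IH]; last exact: hilbert_basis.
move=> I hI; case: (pselect (I = [set 0])) => [->|].
  exists 0%N, (fun _ => 0); apply/seteqP; split=> x.
    by move=> ->; exists (fun _ => 0); rewrite big_ord0.
  by move=> [c ->]; rewrite big_ord0.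
move=> nz; exists 1%N, (fun _ => 1); apply/seteqP; split=> x.
  by exists (fun _ => x); rewrite big_ord1 mulr1.
move=> _; apply: ideal1 => //.
have [y [Iy y0]] : exists y, I y /\ y != 0.
  apply: contrapT => h; apply: nz; apply/seteqP; split=> y.
    by move=> Iy; apply: contrapT => /eqP y0; apply: h; exists y.
  by move=> ->; exact: ideal0.
by rewrite -(@mulVf k y y0); exact: idealMl.
Qed.

Lemma polyn_eval (k : comNzRingType) (A : comPzRingType)
    (kappa : {rmorphism k -> A}) n (x : 'I_n -> A) :
  exists f : {rmorphism polyn k n -> A},
    (forall c, f (polync k n c) = kappa c) /\ forall i, exists t, f t = x i.
Proof.
(* Horner evaluation takes values in a nonzero ring, so the zero ring is treated apart. *)
have [A0|A1] := pselect ((1 : A) = 0).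
  have t0 (a b : A) : a = b by rewrite -(mul1r a) -(mul1r b) A0 !mul0r.
  pose z (p : polyn k n) : A := 0.
  have za : zmod_morphism z by move=> *; exact: t0.
  have zm : monoid_morphism z by split=> [|a b]; exact: t0.
  pose zz : {rmorphism polyn k n -> A} := HB.pack z
    (GRing.isZmodMorphism.Build _ _ _ za) (GRing.isMonoidMorphism.Build _ _ _ zm).
  exists zz; split; first by move=> c; exact: t0.
  by move=> i; exists 0; exact: t0.
have o0 : (1 : A) != 0 by apply/eqP.
pose B : comNzRingType := HB.pack A (GRing.PzSemiRing_isNonZero.Build A o0).
elim: n x => [|n IH] x.
  by exists kappa; split=> // -[].
have [f [fc fx]] := IH (fun i => x (lift ord0 i)).
pose f' : {rmorphism polyn k n -> B} := f.
have cf : commr_rmorph f' (x ord0 : B) by move=> a; exact: mulrC.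
exists (horner_morph cf : {rmorphism {poly polyn k n} -> B}); split=> [c|i].
  by rewrite /= horner_morphC; exact: fc.
case: (unliftP ord0 i) => [j ->|->]; last by exists 'X; rewrite /= horner_morphX.
by have [t <-] := fx j; exists t%:P; rewrite /= horner_morphC.
Qed.

Lemma fin_gen_alg_surj (k : comNzRingType) (A : comPzRingType)
    (kappa : {rmorphism k -> A}) : finitely_generated_algebra kappa ->
  exists n (f : {rmorphism polyn k n -> A}),
    (forall c, f (polync k n c) = kappa c) /\ forall a, exists t, f t = a.
Proof.
move=> [n [x hx]]; have [f [fc fx]] := polyn_eval kappa x.
exists n, f; split=> // a.
apply: (hx [set a | exists t, f t = a]) => [c|i|_ _ [s <-] [t <-]|_ _ [s <-] [t <-]].
- by exists (polync k n c).
- exact: fx.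
- by exists (s - t); rewrite rmorphB.
- by exists (s * t); rewrite rmorphM.
Qed.

Lemma fin_gen_alg_noetherian (k : fieldType) (A : comPzRingType)
    (kappa : {rmorphism k -> A}) : finitely_generated_algebra kappa ->
  noetherian A.
Proof.
move=> /fin_gen_alg_surj[n [f [_ sf]]].
exact: (noetherian_surj sf (@polyn_noetherian k n)).
Qed.

(** * The Nullstellensatz *)

Section PseudoDivision.
Variable P : comNzRingType.
Implicit Types f g q r : {poly P}.

(** The leading coefficient of [g] need not be invertible, hence the power in front of [f]. The
    bound on the size of [q] is what forces [e] to be constant in [prime_extension]. *)
Lemma pseudo_div g f : g != 0 -> exists N q r,
  [/\ (lead_coef g ^+ N)%:P * f = q * g + r, (size r < size g)%N &
      (size q <= (size f - size g).+1)%N].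
Proof.
move=> g0; move: {2}(size f) (leqnn (size f)) => n.
elim: n f => [|n IH] f sf.
  move: sf; rewrite leqn0 size_poly_eq0 => /eqP ->.
  exists 0%N, 0, 0; rewrite mulr0 mul0r addr0 size_poly0; split=> //.
  by rewrite lt0n size_poly_eq0.
have [fg|gf] := ltnP (size f) (size g).
  by exists 0%N, 0, f; rewrite expr0 mul1r mul0r add0r size_poly0.
have sg : (0 < size g)%N by rewrite lt0n size_poly_eq0.
pose d := (size f - size g)%N.
have sfg : (size f = d + size g)%N by rewrite subnK.
have dE : (size f - size g)%N = d by []; clearbody d.
pose f' := (lead_coef g)%:P * f - (lead_coef f)%:P * 'X^d * g.
have sf' : (size f' < size f)%N.
  rewrite -(prednK (leq_trans sg gf)) ltnS; apply/leq_sizeP => j.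
  rewrite leq_eqVlt => /orP[/eqP <-|nj].
    rewrite coefB coefCM -mulrA coefCM coefXnM ifF; last by apply/negbTE; lia.
    by rewrite (_ : (_ - d)%N = (size g).-1) ?lead_coefE 1?mulrC ?subrr//; lia.
  have fj : (size f <= j)%N by lia.
  have gj : (size g <= j - d)%N by lia.
  rewrite coefB coefCM nth_default// mulr0 -mulrA coefCM coefXnM ifF; last first.
    by apply/negbTE; lia.
  by rewrite nth_default ?mulr0 ?subrr//.
have [|N [q [r [e sr sq]]]] := IH f'.
  by rewrite -ltnS (leq_trans sf').
exists N.+1, ((lead_coef g ^+ N)%:P * (lead_coef f)%:P * 'X^d + q), r; split=> //.
  rewrite exprSr polyCM mulrDl -addrA -e /f'; ring.
rewrite (leq_trans (size_polyD _ _))// geq_max; apply/andP; split.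
  by rewrite -polyCM mul_polyC (leq_trans (size_scale_leq _ _))// size_polyXn dE.
rewrite (leq_trans sq)// ltnS leq_sub2r// ltnW//.
Qed.

Variable Q : set {poly P}.
Hypothesis prQ : prime_ideal Q.
Let q0 : set P := [set c | Q c%:P].
Let inq f := forall i, q0 f`_i.
Let iQ := prime_ideal_ideal prQ.

Let pr_q0 : prime_ideal q0.
Proof.
case: prQ => _ Q1 pr; split=> //.
- split; rewrite /q0/=.
  + by rewrite polyC0; exact: ideal0.
  + by move=> a b /= *; rewrite polyCD; exact: idealD.
  + by move=> a b /= *; rewrite polyCM; exact: idealMl.
- by move=> a b; rewrite /q0/= polyCM; exact: pr.
Qed.

Let inqQ f : inq f -> Q f.
Proof.
move=> h; rewrite -(coefK f) poly_def; apply: ideal_sum => // i _.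
by rewrite -mul_polyC; apply: idealMr => //; exact: h.
Qed.

Let lead_term f : Q (lead_coef f)%:P -> let f' := f - (lead_coef f)%:P * 'X^((size f).-1) in
  f != 0 -> (size f' < size f)%N /\ (inq f' -> inq f).
Proof.
move=> Ql /= f0; split.
  have sf : (0 < size f)%N by rewrite lt0n size_poly_eq0.
  rewrite -{2}(prednK sf) ltnS; apply/leq_sizeP => j.
  rewrite leq_eqVlt coefB coefCM coefXn => /orP[/eqP <-|nj].
    by rewrite eqxx mulr1 lead_coefE subrr.
  by rewrite gtn_eqF// mulr0 subr0 nth_default// -(prednK sf).
move=> h i; move: (h i); rewrite coefB coefCM coefXn.
have [->|_] := eqVneq i (size f).-1; last by rewrite mulr0 subr0.
by move=> _; rewrite -lead_coefE.
Qed.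

(** Points of the base extend to points of P[X] / Q with [h] nonzero, over the open set where [r]
    does not vanish. Either all coefficients of members of [Q] lie in [q0], and any non-root of the
    specialized [h] serves, or a member of [Q] of least degree offers its roots, and [r] ensures
    that [h] does not vanish at them. *)
Lemma prime_extension (k : closedFieldType) (h : {poly P}) : ~ Q h ->
  exists r : P, ~ Q r%:P /\ forall phi : {rmorphism P -> k},
    (forall c, Q c%:P -> phi c = 0) -> phi r != 0 ->
    exists c : k, (forall f, Q f -> (map_poly phi f).[c] = 0) /\
      (map_poly phi h).[c] != 0.
Proof.
move=> Qh.
have map0 (phi : {rmorphism P -> k}) f : (forall c, Q c%:P -> phi c = 0) ->
    inq f -> map_poly phi f = 0.
  by move=> ph hf; apply/polyP => i; rewrite coef_map coef0; apply: ph; exact: hf.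
have [allq|] := pselect (forall f, Q f -> inq f).
  have [i hi] : exists i, ~ q0 h`_i.
    by apply: contrapT => nn; apply/Qh/inqQ => i; apply: contrapT => ni; apply: nn; exists i.
  exists h`_i; split=> // phi ph r0.
  have /closed_nonrootP[c hc] : map_poly phi h != 0.
    by apply/eqP => /polyP/(_ i); rewrite coef_map coef0; exact/eqP.
  exists c; split=> [f /allq hf|]; last exact: hc.
  by rewrite map0// horner0.
move=> nall.
(* [g] plays the role of the minimal polynomial of the variable over the fraction field of the base
   modulo [q0]. *)
pose G n := `[< exists g, [/\ Q g, ~ inq g & size g = n] >].
have exG : exists n, G n.
  apply: contrapT => nn; apply: nall => f Qf; apply: contrapT => nf.
  by apply: nn; exists (size f); apply/asboolP; exists f.
case: (ex_minnP exG) => n /asboolP[g [Qg ng sg]] ming.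
have {}ming f : Q f -> ~ inq f -> (size g <= size f)%N.
  by move=> Qf nf; rewrite sg; apply: ming; apply/asboolP; exists f.
have g0 : g != 0 by apply/eqP => e; apply: ng => i; rewrite e coef0 /q0/= polyC0; exact: ideal0.
have ql : ~ q0 (lead_coef g).
  move=> qlg; have [s1 s2] := lead_term qlg g0.
  have : (size g <= size (g - (lead_coef g)%:P * 'X^((size g).-1))%R)%N.
    apply: ming; last by move/s2.
    by apply: idealB => //; exact: idealMr.
  by rewrite leqNgt s1.
(* Modulo [Q] the ideal of [h] meets the base: a member [e] of least size outside [Q] turns out to
   be constant. *)
pose J : set {poly P} := isum (pgen h) Q.
have iJ : is_ideal J by apply: isum_ideal => //; exact: pgen_ideal.
pose E n := `[< exists e, [/\ J e, ~ Q e & size e = n] >].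
have exE : exists n, E n.
  by exists (size h); apply/asboolP; exists h; split=> //; apply: isuml => //; exact: pgen_id.
case: (ex_minnP exE) => m /asboolP[e [Je ne se]] mine.
have {}mine f : J f -> ~ Q f -> (size e <= size f)%N.
  by move=> Jf nf; rewrite se; apply: mine; apply/asboolP; exists f.
have QJ : Q `<=` J by apply: isumr; exact: pgen_ideal.
have e0 : e != 0 by apply/eqP => ee; apply: ne; rewrite ee; exact: ideal0.
have qe : ~ q0 (lead_coef e).
  move=> qle; have [s1 s2] := lead_term qle e0.
  have Qt : Q ((lead_coef e)%:P * 'X^((size e).-1)) by exact: idealMr.
  have : (size e <= size (e - (lead_coef e)%:P * 'X^((size e).-1))%R)%N.
    apply: mine; first by apply: idealB => //; exact: QJ.
    by move=> Qe'; apply: ne; rewrite -(subrK ((lead_coef e)%:P * 'X^((size e).-1)) e); exact: idealD.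
  by rewrite leqNgt s1.
have nX (a : P) N f : ~ q0 a -> Q ((a ^+ N)%:P * f) -> Q f.
  move=> na; case: (prQ) => _ _ pr /pr[]//; rewrite rmorphXn.
  by move/(prime_expr prQ).
have seg : (size e < size g)%N.
  have [N [q [r [er sr _]]]] := pseudo_div e g0.
  apply: leq_ltn_trans sr; apply: mine.
    rewrite (_ : r = (lead_coef g ^+ N)%:P * e - q * g).
      by apply: idealB => //; [exact: idealMl|apply: idealMl => //; exact: QJ].
    by rewrite er addrC addKr.
  move=> Qr; apply: ne; apply: (nX (lead_coef g) N) => //; rewrite er.
  by apply: idealD => //; exact: idealMl.
(* Dividing [g] by [e] leaves a remainder in [Q], so [q * e] and hence [q] lie in [Q]. As [q] is
   then no smaller than [g], little room remains for [e]. *)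
have se1 : (size e <= 1)%N.
  have [N [q [r [er sr sq]]]] := pseudo_div g e0.
  have Qr : Q r.
    apply: contrapT => nr; have : (size e <= size r)%N; last by rewrite leqNgt sr.
    apply: mine => //; rewrite (_ : r = (lead_coef e ^+ N)%:P * g - q * e).
      by apply: idealB => //; [apply: idealMl => //; exact: QJ|exact: idealMl].
    by rewrite er addrC addKr.
  have Qq : Q q.
    have : Q (q * e) by rewrite (_ : q * e = (lead_coef e ^+ N)%:P * g - r);
      [apply: idealB => //; exact: idealMl|rewrite er addrK].
    by case: (prQ) => _ _ pr /pr[].
  have nq : ~ inq q.
    move=> hq; have h1 : q0 (((lead_coef e ^+ N)%:P * g)`_(size g).-1).
      rewrite er coefD [r`__]nth_default ?addr0; last first.
        by rewrite -ltnS (leq_trans sr)// prednK ?lt0n ?size_poly_eq0// ltnW.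
      rewrite coefM; apply: ideal_sum; first exact: prime_ideal_ideal pr_q0.
      by move=> i _; apply: idealMr; [exact: prime_ideal_ideal pr_q0|exact: hq].
    move: h1; rewrite coefCM -lead_coefE; case: (pr_q0) => _ _ pr /pr[]//.
    by move/(prime_expr pr_q0).
  have := leq_trans (ming _ Qq nq) sq.
  by move: seg; clear; lia.
have [r0 er0] : exists r0 : P, e = r0%:P by exists e`_0; exact: size1_polyC.
have nr0 : ~ q0 r0 by move: ne; rewrite er0.
exists (lead_coef g * r0); split; first by case: (pr_q0) => _ _ pr /pr[].
move=> phi ph; rewrite rmorphM mulf_eq0 negb_or => /andP[pl pr].
have smg : size (map_poly phi g) = size g by rewrite size_map_poly_id0.
have g1 : (1 < size g)%N.
  rewrite ltnNge; apply/negP => /size1_polyC eg; apply: ng => i.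
  rewrite eg coefC; case: eqP => _; first by move: Qg; rewrite {1}eg.
  by rewrite /q0/= polyC0; exact: ideal0.
have [c rc] : exists c, root (map_poly phi g) c.
  by apply/closed_rootP; rewrite smg gtn_eqF.
have hc f : Q f -> (map_poly phi f).[c] = 0.
  move=> Qf; have [N [q [r [er sr _]]]] := pseudo_div f g0.
  have Qr : Q r.
    rewrite (_ : r = (lead_coef g ^+ N)%:P * f - q * g).
      by apply: idealB => //; exact: idealMl.
    by rewrite er addrC addKr.
  have qr : inq r by apply: contrapT => /(ming _ Qr); rewrite leqNgt sr.
  have := congr1 (fun p => (map_poly phi p).[c]) er.
  rewrite /= rmorphD/= !rmorphM/= (map0 _ _ ph qr) addr0 !hornerM.
  rewrite (eqP rc) mulr0 map_polyC/= hornerC rmorphXn => /eqP.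
  by rewrite mulf_eq0 expf_eq0 (negbTE pl) andbF => /eqP.
(* The constant [r0] is a multiple of [h] modulo [Q]; since [phi r0] is nonzero, [h] cannot vanish
   at [c]. *)
exists c; split=> //; apply/eqP => h0.
case: Je => _ [b [[a ->] Qb]]; rewrite er0 => /(congr1 (fun p => (map_poly phi p).[c])).
rewrite /= rmorphD/= rmorphM/= map_polyC/= hornerC hornerD hornerM h0 mulr0 add0r hc//.
by move/eqP; rewrite (negbTE pr).
Qed.

End PseudoDivision.

(** Carrying the non-member [h] along makes the induction work: removing a variable replaces it by
    the [r] of [prime_extension]. *)
Lemma nullstellensatz_polyn (k : closedFieldType) n (Q : set (polyn k n)) h :
  prime_ideal Q -> ~ Q h -> exists phi : {rmorphism polyn k n -> k},
    [/\ forall c, phi (polync k n c) = c, forall f, Q f -> phi f = 0 & phi h != 0].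
Proof.
elim: n Q h => [|n IH] Q h prQ Qh.
  exists [the {rmorphism k -> k} of idfun]; split=> //= [f Qf|].
    apply: contrapT => /eqP f0; case: prQ => iQ + _; apply.
    by rewrite -(@mulVf k f f0); exact: idealMl.
  by apply/eqP => h0; apply: Qh; rewrite h0; apply: ideal0; case: prQ.
have [r [Qr hr]] := prime_extension prQ k Qh.
have prq : prime_ideal [set c : polyn k n | Q c%:P].
  case: prQ => iQ Q1 pr; split=> //.
  - split; rewrite /=.
    + by rewrite polyC0; exact: ideal0.
    + by move=> a b /= *; rewrite polyCD; exact: idealD.
    + by move=> a b /= *; rewrite polyCM; exact: idealMl.
  - by move=> a b; rewrite /= polyCM; exact: pr.
have [phi [phc ph0 phr]] := IH _ _ prq Qr.
have [c [c0 ch]] := hr phi ph0 phr.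
have cf : commr_rmorph phi c by move=> a; exact: mulrC.
exists (horner_morph cf : {rmorphism {poly polyn k n} -> k}); split=> //= a.
by rewrite horner_morphC.
Qed.

Lemma nullstellensatz (k : closedFieldType) (A : comPzRingType)
    (kappa : {rmorphism k -> A}) (Q : set A) h :
  finitely_generated_algebra kappa -> prime_ideal Q -> ~ Q h ->
  exists phi : {rmorphism A -> k},
    [/\ forall c, phi (kappa c) = c, forall f, Q f -> phi f = 0 & phi h != 0].
Proof.
move=> /fin_gen_alg_surj[n [f [fc sf]]] prQ Qh.
have prQ' : prime_ideal [set a | Q (f a)].
  case: prQ => iQ Q1 pr; split; last by move=> a b /=; rewrite rmorphM; exact: pr.
    split => /=; first by rewrite rmorph0; exact: ideal0.
      by move=> a b; rewrite rmorphD; exact: idealD.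
    by move=> a b; rewrite rmorphM; exact: idealMl.
  by rewrite /= rmorph1.
have [h' eh] := sf h.
have [|phi [phc ph0 phh]] := @nullstellensatz_polyn k n _ h' prQ'.
  by rewrite /= eh.
pose s a := projT1 (cid (sf a)).
have sK a : f (s a) = a by rewrite /s; case: cid.
have ps a b : f a = f b -> phi a = phi b.
  move=> e; apply/eqP; rewrite -subr_eq0 -rmorphB ph0//= rmorphB e subrr.
  by apply: ideal0; case: prQ.
pose psi a := phi (s a).
have pa : zmod_morphism psi.
  by move=> a b; rewrite /psi -rmorphB; apply: ps; rewrite rmorphB !sK.
have pm : monoid_morphism psi.
  split=> [|a b]; rewrite /psi; first by rewrite -(rmorph1 phi); apply: ps; rewrite sK rmorph1.
  by rewrite -rmorphM; apply: ps; rewrite rmorphM !sK.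
pose g : {rmorphism A -> k} := HB.pack psi
    (GRing.isZmodMorphism.Build _ _ _ pa) (GRing.isMonoidMorphism.Build _ _ _ pm).
exists g; split=> [c|a Qa|] /=; rewrite /psi.
- by rewrite (ps (s (kappa c)) (polync k n c)) ?sK ?fc.
- by apply: ph0; rewrite /= sK.
- by rewrite (ps _ h')// sK.
Qed.

(** * Krull's height theorem and regular local rings *)

Section Krull.
Variable C : comPzRingType.
Hypothesis noe : noetherian C.
Implicit Types (I J K P Q L m : set C) (y : nat -> C).

(** The contraction to [C] of the extension of [I] to the localization at [m]. Dimension theory is
    thus carried out with ideals of one ring, even when it needs localizations at two different
    primes. *)
Definition sat m I : set C := [set w | exists u, ~ m u /\ I (u * w)].

Lemma sub_sat m I : prime_ideal m -> I `<=` sat m I.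
Proof. by case=> _ m1 _ w Iw; exists 1; rewrite mul1r. Qed.

Lemma prime_notM m a b : prime_ideal m -> ~ m a -> ~ m b -> ~ m (a * b).
Proof. by case=> _ _ pr na nb /pr[]. Qed.

Lemma sat_ideal m I : prime_ideal m -> is_ideal I -> is_ideal (sat m I).
Proof.
move=> pm h; split.
- by exists 1; rewrite mulr0; split; [case: pm|exact: ideal0].
- move=> a b [u [nu Iu]] [v [nv Iv]]; exists (u * v); split.
    exact: prime_notM.
  rewrite (_ : u * v * (a + b) = v * (u * a) + u * (v * b)); last by ring.
  by apply: idealD => //; exact: idealMl.
- move=> a b [u [nu Iu]]; exists u; split=> //.
  by rewrite mulrCA; exact: idealMl.
Qed.

Lemma sat_mono m I J : I `<=` J -> sat m I `<=` sat m J.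
Proof. by move=> s w [u [nu /s]]; exists u. Qed.

Lemma sat_idem m I : prime_ideal m -> sat m (sat m I) `<=` sat m I.
Proof.
move=> pm w [u [nu [v [nv Iw]]]]; exists (v * u).
by rewrite -mulrA; split=> //; exact: prime_notM.
Qed.

Lemma sat_sub m Q I : Q `<=` m -> sat m I `<=` sat Q I.
Proof. by move=> s w [u [nu Iw]]; exists u; split=> // /s. Qed.

Lemma sat_prime m P : prime_ideal P -> P `<=` m -> sat m P `<=` P.
Proof. by move=> [_ _ pr] s w [u [nu /pr[/s|]]]. Qed.

(** Take a saturated [K] above [N'], maximal among those not containing [N], and [w] in [N] outside
    [K]. Maximality puts [N] locally into K + (w), and the hypothesis then yields an element outside
    [m] that multiplies [w] into [K]. *)
Lemma nakayama m N N' : prime_ideal m -> is_ideal N -> is_ideal N' ->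
  N `<=` sat m (isum N' (iprod m N)) -> N `<=` sat m N'.
Proof.
move=> pm hN hN' hs; apply: contrapT => nNs.
have [K [[hK sK NK nK] maxK]] := @noetherian_max C
  [set K | [/\ is_ideal K, sat m K `<=` K, N' `<=` K & ~ N `<=` K]] noe
  (fun K h => let: And4 h _ _ _ := h in h)
  (ex_intro _ (sat m N') (And4 (sat_ideal pm hN') (@sat_idem m N' pm)
     (@sub_sat m N' pm) nNs)).
have [w [Nw Kw]] : exists w, N w /\ ~ K w.
  by apply: contrapT => h; apply: nK => w Nw; apply: contrapT => Kw; apply: h; exists w.
have hKw : is_ideal (isum K (pgen w)) by apply: isum_ideal => //; exact: pgen_ideal.
have Nsub : N `<=` sat m (isum K (pgen w)).
  apply: contrapT => h; apply: Kw; apply: (maxK (sat m (isum K (pgen w)))).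
  - split=> //; [exact: sat_ideal|exact: sat_idem|].
    move=> a /NK Ka; apply: sub_sat => //; apply: isuml => //; exact: pgen_ideal.
  - by move=> a Ka; apply: sub_sat => //; apply: isuml => //; exact: pgen_ideal.
  - apply: sub_sat => //; apply: isumr => //; exact: pgen_id.
have hm := prime_ideal_ideal pm.
pose mw : set C := [set a | exists c, m c /\ a = c * w].
have hmw : is_ideal mw.
  split; first by exists 0; rewrite mul0r; split=> //; exact: ideal0.
    move=> _ _ [a [ma ->]] [b [mb ->]]; exists (a + b).
    by rewrite mulrDl; split=> //; exact: idealD.
  by move=> a _ [b [mb ->]]; exists (a * b); rewrite mulrA; split=> //; exact: idealMl.
have hKm : is_ideal (isum K mw) by exact: isum_ideal.
have msub : iprod m N `<=` sat m (isum K mw).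
  apply: iprod_sub; first exact: sat_ideal.
  move=> c n mc /Nsub[u [nu [k [_ [Kk [b ->] e]]]]]; exists u; split=> //.
  rewrite mulrCA e mulrDr; exists (c * k), (c * (b * w)); split=> //.
    exact: idealMl.
  by exists (c * b); rewrite mulrA; split=> //; exact: idealMr.
have [u [nu [k [n [Kk /msub [v [nv [k' [_ [Kk' [c [mc ->]] e']]]] e]]]]]] := hs _ Nw.
apply: Kw; apply: sK; exists (v * u - c); split.
  by move=> h; apply: (prime_notM pm nv nu); rewrite -(subrK c (v * u)); exact: idealD.
rewrite mulrBl -mulrA e mulrDr e' addrA addrK.
by apply: idealD => //; apply: idealMl => //; exact: NK.
Qed.

Fixpoint ipow I n : set C := if n is p.+1 then iprod I (ipow I p) else setT.

Lemma ipow_ideal I n : is_ideal (ipow I n).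
Proof. by case: n => [|n]; [split|exact: iprod_ideal]. Qed.

Lemma ipow_expr I a n : I a -> ipow I n (a ^+ n).
Proof. by move=> Ia; elim: n => //= n IH; rewrite exprS; exact: iprodM. Qed.

Lemma ipowS_sub I n : ipow I n.+1 `<=` ipow I n.
Proof. by apply: iprod_subr; exact: ipow_ideal. Qed.

(** Pigeonhole: among s + n factors from K + L, either [s] come from [K] or [n] from [L]. *)
Lemma ipow_isum K L s n : is_ideal K -> is_ideal L ->
  ipow (isum K L) (s + n) `<=` isum (ipow K s) (ipow L n).
Proof.
move=> hK hL; have hi s' n' : is_ideal (isum (ipow K s') (ipow L n')).
  by apply: isum_ideal; exact: ipow_ideal.
move: {2}(s + n)%N (erefl (s + n)%N) => t; elim: t s n => [|t IH] s n e.
  by case: s n e => [|s] [|n]// _ a _; apply: isuml => //; exact: ipow_ideal.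
case: s e => [|s] e; first by move=> a _; apply: isuml => //; exact: ipow_ideal.
case: n e => [|n] e; first by move=> a _; apply: isumr => //; exact: ipow_ideal.
rewrite e /=; apply: iprod_sub; first exact: (hi s.+1 n.+1).
move=> _ b [k [l [Kk Ll ->]]] Ib; rewrite mulrDl; apply: (idealD (hi s.+1 n.+1)).
  have /IH : (s + n.+1)%N = t by lia.
  rewrite (_ : (s + n.+1)%N = t); last by lia.
  move=> /(_ _ Ib)[b1 [b2 [h1 h2 ->]]]; rewrite mulrDr; exists (k * b1), (k * b2).
  split=> //; first exact: iprodM.
  exact: (idealMl _ (ipow_ideal L n.+1) h2).
have /IH : (s.+1 + n)%N = t by lia.
rewrite (_ : (s.+1 + n)%N = t); last by lia.
move=> /(_ _ Ib)[b1 [b2 [h1 h2 ->]]]; rewrite mulrDr; exists (l * b1), (l * b2).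
split=> //; last exact: iprodM.
exact: (idealMl _ (ipow_ideal K s.+1) h1).
Qed.

(** The products [u * w ^+ n] form a multiplicative system, and an ideal maximal among those that
    miss it is prime. *)
Lemma prime_avoiding m J w : prime_ideal m -> is_ideal J ->
  (forall u n, ~ m u -> ~ J (u * w ^+ n)) ->
  exists L, [/\ prime_ideal L, J `<=` L, L `<=` m & ~ L w].
Proof.
move=> pm hJ nJ; have hm := prime_ideal_ideal pm.
have [L [[hL JL nL] maxL]] := @noetherian_max C
  [set L | [/\ is_ideal L, J `<=` L & forall u n, ~ m u -> ~ L (u * w ^+ n)]] noe
  (fun K h => let: And3 h _ _ := h in h)
  (ex_intro _ J (And3 hJ (fun _ h => h) nJ)).
exists L; split=> //; last first.
- by move=> Lw; apply: (nL 1 1%N); rewrite ?mul1r//; case: pm.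
- by move=> u Lu; apply: contrapT => mu; apply: (nL u 0%N mu); rewrite expr0 mulr1.
split=> //; first by move=> L1; apply: (nL 1 0%N); rewrite ?mulr1//; case: pm.
move=> a b Lab; apply: contrapT => /not_orP[La Lb].
have ex c : ~ L c -> exists u n, ~ m u /\ isum L (pgen c) (u * w ^+ n).
  move=> nLc; apply: contrapT => h; apply: nLc.
  apply: (maxL (isum L (pgen c))); last by apply: isumr => //; exact: pgen_id.
    split; [by apply: isum_ideal => //; exact: pgen_ideal| |].
      by move=> x /JL; apply: isuml; exact: pgen_ideal.
    by move=> u n mu Lu; apply: h; exists u, n.
  by apply: isuml; exact: pgen_ideal.
have [u [n [mu [l [_ [Ll [c ->] e]]]]]] := ex _ La.
have [u' [n' [mu' [l' [_ [Ll' [c' ->] e']]]]]] := ex _ Lb.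
apply: (nL (u * u') (n + n')%N); first exact: prime_notM.
rewrite (_ : _ * _ = (u * w ^+ n) * (u' * w ^+ n')); last by rewrite exprD; ring.
rewrite e e' (_ : _ * _ = (l' + c' * b) * l + c * a * l' + c * c' * (a * b)); last by ring.
by apply: idealD => //; [apply: idealD => //; exact: idealMl|exact: idealMl].
Qed.

(** The last hypothesis says that [m] is minimal over [J], so every [w] in [m] is locally nilpotent
    modulo [J]. A maximal [K] in [m] having a power locally inside [J] therefore absorbs all of
    [m]. *)
Lemma ipow_sub_sat m J : prime_ideal m -> is_ideal J ->
  (forall L, prime_ideal L -> J `<=` L -> L `<=` m -> m `<=` L) ->
  exists s, ipow m s `<=` sat m J.
Proof.
move=> pm hJ hL; have hm := prime_ideal_ideal pm; have hs := sat_ideal pm hJ.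
have [K [[hK Km [s hKs]] maxK]] := @noetherian_max C
  [set K | [/\ is_ideal K, K `<=` m & exists s, ipow K s `<=` sat m J]] noe
  (fun K h => let: And3 h _ _ := h in h)
  (ex_intro _ (pgen 0) (And3 (@pgen_ideal C 0) (pgen_sub hm (ideal0 hm))
     (ex_intro _ 1%N (subset_trans (iprod_subl (@pgen_ideal C 0))
        (pgen_sub hs (ideal0 hs)))))).
suff mK : m `<=` K.
  exists s => a ha; apply: hKs; elim: s a ha => //= s IH a.
  exact: iprod_mono.
move=> w mw.
have [u [n [mu Ju]]] : exists u n, ~ m u /\ J (u * w ^+ n).
  apply: contrapT => h.
  have [|L [pL JL Lm Lw]] := @prime_avoiding m J w pm hJ.
    by move=> u n mu Ju; apply: h; exists u, n.
  by apply: Lw; exact: (hL L).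
have hw := @pgen_ideal C w.
apply: (maxK (isum K (pgen w))); last by apply: isumr => //; exact: pgen_id.
  split; [exact: isum_ideal|by apply: isum_sub => //; exact: pgen_sub|].
  exists (s + n)%N => a /(ipow_isum hK hw); apply: isum_sub => //.
  have pw p a' : ipow (pgen w) p a' -> pgen (w ^+ p) a'.
    elim: p a' => [|p IH] a'; first by exists a'; rewrite mulr1.
    apply: iprod_sub; first exact: pgen_ideal.
    move=> _ b [c ->] /IH[d ->]; exists (c * d); rewrite exprS; ring.
  by move=> b /pw[c ->]; apply: idealMl => //; exists u.
exact: isuml.
Qed.

(** The local ring at [m] modulo [J] is artinian. For a maximal counterexample [K], let [g] outside
    [K] be killed by [m] modulo [K]. Adding [g] enlarges each member of a chain by at most a simple
    step, so a bad chain over [K] gives one over K + (g). *)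
Lemma ideal_dcc m s J (F : nat -> set C) : prime_ideal m -> is_ideal J ->
  sat m J `<=` J -> ipow m s `<=` J ->
  (forall n, [/\ is_ideal (F n), sat m (F n) `<=` F n, J `<=` F n & F n.+1 `<=` F n]) ->
  exists N, forall n, (N <= n)%N -> F N `<=` F n.
Proof.
move=> pm hJ0 sJ0 mJ0 hF0; apply: contrapT => nF0.
pose bad (J : set C) := [/\ is_ideal J, sat m J `<=` J, ipow m s `<=` J &
  exists F : nat -> set C,
  (forall n, [/\ is_ideal (F n), sat m (F n) `<=` F n, J `<=` F n & F n.+1 `<=` F n]) /\
  ~ exists N, forall n, (N <= n)%N -> F N `<=` F n].
have [K [[hK sK mK [G [hG nG]]] maxK]] := @noetherian_max C bad noe
  (fun K h => let: And4 h _ _ _ := h in h)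
  (ex_intro _ J (And4 hJ0 sJ0 mJ0 (ex_intro _ F (conj hF0 nF0)))).
have K1 : ~ K 1.
  move=> K1; apply: nG; exists 0%N => n _ a _.
  by case: (hG n) => h _ KG _; apply: ideal1 => //; exact: KG.
(* The last power of [m] not contained in [K] supplies [g]. *)
have [g [Kg mg]] : exists g, ~ K g /\ forall c, m c -> K (c * g).
  elim: s mK {mJ0 bad maxK} => [|t IH] mK; first by case: K1; exact: mK.
  have [h|h] := pselect (ipow m t `<=` K); first exact: IH.
  have [g [tg Kg]] : exists g, ipow m t g /\ ~ K g.
    by apply: contrapT => nn; apply: h => a ta; apply: contrapT => Ka; apply: nn; exists a.
  by exists g; split=> // c mc; apply: mK; exact: iprodM.
have mono i j : (i <= j)%N -> G j `<=` G i.
  move=> /subnK <-; elim: (j - i)%N => [|d IH]; first by rewrite add0n.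
  by rewrite addSn => a h; apply: IH; case: (hG (d + i)%N) => _ _ _; exact.
have [allg|] := pselect (forall n, G n g); last first.
  move=> /existsNP[i0 Gi0].
  have hKg : is_ideal (isum K (pgen g)) by apply: isum_ideal => //; exact: pgen_ideal.
  have hGg n : is_ideal (isum (G n) (pgen g)).
    by apply: isum_ideal; [case: (hG n)|exact: pgen_ideal].
  have : ~ bad (sat m (isum K (pgen g))).
    move=> hb; apply: Kg; apply: (maxK _ hb); last first.
      by apply: sub_sat => //; apply: isumr => //; exact: pgen_id.
    by move=> a Ka; apply: sub_sat => //; apply: isuml => //; exact: pgen_ideal.
  apply; split; [exact: sat_ideal|exact: sat_idem| |].
    by move=> a /mK Ka; apply: sub_sat => //; apply: isuml => //; exact: pgen_ideal.
  exists (fun n => sat m (isum (G n) (pgen g))); split=> [n|[N hN]].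
    split; [exact: sat_ideal|exact: sat_idem| |].
      apply: sat_mono; apply: isum_sub => //.
        by move=> a Ka; apply: isuml; [exact: pgen_ideal|case: (hG n) => _ _ KG _; exact: KG].
      by apply: isumr; case: (hG n).
    apply: sat_mono; apply: isum_sub => //.
      by move=> a Ga; apply: isuml; [exact: pgen_ideal|case: (hG n) => _ _ _; exact].
    by apply: isumr; case: (hG n).
  apply: nG; exists (maxn N i0) => n hn w Gw.
  have Nn : (N <= n)%N by lia.
  have [u [mu [v [_ [Gv [b ->] e]]]]] : sat m (isum (G n) (pgen g)) w.
    apply: (hN n Nn); apply: sub_sat => //; apply: isuml; first exact: pgen_ideal.
    by apply: mono Gw; lia.
  have [hGn sGn KGn _] := hG n; have [hGi sGi _ _] := hG i0.
  have mb : m b.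
    apply: contrapT => nb; apply: Gi0; apply: sGi; exists b; split=> //.
    rewrite (_ : b * g = u * w - v); last by rewrite e addrC addKr.
    apply: idealB => //; last by apply: mono Gv; lia.
    by apply: idealMl => //; apply: mono Gw; lia.
  by apply: sGn; exists u; split=> //; rewrite e; apply: idealD => //; apply: KGn; exact: mg.
have hKg : is_ideal (isum K (pgen g)) by apply: isum_ideal => //; exact: pgen_ideal.
apply: Kg; apply: (maxK (sat m (isum K (pgen g)))); last first.
- by apply: sub_sat => //; apply: isumr => //; exact: pgen_id.
- by move=> a Ka; apply: sub_sat => //; apply: isuml => //; exact: pgen_ideal.
split; [exact: sat_ideal|exact: sat_idem| |].
  by move=> a /mK Ka; apply: sub_sat => //; apply: isuml => //; exact: pgen_ideal.
exists G; split=> // n; case: (hG n) => h1 h2 h3 h4; split=> //.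
apply: subset_trans h2; apply: sat_mono; apply: isum_sub => //.
by apply: pgen_sub.
Qed.

(** Krull's principal ideal theorem for C / P, stated in [C]. The symbolic powers [Qi] of [Q] modulo
    [P] are stationary modulo [y] by the descending chain condition, hence stationary by Nakayama at
    [m]; Nakayama at [Q] then makes a power of [Q] locally contained in [P]. *)
Lemma principal_ideal_thm m P Q (y : C) : prime_ideal m -> prime_ideal P ->
  prime_ideal Q -> P `<=` Q -> Q `<=` m -> m y -> ~ Q y ->
  (forall L, prime_ideal L -> P `<=` L -> L y -> L `<=` m -> m `<=` L) ->
  Q `<=` P.
Proof.
move=> pm pP pQ PQ Qm my Qy hL.
have [hm hP hQ] := And3 (prime_ideal_ideal pm) (prime_ideal_ideal pP) (prime_ideal_ideal pQ).
pose J := isum P (pgen y).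
have hy := @pgen_ideal C y.
have hJ : is_ideal J by exact: isum_ideal.
have [s hs] : exists s, ipow m s `<=` sat m J.
  apply: ipow_sub_sat => // L pL JL; apply: hL => //.
    by move=> a Pa; apply: JL; exact: isuml.
  by apply: JL; apply: isumr => //; exact: pgen_id.
pose Qi i := sat Q (isum P (ipow Q i)).
have hPi i : is_ideal (isum P (ipow Q i)) by apply: isum_ideal => //; exact: ipow_ideal.
have hQi i : is_ideal (Qi i) by exact: sat_ideal.
have PQi i : P `<=` Qi i.
  by move=> a Pa; apply: sub_sat => //; apply: isuml => //; exact: ipow_ideal.
have hJQ i : is_ideal (isum J (Qi i)) by exact: isum_ideal.
have [N hN] := @ideal_dcc m s (sat m J) (fun i => sat m (isum J (Qi i))) pm
  (sat_ideal pm hJ) (@sat_idem m J pm) hs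
  (fun n => And4 (sat_ideal pm (hJQ n)) (@sat_idem m _ pm)
    (sat_mono (isuml (hQi n)))
    (sat_mono (isum_sub (hJQ n) (isuml (hQi n))
      (subset_trans (sat_mono (isum_sub (hPi n) (isuml (ipow_ideal Q n))
        (subset_trans (@ipowS_sub Q n) (isumr hP)))) (isumr hJ))))).
have step1 : Qi N `<=` Qi N.+1.
  have : Qi N `<=` sat m (Qi N.+1).
    apply: nakayama => // w Qw.
    have [u [nu [j [v [[p [_ [Pp [c ->] ->]]] Qv e]]]]] : sat m (isum J (Qi N.+1)) w.
      by apply: (hN N.+1) => //; apply: sub_sat => //; exact: isumr.
    (* [Qi N] is saturated at [Q] and [y] is outside [Q], so [c] lies in [Qi N] again; this puts
       [c * y] in [m] times [Qi N]. *)
    exists u; split=> //; exists (v + p), (c * y); split.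
    - by apply: idealD => //; exact: PQi.
    - rewrite mulrC; apply: iprodM => //.
      apply: (@sat_idem Q _ pQ); exists y; split=> //.
      rewrite (_ : y * c = u * w - (v + p)); last by rewrite e; ring.
      apply: (idealB (hQi N)); first exact: (idealMl _ (hQi N) Qw).
      apply: (idealD (hQi N)); last exact: PQi.
      apply: sat_mono Qv; apply: isum_sub => //; first by apply: isuml; exact: ipow_ideal.
      by move=> a /ipowS_sub; exact: isumr.
    - by rewrite e; ring.
  move=> h a /h /(sat_sub Qm); exact: sat_idem.
have step2 : ipow Q N `<=` sat Q P.
  apply: nakayama => //; first exact: ipow_ideal.
  move=> a Qa; apply: step1; apply: sub_sat => //; exact: isumr.
by move=> q Qq; apply: (@prime_expr _ _ _ N pP); apply: (sat_prime pP PQ); apply: step2; exact: ipow_expr.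
Qed.
End Krull.

(** * The height theorem and regular systems of parameters *)

Section Regular.
Variable C : comPzRingType.
Hypothesis noe : noetherian C.
Implicit Types (I J K P Q L m : set C) (y : nat -> C).

Definition chain_in J m n (P : nat -> set C) :=
  [/\ prime_chain n P, J `<=` P 0%N & P n = m].

Lemma chain_rcons n (P : nat -> set C) m : prime_chain n P -> prime_ideal m ->
  P n `<` m ->
  prime_chain n.+1 (fun i => if i == n.+1 then m else P i).
Proof.
move=> [h1 h2] pm pr; split=> i.
  rewrite leq_eqVlt => /orP[/eqP ->|]; first by rewrite eqxx.
  by rewrite ltnS => ni; rewrite ifF; [exact: h1|apply/negbTE; lia].
rewrite ltnS leq_eqVlt => /orP[/eqP ->|ni]; first by rewrite eqxx ifF//; apply/negbTE; lia.
by rewrite !ifF; [exact: h2| |]; apply/negbTE; lia.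
Qed.

Lemma chain_cons n (P : nat -> set C) L : prime_chain n P -> prime_ideal L ->
  L `<` P 0%N -> prime_chain n.+1 (fun i => if i is j.+1 then P j else L).
Proof.
by move=> [h1 h2] pL pr; split=> [[|i]//|[|i]//]; [exact: h1|exact: h2].
Qed.

(** At the cost of one link, [y] is pushed down the chain from its top to its bottom, one prime at a
    time, by the principal ideal theorem. *)
Lemma chain_swap n (P : nat -> set C) (y : C) : prime_chain n.+1 P -> P n.+1 y ->
  exists P' : nat -> set C, [/\ prime_chain n P', P 0%N `<=` P' 0%N, P' 0%N y & P' n = P n.+1].
Proof.
elim: n P => [|n IH] P [h1 h2] Py.
  exists (fun _ => P 1%N); split=> //; last by case: (h2 0%N).
  by split=> // i _; exact: h1.
have trunc (Q : nat -> set C) : (forall i, (i <= n)%N -> Q i = P i) -> prime_chain n.+1 Q ->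
    Q n.+1 y -> Q n.+1 `<` P n.+2 ->
    exists P' : nat -> set C, [/\ prime_chain n.+1 P', P 0%N `<=` P' 0%N, P' 0%N y & P' n.+1 = P n.+2].
  move=> QP cQ Qy Qm; have [P' [cP' s0 y0 e]] := IH Q cQ Qy.
  exists (fun i => if i == n.+1 then P n.+2 else P' i); split.
  - by apply: chain_rcons => //; [exact: h1|rewrite e].
  - by rewrite /= -QP.
  - by [].
  - by rewrite eqxx.
have [yQ|yQ] := pselect (P n.+1 y).
  apply: (trunc P) => //; last exact: h2.
  by split=> i hi; [apply: h1|apply: h2]; lia.
have [s1 ns1] := h2 n (leqnSn _); have [s2 ns2] := h2 n.+1 (leqnn _).
(* Without such an [L] the prime [P n.+2] would be minimal over [P n] and [y], which leaves no room
   for [P n.+1] strictly between. *)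
have [L [pL PL Ly [Lm nLm]]] : exists L, [/\ prime_ideal L, P n `<=` L, L y & L `<` P n.+2].
  apply: contrapT => h; apply: ns1.
  apply: (@principal_ideal_thm C noe (P n.+2) (P n) (P n.+1) y) => //.
  - exact: h1.
  - by apply: h1; lia.
  - by apply: h1; lia.
  move=> L pL PL Ly Lm; apply: contrapT => nLm; apply: h.
  by exists L; split.
have PnL : P n `<` L by split=> // LP; apply: yQ; apply: s1; exact: LP.
apply: (trunc (fun i => if i == n.+1 then L else P i)).
- by move=> i ni; rewrite ifF//; apply/negbTE; lia.
- apply: chain_rcons => //; split=> i hi; [apply: h1|apply: h2]; lia.
- by rewrite eqxx.
- by rewrite eqxx.
Qed.

(** Generators form a sequence over [nat] cut off at [n], so that prefixes and shifts of a system
    need no reindexing. The base ideal [J] lets inductions pass to quotients while staying in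
    [C]. *)
Definition addg J (y : nat -> C) n : set C :=
  [set a | exists j (c : nat -> C), J j /\ a = j + \sum_(i < n) c i * y i].

Lemma addg_ideal J y n : is_ideal J -> is_ideal (addg J y n).
Proof.
move=> hJ; split.
- exists 0, (fun _ => 0); split; first exact: ideal0.
  by rewrite big1 ?addr0// => i _; rewrite mul0r.
- move=> _ _ [j [c [Jj ->]]] [j' [c' [Jj' ->]]].
  exists (j + j'), (fun i => c i + c' i); split; first exact: idealD.
  by rewrite addrACA -big_split; congr (_ + _); apply: eq_bigr => i _; rewrite mulrDl.
- move=> a _ [j [c [Jj ->]]]; exists (a * j), (fun i => a * c i); split.
    exact: idealMl.
  by rewrite mulrDr mulr_sumr; congr (_ + _); apply: eq_bigr => i _; rewrite mulrA.
Qed.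

Lemma sub_addg J y n : J `<=` addg J y n.
Proof.
move=> j Jj; exists j, (fun _ => 0); split=> //.
by rewrite big1 ?addr0// => i _; rewrite mul0r.
Qed.

Lemma addg_gen J y n i : is_ideal J -> (i < n)%N -> addg J y n (y i).
Proof.
move=> hJ ni; exists 0, (fun j => (j == i)%:R); split; first exact: ideal0.
rewrite add0r (bigD1 (Ordinal ni))//= eqxx mul1r big1 ?addr0// => j.
by rewrite -val_eqE/= => /negbTE ->; rewrite mul0r.
Qed.

Lemma addg_sub J y n K : is_ideal K -> J `<=` K -> (forall i, (i < n)%N -> K (y i)) ->
  addg J y n `<=` K.
Proof.
move=> hK JK yK _ [j [c [/JK Kj ->]]]; apply: idealD => //.
by apply: ideal_sum => // i _; apply: idealMl => //; exact: yK.
Qed.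

Lemma addg0 J y : addg J y 0 = J.
Proof.
apply/seteqP; split; last exact: sub_addg.
by move=> _ [j [c [Jj ->]]]; rewrite big_ord0 addr0.
Qed.

Lemma addgS J y n : is_ideal J ->
  addg (isum J (pgen (y 0%N))) (fun i => y i.+1) n = addg J y n.+1.
Proof.
move=> hJ; have hA := @addg_ideal J y n.+1 hJ; have hp := @pgen_ideal C (y 0%N).
have hs := isum_ideal hJ hp.
apply/seteqP; split; apply: addg_sub => //.
- apply: isum_sub => //; first exact: sub_addg.
  by apply: pgen_sub => //; exact: addg_gen.
- by move=> i ni; exact: addg_gen.
- exact: addg_ideal.
- by move=> j Jj; apply: sub_addg; exact: isuml.
- move=> [|i] ni; last by apply: (addg_gen (fun i => y i.+1)).
  by apply: sub_addg; apply: isumr => //; exact: pgen_id.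
Qed.

(** Here [m] is minimal over [J] and the [y i]. Each generator costs one link of the chain by
    [chain_swap], and [J] accumulates the generators already spent. *)
Lemma krull_height n y J m d (P : nat -> set C) : is_ideal J -> chain_in J m d P ->
  (forall i, (i < n)%N -> m (y i)) ->
  (forall L, prime_ideal L -> J `<=` L -> (forall i, (i < n)%N -> L (y i)) ->
     L `<=` m -> m `<=` L) -> (d <= n)%N.
Proof.
elim: n y J d P => [|n IH] y J [|d] P hJ [[h1 h2] JP em] my hL //.
  have [s ns] := h2 0%N isT.
  have sm i : (i <= d.+1)%N -> P i `<=` m.
    rewrite -em => hi; have -> : i = (d.+1 - (d.+1 - i))%N by lia.
    elim: (d.+1 - i)%N => [|t IH]; first by rewrite subn0.
    have [td|td] := leqP d.+1 t; first by rewrite (_ : (_ - t.+1)%N = d.+1 - t)%N//; lia.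
    have := h2 (d.+1 - t.+1)%N; rewrite (_ : (d.+1 - t.+1).+1 = d.+1 - t)%N; last by lia.
    by move=> /(_ ltac:(lia))[+ _] => /subset_trans; exact.
  have := hL _ (h1 0%N isT) JP; move=> /(_ ltac:(by []) (sm 0%N isT)).
  by move/(subset_trans (sm 1%N isT)).
have [|P' [cP' s0 y0 e]] := @chain_swap d P (y 0%N) (conj h1 h2).
  by rewrite em; exact: my.
have hp := @pgen_ideal C (y 0%N).
have hP'0 : is_ideal (P' 0%N) by case: cP' => h _; exact: prime_ideal_ideal (h 0%N isT).
apply: (IH (fun i => y i.+1) (isum J (pgen (y 0%N))) d P').
- exact: isum_ideal.
- split=> //; last by rewrite e.
  by apply: isum_sub => //; [exact: subset_trans s0|exact: pgen_sub].
- by move=> i ni; exact: my.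
- move=> L pL JL Ly; apply: hL => //; first by move=> a Ja; apply: JL; exact: isuml.
  by move=> [|i] ni; [apply: JL; apply: isumr => //; exact: pgen_id|exact: Ly].
Qed.

Variable m : set C.
Hypothesis pm : prime_ideal m.
Hypothesis local : forall u, ~ m u -> invertible u.

Lemma sat_local J : is_ideal J -> sat m J `<=` J.
Proof.
move=> hJ w [u [/local[v uv] Jw]].
rewrite (_ : w = v * (u * w)); first exact: idealMl.
by rewrite mulrA (mulrC v) uv mul1r.
Qed.

Lemma nakayama_local N N' : is_ideal N -> is_ideal N' ->
  N `<=` isum N' (iprod m N) -> N `<=` N'.
Proof.
move=> hN hN' s; apply: subset_trans (sat_local hN').
by apply: nakayama => //; apply: subset_trans s _; exact: sub_sat.
Qed.

Lemma local_proper L : is_ideal L -> ~ L 1 -> L `<=` m.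
Proof.
move=> hL L1 a La; apply: contrapT => /local[b ab]; apply: L1.
by rewrite -ab; exact: idealMr.
Qed.

Lemma krull_local n y J d (P : nat -> set C) : is_ideal J -> chain_in J m d P ->
  m = addg J y n -> (d <= n)%N.
Proof.
move=> hJ ch em; apply: (krull_height hJ ch (y := y)).
  by move=> i ni; rewrite em; exact: addg_gen.
move=> L pL JL Ly _; rewrite em; apply: addg_sub => //; exact: prime_ideal_ideal.
Qed.

(* Killing one generator of a regular system of parameters leaves a chain one
   shorter above the quotient, and that quotient again satisfies the
   hypotheses. *)
Lemma regular_prime n y J (P : nat -> set C) : is_ideal J -> chain_in J m n P ->
  m = addg J y n ->
  forall i, (i <= n)%N ->
    prime_ideal (addg J y i) /\ ((i < n)%N -> ~ addg J y i (y i)).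
Proof.
elim: n y J P => [|n IH] y J P hJ ch em i.
  by rewrite leqn0 => /eqP ->; rewrite -em; split.
have [[h1 h2] JP eP] := ch.
have [|P' [cP' s0 y0 e]] := @chain_swap n P (y 0%N) (conj h1 h2).
  by rewrite eP em; exact: addg_gen.
have hp := @pgen_ideal C (y 0%N); have hJ1 := isum_ideal hJ hp.
have hP'0 : is_ideal (P' 0%N) by case: cP' => h _; exact: prime_ideal_ideal (h 0%N isT).
have ch1 : chain_in (isum J (pgen (y 0%N))) m n P'.
  split=> //; last by rewrite e.
  by apply: isum_sub => //; [exact: subset_trans s0|exact: pgen_sub].
have em1 : m = addg (isum J (pgen (y 0%N))) (fun i => y i.+1) n by rewrite addgS.
have IH1 := IH _ _ _ hJ1 ch1 em1.
case: i => [_|i ni]; last by have := IH1 i ni; rewrite addgS.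
have [pJ1 _] := IH1 0%N isT; rewrite addg0 in pJ1; rewrite addg0.
(* Otherwise the prime J + (y 0) could be put in front of [P'], giving a chain longer than the
   number of remaining generators. *)
have sJ1 : P' 0%N `<=` isum J (pgen (y 0%N)).
  apply: contrapT => ns; have [_ JP' _] := ch1.
  suff : (n.+1 <= n)%N by rewrite ltnn.
  apply: (@krull_local n (fun i => y i.+1) (isum J (pgen (y 0%N))) n.+1
    (fun i => if i is j.+1 then P' j else isum J (pgen (y 0%N))) hJ1) => //.
  by split=> //; [exact: chain_cons|rewrite e].
have hP0 := prime_ideal_ideal (h1 0%N isT).
(* Otherwise the whole chain [P] would lie above J + (y 0), again too long for the remaining
   generators. *)
have y0P : ~ P 0%N (y 0%N).
  move=> y0P; suff : (n.+1 <= n)%N by rewrite ltnn.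
  apply: (@krull_local n (fun i => y i.+1) (isum J (pgen (y 0%N))) n.+1 P hJ1) => //.
  by split=> //; apply: isum_sub => //; exact: pgen_sub.
(* The multiplier [c] of [y 0] lies in the prime [P 0], since [y 0] does not; so [P 0] is contained
   in J + m P 0 and Nakayama applies. *)
have PJ : P 0%N `<=` J.
  apply: nakayama_local => // w Pw.
  have [j [_ [Jj [c ->] ew]]] := sJ1 _ (s0 _ Pw).
  exists j, (c * y 0%N); split=> //; rewrite mulrC; apply: iprodM.
    by rewrite em; exact: addg_gen.
  have : P 0%N (c * y 0%N) by rewrite (_ : _ * _ = w - j); [apply: idealB => //; exact: JP|rewrite ew addrAC subrr add0r].
  by case: (h1 0%N isT) => _ _ pr /pr[].
have eJ : J = P 0%N by apply/seteqP; split.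
by rewrite eJ; split=> //; exact: h1.
Qed.

(* The Koszul relations of a regular system of parameters. *)
Lemma regular_relation n y J (P : nat -> set C) e (g : nat -> C) : is_ideal J -> chain_in J m n P ->
  m = addg J y n -> (e <= n)%N -> J (\sum_(i < e) g i * y i) ->
  forall i, (i < e)%N -> addg J y e (g i).
Proof.
move=> hJ ch em; elim: e g => [//|e IH] g en Jg.
have hE := @addg_ideal J y e.+1 hJ.
have mono : addg J y e `<=` addg J y e.+1.
  apply: addg_sub => //; first exact: sub_addg.
  by move=> i ie; apply: addg_gen => //; lia.
have [[_ _ pr] ney] := regular_prime hJ ch em (ltnW en).
have hE' := @addg_ideal J y e hJ.
have [j [c [Jj ge]]] : addg J y e (g e).
  have : addg J y e (g e * y e).
    rewrite big_ord_recr/= addrC in Jg.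
    apply: (idealDl hE' (b := \sum_(i < e) g i * y i)); last exact: sub_addg.
    by apply: ideal_sum => // i _; apply: idealMl => //; exact: addg_gen.
  by move=> /pr[]// h; case: (ney en).
(* Substituting the expression of [g e] by the earlier generators folds the last term into the
   others and leaves a relation of length [e]. *)
have Jg' : J (\sum_(i < e) (g i + c i * y e) * y i).
  have -> : \sum_(i < e) (g i + c i * y e) * y i =
      \sum_(i < e.+1) g i * y i - j * y e.
    have e2 : \sum_(i < e) c i * y e * y i = (\sum_(i < e) c i * y i) * y e.
      by rewrite mulr_suml; apply: eq_bigr => i _; ring.
    rewrite (eq_bigr (fun i : 'I_e => g i * y i + c i * y e * y i)).
      by rewrite big_split/= e2 big_ord_recr/= ge; ring.
    by move=> i _; rewrite mulrDl.
  by apply: idealB => //; exact: idealMr.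
move=> i; rewrite ltnS leq_eqVlt => /orP[/eqP ->|ie].
  by apply: mono; exists j, c.
apply: (idealDl hE (b := c i * y e)).
  by apply: idealMl => //; exact: addg_gen.
by apply: mono; exact: (IH (fun i => g i + c i * y e) (ltnW en)).
Qed.

End Regular.

Lemma ord_fun_ext (T : Type) (t0 : T) n (x : 'I_n -> T) :
  exists y : nat -> T, forall i : 'I_n, y i = x i.
Proof.
by exists (fun i => if insub i is Some j then x j else t0) => i; rewrite valK.
Qed.

Section LocalRegular.
Variable D : comPzRingType.
Hypothesis noe : noetherian D.
Hypothesis loc : is_local D.
Let m : set D := nonunits (A := D).

Lemma zero_ideal (C : comPzRingType) : is_ideal [set (0 : C)].
Proof.
split=> //; first by move=> a b -> ->; rewrite addr0.
by move=> a b ->; rewrite mulr0.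
Qed.

Lemma nonunits_prime : prime_ideal m.
Proof.
split=> //; first by apply; exists 1; rewrite mulr1.
move=> a b mab; apply: contrapT => /not_orP[/contrapT[a' ea] /contrapT[b' eb]].
by apply: mab; exists (a' * b'); rewrite mulrACA ea eb mulr1.
Qed.

Lemma nonunitsN (u : D) : ~ m u -> invertible u.
Proof. exact: contrapT. Qed.

Lemma addg_zero_gen n (y : nat -> D) :
  addg [set 0] y n = ideal_gen (fun i : 'I_n => y i).
Proof.
apply/seteqP; split.
  move=> _ [_ [c [-> ->]]]; rewrite add0r; by exists (fun i => c i).
move=> _ [c ->]; have [c' hc'] := ord_fun_ext 0 c.
exists 0, c'; rewrite add0r; split=> //.
by apply: eq_bigr => i _; rewrite hc'.
Qed.

Lemma chain_to_top d (P : nat -> set D) : prime_chain d P ->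
  exists P' : nat -> set D, chain_in [set 0] m d P'.
Proof.
move=> [h1 h2]; exists (fun i => if i == d then m else P i); split; last by rewrite eqxx.
  split=> i hi; first by case: eqP => _; [exact: nonunits_prime|exact: h1].
  have [s ns] := h2 i hi.
  rewrite ifF; last by apply/negbTE; lia.
  case: eqP => [e|_]; last by split.
  have Pm j : (j <= d)%N -> P j `<=` m.
    by move=> /h1[hP P1 _]; apply: local_proper; [exact: nonunitsN|..].
  split; first by apply: Pm; exact: ltnW.
  by move=> mP; apply: ns; apply: subset_trans mP; exact: Pm.
move=> _ ->; case: eqP => _; first by apply: ideal0.
by have /h1 /prime_ideal_ideal := leq0n d; exact: ideal0.
Qed.

(** The given chain bounds the dimension from below, the number of generators bounds it from above
    by [krull_local]. *)
Lemma regular_local_intro n (y : nat -> D) (P : nat -> set D) :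
  m = addg [set 0] y n -> prime_chain n P -> regular_local D.
Proof.
move=> em ch; split=> //; exists n; split.
  split; first by exists P.
  move=> d P' /chain_to_top[P'' h].
  exact: (krull_local noe (@zero_ideal D) h em).
by exists (fun i : 'I_n => y i); rewrite -addg_zero_gen.
Qed.

(** The colon ideals of [J] by powers of [x] become stationary. This shows that the intersection [T]
    of the ideals J + (x^r) satisfies T = J + x T, and Nakayama gives T = J. *)
Lemma krull_intersection (J : set D) (x w : D) : is_ideal J -> m x ->
  (forall r, isum J (pgen (x ^+ r)) w) -> J w.
Proof.
move=> hJ mx Tw.
pose T : set D := [set w | forall r, isum J (pgen (x ^+ r)) w].
have hr r : is_ideal (isum J (pgen (x ^+ r))) by apply: isum_ideal => //; exact: pgen_ideal.
have hT : is_ideal T.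
  split; first by move=> r; exact: ideal0.
    by move=> a b Ta Tb r; exact: (idealD (hr r)).
  by move=> a b Tb r; exact: (idealMl _ (hr r)).
suff : T `<=` J by apply.
apply: (nakayama_local noe nonunits_prime nonunitsN) => // v Tv.
pose F r : set D := [set a | J (x ^+ r * a)].
have [r0 hr0] : exists N, forall n, (N <= n)%N -> F n `<=` F N.
  apply: noetherian_acc => // r.
    split; rewrite /F /=; first by rewrite mulr0; exact: ideal0.
      by move=> a b *; rewrite mulrDr; exact: idealD.
    by move=> a b *; rewrite mulrCA; exact: idealMl.
  by move=> a; rewrite /F /= exprS -mulrA; exact: idealMl.
have [j1 [_ [Jj1 [b1 ->] e1]]] := Tv r0.+1.
exists j1, (x * (x ^+ r0 * b1)); split=> //; last by rewrite e1 exprS; ring.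
apply: iprodM => // r.
have [j2 [_ [Jj2 [b2 ->] e2]]] := Tv (r0.+1 + r)%N.
have : F r0.+1 (b1 - b2 * x ^+ r).
  rewrite /F /= (_ : _ * _ = j2 - j1); first exact: idealB.
  have e3 : j1 + b1 * x ^+ r0.+1 = j2 + b2 * x ^+ (r0.+1 + r) by rewrite -e1 -e2.
  rewrite (_ : j2 = j1 + b1 * x ^+ r0.+1 - b2 * x ^+ (r0.+1 + r)); last by rewrite e3 addrK.
  by rewrite exprD; ring.
move=> /(hr0 _ (leqnSn _)); rewrite /F /= => h.
exists (x ^+ r0 * (b1 - b2 * x ^+ r)), (x ^+ r0 * b2 * x ^+ r); split=> //.
  by exists (x ^+ r0 * b2).
by ring.
Qed.

Lemma addgSr (J : set D) y n : is_ideal J ->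
  addg J y n.+1 = isum (addg J y n) (pgen (y n)).
Proof.
move=> hJ; apply/seteqP; split=> [_ [j [c [Jj ->]]]|].
  rewrite big_ord_recr/= addrA.
  exists (j + \sum_(i < n) c i * y i), (c n * y n); split=> //.
    by exists j, c.
  by exists (c n).
apply: isum_sub; first exact: addg_ideal.
  apply: addg_sub; [exact: addg_ideal|exact: sub_addg|].
  by move=> i ni; apply: addg_gen => //; lia.
by apply: pgen_sub; [exact: addg_ideal|exact: addg_gen].
Qed.

(** The ideals [Q j] of the first [j] generators form a chain of [n] links. They are proved prime
    downwards from [Q n], which is [m]: as [del j] preserves [Q j] and differentiates powers of
    [x j], in characteristic zero [x j] behaves like a variable over D / Q j. *)
Lemma regular_of_derivations n (x : nat -> D) (del : nat -> D -> D) :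
  m = addg [set 0] x n ->
  (forall i, zmod_morphism (del i)) ->
  (forall i a b, del i (a * b) = a * del i b + b * del i a) ->
  (forall i j, (i < n)%N -> (j < n)%N -> del i (x j) = (i == j)%:R) ->
  (forall N, invertible (N.+1%:R : D)) ->
  regular_local D.
Proof.
move=> em delB delM delx inv.
have z0 := @zero_ideal D; pose Q j := addg [set 0] x j.
have hQ j : is_ideal (Q j) by exact: addg_ideal.
have del0 i : del i 0 = 0 by have := delB i 0 0; rewrite !subrr.
have delD i a b : del i (a + b) = del i a + del i b.
  have delN c : del i (- c) = - del i c by rewrite -[- c]sub0r delB del0 sub0r.
  by rewrite -{1}(opprK b) delB delN opprK.
have del_sum i s (F : 'I_s -> D) : del i (\sum_(l < s) F l) = \sum_(l < s) del i (F l).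
  by elim: s F => [|s IH] F; rewrite ?big_ord0// !big_ord_recr/= delD IH.
have del1 i : del i 1 = 0.
  have := delM i 1 1; rewrite !mul1r => /(congr1 (fun t => t - del i 1)).
  by rewrite /= subrr addrK => /esym.
have Qm j : (j <= n)%N -> Q j `<=` m.
  move=> jn; rewrite em; apply: addg_sub => //.
    exact: sub_addg.
  by move=> i ij; apply: addg_gen => //; lia.
have delQ j a : (j < n)%N -> Q j a -> Q j (del j a).
  move=> jn [_ [c [-> ->]]]; rewrite add0r del_sum.
  apply: ideal_sum => // i _; rewrite delM delx//; last by have := ltn_ord i; lia.
  rewrite gtn_eqF// mulr0 add0r mulrC; apply: idealMl => //.
  exact: addg_gen.
have Q1 j : (j <= n)%N -> ~ Q j 1.
  by move=> jn /(Qm _ jn); case: nonunits_prime.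
(* Differentiating and dividing by the exponent lowers it by one. The term with [del j h] keeps a
   factor [x j], which lies in [Q j.+1]. *)
have stepN j N h : (j < n)%N -> Q j (x j ^+ N * h) -> Q j.+1 h.
  move=> jn; elim: N h => [|N IH] h.
    rewrite expr0 mul1r /Q addgSr//; apply: isuml; exact: pgen_ideal.
  have delX N' : del j (x j ^+ N') = N'%:R * x j ^+ N'.-1.
    elim: N' => [|N' IH']; first by rewrite expr0 del1 mul0r.
    rewrite exprS delM IH' delx// eqxx mulr1.
    case: N' {IH'} => [|N']; first by rewrite mul0r mulr0 add0r expr0 mulr1.
    rewrite [N'.+1.-1]/= [N'.+2.-1]/= [N'.+2%:R]mulrS [in RHS]exprS exprS; ring.
  move=> /(delQ _ _ jn); rewrite delM delX/= => h1.
  have : Q j.+1 (N.+1%:R * h + x j * del j h).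
    by apply: IH; move: h1; congr (Q j _); rewrite exprS; ring.
  move=> h2; have : Q j.+1 (N.+1%:R * h).
    apply: (idealDl (hQ _) (b := x j * del j h)) h2.
    by apply: idealMr => //; exact: addg_gen.
  have [t et] := inv N.
  move=> /(idealMl t (hQ _)); rewrite mulrA (mulrC t) et mul1r; exact.
have pQ j : (j <= n)%N -> prime_ideal (Q j).
  move=> jn; rewrite -(subKn jn); move: (n - j)%N => t.
  elim: t {j jn} => [|t IH].
    by rewrite subn0 /Q -em; exact: nonunits_prime.
  have [tn|tn] := leqP n t; first by rewrite (_ : (n - t.+1)%N = n - t)%N//; lia.
  set j := (n - t.+1)%N; have ejt : (n - t)%N = j.+1 by rewrite /j; lia.
  rewrite ejt in IH; have jn : (j < n)%N by rewrite /j; lia.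
  clearbody j; split=> //; first by apply: Q1; lia.
  have mx : m (x j) by rewrite em; apply: addg_gen.
  (* Modulo [Q j], an element outside [Q j] is a power of [x j] times an element outside [Q j.+1];
     the intersection theorem bounds the exponent. *)
  have ex f : ~ Q j f -> exists r f', ~ Q j.+1 f' /\ Q j (f - x j ^+ r * f').
    move=> nf; apply: contrapT => no; apply: nf.
    apply: (krull_intersection (x := x j)) => // r; elim: r => [|r [q [_ [Qq [f' ->] e]]]].
      by apply: isumr => //; exists f; rewrite expr0 mulr1.
    have [Qf|Qf] := pselect (Q j.+1 f').
      move: Qf; rewrite /Q addgSr// => -[q' [_ [Qq' [c ->] e']]].
      exists (q + q' * x j ^+ r), (c * x j ^+ r.+1); split; last by rewrite e e' exprS; ring.
        by apply: (idealD (hQ j)) => //; apply: (idealMr _ (hQ j)).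
      by exists c.
    case: no; exists r, f'; split=> //; rewrite e mulrC addrK //.
  move=> f g fg; apply: contrapT => /not_orP[/ex[r [f' [nf' ef]]] /ex[s [g' [ng' eg]]]].
  have : Q j.+1 (f' * g').
    apply: (stepN j (r + s)%N) => //.
    rewrite (_ : _ * _ = f * g - (f - x j ^+ r * f') * g - x j ^+ r * f' * (g - x j ^+ s * g')).
      by apply: (idealB (hQ j)); [apply: (idealB (hQ j)) => //; exact: (idealMr _ (hQ j))
        |exact: (idealMl _ (hQ j))].
    by rewrite exprD; ring.
  by case: IH => _ _ pr /pr[].
apply: (regular_local_intro em (P := Q)); split=> // j jn.
split; first by rewrite /Q addgSr//; apply: isuml; exact: pgen_ideal.
(* Strictness: [del j] preserves [Q j] and takes [x j] to 1. *)
move=> s; apply: (Q1 j (ltnW jn)); rewrite -[1]/(true%:R) -(eqxx j) -(delx j j)//.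
by apply: delQ => //; apply: s; exact: addg_gen.
Qed.

Lemma regular_dvr (p : D) : is_domain D -> p <> 0 -> m = pgen p -> regular_local D.
Proof.
move=> [o0 dom] p0 em.
have em' : m = addg [set 0] (fun _ => p) 1.
  rewrite addg_zero_gen em; apply/seteqP; split=> a.
    by move=> [c ->]; exists (fun _ => c); rewrite big_ord1.
  by move=> [c ->]; rewrite big_ord1; exists (c ord0).
apply: (regular_local_intro em' (P := fun i => if i is 0%N then [set 0] else m)).
split=> [[|i] _|[|//] _].
- split; [exact: zero_ideal|by []|by move=> a b /dom[->|->]; [left|right]].
- exact: nonunits_prime.
- split=> [_ ->|s]; first by apply: ideal0.
  by apply: p0; apply: s; rewrite em; exact: pgen_id.
Qed.

Lemma regular_field : (forall a : D, m a -> a = 0) -> regular_local D.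
Proof.
move=> m0; have em : m = addg [set 0] (fun _ => 0) 0.
  by rewrite addg0; apply/seteqP; split=> [a /m0//|_ ->]; apply: ideal0.
apply: (regular_local_intro em (P := fun _ => m)); split=> // i _.
exact: nonunits_prime.
Qed.

End LocalRegular.

(** * Localizations and tensor products *)

(** The localization at a prime of a domain: [la_inj] takes the place of the usual condition on the
    kernel, and [la_non] keeps elements of [z] from becoming units. *)
Record is_loc_at (R B : comPzRingType) (loc : {rmorphism R -> B}) (z : set R) : Prop :=
  IsLocAt {
    la_unit : forall v, ~ z v -> invertible (loc v);
    la_frac : forall b, exists a v, ~ z v /\ loc v * b = loc a;
    la_inj : injective loc;
    la_non : forall v, z v -> ~ invertible (loc v) }.

Lemma invertible_cancel (B : comPzRingType) (u a b : B) :
  invertible u -> u * a = u * b -> a = b.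
Proof.
move=> [v uv] /(congr1 (fun t => v * t)).
by rewrite /= !mulrA (mulrC v) uv !mul1r.
Qed.

Lemma invertibleM (B : comPzRingType) (u v : B) :
  invertible u -> invertible v -> invertible (u * v).
Proof. by move=> [a ea] [b eb]; exists (a * b); rewrite mulrACA ea eb mulr1. Qed.

Lemma invertibleMl (B : comPzRingType) (u v : B) : invertible (u * v) -> invertible u.
Proof. by move=> [a ea]; exists (v * a); rewrite mulrA. Qed.

Section Localization.
Variables (R B : comPzRingType) (loc : {rmorphism R -> B}) (z : set R).
Hypothesis pz : prime_ideal z.
Hypothesis L : is_loc_at loc z.
Let iz := prime_ideal_ideal pz.

Lemma notz_mul v w : ~ z v -> ~ z w -> ~ z (v * w).
Proof. by case: pz => _ _ pr nv nw /pr[]. Qed.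

Lemma notz1 : ~ z 1. Proof. by case: pz. Qed.

Lemma la_noetherian : noetherian R -> noetherian B.
Proof.
move=> noe I hI.
have hJ : is_ideal [set a | I (loc a)].
  split=> [|a b|a b] /=; rewrite ?rmorph0 ?rmorphD ?rmorphM.
  - exact: ideal0.
  - exact: idealD.
  - exact: idealMl.
have [n [x E]] := noe _ hJ.
exists n, (loc \o x); apply/seteqP; split=> b; last first.
  apply: ideal_gen_sub => // i /=.
  by have : [set a | I (loc a)] (x i) by rewrite E; exact: ideal_gen_in.
have [a [v [nv e]]] := la_frac L b => Ib.
have [w vw] := la_unit L nv.
have : [set a | I (loc a)] a by rewrite /= -e; exact: idealMl.
rewrite E => -[c ea]; exists (fun i => w * loc (c i)).
rewrite -(mul1r b) -vw mulrAC e ea rmorph_sum mulr_suml; apply: eq_bigr => i _.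
by rewrite rmorphM /=; ring.
Qed.

Definition ext (I : set R) : set B :=
  [set b | exists a v, [/\ I a, ~ z v & loc v * b = loc a]].

Lemma ext_ideal I : is_ideal I -> is_ideal (ext I).
Proof.
move=> hI; split.
- by exists 0, 1; rewrite mulr0 rmorph0; split=> //; [exact: ideal0|exact: notz1].
- move=> b b' [a [v [Ia nv e]]] [a' [v' [Ia' nv' e']]].
  exists (v' * a + v * a'), (v * v'); split.
  + by apply: idealD => //; exact: idealMl.
  + exact: notz_mul.
  + by rewrite rmorphD !rmorphM -e -e'; ring.
- move=> c b [a [v [Ia nv e]]]; have [a' [v' [nv' e']]] := la_frac L c.
  exists (a' * a), (v' * v); split; [exact: idealMl|exact: notz_mul|].
  by rewrite !rmorphM -e -e'; ring.
Qed.

Lemma ext_loc I a : I a -> ext I (loc a).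
Proof. by move=> Ia; exists a, 1; rewrite rmorph1 mul1r; split=> //; exact: notz1. Qed.

Lemma ext_locE I a : ext I (loc a) -> exists v, ~ z v /\ I (v * a).
Proof.
by move=> [b [v [Ib nv]]]; rewrite -rmorphM => /(la_inj L) e; exists v; rewrite e.
Qed.

Lemma la_nonunits : nonunits (A := B) = ext z.
Proof.
apply/seteqP; split=> b.
  have [a [v [nv e]]] := la_frac L b => nb; exists a, v; split=> //.
  apply: contrapT => na; apply: nb.
  by apply: (@invertibleMl _ _ (loc v)); rewrite mulrC e; exact: (la_unit L).
move=> [a [v [za nv e]]] ib; apply: (la_non L za); rewrite -e.
by apply: invertibleM => //; exact: (la_unit L).
Qed.

Lemma la_local : is_local B.
Proof. by rewrite /is_local la_nonunits; exact: ext_ideal. Qed.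

Lemma la_domain : is_domain R -> is_domain B.
Proof.
move=> [o dom]; split=> [e|b c bc].
  by apply: o; apply: (la_inj L); rewrite rmorph1 rmorph0.
have [a [v [nv e]]] := la_frac L b; have [a' [v' [nv' e']]] := la_frac L c.
have : loc (a * a') = 0.
  by rewrite rmorphM -e -e' mulrACA bc mulr0.
rewrite -(rmorph0 loc) => /(la_inj L)/dom[a0|a0].
  left; apply: (invertible_cancel (la_unit L nv)).
  by rewrite e a0 rmorph0 mulr0.
right; apply: (invertible_cancel (la_unit L nv')).
by rewrite e' a0 rmorph0 mulr0.
Qed.

Lemma ext_prod I J : is_ideal I -> is_ideal J ->
  iprod (ext I) (ext J) `<=` ext (iprod I J).
Proof.
move=> hI hJ; apply: iprod_sub; first by apply: ext_ideal; exact: iprod_ideal.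
move=> b b' [a [v [Ia nv e]]] [a' [v' [Ja' nv' e']]].
exists (a * a'), (v * v'); split; [exact: iprodM|exact: notz_mul|].
by rewrite !rmorphM -e -e'; ring.
Qed.

Lemma ext_prod_loc I J a : is_ideal I -> is_ideal J -> iprod I J a ->
  iprod (ext I) (ext J) (loc a).
Proof.
move=> hI hJ; apply: (@iprod_sub R I J [set a | iprod (ext I) (ext J) (loc a)]).
  have h := @iprod_ideal B (ext I) (ext J).
  split=> [|x y|x y] /=; rewrite ?rmorph0 ?rmorphD ?rmorphM.
  - exact: ideal0.
  - exact: idealD.
  - exact: idealMl.
by move=> x y Ix Jy /=; rewrite rmorphM; apply: iprodM; exact: ext_loc.
Qed.

(** The quotient rule. [T b c] is its form with denominators cleared, and it is single-valued
    because [loc] is injective. *)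
Lemma derivation_loc (del : R -> R) : zmod_morphism del ->
  (forall a b, del (a * b) = a * del b + b * del a) ->
  exists del' : B -> B, [/\ zmod_morphism del',
    forall a b, del' (a * b) = a * del' b + b * del' a &
    forall a, del' (loc a) = loc (del a)].
Proof.
move=> dB dM.
pose T b c := exists a v, [/\ ~ z v, loc v * b = loc a &
  loc v * c = loc (del a) - b * loc (del v)].
have del1 : del 1 = 0.
  have := dM 1 1; rewrite !mul1r => /(congr1 (fun t => t - del 1)).
  by rewrite /= subrr addrK => /esym.
have Tex b : exists c, T b c.
  have [a [v [nv e]]] := la_frac L b; have [w vw] := la_unit L nv.
  exists (w * (loc (del a) - b * loc (del v))), a, v; split=> //.
  by rewrite mulrA vw mul1r.
have Tuniq b c c' : T b c -> T b c' -> c = c'.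
  move=> [a [v [nv e1 e2]]] [a' [v' [nv' e1' e2']]].
  apply: (invertible_cancel (la_unit L (notz_mul nv nv'))); rewrite rmorphM.
  have e3 : a * v' = a' * v.
    by apply: (la_inj L); rewrite !rmorphM -e1 -e1'; ring.
  have := congr1 (fun t => loc (del t)) e3; rewrite /= !dM !rmorphD !rmorphM => e4.
  rewrite (_ : _ * _ * c = loc v' * (loc v * c)); last by ring.
  rewrite -[X in _ = X]mulrA e2 e2' !mulrBr.
  have -> : loc v' * loc (del a) = loc a' * loc (del v) + loc v * loc (del a') - loc a * loc (del v').
    by rewrite -e4; ring.
  by rewrite -e1 -e1'; ring.
pose d b := projT1 (cid (Tex b)).
have dP b : T b (d b) by rewrite /d; case: cid.
exists d; split.
- move=> b b'; apply: (Tuniq (b - b')) => //.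
  have [a [v [nv e1 e2]]] := dP b; have [a' [v' [nv' e1' e2']]] := dP b'.
  exists (v' * a - v * a'), (v * v'); split; first exact: notz_mul.
    by rewrite rmorphB !rmorphM -e1 -e1'; ring.
  rewrite dB !dM !(rmorphB, rmorphD, rmorphM) -e1 -e1'.
  rewrite (_ : loc v * loc v' * (d b - d b') = loc v' * (loc v * d b) - loc v * (loc v' * d b')); last by ring.
  by rewrite e2 e2'; ring.
- move=> b b'; apply: (Tuniq (b * b')) => //.
  have [a [v [nv e1 e2]]] := dP b; have [a' [v' [nv' e1' e2']]] := dP b'.
  exists (a * a'), (v * v'); split; first exact: notz_mul.
    by rewrite !rmorphM -e1 -e1'; ring.
  rewrite !dM !(rmorphD, rmorphM) -e1 -e1'.
  rewrite (_ : loc v * loc v' * _ = loc v * b * (loc v' * d b') + loc v' * b' * (loc v * d b)); last by ring.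
  by rewrite e2 e2'; ring.
- move=> a; apply: (Tuniq (loc a)) => //; exists a, 1; rewrite del1 rmorph1 rmorph0 mulr0 subr0 !mul1r.
  by split=> //; exact: notz1.
Qed.

End Localization.

(** A criterion for a given ring [R] to be the tensor product: [tp_univ] asks every balanced
    biadditive map to respect the relations among elementary tensors, from which [tp_lift] builds
    the induced map. *)
Record is_tensor (k A B R : comPzRingType) (kA : {rmorphism k -> A})
    (kB : {rmorphism k -> B}) (i1 : {rmorphism A -> R}) (i2 : {rmorphism B -> R}) : Prop :=
  IsTensor {
    tp_k : forall c, i1 (kA c) = i2 (kB c);
    tp_span : forall r, exists s : seq (A * B), r = \sum_(p <- s) i1 p.1 * i2 p.2;
    tp_univ : forall (M : zmodType) (beta : A -> B -> M),
      (forall b, zmod_morphism (beta^~ b)) -> (forall a, zmod_morphism (beta a)) ->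
      (forall c a b, beta (kA c * a) b = beta a (kB c * b)) ->
      forall s : seq (A * B), \sum_(p <- s) i1 p.1 * i2 p.2 = 0 ->
        \sum_(p <- s) beta p.1 p.2 = 0 }.

Lemma zmod_morph0 (U V : zmodType) (f : U -> V) : zmod_morphism f -> f 0 = 0.
Proof. by move=> h; have := h 0 0; rewrite !subrr. Qed.
Lemma zmod_morphN (U V : zmodType) (f : U -> V) a : zmod_morphism f -> f (- a) = - f a.
Proof. by move=> h; rewrite -[- a]sub0r h (zmod_morph0 h) sub0r. Qed.
Lemma zmod_morphD (U V : zmodType) (f : U -> V) a b : zmod_morphism f ->
  f (a + b) = f a + f b.
Proof. by move=> h; rewrite -{1}(opprK b) h (zmod_morphN _ h) opprK. Qed.
Lemma zmod_morph_sum (U V : zmodType) (f : U -> V) (T : Type) (s : seq T) (F : T -> U) :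
  zmod_morphism f -> f (\sum_(i <- s) F i) = \sum_(i <- s) f (F i).
Proof.
move=> h; elim: s => [|t s IH]; first by rewrite !big_nil (zmod_morph0 h).
by rewrite !big_cons (zmod_morphD _ _ h) IH.
Qed.

Section Tensor.
Variables (k A B R : comPzRingType) (kA : {rmorphism k -> A})
    (kB : {rmorphism k -> B}) (i1 : {rmorphism A -> R}) (i2 : {rmorphism B -> R}).
Hypothesis T : is_tensor kA kB i1 i2.

Lemma tp_lift (M : zmodType) (beta : A -> B -> M) :
  (forall b, zmod_morphism (beta^~ b)) -> (forall a, zmod_morphism (beta a)) ->
  (forall c a b, beta (kA c * a) b = beta a (kB c * b)) ->
  exists Phi : R -> M, zmod_morphism Phi /\ forall a b, Phi (i1 a * i2 b) = beta a b.
Proof.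
move=> b1 b2 b3.
pose rep r := projT1 (cid (tp_span T r)).
have repP r : r = \sum_(p <- rep r) i1 p.1 * i2 p.2 by rewrite /rep; case: cid.
pose Phi r := \sum_(p <- rep r) beta p.1 p.2.
have uniq s s' : \sum_(p <- s) i1 p.1 * i2 p.2 = \sum_(p <- s') i1 p.1 * i2 p.2 ->
    \sum_(p <- s) beta p.1 p.2 = \sum_(p <- s') beta p.1 p.2.
  move=> /eqP e; apply/eqP; move: e; rewrite -subr_eq0 => /eqP e.
  rewrite -subr_eq0; apply/eqP.
  have := @tp_univ _ _ _ _ _ _ _ _ T M beta b1 b2 b3 (s ++ [seq (- p.1, p.2) | p <- s']).
  rewrite !big_cat !big_map/= => h.
  apply: etrans (h _).
    rewrite -sumrN; congr (_ + _); apply: eq_bigr => p _.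
    by rewrite (zmod_morphN _ (b1 p.2)).
  apply: etrans e; rewrite -sumrN; congr (_ + _); apply: eq_bigr => p _.
  by rewrite rmorphN mulNr.
exists Phi; split=> [r r'|a b].
  rewrite /Phi -sumrN.
  have -> : \sum_(i <- rep r') - beta i.1 i.2 = \sum_(p <- [seq (- p.1, p.2) | p <- rep r']) beta p.1 p.2.
    by rewrite big_map/=; apply: eq_bigr => p _; rewrite (zmod_morphN _ (b1 p.2)).
  rewrite -big_cat/=; apply: uniq; rewrite -repP big_cat big_map/= -repP.
  rewrite {1}(repP r'); congr (_ + _); rewrite -sumrN; apply: eq_bigr => p _.
  by rewrite rmorphN mulNr.
have := uniq (rep (i1 a * i2 b)) [:: (a, b)].
by rewrite !big_seq1; apply; rewrite -repP.
Qed.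

Lemma tp_ind (P : R -> Prop) : (forall a b, P (i1 a * i2 b)) -> P 0 ->
  (forall r r', P r -> P r' -> P (r + r')) -> forall r, P r.
Proof.
move=> h h0 hD r; have [s ->] := tp_span T r.
by elim: s => [|p s IH]; rewrite ?big_nil ?big_cons//; exact: hD.
Qed.

Lemma tp_ring_lift (C : comPzRingType) (f : {rmorphism A -> C}) (g : {rmorphism B -> C}) :
  (forall c, f (kA c) = g (kB c)) ->
  exists Phi : {rmorphism R -> C}, (forall a, Phi (i1 a) = f a) /\ (forall b, Phi (i2 b) = g b).
Proof.
move=> e.
have [|||Phi [PB PE]] := @tp_lift C (fun a b => f a * g b).
- by move=> b x y; rewrite rmorphB mulrBl.
- by move=> a x y; rewrite rmorphB mulrBr.
- by move=> c a b; rewrite !rmorphM e; ring.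
have P1 : Phi 1 = 1 by have := PE 1 1; rewrite !rmorph1 !mulr1.
have PM : monoid_morphism Phi.
  split=> // r r'; elim/tp_ind: r => [a b||x y hx hy]; last first.
  - by rewrite mulrDl !(zmod_morphD _ _ PB) hx hy mulrDl.
  - by rewrite mul0r (zmod_morph0 PB) mul0r.
  elim/tp_ind: r' => [a' b'||x y hx hy]; last first.
  - by rewrite mulrDr !(zmod_morphD _ _ PB) hx hy mulrDr.
  - by rewrite mulr0 (zmod_morph0 PB) mulr0.
  by rewrite mulrACA -!rmorphM !PE !rmorphM; ring.
pose F : {rmorphism R -> C} := HB.pack Phi
    (GRing.isZmodMorphism.Build _ _ _ PB) (GRing.isMonoidMorphism.Build _ _ _ PM).
exists F; split=> [a|b].
  by have := PE a 1; rewrite !rmorph1 !mulr1.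
by have := PE 1 b; rewrite !rmorph1 !mul1r.
Qed.

Lemma tp_fin_gen : finitely_generated_algebra kA -> finitely_generated_algebra kB ->
  finitely_generated_algebra (i1 \o kA).
Proof.
move=> [n [x hx]] [n' [y hy]]; exists (n + n')%N.
pose w (i : 'I_(n + n')) := match fintype.split i with inl j => i1 (x j) | inr j => i2 (y j) end.
have wl i : w (lshift n' i) = i1 (x i) by rewrite /w; case: split_ordP => j;
  [move/lshift_inj ->|move/eqP; rewrite eq_lrshift].
have wr i : w (rshift n i) = i2 (y i) by rewrite /w; case: split_ordP => j;
  [move/eqP; rewrite eq_rlshift|move/rshift_inj ->].
exists w => S Sc Sw SB SM r.
have S0 : S 0 by rewrite -(subrr (i1 (kA 0))); apply: SB; exact: Sc.
have S1 a : S (i1 a).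
  apply: (hx [set a | S (i1 a)]) => [c|i|b c|b c] /=; rewrite ?rmorphB ?rmorphM//.
  - exact: Sc.
  - by rewrite -wl.
  - exact: SB.
  - exact: SM.
have S2 b : S (i2 b).
  apply: (hy [set a | S (i2 a)]) => [c|i|a c|a c] /=; rewrite ?rmorphB ?rmorphM//.
  - by rewrite -(tp_k T); exact: Sc.
  - by rewrite -wr.
  - exact: SB.
  - exact: SM.
elim/tp_ind: r => // [a b|r r' Sr Sr']; first exact: SM.
by rewrite -(opprK r'); apply: (SB) => //; rewrite -sub0r; exact: SB.
Qed.

(** Serves to cancel a denominator from [A] against one from [B]. Evaluating at a point of [A] where
    [a] and the first factor of the leading term of [r] survive writes its second factor as a
    multiple of [b] plus a combination of the other second factors; subtracting the multiple
    shortens the sum. *)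
Lemma tp_divides (a : A) (b : B) (r r' : R) :
  (forall c : A, c <> 0 -> exists phi : {rmorphism A -> k}, (forall l, phi (kA l) = l) /\ invertible (phi c)) ->
  is_domain A -> a <> 0 -> i1 a * r = i2 b * r' -> exists q, r = i2 b * q.
Proof.
move=> sep [_ dom] a0; have [s ->] := tp_span T r.
move: {2}(size s) (leqnn (size s)) => n; elim: n s r' => [|n IH] [|p s] r' //=.
- by move=> *; exists 0; rewrite big_nil mulr0.
- by move=> *; exists 0; rewrite big_nil mulr0.
rewrite ltnS => ss; rewrite big_cons => e.
have [p0|p0] := pselect (p.1 = 0).
  have [|q ->] := IH s r' ss.
    by rewrite -e p0 rmorph0 mul0r add0r.
  by exists q; rewrite p0 rmorph0 mul0r add0r.
have [phi [phk [t pht]]] := sep (a * p.1) (fun e => match dom _ _ e with or_introl h => a0 h | or_intror h => p0 h end).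
have [|ev [ev1 ev2]] := @tp_ring_lift B [the {rmorphism A -> B} of kB \o phi] [the {rmorphism B -> B} of idfun].
  by move=> c /=; rewrite phk.
have /= eb := congr1 ev e.
rewrite !rmorphM rmorphD !rmorphM /= !ev1 !ev2 /= in eb.
pose c (q : A * B) := t * phi (a * q.1).
have e2 : p.2 + \sum_(q <- s) kB (c q) * q.2 = b * (kB t * ev r').
  rewrite mulrCA -eb mulrDr mulrDr rmorph_sum; congr (_ + _).
    rewrite (mulrA (kB (phi a))) -rmorphM -rmorphM mulrA -rmorphM mulrC /=.
    by rewrite [t * _]mulrC pht rmorph1 mulr1.
  rewrite mulr_sumr mulr_sumr; apply: eq_bigr => q _.
  by rewrite rmorphM ev1 ev2/= /c !rmorphM; ring.
clearbody c.
pose s' := [seq (q.1 - kA (c q) * p.1, q.2) | q <- s].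
have e3 : \sum_(q <- s') i1 q.1 * i2 q.2 = i1 p.1 * i2 p.2 + \sum_(q <- s) i1 q.1 * i2 q.2
    - i1 p.1 * i2 (b * (kB t * ev r')).
  rewrite -e2 rmorphD mulrDr opprD addrACA subrr add0r rmorph_sum mulr_sumr -sumrB.
  rewrite big_map; apply: eq_bigr => q _ /=.
  by rewrite rmorphB !rmorphM (tp_k T); ring.
have [|q eq] := IH s' (r' - i1 a * i1 p.1 * i2 (kB t * ev r')) ltac:(by rewrite size_map).
  by rewrite e3 !mulrBr e rmorphM; ring.
exists (q + i1 p.1 * i2 (kB t * ev r')).
by rewrite mulrDr -eq e3 [i2 (b * _)]rmorphM; ring.
Qed.

End Tensor.

Section TensorConstruction.
Variables (k : fieldType) (A B : comPzRingType) (kA : {rmorphism k -> A})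
    (kB : {rmorphism k -> B}).

Definition kpoint (C : comPzRingType) (kC : {rmorphism k -> C}) : Type :=
  {f : {rmorphism C -> k} | forall c, f (kC c) = c}.

Definition tensor_fun (s : seq (A * B)) : kpoint kA * kpoint kB -> k :=
  fun x => \sum_(p <- s) sval x.1 p.1 * sval x.2 p.2.

Definition tensor_pred : {pred kpoint kA * kpoint kB -> k} :=
  fun f => `[< exists s, f = tensor_fun s >].

Lemma tensor_predP f : reflect (exists s, f = tensor_fun s) (f \in tensor_pred).
Proof. exact: asboolP. Qed.

Lemma tensor_subring : subring_closed tensor_pred.
Proof.
split.
- apply/tensor_predP; exists [:: (1, 1)]; apply/funext => x.
  by rewrite /tensor_fun big_seq1 !rmorph1 mulr1.
- move=> _ _ /tensor_predP[s ->] /tensor_predP[s' ->]; apply/tensor_predP.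
  exists (s ++ [seq (- p.1, p.2) | p <- s']); apply/funext => x.
  transitivity (tensor_fun s x - tensor_fun s' x) => //.
  rewrite /tensor_fun big_cat big_map/=; congr (_ + _).
  by rewrite -sumrN; apply: eq_bigr => p _; rewrite rmorphN mulNr.
- move=> _ _ /tensor_predP[s ->] /tensor_predP[s' ->]; apply/tensor_predP.
  exists [seq (p.1 * q.1, p.2 * q.2) | p <- s, q <- s']; apply/funext => x.
  transitivity (tensor_fun s x * tensor_fun s' x) => //.
  rewrite /tensor_fun big_allpairs_dep/= mulr_suml; apply: eq_bigr => p _.
  by rewrite mulr_sumr; apply: eq_bigr => q _; rewrite !rmorphM; ring.
Qed.

HB.instance Definition _ := GRing.isSubringClosed.Build _ tensor_pred tensor_subring.

Record tensor := Tensor { tensor_val : kpoint kA * kpoint kB -> k;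
  _ : tensor_val \in tensor_pred }.
HB.instance Definition _ := [isSub for tensor_val].
HB.instance Definition _ := [Choice of tensor by <:].
HB.instance Definition _ := GRing.SubChoice_isSubComPzRing.Build _ _ tensor (subringClosedP _).

Lemma tensor_inl_subproof a : (fun x : kpoint kA * kpoint kB => sval x.1 a) \in tensor_pred.
Proof.
apply/tensor_predP; exists [:: (a, 1)]; apply/funext => x.
by rewrite /tensor_fun big_seq1 rmorph1 mulr1.
Qed.
Lemma tensor_inr_subproof b : (fun x : kpoint kA * kpoint kB => sval x.2 b) \in tensor_pred.
Proof.
apply/tensor_predP; exists [:: (1, b)]; apply/funext => x.
by rewrite /tensor_fun big_seq1 rmorph1 mul1r.
Qed.
Definition tensor_inl (a : A) : tensor := Tensor (tensor_inl_subproof a).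
Definition tensor_inr (b : B) : tensor := Tensor (tensor_inr_subproof b).

Lemma tensor_inl_additive : zmod_morphism tensor_inl.
Proof. by move=> a b; apply/val_inj/funext => x /=; rewrite rmorphB. Qed.
Lemma tensor_inl_mult : monoid_morphism tensor_inl.
Proof. by split=> [|a b]; apply/val_inj/funext => x /=; rewrite ?rmorph1 ?rmorphM. Qed.
Lemma tensor_inr_additive : zmod_morphism tensor_inr.
Proof. by move=> a b; apply/val_inj/funext => x /=; rewrite rmorphB. Qed.
Lemma tensor_inr_mult : monoid_morphism tensor_inr.
Proof. by split=> [|a b]; apply/val_inj/funext => x /=; rewrite ?rmorph1 ?rmorphM. Qed.
HB.instance Definition _ := GRing.isZmodMorphism.Build A tensor tensor_inl tensor_inl_additive.
HB.instance Definition _ := GRing.isMonoidMorphism.Build A tensor tensor_inl tensor_inl_mult.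
HB.instance Definition _ := GRing.isZmodMorphism.Build B tensor tensor_inr tensor_inr_additive.
HB.instance Definition _ := GRing.isMonoidMorphism.Build B tensor tensor_inr tensor_inr_mult.

Definition separates_points (C : comPzRingType) (kC : {rmorphism k -> C}) :=
  forall c, c <> 0 -> exists x : kpoint kC, sval x c <> 0.

Hypotheses (sepA : separates_points kA) (sepB : separates_points kB).

Lemma tensor_val_sum s : val (\sum_(p <- s) tensor_inl p.1 * tensor_inr p.2) = tensor_fun s.
Proof.
rewrite (big_morph val (id1 := 0) (op1 := +%R))//.
by apply/funext => x; rewrite fct_sumE.
Qed.

(** Evaluating a vanishing sum at a point of [B] where the second factor of its first term survives
    expresses the first factor of that term by the others, since points of [A] separate elements.
    The relation gets shorter, and a balanced map follows it. *)
Lemma tensor_is_tensor : is_tensor kA kB [the {rmorphism A -> tensor} of tensor_inl]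
  [the {rmorphism B -> tensor} of tensor_inr].
Proof.
split.
- move=> c; apply/val_inj/funext => x /=.
  by rewrite (svalP x.1) (svalP x.2).
- move=> r; have /tensor_predP[s es] := valP r.
  by exists s; apply/val_inj; rewrite tensor_val_sum.
- move=> M beta b1 b2 b3 s; move: {2}(size s) (leqnn (size s)) => n.
  elim: n s => [|n IH] [|p s]; rewrite ?big_nil// ltnS !big_cons => ss e.
  have [p0|p0] := pselect (p.2 = 0).
    rewrite p0 (zmod_morph0 (b2 p.1)) add0r; apply: IH => //.
    by move: e; rewrite p0 rmorph0 mulr0 add0r.
  have [y y0] := sepB p0.
  pose c (q : A * B) := sval y q.2 / sval y p.2.
  have e1 : p.1 = - \sum_(q <- s) kA (c q) * q.1.
    apply/eqP; rewrite -addr_eq0; apply/eqP; apply: contrapT => ne.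
    have [x] := sepA ne; apply.
    have h : tensor_fun (p :: s) (x, y) = 0 by rewrite -tensor_val_sum big_cons e.
    rewrite /tensor_fun big_cons /= in h.
    apply: (mulIf (x := sval y p.2)); first exact/eqP.
    rewrite mul0r -[RHS]h rmorphD mulrDl; congr (_ + _).
    rewrite rmorph_sum mulr_suml; apply: eq_bigr => q _.
    rewrite rmorphM (svalP x) /c; field; exact/eqP.
  clearbody c.
  pose s' := [seq (q.1, q.2 - kB (c q) * p.2) | q <- s].
  have : \sum_(q <- s') beta q.1 q.2 = 0.
    apply: IH; first by rewrite size_map.
    rewrite -[RHS]e e1 rmorphN mulNr addrC rmorph_sum mulr_suml -sumrB big_map.
    apply: eq_bigr => q _ /=.
    have ec : tensor_inl (kA (c q)) = tensor_inr (kB (c q)).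
      by apply/val_inj/funext => x /=; rewrite (svalP x.1) (svalP x.2).
    rewrite -[RHS]/(tensor_inl q.1 * tensor_inr q.2 - tensor_inl (kA (c q) * q.1) * tensor_inr p.2).
    rewrite [tensor_inl (_ * _)](rmorphM tensor_inl) /= ec.
    rewrite -[LHS]/(tensor_inl q.1 * tensor_inr (q.2 - kB (c q) * p.2)).
    by rewrite (rmorphB tensor_inr) (rmorphM tensor_inr); ring.
  rewrite big_map/= => h; apply: etrans h.
  rewrite {1}e1 (zmod_morphN _ (b1 p.2)) (zmod_morph_sum _ _ (b1 p.2)) addrC -sumrB.
  by apply: eq_bigr => q _; rewrite b2 b3.
Qed.

(** Freezing the second variable at points where [u] and [v] do not vanish gives nonzero elements of
    [A], which survive together at some [x]; freezing the first variable at [x] gives nonzero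
    elements of [B], which survive together at some [y]. *)
Lemma tensor_domain : is_domain A -> is_domain B -> is_domain tensor.
Proof.
move=> [oA dA] [oB dB].
have ev1 (r : tensor) (y : kpoint kB) : exists a : A, forall x, val r (x, y) = sval x a.
  have /tensor_predP[s ->] := valP r.
  exists (\sum_(p <- s) kA (sval y p.2) * p.1) => x.
  rewrite rmorph_sum; apply: eq_bigr => p _.
  by rewrite rmorphM (svalP x) mulrC.
have ev2 (r : tensor) (x : kpoint kA) : exists b : B, forall y, val r (x, y) = sval y b.
  have /tensor_predP[s ->] := valP r.
  exists (\sum_(p <- s) kB (sval x p.1) * p.2) => y.
  rewrite rmorph_sum; apply: eq_bigr => p _.
  by rewrite rmorphM (svalP y).
have nz (r : tensor) : r <> 0 -> exists x y, val r (x, y) <> 0.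
  move=> r0; apply: contrapT => h; apply: r0; apply/val_inj/funext => -[x y].
  by apply: contrapT => n; apply: h; exists x, y.
split.
  move=> e; have [x x1] := sepA oA; have [y y1] := sepB oB.
  have := congr1 (fun r => val r (x, y)) e => /= /eqP.
  by rewrite oner_eq0.
move=> u v uv; apply: contrapT => /not_orP[/nz[x0 [y0 h0]] /nz[x1 [y1 h1]]].
have [a ea] := ev1 u y0; have [a' ea'] := ev1 v y1.
have [x xa] : exists x : kpoint kA, sval x (a * a') <> 0.
  apply: sepA => /dA[e|e].
    by apply: h0; rewrite ea e rmorph0.
  by apply: h1; rewrite ea' e rmorph0.
have [b eb] := ev2 u x; have [b' eb'] := ev2 v x.
have [y yb] : exists y : kpoint kB, sval y (b * b') <> 0.
  apply: sepB => /dB[e|e]; apply: xa; rewrite rmorphM.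
    by rewrite -ea eb e rmorph0 mul0r.
  by rewrite -ea' eb' e rmorph0 mulr0.
apply: yb; rewrite rmorphM -eb -eb'.
by have := congr1 (fun r => val r (x, y)) uv.
Qed.

End TensorConstruction.

Lemma fin_gen_separates (k : closedFieldType) (A : comPzRingType)
    (kA : {rmorphism k -> A}) : finitely_generated_algebra kA -> is_domain A ->
  separates_points kA.
Proof.
move=> fg [o dom] c c0.
have p0 : prime_ideal [set (0 : A)].
  split; [|by []|by move=> a b /dom[->|->]; [left|right]].
  split=> //; first by move=> a b -> ->; rewrite addr0.
  by move=> a b ->; rewrite mulr0.
have [phi [h1 _ h2]] := nullstellensatz fg p0 c0.
by exists (exist _ phi h1); exact/eqP.
Qed.

(** * Normality of the tensor product *)

(** Subrings and subfields are subsets of one field because the tower varies them inside Frac R;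
    [sring] and [sfield] make types of them where results on integral elements or polynomials over a
    field are applied. *)
Definition subring_set (F : fieldType) (S : set F) : Prop :=
  [/\ S 1, forall a b, S a -> S b -> S (a - b) & forall a b, S a -> S b -> S (a * b)].

Definition subfield_set (F : fieldType) (L : set F) : Prop :=
  subring_set L /\ forall a, L a -> L a^-1.

Section SubringSets.
Variables (F : fieldType) (S : set F).
Hypothesis hS : subring_set S.
Lemma sring1 : S 1. Proof. by case: hS. Qed.
Lemma sringB a b : S a -> S b -> S (a - b). Proof. by case: hS => _ + _; exact. Qed.
Lemma sringM a b : S a -> S b -> S (a * b). Proof. by case: hS => _ _; exact. Qed.
Lemma sring0 : S 0. Proof. by rewrite -(subrr 1); apply: sringB; exact: sring1. Qed.
Lemma sringN a : S a -> S (- a).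
Proof. by rewrite -sub0r => Sa; apply: sringB => //; exact: sring0. Qed.
Lemma sringD a b : S a -> S b -> S (a + b).
Proof. by rewrite -{2}(opprK b) => Sa Sb; apply: sringB => //; exact: sringN. Qed.
Lemma sring_sum (T : Type) (r : seq T) (P : pred T) (G : T -> F) :
  (forall i, P i -> S (G i)) -> S (\sum_(i <- r | P i) G i).
Proof. by move=> h; apply: big_ind => //; [exact: sring0|exact: sringD]. Qed.
Lemma sringX a n : S a -> S (a ^+ n).
Proof. by move=> Sa; elim: n => [|n IH]; [exact: sring1|rewrite exprS; exact: sringM]. Qed.
Lemma sring_nat n : S n%:R.
Proof.
by elim: n => [|n IH]; [exact: sring0|rewrite mulrS; apply: sringD => //; exact: sring1].
Qed.
End SubringSets.

Section SubringType.
Variables (F : fieldType) (S : set F) (hS : subring_set S).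
Definition sring_pred of subring_set S : {pred F} := fun x => `[< S x >].
Lemma sring_pred_closed : subring_closed (sring_pred hS).
Proof.
split; rewrite /in_mem/=; first by apply/asboolP; exact: sring1.
  by move=> a b /asboolP Sa /asboolP Sb; apply/asboolP; exact: sringB.
by move=> a b /asboolP Sa /asboolP Sb; apply/asboolP; exact: sringM.
Qed.
HB.instance Definition _ := GRing.isSubringClosed.Build F (sring_pred hS) sring_pred_closed.
Record sring := SRing { sring_val : F; _ : sring_val \in sring_pred hS }.
HB.instance Definition _ := [isSub for sring_val].
HB.instance Definition _ := [Choice of sring by <:].
HB.instance Definition _ := [SubChoice_isSubComNzRing of sring by <:].
Lemma sringP (x : sring) : S (val x).
Proof. by apply/asboolP; exact: (valP x). Qed.
Lemma sring_ex a : S a -> exists x : sring, val x = a.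
Proof. move=> Sa; have h : a \in sring_pred hS by exact/asboolP.
by exists (SRing h). Qed.
End SubringType.

Section SubfieldType.
Variables (F : fieldType) (L : set F) (hL : subfield_set L).
Definition sfield_pred of subfield_set L : {pred F} := fun x => `[< L x >].
Lemma sfield_pred_closed : divring_closed (sfield_pred hL).
Proof.
case: (hL) => hS hV; split; rewrite /in_mem/=; first by apply/asboolP; exact: sring1.
  by move=> a b /asboolP Sa /asboolP Sb; apply/asboolP; exact: sringB.
move=> a b /asboolP Sa /asboolP Sb; apply/asboolP; apply: sringM => //; exact: hV.
Qed.
HB.instance Definition _ := GRing.isDivringClosed.Build F (sfield_pred hL) sfield_pred_closed.
Record sfield := SField { sfield_val : F; _ : sfield_val \in sfield_pred hL }.
HB.instance Definition _ := [isSub for sfield_val].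
HB.instance Definition _ := [Choice of sfield by <:].
HB.instance Definition _ := [SubChoice_isSubIntegralDomain of sfield by <:].
HB.instance Definition _ := [SubIntegralDomain_isSubField of sfield by <:].
Lemma sfieldP (x : sfield) : L (val x).
Proof. by apply/asboolP; exact: (valP x). Qed.
Lemma sfield_ex a : L a -> exists x : sfield, val x = a.
Proof. move=> Sa; have h : a \in sfield_pred hL by exact/asboolP.
by exists (SField h). Qed.
End SubfieldType.

Definition coefs_in (F : fieldType) (S : set F) (p : {poly F}) := forall i, S p`_i.

Definition intover (F : fieldType) (S : set F) (w : F) :=
  exists p : {poly F}, [/\ p \is monic, coefs_in S p & root p w].

Section Intover.
Variables (F : fieldType).
Implicit Types (S L : set F).

Lemma coefs_in_map (E : fieldType) (i : {rmorphism E -> F}) (S : set E) (p : {poly F}) :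
  coefs_in (i @` S) p -> exists q, coefs_in S q /\ p = map_poly i q.
Proof.
move=> h; pose c j := projT1 (cid2 (h j)).
have cP j : S (c j) /\ i (c j) = p`_j by rewrite /c; case: cid2.
have e : p = map_poly i (\poly_(j < size p) c j).
  apply/polyP => j; rewrite coef_map coef_poly; case: ltnP => jp.
    by case: (cP j).
  by rewrite nth_default//; apply/esym; exact: (rmorph0 i).
exists (\poly_(j < size p) c j); split=> // j.
rewrite coef_poly; case: ltnP => jp; first by case: (cP j).
have [Sc ec] := cP (size p); move: ec; rewrite nth_default// -(rmorph0 i) => /fmorph_inj <-.
exact: Sc.
Qed.

Lemma coefs_in_sring S (hS : subring_set S) p : coefs_in S p ->
  exists q : {poly sring hS}, p = map_poly val q.
Proof.
move=> h; pose c j := projT1 (cid (sring_ex hS (h j))).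
have cP j : val (c j) = p`_j by rewrite /c; case: cid.
exists (\poly_(j < size p) c j); apply/polyP => j.
rewrite coef_map_id0// coef_poly; case: ltnP => jp; first by rewrite cP.
by rewrite nth_default.
Qed.

Lemma coefs_in_sfield L (hL : subfield_set L) p : coefs_in L p ->
  exists q : {poly sfield hL}, p = map_poly val q.
Proof.
move=> h; pose c j := projT1 (cid (sfield_ex hL (h j))).
have cP j : val (c j) = p`_j by rewrite /c; case: cid.
exists (\poly_(j < size p) c j); apply/polyP => j.
rewrite coef_map_id0// coef_poly; case: ltnP => jp; first by rewrite cP.
by rewrite nth_default.
Qed.

Lemma intover_integral S (hS : subring_set S) w :
  intover S w <-> integralOver (val : sring hS -> F) w.
Proof.
split.
  move=> [p [mp /(coefs_in_sring hS)[q eq] rp]]; exists q; last by rewrite -eq.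
  move: mp; rewrite eq !monicE lead_coef_map_inj//.
move=> [q mq rq]; exists (map_poly val q); split=> //.
  by move: mq; rewrite !monicE lead_coef_map_inj// => /eqP ->.
by move=> i; rewrite coef_map_id0//; exact: sringP.
Qed.

Lemma intover_integral_field L (hL : subfield_set L) w :
  intover L w <-> integralOver (val : sfield hL -> F) w.
Proof.
split.
  move=> [p [mp /(coefs_in_sfield hL)[q eq] rp]]; exists q; last by rewrite -eq.
  move: mp; rewrite eq !monicE lead_coef_map_inj//.
move=> [q mq rq]; exists (map_poly val q); split=> //.
  by move: mq; rewrite !monicE lead_coef_map_inj// => /eqP ->.
by move=> i; rewrite coef_map_id0//; exact: sfieldP.
Qed.

Lemma intover_mono S S' : S `<=` S' -> intover S `<=` intover S'.
Proof. by move=> s w [p [mp cp rp]]; exists p; split=> // i; exact: s. Qed.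

Lemma sub_intover S : subring_set S -> S `<=` intover S.
Proof.
move=> hS a /(sring_ex hS)[x <-]; apply/(intover_integral hS).
exact: (integral_id [the {rmorphism sring hS -> F} of val]).
Qed.

Lemma intover_sring S : subring_set S -> subring_set (intover S).
Proof.
move=> hS; split.
- by apply: sub_intover => //; exact: sring1.
- move=> a b /(intover_integral hS) ia /(intover_integral hS) ib.
  apply/(intover_integral hS).
  exact: (@integral_sub _ _ [the {rmorphism sring hS -> F} of val]).
- move=> a b /(intover_integral hS) ia /(intover_integral hS) ib.
  apply/(intover_integral hS).
  exact: (@integral_mul _ _ [the {rmorphism sring hS -> F} of val]).
Qed.

Lemma intover_root S p u : subring_set S -> p \is monic -> coefs_in (intover S) p ->
  root p u -> intover S u.
Proof.
move=> hS mp cp rp; apply/(intover_integral hS).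
apply: (@integral_root_monic _ _ [the {rmorphism sring hS -> F} of val] u p) => //.
by apply/integral_poly => i; apply/(intover_integral hS); exact: cp.
Qed.

Lemma intover_inv L u : subfield_set L -> intover L u -> intover L u^-1.
Proof.
move=> hL /(intover_integral_field hL) iu; apply/(intover_integral_field hL).
exact: (@integral_inv _ _ [the {rmorphism sfield hL -> F} of val]).
Qed.

Lemma coefs_inD S p q : subring_set S -> coefs_in S p -> coefs_in S q -> coefs_in S (p + q).
Proof. by move=> hS cp cq i; rewrite coefD; apply: sringD. Qed.
Lemma coefs_inM S p q : subring_set S -> coefs_in S p -> coefs_in S q -> coefs_in S (p * q).
Proof. by move=> hS cp cq i; rewrite coefM; apply: sring_sum => // j _; apply: sringM. Qed.
Lemma coefs_inC S c : subring_set S -> S c -> coefs_in S c%:P.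
Proof. by move=> hS Sc i; rewrite coefC; case: eqP => // _; exact: sring0. Qed.
Lemma coefs_inX S : subring_set S -> coefs_in S 'X.
Proof. by move=> hS i; rewrite coefX; exact: sring_nat. Qed.
Lemma coefs_inN S p : subring_set S -> coefs_in S p -> coefs_in S (- p).
Proof. by move=> hS cp i; rewrite coefN; apply: sringN. Qed.
Lemma coefs_in_exp S p n : subring_set S -> coefs_in S p -> coefs_in S (p ^+ n).
Proof.
move=> hS cp; elim: n => [|n IH]; last by rewrite exprS; exact: coefs_inM.
by rewrite expr0 -polyC1; apply: coefs_inC => //; exact: sring1.
Qed.
Lemma coefs_in_sum S (T : Type) (r : seq T) (G : T -> {poly F}) : subring_set S ->
  (forall i, coefs_in S (G i)) -> coefs_in S (\sum_(i <- r) G i).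
Proof.
move=> hS h; elim: r => [|t r IH]; rewrite ?big_nil ?big_cons; last exact: coefs_inD.
by rewrite -polyC0; apply: coefs_inC => //; exact: sring0.
Qed.
Lemma coefs_in_horner S p c : subring_set S -> coefs_in S p -> S c -> S p.[c].
Proof.
move=> hS cp Sc; rewrite horner_coef; apply: sring_sum => // i _.
by apply: sringM => //; exact: sringX.
Qed.

(** Newton interpolation: division by ['X - c%:P] removes a node, and the divided differences remain
    in [S] because differences of nodes are invertible there. *)
Lemma interpolation S (rs : seq F) (p : {poly F}) : subring_set S -> uniq rs ->
  (forall c, c \in rs -> S c) ->
  (forall c c', c \in rs -> c' \in rs -> c != c' -> S (c - c')^-1) ->
  (size p <= size rs)%N -> (forall c, c \in rs -> S p.[c]) -> coefs_in S p.
Proof.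
move=> hS; elim: rs p => [|c rs IH] p /=.
  move=> _ _ _; rewrite leqn0 size_poly_eq0 => /eqP -> _ i.
  by rewrite coef0; exact: sring0.
move=> /andP[nc urs] Src Sinv sp Sp.
have /factor_theorem[q eq] : root (p - p.[c]%:P) c by rewrite /root hornerD hornerN hornerC subrr.
have ep : p = q * ('X - c%:P) + p.[c]%:P by rewrite -eq subrK.
have Sc : S c by apply: Src; rewrite mem_head.
have cq : coefs_in S q.
  apply: IH => //.
  - by move=> c' c'r; apply: Src; rewrite inE c'r orbT.
  - by move=> d d' hd hd'; apply: Sinv; rewrite inE ?hd ?hd' orbT.
  - have [->|q0] := eqVneq q 0; first by rewrite size_poly0.
    have : (size (q * ('X - c%:P))%R <= (size rs).+1)%N.
      rewrite -eq (leq_trans (size_polyD _ _))// geq_max sp size_polyN.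
      by rewrite (leq_trans (size_polyC_leq1 _)).
    by rewrite size_Mmonic ?monicXsubC// size_XsubC addn2.
  - move=> d dr; have dc : d != c by apply: contraNneq nc => <-.
    have -> : q.[d] = (p.[d] - p.[c]) * (d - c)^-1.
      have := congr1 (fun t => t.[d]) ep.
      rewrite /= hornerD hornerM hornerC hornerXsubC => ->.
      by rewrite addrK mulfK// subr_eq0.
    apply: sringM => //; first by apply: sringB => //; apply: Sp; rewrite inE ?dr ?eqxx ?orbT.
    by apply: Sinv => //; rewrite inE ?dr ?eqxx ?orbT.
rewrite ep; apply: coefs_inD => //; last first.
  by apply: coefs_inC => //; apply: Sp; rewrite mem_head.
apply: coefs_inM => //; apply: coefs_inD => //; first exact: coefs_inX.
by apply: coefs_inN => //; exact: coefs_inC.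
Qed.

Definition fracs S : set F := [set w | exists a b, [/\ S a, S b, b != 0 & w = a / b]].

Lemma sub_fracs S : subring_set S -> S `<=` fracs S.
Proof.
move=> hS a Sa; exists a, 1; rewrite divr1 oner_neq0; split=> //; exact: sring1.
Qed.

Lemma fracs_subfield S : subring_set S -> subfield_set (fracs S).
Proof.
move=> hS; split; first split.
- by apply: sub_fracs => //; exact: sring1.
- move=> _ _ [a [b [Sa Sb b0 ->]]] [a' [b' [Sa' Sb' b0' ->]]].
  exists (a * b' - a' * b), (b * b'); rewrite mulf_neq0//; split=> //.
  + by apply: sringB => //; exact: sringM.
  + exact: sringM.
  + by field; rewrite b0 b0'.
- move=> _ _ [a [b [Sa Sb b0 ->]]] [a' [b' [Sa' Sb' b0' ->]]].
  exists (a * a'), (b * b'); rewrite mulf_neq0//; split=> //; [exact: sringM|exact: sringM|].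
  by field; rewrite b0 b0'.
- move=> _ [a [b [Sa Sb b0 ->]]]; have [->|a0] := eqVneq a 0.
    by rewrite mul0r invr0; apply: sub_fracs => //; exact: sring0.
  by exists b, a; split=> //; rewrite invf_div.
Qed.

Definition normal_in S := forall w, fracs S w -> intover S w -> S w.

Hypothesis char0 : forall n, n.+1%:R != 0 :> F.

Lemma natr_inj m n : (m%:R : F) = n%:R -> m = n.
Proof.
wlog mn : m n / (m <= n)%N.
  move=> h e; have [mn|/ltnW nm] := leqP m n; first exact: h.
  by apply/esym/h.
move=> /eqP; rewrite eq_sym -subr_eq0 -natrB//; case e: (n - m)%N => [|d].
  by move=> _; lia.
by rewrite (negbTE (char0 _)).
Qed.

Lemma avoid_roots (V : {poly F}) m : V != 0 -> exists rs : seq F,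
  [/\ uniq rs, size rs = m, forall c, c \in rs -> exists n, c = n%:R &
      forall c, c \in rs -> V.[c] != 0].
Proof.
(* Fewer than [size V] of these [m + size V] distinct elements are roots of [V], so at least [m]
   remain. *)
move=> V0; pose s := [seq n%:R : F | n <- iota 0 (m + size V)].
have us : uniq s by rewrite map_inj_uniq ?iota_uniq// => a b; exact: natr_inj.
pose t := seq.filter (predC (root V)) s.
have st : (m <= size t)%N.
  have : (size (seq.filter (root V) s) < size V)%N.
    apply: max_poly_roots => //; first exact: filter_all.
    exact: filter_uniq.
  have : (size (seq.filter (root V) s) + size t = m + size V)%N.
    by rewrite !size_filter count_predC size_map size_iota.
  by move: (size t) (size (seq.filter _ s)) (size V); lia.
exists (take m t); split.
- by apply: take_uniq; exact: filter_uniq.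
- by rewrite size_take_min (minn_idPl st).
- move=> c /mem_take; rewrite mem_filter => /andP[_ /mapP[n _ ->]].
  by exists n.
- by move=> c /mem_take; rewrite mem_filter => /andP[].
Qed.

(** If p(T) annihilates [w], then m^d p(T / m) annihilates [m * w]; with [m] a common denominator of
    the coefficients it is a monic polynomial over [S1]. *)
Lemma intover_clear S1 (M : set F) S' w : subring_set S1 -> M `<=` S1 -> M 1 ->
  (forall a b, M a -> M b -> M (a * b)) ->
  (forall s, S' s -> exists m, M m /\ S1 (m * s)) ->
  intover S' w -> exists m, M m /\ intover S1 (m * w).
Proof.
move=> hS1 MS M1 MM hM [p [mp cp rp]].
have [m [Mm hm]] : exists m, M m /\ forall i, (i < size p)%N -> S1 (m * p`_i).
  elim: (size p) => [|n [m [Mm hm]]]; first by exists 1.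
  have [m' [Mm' hm']] := hM _ (cp n).
  exists (m * m'); split; first exact: MM.
  move=> i; rewrite ltnS leq_eqVlt => /orP[/eqP ->|ni].
    by rewrite -mulrA; apply: sringM => //; exact: MS.
  by rewrite mulrAC; apply: sringM; [|exact: hm|exact: MS].
exists m; split=> //.
have sp : (0 < size p)%N by rewrite lt0n size_poly_eq0 monic_neq0.
pose d := (size p).-1.
have ld : p`_d = 1 by move: mp; rewrite monicE => /eqP.
have sq : size (\poly_(i < size p) (p`_i * m ^+ (d - i))) = size p.
  by rewrite size_poly_eq// -/d subnn expr0 mulr1 ld oner_neq0.
exists (\poly_(i < size p) (p`_i * m ^+ (d - i))); split.
- by rewrite monicE lead_coefE sq -/d coef_poly prednK// leqnn subnn expr0 mulr1 ld.
- move=> i; rewrite coef_poly; case: ltnP => ip; last exact: sring0.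
  have [->|id] := eqVneq i d; first by rewrite subnn expr0 mulr1 ld; exact: sring1.
  have -> : (d - i)%N = (d - i).-1.+1 by rewrite /d in id *; lia.
  rewrite exprS mulrCA mulrA; apply: sringM => //; first exact: hm.
  by apply: sringX => //; exact: MS.
- rewrite /root horner_poly (eq_bigr (fun i : 'I_(size p) => m ^+ d * (p`_i * w ^+ i))).
    by rewrite -mulr_sumr -horner_coef (eqP rp) mulr0.
  move=> i _; rewrite exprMn -mulrA (mulrA (m ^+ _)) -exprD subnK; first by ring.
  by have := ltn_ord i; rewrite /d; lia.
Qed.
End Intover.

(** A nonconstant divisor of least size is irreducible; adjoining one of its roots splits off a
    linear factor, and the cofactor is smaller. *)
Lemma monic_splits (E : fieldType) (f : {poly E}) : f \is monic ->
  exists (M : fieldType) (j : {rmorphism E -> M}) (rs : seq M),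
    map_poly j f = \prod_(r <- rs) ('X - r%:P).
Proof.
move: {2}(size f) (leqnn (size f)) => n.
elim: n E f => [|n IH] E f sf mf.
  by move: sf; rewrite leqn0 size_poly_eq0 (negbTE (monic_neq0 mf)).
have [s1|s1] := leqP (size f) 1.
  exists E, [the {rmorphism E -> E} of idfun], [::].
  rewrite big_nil map_poly_id//; have [c ef] : exists c : E, f = c%:P by exists f`_0; exact: size1_polyC.
  by move: mf; rewrite ef monicE lead_coefC => /eqP ->.
pose G m := `[< exists g : {poly E}, [/\ g %| f, (1 < size g)%N & size g = m] >].
have exG : exists m, G m by exists (size f); apply/asboolP; exists f.
case: (ex_minnP exG) => m /asboolP[g [gf g1 sg]] ming.
have g0 : g != 0 by rewrite -size_poly_gt0 ltnW.
have irr : irreducible_poly g.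
  split=> // q sq qg; have q0 : q != 0 by apply: contraNneq g0 => q0; move: qg; rewrite q0 dvd0p.
  rewrite -dvdp_size_eqp// eqn_leq dvdp_leq//=.
  rewrite sg; apply: ming; apply/asboolP; exists q; split=> //.
    exact: dvdp_trans qg gf.
  by rewrite ltn_neqAle eq_sym sq size_poly_gt0.
have [L _ [z rz _]] := fieldext.irredp_FAdjoin irr.
pose i : {rmorphism E -> L} := [the {rmorphism E -> L} of in_alg L].
have : root (map_poly i f) z.
  by have /dvdpP[q ->] := gf; rewrite rmorphM rootM rz orbT.
move=> /factor_theorem[h eh].
have mh : h \is monic.
  have : map_poly i f \is monic by rewrite map_monic.
  by rewrite eh monicMr ?monicXsubC.
have sh : (size h <= n)%N.
  have : size (map_poly i f) = size f by rewrite size_map_poly.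
  rewrite eh size_Mmonic ?monicXsubC ?monic_neq0// size_XsubC addn2/= => e.
  by move: sf; rewrite -e.
have [M [j [rs ers]]] := IH L h sh mh.
exists M, [the {rmorphism E -> M} of j \o i], (j z :: rs).
rewrite big_cons -ers map_poly_comp eh rmorphM mulrC; congr (_ * _).
by rewrite rmorphB /= map_polyX map_polyC.
Qed.

Lemma image_sring (E M : fieldType) (j : {rmorphism E -> M}) (S : set E) :
  subring_set S -> subring_set (j @` S).
Proof.
move=> hS; split.
- by exists 1; rewrite ?rmorph1//; exact: sring1.
- by move=> _ _ [a Sa <-] [b Sb <-]; exists (a - b); rewrite ?rmorphB//; exact: sringB.
- by move=> _ _ [a Sa <-] [b Sb <-]; exists (a * b); rewrite ?rmorphM//; exact: sringM.
Qed.

Lemma image_sfield (E M : fieldType) (j : {rmorphism E -> M}) (S : set E) :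
  subfield_set S -> subfield_set (j @` S).
Proof.
move=> [hS hV]; split; first exact: image_sring.
by move=> _ [a Sa <-]; exists a^-1; rewrite ?fmorphV//; exact: hV.
Qed.

Lemma intover_eq (F : fieldType) (S : set F) u d (c : nat -> F) : subring_set S ->
  (forall i, (i < d)%N -> intover S (c i)) -> u ^+ d + \sum_(i < d) c i * u ^+ i = 0 ->
  intover S u.
Proof.
move=> hS hc e; have hT := intover_sring hS.
have sp : (size (\poly_(i < d) c i) < (size ('X^d : {poly F})))%N.
  by rewrite size_polyXn ltnS size_poly.
apply: (@intover_root _ S ('X^d + \poly_(i < d) c i)) => //.
- by rewrite monicE lead_coefDl// lead_coefXn.
- apply: coefs_inD => //; first by apply: coefs_in_exp => //; exact: coefs_inX.
  by move=> i; rewrite coef_poly; case: ltnP => [id|_]; [exact: hc|exact: sring0].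
- by rewrite /root hornerD hornerXn horner_poly e.
Qed.

Lemma intover_eqP (F : fieldType) (S : set F) u : intover S u ->
  exists d (c : nat -> F), (forall i, S (c i)) /\ u ^+ d + \sum_(i < d) c i * u ^+ i = 0.
Proof.
move=> [p [mp cp /eqP rp]]; exists (size p).-1, (fun i => p`_i); split=> //.
have sp : (0 < size p)%N by rewrite lt0n size_poly_eq0 monic_neq0.
move: rp mp; rewrite horner_coef monicE lead_coefE.
case: (size p) sp => // n _; rewrite big_ord_recr /= => e /eqP e1.
by apply: etrans e; rewrite e1 mul1r addrC.
Qed.

Lemma intover_inj (E M : fieldType) (j : {rmorphism E -> M}) (S : set E) w :
  intover (j @` S) (j w) -> intover S w.
Proof.
move=> [p [mp /coefs_in_map[q [cq eq]] rp]]; exists q; split=> //.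
  by move: mp; rewrite eq map_monic.
by move: rp; rewrite eq fmorph_root.
Qed.

Lemma subfield_exists (F : fieldType) (L : set F) : subfield_set L ->
  exists (E : fieldType) (e : {rmorphism E -> F}), (forall a, L (e a)) /\
    forall p, coefs_in L p -> exists q, p = map_poly e q.
Proof.
move=> hL; exists (sfield hL), [the {rmorphism sfield hL -> F} of val].
by split=> [a|p /(coefs_in_sfield hL)//]; exact: sfieldP.
Qed.

(** * Normality after adjoining one element *)

Section NormalExtension.
Variable F : fieldType.
Hypothesis char0 : forall n, n.+1%:R != 0 :> F.
Variables (S L : set F) (x : F).
Hypotheses (hS : subring_set S) (nS : normal_in S) (hL : subfield_set L) (LS : L `<=` S).
(** Linear disjointness over [L], in the form used: an equation of [x] over [S] can be replaced by
    one over [L] of no larger degree. It gives the minimal polynomial of [x] over Frac S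
    coefficients in [L], so that its roots are integral over a field contained in the base. *)
Hypothesis LD : forall p : {poly F}, coefs_in S p -> p != 0 -> p.[x] = 0 ->
  exists q : {poly F}, [/\ coefs_in L q, q != 0, (size q <= size p)%N & q.[x] = 0].

Definition adjoin_ring : set F := [set w | exists p, coefs_in S p /\ w = p.[x]].

Lemma adjoin_sring : subring_set adjoin_ring.
Proof.
split.
- exists 1; rewrite hornerC; split=> //; rewrite -polyC1.
  by apply: coefs_inC => //; exact: sring1.
- move=> _ _ [p [cp ->]] [q [cq ->]]; exists (p - q); rewrite hornerD hornerN.
  by split=> //; apply: coefs_inD => //; exact: coefs_inN.
- move=> _ _ [p [cp ->]] [q [cq ->]]; exists (p * q); rewrite hornerM.
  by split=> //; exact: coefs_inM.
Qed.

Let adjoin_coefs (c : nat -> F) : (forall i, adjoin_ring (c i)) ->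
  exists g : nat -> {poly F}, forall i, coefs_in S (g i) /\ c i = (g i).[x].
Proof.
move=> h; exists (fun i => projT1 (cid (h i))) => i; by case: cid.
Qed.

(* A polynomial over Frac S whose values at enough natural numbers lie in S
   has its coefficients in S. *)
Lemma adjoin_normal_transcendental :
  (forall p, coefs_in S p -> p.[x] = 0 -> p = 0) ->
  forall w, fracs adjoin_ring w -> intover adjoin_ring w -> adjoin_ring w.
Proof.
move=> tr w0 [_ [_ [[U [cU ->]] [V [cV ->]] Vx ->]]] /intover_eqP[d [c [/adjoin_coefs[g hg] e]]].
set w := _ / _ in e *.
have V0 : V != 0 by apply: contraNneq Vx => ->; rewrite horner0.
(* The integral equation of U / V made homogeneous; as [x] is transcendental, it holds already
   between the polynomials. *)
pose H (A B : {poly F}) := A ^+ d + \sum_(i < d) g i * A ^+ i * B ^+ (d - i).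
have K0 : H U V = 0.
  apply: tr.
    apply: coefs_inD => //; first exact: coefs_in_exp.
    apply: coefs_in_sum => // i; apply: coefs_inM => //; last exact: coefs_in_exp.
    by apply: coefs_inM => //; [case: (hg i)|exact: coefs_in_exp].
  have -> : (H U V).[x] = V.[x] ^+ d * (w ^+ d + \sum_(i < d) c i * w ^+ i).
    rewrite hornerD horner_exp horner_sum mulrDr mulr_sumr; congr (_ + _).
      by rewrite -exprMn mulrC divfK.
    apply: eq_bigr => i _; rewrite !hornerM !horner_exp (hg i).2.
    have -> : V.[x] ^+ d = V.[x] ^+ i * V.[x] ^+ (d - i).
      by rewrite -exprD subnKC// ltnW.
    rewrite /w expr_div_n; move: (V.[x] ^+ i) (expf_neq0 i Vx) => Vi Vi0.
    by field.
  by rewrite e mulr0.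
have HM A B D : H (A * D) (B * D) = H A B * D ^+ d.
  rewrite /H mulrDl mulr_suml exprMn; congr (_ + _); apply: eq_bigr => i _.
  have -> : D ^+ d = D ^+ i * D ^+ (d - i) by rewrite -exprD subnKC// ltnW.
  by rewrite !exprMn; ring.
(* In lowest terms the equation makes [v] divide a power of [u], so [v] is constant and [w] is a
   polynomial in [x] over [F]. *)
pose D := gcdp U V; have D0 : D != 0 by rewrite gcdp_eq0 negb_and V0 orbT.
have [u eu] : exists u, U = u * D by apply/dvdpP; exact: dvdp_gcdl.
have [v ev] : exists v, V = v * D by apply/dvdpP; exact: dvdp_gcdr.
have cop : coprimep u v.
  have -> : u = U %/ D by rewrite eu mulpK.
  have -> : v = V %/ D by rewrite ev mulpK.
  by apply: coprimep_div_gcd; rewrite V0 orbT.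
have H0 : H u v = 0.
  move: K0; rewrite eu ev HM => /eqP; rewrite mulf_eq0 expf_eq0 (negbTE D0) andbF orbF.
  by move/eqP.
have v1 : size v == 1%N.
  have : v %| u ^+ d.
    have -> : u ^+ d = - \sum_(i < d) g i * u ^+ i * v ^+ (d - i).
      by apply/eqP; rewrite -addr_eq0; exact/eqP.
    rewrite dvdpNr; apply: (big_ind (fun t => v %| t)); [exact: dvdp0|exact: dvdp_add|].
    move=> i _; apply: dvdp_mull; have -> : (d - i)%N = (d - i).-1.+1 by have := ltn_ord i; lia.
    by rewrite exprS dvdp_mulIl.
  by move=> h; move: (coprimep_expl d cop); rewrite coprimep_sym => /coprimepP/(_ v (dvdpp v) h);
    rewrite -size_poly_eq1.
have [a [a0 eva]] : exists a : F, a != 0 /\ v = a%:P.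
  by move/size_poly1P: v1 => [a a0 ->]; exists a.
pose Pw := a^-1 *: u.
have eU : U = Pw * V.
  by rewrite eu ev eva /Pw -scalerAl mulrCA mul_polyC scalerA mulVf// scale1r.
have ew : w = Pw.[x] by rewrite /w eU hornerM mulfK.
have HP : H Pw 1 = 0.
  have : H (Pw * V) (1 * V) = 0 by rewrite -eU mul1r.
  rewrite HM => /eqP; rewrite mulf_eq0 expf_eq0 (negbTE V0) andbF orbF.
  by move/eqP.
rewrite -/w ew; exists Pw; split=> //.
have [rs [urs srs nrs Vrs]] := avoid_roots char0 (size Pw) V0.
have Lrs c0 : c0 \in rs -> L c0 by move=> /nrs[n ->]; apply: sring_nat; case: hL.
have Lrs' : forall c', c' \in rs -> S c' by move=> c' /Lrs; exact: LS.
apply: (@interpolation _ S rs) => //.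
- move=> c1 c2 h1 h2 _; apply: LS; case: hL => hL1; apply.
  by apply: sringB => //; exact: Lrs.
- by rewrite srs.
(* At a node the value is a fraction of [S], because [V] does not vanish there, and it satisfies the
   equation specialized at the node. *)
move=> c1 h1; apply: nS.
  exists U.[c1], V.[c1]; split; [| |exact: Vrs|by rewrite eU hornerM mulfK// Vrs].
    by apply: coefs_in_horner => //; exact: Lrs'.
  by apply: coefs_in_horner => //; exact: Lrs'.
apply: (@intover_eq _ S _ d (fun i => (g i).[c1])) => //.
  move=> i _; apply: sub_intover => //; apply: coefs_in_horner => //; last exact: Lrs'.
  by case: (hg i).
rewrite -[RHS](horner0 c1) -HP hornerD horner_exp horner_sum; congr (_ + _).
by apply: eq_bigr => i _; rewrite expr1n mulr1 hornerM horner_exp.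
Qed.

Lemma common_denominator (p : {poly F}) : coefs_in (fracs S) p ->
  exists s, [/\ S s, s != 0 & coefs_in S (s *: p)].
Proof.
move=> cp; have [s [Ss s0 hs]] : exists s, [/\ S s, s != 0 &
    forall i, (i < size p)%N -> S (s * p`_i)].
  elim: (size p) => [|n [s [Ss s0 hs]]].
    by exists 1; rewrite oner_neq0; split=> //; exact: sring1.
  have [a [b [Sa Sb b0 ep]]] := cp n.
  exists (s * b); split; [exact: sringM|exact: mulf_neq0|move=> i].
  rewrite ltnS leq_eqVlt => /orP[/eqP ->|ni].
    by rewrite ep -mulrA (mulrC b) divfK//; exact: sringM.
  by rewrite mulrAC; apply: sringM => //; exact: hs.
exists s; split=> // i; rewrite coefZ; have [ip|ip] := ltnP i (size p); first exact: hs.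
by rewrite nth_default// mulr0; exact: sring0.
Qed.

(** Write [w] as P(x) with P over Frac S of degree below that of the minimal polynomial. The
    conjugates of [w] are the values of P at the conjugates of [x]; they are integral over [S], so
    interpolation makes the coefficients of P integral over [S], and these lie in Frac S. *)
Lemma adjoin_normal_algebraic (q0 : {poly F}) :
  coefs_in L q0 -> q0 != 0 -> q0.[x] = 0 ->
  forall w, fracs adjoin_ring w -> intover adjoin_ring w -> adjoin_ring w.
Proof.
move=> cq0 q00 rq0.
have hE := fracs_subfield hS.
have [E [e [e_in e_lift]]] := subfield_exists hE.
pose SE : set E := [set a | S (e a)]; pose LE : set E := [set a | L (e a)].
have hSE : subring_set SE.
  split; rewrite /SE/mkset; first by rewrite rmorph1; exact: sring1.
    by move=> a b ? ?; rewrite rmorphB; exact: sringB.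
  by move=> a b ? ?; rewrite rmorphM; exact: sringM.
have hLE : subfield_set LE.
  have [hL1 hLV] := hL; split.
    split; rewrite /LE/mkset; first by rewrite rmorph1; exact: sring1.
      by move=> a b ? ?; rewrite rmorphB; exact: sringB.
    by move=> a b ? ?; rewrite rmorphM; exact: sringM.
  by move=> a; rewrite /LE/= fmorphV; exact: hLV.
have LSE : LE `<=` SE by move=> a; exact: LS.
pose ev (p : {poly E}) := (map_poly e p).[x].
have evB p q : ev (p - q) = ev p - ev q by rewrite /ev rmorphB hornerD hornerN.
have evD p q : ev (p + q) = ev p + ev q by rewrite /ev rmorphD hornerD.
have evM p q : ev (p * q) = ev p * ev q by rewrite /ev rmorphM hornerM.
have evC c : ev c%:P = e c by rewrite /ev map_polyC hornerC.
have evX p i : ev (p ^+ i) = ev p ^+ i by rewrite /ev rmorphXn horner_exp.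
have lift (P : set F) p : P `<=` fracs S -> coefs_in P p ->
    exists pE : {poly E}, p = map_poly e pE.
  by move=> sP cp; apply: e_lift => i; apply: sP; exact: cp.
have SF := sub_fracs hS; have LF : L `<=` fracs S by move=> a /LS /SF.
(* f is the minimal polynomial of x over Frac S *)
pose G m := `[< exists p : {poly E}, [/\ p != 0, ev p = 0 & size p = m] >].
have exG : exists m, G m.
  have [qE eqE] := lift L q0 LF cq0.
  exists (size qE); apply/asboolP; exists qE; split=> //; last by rewrite /ev -eqE.
  by apply: contraNneq q00 => qE0; rewrite eqE qE0 rmorph0.
case: (ex_minnP exG) => m /asboolP[f1 [f10 evf1 sf1]] minf1.
have {}minf1 p : p != 0 -> ev p = 0 -> (size f1 <= size p)%N.
  by move=> p0 evp; rewrite sf1; apply: minf1; apply/asboolP; exists p.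
(* By [LD] a polynomial of minimal degree can be taken with coefficients in [L]. *)
have [qE [cqE qE0 sqE evqE]] : exists qE : {poly E},
    [/\ coefs_in LE qE, qE != 0, (size qE <= size f1)%N & ev qE = 0].
  have [|s [Ss s0 cs]] := @common_denominator (map_poly e f1).
    by move=> i; rewrite coef_map; exact: e_in.
  have [||q [cq qn sq rq]] := LD cs.
  - by rewrite scaler_eq0 negb_or s0 map_poly_eq0.
  - by rewrite hornerZ -/(ev f1) evf1 mulr0.
  have [qE eqE] := lift L q LF cq.
  exists qE; split.
  - by move=> i; rewrite /LE /= -coef_map -eqE; exact: cq.
  - by apply: contraNneq qn => h; rewrite eqE h rmorph0.
  - by move: sq; rewrite eqE size_map_poly size_scale// size_map_poly.
  - by rewrite /ev -eqE.
pose f := (lead_coef qE)^-1 *: qE.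
have lq0 : (lead_coef qE)^-1 != 0 by rewrite invr_eq0 lead_coef_eq0.
have mf : f \is monic by rewrite monicE lead_coefZ mulVf// lead_coef_eq0.
have cf : coefs_in LE f.
  by move=> i; rewrite coefZ; apply: sringM; [case: hLE|case: hLE => _; apply; exact: cqE|exact: cqE].
have evf : ev f = 0 by rewrite /f -mul_polyC evM evqE mulr0.
have minf p : p != 0 -> ev p = 0 -> (size f <= size p)%N.
  by move=> p0 /(minf1 p p0); rewrite /f size_scale//; exact: leq_trans.
have f0 := monic_neq0 mf.
have fdvd H : ev H = 0 -> f %| H.
  move=> evH; rewrite /dvdp; apply: contraT => r0.
  have : (size f <= size (H %% f)%R)%N.
    apply: minf => //; rewrite (_ : H %% f = H - H %/ f * f); first by rewrite evB evM evf mulr0 evH subrr.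
    by rewrite [in X in X - _](divp_eq H f) addrC addKr.
  by rewrite leqNgt ltn_modp f0.
have cop p : ev p != 0 -> coprimep f p.
  move=> p0; rewrite /coprimep; set D := gcdp f p.
  have D0 : D != 0 by rewrite gcdp_eq0 negb_and f0.
  have [h eh] : exists h, f = h * D by apply/dvdpP; exact: dvdp_gcdl.
  have [h' eh'] : exists h', p = h' * D by apply/dvdpP; exact: dvdp_gcdr.
  have evD0 : ev D != 0 by apply: contraNneq p0 => z; rewrite eh' evM z mulr0.
  have h0 : h != 0 by apply: contraNneq f0 => z; rewrite eh z mul0r.
  have : (size f <= size h)%N.
    apply: minf => //; apply/eqP; move: evf; rewrite {1}eh evM => /eqP.
    by rewrite mulf_eq0 (negbTE evD0) orbF.
  move: D0 h0; rewrite eqn_leq -!size_poly_gt0 => D0 h0.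
  rewrite [in X in (X <= _)%N]eh size_mul -?size_poly_gt0// => h1; rewrite D0 andbT.
  by move: h1 h0 D0; move: (size h) (size D); lia.
have sf2 : (1 < size f)%N.
  rewrite ltnNge; apply/negP => /size1_polyC ef.
  have := evf; rewrite ef evC => /eqP; rewrite fmorph_eq0 => /eqP c0.
  by move: f0; rewrite ef c0 eqxx.
have chE n : n.+1%:R != 0 :> E.
  by rewrite -(fmorph_eq0 e) rmorph_nat char0.
(* In characteristic zero the derivative is nonzero and of smaller size than [f], so it cannot
   vanish at [x]. *)
have sep : coprimep f f^`().
  apply: cop; apply/negP => /eqP ev0.
  have d0 : f^`() != 0.
    apply/eqP => /polyP/(_ (size f).-2); rewrite coef_deriv coef0.
    have -> : (size f).-2.+1 = (size f).-1 by lia.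
    move: mf; rewrite monicE lead_coefE => /eqP ->.
    have -> : (size f).-1 = (size f).-2.+1 by lia.
    exact/eqP/chE.
  have := minf _ d0 ev0; rewrite leqNgt => /negP; apply.
  by rewrite lt_size_deriv.
move=> w [_ [_ [[U [cU ->]] [V [cV ->]] Vx ->]]] /intover_eqP[d [c [/adjoin_coefs[g hg] eqw]]].
have [UE eU] := lift S U SF cU; have [VE eV] := lift S V SF cV.
(* Bezout inverts [V] modulo [f], and a remainder modulo [f] bounds the size of [P]. *)
have [P [sP eP]] : exists P : {poly E}, (size P < size f)%N /\ ev P = U.[x] / V.[x].
  have evV : ev VE != 0 by rewrite /ev -eV.
  have /Bezout_coprimepP[[a b] /= hab] := cop _ evV.
  have /size_poly1P[t t0 et] : size (a * f + b * VE) == 1%N.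
    by rewrite (eqp_size hab) size_poly1.
  have evbV : ev b * ev VE = e t by rewrite -evC -et evD (evM a) evf mulr0 add0r evM.
  exists ((t^-1 *: (UE * b)) %% f); split; first by rewrite ltn_modp f0.
  have -> : forall T : {poly E}, ev (T %% f) = ev T.
    by move=> T; rewrite [in RHS](divp_eq T f) evD evM evf mulr0 add0r.
  rewrite -mul_polyC !evM evC {1}/ev -eU.
  have et0 : e t != 0 by rewrite fmorph_eq0.
  have evb : ev b = e t / V.[x].
    have eVx : ev VE = V.[x] by rewrite /ev -eV.
    by rewrite -evbV eVx mulfK.
  by rewrite evb fmorphV; field; rewrite Vx.
rewrite -eP in eqw *.
have [gE hgE] : exists gE : nat -> {poly E}, forall i, coefs_in SE (gE i) /\ g i = map_poly e (gE i).
  have ex i : exists p : {poly E}, coefs_in SE p /\ g i = map_poly e p.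
    have [cgi _] := hg i; have [p ep] := lift S (g i) SF cgi.
    by exists p; split=> // j; rewrite /SE /= -coef_map -ep; exact: cgi.
  by exists (fun i => projT1 (cid (ex i))) => i; case: cid.
have fH : f %| P ^+ d + \sum_(i < d) gE i * P ^+ i.
  apply: fdvd; rewrite evD evX -[RHS]eqw; congr (_ + _).
  rewrite {1}/ev rmorph_sum horner_sum; apply: eq_bigr => i _.
  by rewrite -/(ev (gE i * P ^+ i)) evM evX (hg i).2 (hgE i).2.
have [M [j [rs ers]]] := monic_splits mf.
have urs : uniq rs.
  by rewrite -separable.separable_prod_XsubC -ers separable.separable_map separable.separable_poly.unlock.
pose SM := j @` SE; pose LM := j @` LE.
have hSM := image_sring j hSE; have hLM := image_sfield j hLE.
have LSM : LM `<=` SM by move=> _ [a /LSE Sa <-]; exists a.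
have hT := intover_sring hSM.
have rsL r : r \in rs -> intover LM r.
  move=> rr; exists (map_poly j f); split; first by rewrite map_monic.
    by move=> i; rewrite coef_map; exists f`_i => //; exact: cf.
  by rewrite ers root_prod_XsubC.
(* The nodes and the inverses of their differences are integral over the field [LM]. The values of
   [P] at the nodes are integral over [SM], since [f] divides the polynomial expressing the integral
   equation. *)
have cP : coefs_in (intover SM) (map_poly j P).
  apply: (interpolation hT urs).
  - by move=> r /rsL; exact: intover_mono.
  - move=> r r' /rsL ir /rsL ir' _; apply: (intover_mono LSM); apply: intover_inv => //.
    by have [hLM1 _] := hLM; have := intover_sring hLM1; move/sringB; apply.
  - rewrite size_map_poly; have : size (map_poly j f) = (size rs).+1 by rewrite ers size_prod_XsubC.
    by rewrite size_map_poly => ef; rewrite -ltnS -ef.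
  - move=> r rr; apply: (@intover_eq _ SM _ d (fun i => (map_poly j (gE i)).[r])) => //.
      move=> i _.
      have : intover (intover SM) (map_poly j (gE i)).[r].
        apply: sub_intover => //; apply: coefs_in_horner => //.
          move=> l; rewrite coef_map; apply: sub_intover => //.
          by exists (gE i)`_l => //; case: (hgE i) => + _; apply.
        by apply: (intover_mono LSM); exact: rsL.
      by move=> [p [mp cp rp]]; exact: (intover_root hSM mp cp rp).
    have /dvdpP[H eH] := fH.
    have := congr1 (fun t => (map_poly j t).[r]) eH.
    rewrite /= rmorphD rmorphXn rmorph_sum hornerD horner_exp horner_sum => eH'.
    have -> : \sum_(i < d) (map_poly j (gE i)).[r] * (map_poly j P).[r] ^+ i =
        \sum_(i < d) (map_poly j (gE i * P ^+ i)).[r].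
      by apply: eq_bigr => i _; rewrite rmorphM rmorphXn hornerM horner_exp.
    rewrite eH' rmorphM hornerM /= ers.
    have /eqP -> : root (\prod_(r <- rs) ('X - r%:P)) r by rewrite root_prod_XsubC.
    by rewrite mulr0.
exists (map_poly e P); split=> // i; rewrite coef_map.
have := cP i; rewrite coef_map => /intover_inj iP.
apply: nS; first exact: e_in.
have [p [mp cp rp]] := iP; exists (map_poly e p); split.
- by rewrite map_monic.
- by move=> l; rewrite coef_map; exact: cp.
- by rewrite fmorph_root.
Qed.

(** The set is the ring generated by [S] and the field L(x). A factor [q.[x]] makes an element
    integral over this ring integral over S[x], to which the algebraic or the transcendental case
    applies. *)
Lemma adjoin_normal :
  normal_in [set w | exists p q, [/\ coefs_in S p, coefs_in L q, q.[x] != 0 & w = p.[x] / q.[x]]].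
Proof.
have core w : fracs adjoin_ring w -> intover adjoin_ring w -> adjoin_ring w.
  have [[q [cq q0 rq]]|no] := pselect (exists q, [/\ coefs_in L q, q != 0 & q.[x] = 0]).
    exact: (adjoin_normal_algebraic cq q0 rq).
  apply: adjoin_normal_transcendental => p cp rp; apply: contrapT => /eqP p0.
  by have [q [cq q0 _ rq]] := LD cp p0 rp; apply: no; exists q.
have [hL1 _] := hL.
pose M : set F := [set m | exists q, [/\ coefs_in L q, q.[x] != 0 & m = q.[x]]].
move=> w [_ [_ [[p1 [q1 [cp1 cq1 nq1 ->]]] [p2 [q2 [cp2 cq2 nq2 ->]]] b0 ->]]] iw.
have cLS q : coefs_in L q -> coefs_in S q by move=> h i; exact: LS.
have [_ [[q [cq nq ->]] iq]] : exists m, M m /\ intover adjoin_ring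
    (m * (p1.[x] / q1.[x] / (p2.[x] / q2.[x]))).
  apply: intover_clear iw; first exact: adjoin_sring.
  - by move=> _ [q [cq _ ->]]; exists q; split=> //; exact: cLS.
  - exists 1; rewrite hornerC oner_neq0; split=> //.
    by rewrite -polyC1; apply: coefs_inC => //; exact: sring1.
  - move=> _ _ [q [cq nq ->]] [q' [cq' nq' ->]]; exists (q * q').
    by rewrite hornerM mulf_neq0//; split=> //; exact: coefs_inM.
  - move=> _ [p [q [cp cq nq ->]]]; exists q.[x]; split; first by exists q.
    by exists p; rewrite mulrC divfK.
have p20 : p2.[x] != 0 by apply: contraNneq b0 => ->; rewrite mul0r.
have [|p [cp ep]] := core _ _ iq.
  exists (q * p1 * q2).[x], (q1 * p2).[x]; rewrite !hornerM; split.
  - by exists (q * p1 * q2); rewrite !hornerM; split=> //; apply: coefs_inM => //;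
      [apply: coefs_inM => //; exact: cLS|exact: cLS].
  - by exists (q1 * p2); rewrite !hornerM; split=> //; apply: coefs_inM => //; exact: cLS.
  - exact: mulf_neq0.
  - by field; rewrite nq1 nq2 p20.
exists p, q; split=> //; rewrite -ep; field.
by rewrite nq1 nq2 p20 nq.
Qed.

End NormalExtension.

Lemma tensor_sym (k A B R : comPzRingType) (kA : {rmorphism k -> A})
    (kB : {rmorphism k -> B}) (i1 : {rmorphism A -> R}) (i2 : {rmorphism B -> R}) :
  is_tensor kA kB i1 i2 -> is_tensor kB kA i2 i1.
Proof.
move=> T; split.
- by move=> c; rewrite (tp_k T).
- move=> r; have [s ->] := tp_span T r; exists [seq (p.2, p.1) | p <- s].
  by rewrite big_map; apply: eq_bigr => p _; rewrite mulrC.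
- move=> M beta b1 b2 b3 s e.
  have := @tp_univ _ _ _ _ _ _ _ _ T M (fun a b => beta b a) b2 b1 _ [seq (p.2, p.1) | p <- s].
  rewrite !big_map; apply.
    by move=> c a b; rewrite b3.
  by apply: etrans e; apply: eq_bigr => p _; rewrite mulrC.
Qed.

(* For the tensor product of rings of functions, a nonzero element stays
   nonzero after specialization at some point of the first factor. *)
Definition specializes (k A B R : comPzRingType) (kA : {rmorphism k -> A})
    (kB : {rmorphism k -> B}) (i1 : {rmorphism A -> R}) (i2 : {rmorphism B -> R}) :=
  forall r, r <> 0 -> exists phi : {rmorphism A -> k}, (forall c, phi (kA c) = c) /\
    forall ev : {rmorphism R -> B}, (forall a, ev (i1 a) = kB (phi a)) ->
      (forall b, ev (i2 b) = b) -> ev r <> 0.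

(** * The tower of subfields and denominators from one factor *)

Section HalfNormal.
Variables (k : fieldType) (A B R : comPzRingType) (kA : {rmorphism k -> A})
    (kB : {rmorphism k -> B}) (i1 : {rmorphism A -> R}) (i2 : {rmorphism B -> R}).
Hypothesis T : is_tensor kA kB i1 i2.
Hypothesis spec : specializes kA kB i1 i2.
Hypothesis i1_inj : injective i1.
Hypothesis i2_inj : injective i2.
Hypothesis char0 : forall n, n.+1%:R != 0 :> k.
Hypothesis fgB : finitely_generated_algebra kB.
Hypothesis nA : integrally_closed_domain A.
Variables (F : fieldType) (io : {rmorphism R -> F}).
Hypothesis io_inj : injective io.

Let a x := io (i1 x).
Let b y := io (i2 y).
Let b_inj : injective b. Proof. by move=> x y /io_inj/i2_inj. Qed.
Let b0 v : v <> 0 -> b v != 0.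
Proof.
by move=> v0; apply/eqP => e; apply: v0; apply: b_inj; rewrite e /b !rmorph0.
Qed.

(** The image of A (x) Frac B in Frac R: the largest subring to which specialization at every point
    of [A] is extended. *)
Let half : set F := [set w | exists r v, v <> 0 /\ w = io r / b v].

Let domB : forall x y : B, x <> 0 -> y <> 0 -> x * y <> 0.
Proof.
move=> x y /b0 x0 /b0 y0 xy; have := mulf_neq0 x0 y0.
by rewrite /b -!rmorphM xy !rmorph0 eqxx.
Qed.
Let B1 : (1 : B) <> 0.
Proof.
move=> e; have := oner_neq0 F; rewrite -(rmorph1 io) -(rmorph1 i2) e !rmorph0.
by rewrite eqxx.
Qed.

Section Specialization.
Variables (phi : {rmorphism A -> k}) (ev : {rmorphism R -> B}).
Hypotheses (phik : forall c, phi (kA c) = c) (ev1 : forall x, ev (i1 x) = kB (phi x))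
  (ev2 : forall y, ev (i2 y) = y).

(** The extension of [ev] to [half], made total on [F] by the dummy value 0 outside it; the chosen
    representation is immaterial by [specializeE]. *)
Definition specialize (w : F) : F :=
  if pselect (half w) is left h then
    let r := projT1 (cid h) in b (ev r) / b (projT1 (cid (projT2 (cid h))))
  else 0.

Lemma specializeE r v : v <> 0 -> specialize (io r / b v) = b (ev r) / b v.
Proof.
move=> v0; rewrite /specialize; case: pselect => [h|[]]; last by exists r, v.
move: (projT1 _) (projT2 (cid h)) => r' h' /=; case: cid => v' /= [v0' e].
have e2 : r * i2 v' = r' * i2 v.
  apply: io_inj; rewrite !rmorphM -/(b v) -/(b v').
  have := congr1 (fun t => t * b v * b v') e.
  by rewrite divfK ?b0// -mulrA (mulrC (b v)) mulrA divfK ?b0.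
have := congr1 ev e2; rewrite !rmorphM !ev2 => e3.
apply/eqP; rewrite eqr_div ?b0//; apply/eqP.
by rewrite /b -!rmorphM e3.
Qed.

Lemma specializeD w w' : half w -> half w' -> specialize (w + w') = specialize w + specialize w'.
Proof.
move=> [r [v [v0 ->]]] [r' [v' [v0' ->]]].
have -> : io r / b v + io r' / b v' = io (r * i2 v' + r' * i2 v) / b (v * v').
  by rewrite addf_div ?b0// /b !(rmorphD, rmorphM).
rewrite !specializeE//; last exact: domB.
by rewrite !(rmorphD, rmorphM) !ev2 addf_div ?b0// /b !(rmorphD, rmorphM).
Qed.

Lemma specializeM w w' : half w -> half w' -> specialize (w * w') = specialize w * specialize w'.
Proof.
move=> [r [v [v0 ->]]] [r' [v' [v0' ->]]].
have -> : io r / b v * (io r' / b v') = io (r * r') / b (v * v').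
  by rewrite mulf_div /b !rmorphM.
rewrite !specializeE//; last exact: domB.
by rewrite !rmorphM mulf_div /b !rmorphM.
Qed.

Lemma specialize_b y v : v <> 0 -> specialize (b y / b v) = b y / b v.
Proof. by move=> v0; rewrite specializeE// ev2. Qed.

Lemma specialize_a x : specialize (a x) = b (kB (phi x)).
Proof.
have -> : a x = io (i1 x) / b 1 by rewrite /b !rmorph1 divr1.
by rewrite specializeE// ev1 /b !rmorph1 divr1.
Qed.
End Specialization.

Let half_sring : subring_set half.
Proof.
split.
- by exists 1, 1; rewrite /b !rmorph1 divr1.
- move=> _ _ [r [v [v0 ->]]] [r' [v' [v0' ->]]].
  exists (r * i2 v' - r' * i2 v), (v * v'); split; first exact: domB.
  rewrite /b !(rmorphB, rmorphM); field.
  by rewrite -/(b v) -/(b v') !b0.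
- move=> _ _ [r [v [v0 ->]]] [r' [v' [v0' ->]]].
  exists (r * r'), (v * v'); split; first exact: domB.
  by rewrite mulf_div /b !rmorphM.
Qed.

Let fracB : set F := [set w | exists y v, v <> 0 /\ w = b y / b v].

(* The tower k(y_1) < k(y_1, y_2) < ... of subfields L of Frac B, together
   with the rings S = A L, which stay normal. *)
Let tower_level (S L : set F) :=
  [/\ [/\ subring_set S, normal_in S & subfield_set L],
      [/\ L `<=` S, S `<=` half & L `<=` fracB],
      (forall x, S (a x)) /\ (forall c, L (b (kB c))) &
      forall (phi : {rmorphism A -> k}) (ev : {rmorphism R -> B}), (forall c, phi (kA c) = c) -> (forall x, ev (i1 x) = kB (phi x)) ->
        (forall y, ev (i2 y) = y) -> forall w, S w -> L (specialize ev w)].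

Let specialize_L (phi : {rmorphism A -> k}) (ev : {rmorphism R -> B}) w :
  (forall x, ev (i1 x) = kB (phi x)) -> (forall y, ev (i2 y) = y) -> fracB w -> specialize ev w = w.
Proof. by move=> e1 e2 [y [v [v0 ->]]]; exact: specialize_b. Qed.

Let spec_horner (ev : {rmorphism R -> B}) (p : {poly F}) y :
  (forall y, ev (i2 y) = y) -> coefs_in half p ->
  specialize ev p.[b y] = (\poly_(i < size p) specialize ev p`_i).[b y].
Proof.
move=> e2 cp; have hb : half (b y) by exists (i2 y), 1; rewrite /b !rmorph1 divr1.
have sb n : specialize ev (b y ^+ n) = b y ^+ n.
  have -> : b y ^+ n = b (y ^+ n) / b 1 by rewrite /b !rmorphXn !rmorph1 divr1.
  exact: specialize_b.
have s0 : specialize ev 0 = 0.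
  have -> : 0 = b 0 / b 1 by rewrite /b !rmorph0 mul0r.
  exact: specialize_b.
rewrite horner_coef horner_poly.
have hs (s : seq 'I_(size p)) : half (\sum_(i <- s) p`_i * b y ^+ i) /\
   specialize ev (\sum_(i <- s) p`_i * b y ^+ i) = \sum_(i <- s) specialize ev p`_i * b y ^+ i.
  elim: s => [|i s [h1 h2]]; rewrite ?big_nil ?big_cons.
    by rewrite s0; split=> //; exact: sring0.
  have h3 : half (p`_i * b y ^+ i) by apply: sringM => //; exact: sringX.
  split; first exact: sringD.
  by rewrite specializeD// specializeM ?sb ?h2//; exact: sringX.
by case: (hs (index_enum _)).
Qed.

(** The point is the hypothesis [LD] of [adjoin_normal]: a relation of [b y] over [S] is specialized
    at a point of [A] where one of its nonzero coefficients survives, and becomes a nonzero relation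
    over [L] of no larger size. *)
Let tower_step S L y : tower_level S L -> exists S' L',
  [/\ tower_level S' L', L `<=` L' & L' (b y)].
Proof.
move=> [[hS nS hL] [LS Sh LB] [aS kL] spL].
have [hL1 hLV] := hL.
have LD : forall p : {poly F}, coefs_in S p -> p != 0 -> p.[b y] = 0 ->
  exists q : {poly F}, [/\ coefs_in L q, q != 0, (size q <= size p)%N & q.[b y] = 0].
  move=> p cp p0 rp.
  have [i pi] : exists i, p`_i != 0.
    by exists (size p).-1; rewrite -lead_coefE lead_coef_eq0.
  have [r [v [v0 epi]]] := Sh _ (cp i).
  have r0 : r <> 0 by move=> e; move: pi; rewrite epi e rmorph0 mul0r eqxx.
  have [phi [phk hphi]] := spec r0.
  have [|ev [ev1 ev2]] := @tp_ring_lift _ _ _ _ _ _ _ _ T B [the {rmorphism A -> B} of kB \o phi]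
     [the {rmorphism B -> B} of idfun].
    by move=> c /=; rewrite phk.
  have evr := hphi ev ev1 ev2.
  exists (\poly_(j < size p) specialize ev p`_j); split.
  - move=> j; rewrite coef_poly; case: ltnP => _; last exact: sring0.
    exact: (spL phi).
  - apply/eqP => /polyP/(_ i); rewrite coef_poly coef0.
    case: ltnP => [_|ip]; last by move: pi; rewrite nth_default ?eqxx.
    rewrite epi specializeE// => /eqP; rewrite mulf_eq0 invr_eq0 (negbTE (b0 v0)) orbF.
    by rewrite (negbTE (b0 evr)).
  - exact: size_poly.
  - rewrite -spec_horner//; last by move=> j; exact: Sh.
    rewrite rp; have -> : 0 = b 0 / b 1 by rewrite /b !rmorph0 mul0r.
    by rewrite specialize_b// /b !rmorph0 mul0r.
have chF n : n.+1%:R != 0 :> F.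
  by rewrite -(rmorph_nat [the {rmorphism k -> F} of (io \o (i2 \o kB))]) fmorph_eq0 char0.
have nS' := adjoin_normal chF hS nS hL LS LD.
set S' := mkset _ in nS'.
pose L' : set F := [set w | exists p q, [/\ coefs_in L p, coefs_in L q, q.[b y] != 0 & w = p.[b y] / q.[b y]]].
have ring_frac (P : set F) : subring_set P -> L `<=` P -> subring_set
   [set w | exists p q, [/\ coefs_in P p, coefs_in L q, q.[b y] != 0 & w = p.[b y] / q.[b y]]].
  move=> hP LP; have cLP q : coefs_in L q -> coefs_in P q by move=> h i; exact: LP.
  split.
  - exists 1, 1; rewrite hornerC divr1 oner_neq0 -polyC1; split=> //; apply: coefs_inC => //; exact: sring1.
  - move=> _ _ [p [q [cp cq q0 ->]]] [p' [q' [cp' cq' q0' ->]]].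
    exists (p * q' - p' * q), (q * q'); rewrite !(hornerM, hornerD, hornerN) mulf_neq0//.
    split=> //; [|exact: coefs_inM|by field; rewrite q0 q0'].
    by apply: coefs_inD => //; [|apply: coefs_inN => //]; apply: coefs_inM => //; exact: cLP.
  - move=> _ _ [p [q [cp cq q0 ->]]] [p' [q' [cp' cq' q0' ->]]].
    exists (p * p'), (q * q'); rewrite !hornerM mulf_neq0//.
    by split=> //; [exact: coefs_inM|exact: coefs_inM|by field; rewrite q0 q0'].
have sub_frac (P : set F) w : subring_set P -> P w -> exists p q,
   [/\ coefs_in P p, coefs_in L q, q.[b y] != 0 & w = p.[b y] / q.[b y]].
  move=> hP Pw; exists w%:P, 1; rewrite !hornerC divr1 oner_neq0 -polyC1; split=> //.
    exact: coefs_inC.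
  by apply: coefs_inC => //; exact: sring1.
have hbh : half (b y) by exists (i2 y), 1; rewrite /b !rmorph1 divr1.
have fracB_horner q : coefs_in L q -> exists u v, v <> 0 /\ q.[b y] = b u / b v.
  move=> cq; rewrite horner_coef; apply: (big_ind (fun w => fracB w)).
  - by exists 0, 1; rewrite /b !rmorph0 mul0r.
  - move=> _ _ [u [v [v0 ->]]] [u' [v' [v0' ->]]].
    exists (u * v' + u' * v), (v * v'); split; first exact: domB.
    by rewrite addf_div ?b0// /b !(rmorphD, rmorphM).
  - move=> i _; have [u [v [v0 ->]]] := LB _ (cq i).
    exists (u * y ^+ i), v; split=> //.
    by rewrite /b !rmorphM !rmorphXn; ring.
have inv_half w : fracB w -> half w^-1 /\ fracB w^-1.
  move=> [u [v [v0 ->]]]; have [u0|u0] := pselect (u = 0).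
    rewrite u0 /b !rmorph0 mul0r invr0; split.
      by exists 0, 1; rewrite !rmorph0 mul0r.
    by exists 0, 1; rewrite /b !rmorph0 mul0r.
  by rewrite invf_div; split; [exists (i2 v), u|exists v, u].
exists S', L'; split; first split.
- split=> //; first exact: (ring_frac S hS LS).
  split; first exact: (ring_frac L hL1 (fun _ h => h)).
  move=> _ [p [q [cp cq q0 ->]]]; have [p0|p0] := eqVneq p.[b y] 0.
    exists 0, 1; rewrite p0 mul0r invr0 horner0 mul0r hornerC oner_neq0; split=> //.
      by rewrite -polyC0; apply: coefs_inC => //; exact: sring0.
    by rewrite -polyC1; apply: coefs_inC => //; exact: sring1.
  by exists q, p; rewrite invf_div.
- split.
  + by move=> _ [p [q [cp cq q0 ->]]]; exists p, q; split=> // i; exact: LS.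
  + move=> _ [p [q [cp cq q0 ->]]]; apply: sringM => //.
      by apply: coefs_in_horner => // i; exact: Sh.
    by case: (inv_half q.[b y]) => //; exact: fracB_horner.
  + move=> _ [p [q [cp cq q0 ->]]].
    have [u [v [v0 ->]]] := fracB_horner p cp.
    have [_ [u' [v' [v0' ->]]]] := inv_half _ (fracB_horner q cq).
    exists (u * u'), (v * v'); split; first exact: domB.
    by rewrite mulf_div /b !rmorphM.
- split=> [x|c]; first exact: sub_frac.
  by apply: (sub_frac L) => //; exact: kL.
- move=> phi ev phk ev1 ev2 _ [p [q [cp cq q0 ->]]].
  have fq := fracB_horner q cq; have [hq fq'] := inv_half _ fq.
  have hp : half p.[b y] by apply: coefs_in_horner => // i; exact: Sh.
  rewrite specializeM// (specialize_L ev1 ev2 fq') spec_horner//; last by move=> i; exact: Sh.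
  exists (\poly_(i < size p) specialize ev p`_i), q; split=> // i.
  rewrite coef_poly; case: ltnP => _; last exact: sring0.
  exact: (spL phi).
- by move=> l Ll; exact: (sub_frac L).
- exists 'X, 1; rewrite hornerX hornerC divr1 oner_neq0; split=> //; first exact: coefs_inX.
  by rewrite -polyC1; apply: coefs_inC => //; exact: sring1.
Qed.

Let tower_base : exists S L, tower_level S L.
Proof.
have [[oA dA] icA] := nA.
have a_inj x y : a x = a y -> x = y by move/io_inj/i1_inj.
have hS : subring_set (range a).
  split.
  - by exists 1; rewrite // /a !rmorph1.
  - by move=> _ _ [x _ <-] [y _ <-]; exists (x - y); rewrite // /a !rmorphB.
  - by move=> _ _ [x _ <-] [y _ <-]; exists (x * y); rewrite // /a !rmorphM.
pose f : {rmorphism k -> F} := [the {rmorphism k -> F} of (io \o (i2 \o kB))].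
have fE c : f c = b (kB c) by [].
exists (range a), (range f); split.
- split=> //.
    move=> _ [_ [_ [[x _ <-] [y _ <-] y0 ->]]] /intover_eqP[d [c [hc e]]].
    have ny : y <> 0 by move=> e0; move: y0; rewrite e0 /a !rmorph0 eqxx.
    have exg i : exists z, a z = c i by have [z _ <-] := hc i; exists z.
    pose g i := projT1 (cid (exg i)).
    have gP i : a (g i) = c i by rewrite /g; case: cid.
    have [|q eq] := icA x y ny; last by exists q; rewrite // eq /a !rmorphM mulfK.
    exists d, (fun i => g i); apply: a_inj; rewrite /a !rmorphD !rmorphXn !rmorph_sum -/(a x).
    have -> : \sum_(i < d) io (i1 (g i * x ^+ i * y ^+ (d - i))) =
        a y ^+ d * \sum_(i < d) c i * (a x / a y) ^+ i.
      rewrite mulr_sumr; apply: eq_bigr => i _.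
      have -> : a y ^+ d = a y ^+ i * a y ^+ (d - i) by rewrite -exprD subnKC// ltnW.
      rewrite -gP /a !rmorphM !rmorphXn expr_div_n -/(a y); field.
      exact: expf_neq0.
    rewrite !rmorph0.
    transitivity (a y ^+ d * ((a x / a y) ^+ d + \sum_(i < d) c i * (a x / a y) ^+ i)).
      by rewrite mulrDr expr_div_n mulrCA mulfV ?mulr1//; exact: expf_neq0.
    by rewrite e mulr0.
  split; first split.
  + by exists 1; rewrite ?rmorph1.
  + by move=> _ _ [x _ <-] [y _ <-]; exists (x - y); rewrite ?rmorphB.
  + by move=> _ _ [x _ <-] [y _ <-]; exists (x * y); rewrite ?rmorphM.
  + by move=> _ [x _ <-]; exists x^-1; rewrite ?fmorphV.
- split.
  + by move=> _ [c _ <-]; exists (kA c); rewrite // /a (tp_k T).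
  + by move=> _ [x _ <-]; exists (i1 x), 1; rewrite /b !rmorph1 divr1.
  + by move=> _ [c _ <-]; exists (kB c), 1; rewrite /b !rmorph1 divr1.
- by split=> [x|c]; [exists x|exists c].
- move=> phi ev phk ev1 ev2 _ [x _ <-]; rewrite (specialize_a ev1 ev2).
  by exists (phi x).
Qed.

(** At the top of the tower [L] contains all of [B], so the normal ring [S] contains [R]. An
    integral fraction lies in [S], hence in [half], and has a denominator from [B]. *)
Lemma half_normal w : intover (range io) w -> (forall z : F, exists r s, s <> 0 /\ z = io r / io s) ->
  exists r v, v <> 0 /\ w = io r / io (i2 v).
Proof.
move=> iw fr; have [n [y hy]] := fgB.
have [S [L [tw Ly]]] : exists S L, tower_level S L /\ forall i, L (b (y i)).
  have [S0 [L0 tw0]] := tower_base.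
  have : forall m, (m <= n)%N -> exists S L, tower_level S L /\
      forall i : 'I_n, (i < m)%N -> L (b (y i)).
    elim=> [_|m IH mn]; first by exists S0, L0.
    have [S1 [L1 [tw1 h1]]] := IH (ltnW mn).
    have [S2 [L2 [tw2 L12 h2]]] := tower_step (y (Ordinal mn)) tw1.
    exists S2, L2; split=> // i; rewrite ltnS leq_eqVlt => /orP[/eqP e|im].
      by rewrite (_ : i = Ordinal mn)//; exact: val_inj.
    by apply: L12; exact: h1.
  move=> /(_ n (leqnn n))[S [L [tw h]]]; exists S, L; split=> // i; exact: h.
have [[hS nS hL] [LS Sh LB] [aS kL] spL] := tw; have [hL1 _] := hL.
have bL v : L (b v).
  apply: (hy [set v | L (b v)]) => [c|i|u v' |u v'] /=.
  - exact: kL.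
  - exact: Ly.
  - by rewrite /b !rmorphB; exact: sringB.
  - by rewrite /b !rmorphM; exact: sringM.
have ioS r : S (io r).
  elim/(tp_ind T): r => [x v||r r' Sr Sr'].
  - by rewrite rmorphM; apply: sringM => //; [exact: aS|apply: LS; exact: bL].
  - by rewrite rmorph0; exact: sring0.
  - by rewrite rmorphD; exact: sringD.
have Sw : S w.
  apply: nS; last by apply: intover_mono iw => _ [r _ <-]; exact: ioS.
  have [r [s [s0 ->]]] := fr w; exists (io r), (io s); split=> //.
  by apply/eqP => e; apply: s0; apply: io_inj; rewrite e rmorph0.
exact: Sh.
Qed.

End HalfNormal.

Lemma closed_char0 (k : fieldType) : [pchar k]%R =i pred0 -> forall n, n.+1%:R != 0 :> k.
Proof. by move=> /pcharf0P h n; rewrite h. Qed.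

Section GoodTensor.
Variables (k : closedFieldType) (A B : comPzRingType) (kA : {rmorphism k -> A})
    (kB : {rmorphism k -> B}).
Hypotheses (fgA : finitely_generated_algebra kA) (fgB : finitely_generated_algebra kB).
Hypotheses (dA : is_domain A) (dB : is_domain B).
Local Notation R := (tensor kA kB).
Definition tinl : {rmorphism A -> R} := [the {rmorphism A -> R} of @tensor_inl k A B kA kB].
Definition tinr : {rmorphism B -> R} := [the {rmorphism B -> R} of @tensor_inr k A B kA kB].
Let sepA := fin_gen_separates fgA dA.
Let sepB := fin_gen_separates fgB dB.

Lemma good_tensor : is_tensor kA kB tinl tinr.
Proof. exact: tensor_is_tensor. Qed.

Lemma good_domain : is_domain R.
Proof. exact: tensor_domain. Qed.

Lemma tinl_inj : injective tinl.
Proof.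
move=> a a' e; apply: contrapT => ne.
have nz : a - a' <> 0 by move=> /eqP; rewrite subr_eq0 => /eqP.
have [x xa] := sepA nz; have [y _] := sepB (proj1 dB).
apply: xa; rewrite rmorphB; apply/eqP; rewrite subr_eq0; apply/eqP.
exact: (congr1 (fun r : R => val r (x, y)) e).
Qed.

Lemma tinr_inj : injective tinr.
Proof.
move=> a a' e; apply: contrapT => ne.
have nz : a - a' <> 0 by move=> /eqP; rewrite subr_eq0 => /eqP.
have [y ya] := sepB nz; have [x _] := sepA (proj1 dA).
apply: ya; rewrite rmorphB; apply/eqP; rewrite subr_eq0; apply/eqP.
exact: (congr1 (fun r : R => val r (x, y)) e).
Qed.

Lemma tensor_nz (r : R) : r <> 0 -> exists x y, val r (x, y) <> 0.
Proof.
move=> r0; apply: contrapT => h; apply: r0; apply/val_inj/funext => -[x y].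
by apply: contrapT => n; apply: h; exists x, y.
Qed.

Lemma good_specl : specializes kA kB tinl tinr.
Proof.
move=> r /tensor_nz[x [y xy]]; exists (sval x); split; first exact: (svalP x).
move=> ev ev1 ev2 e; apply: xy; rewrite -(rmorph0 (sval y)) -e.
have [s ->] := tp_span good_tensor r.
rewrite tensor_val_sum rmorph_sum rmorph_sum; apply: eq_bigr => p _.
by rewrite !rmorphM ev1 ev2 (svalP y).
Qed.

Lemma good_specr : specializes kB kA tinr tinl.
Proof.
move=> r /tensor_nz[x [y xy]]; exists (sval y); split; first exact: (svalP y).
move=> ev ev2 ev1 e; apply: xy; rewrite -(rmorph0 (sval x)) -e.
have [s ->] := tp_span good_tensor r.
rewrite tensor_val_sum rmorph_sum rmorph_sum; apply: eq_bigr => p _.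
by rewrite !rmorphM ev1 ev2 (svalP x).
Qed.

Lemma good_fin_gen : finitely_generated_algebra (tinl \o kA).
Proof. exact: (tp_fin_gen good_tensor). Qed.

Lemma good_noetherian : noetherian R.
Proof.
exact: (@fin_gen_alg_noetherian k R [the {rmorphism k -> R} of tinl \o kA] good_fin_gen).
Qed.

(** Both versions of [half_normal] give the integral fraction a denominator [v] from [B] and another
    [u] from [A]; comparing them, [tp_divides] cancels [v]. *)
Lemma good_normal : [pchar k]%R =i pred0 -> integrally_closed_domain A ->
  integrally_closed_domain B -> integrally_closed_domain R.
Proof.
move=> char0 nA nB; split; first exact: good_domain.
move=> x y y0 [n [c e]]; have ch := closed_char0 char0.
have [F [io [io_inj fr]]] := frac_exists good_domain.
have y0' : io y != 0 by apply/eqP => h; apply: y0; apply: io_inj; rewrite h rmorph0.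
have hS : subring_set (range io).
  split.
  - by exists 1; rewrite ?rmorph1.
  - by move=> _ _ [a _ <-] [b _ <-]; exists (a - b); rewrite ?rmorphB.
  - by move=> _ _ [a _ <-] [b _ <-]; exists (a * b); rewrite ?rmorphM.
have iw : intover (range io) (io x / io y).
  have [c' hc'] := ord_fun_ext 0 c.
  apply: (@intover_eq _ _ _ n (fun i => io (c' i))) => //.
    by move=> i _; apply: sub_intover => //; exists (c' i).
  apply: (mulfI (expf_neq0 n y0')); rewrite mulr0 mulrDr mulr_sumr.
  rewrite -{2}(rmorph0 io) -[in RHS]e rmorphD rmorphXn rmorph_sum; congr (_ + _).
    by rewrite expr_div_n mulrCA mulfV ?mulr1// expf_neq0.
  apply: eq_bigr => i _; rewrite hc' !rmorphM !rmorphXn.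
  have -> : io y ^+ n = io y ^+ i * io y ^+ (n - i) by rewrite -exprD subnKC// ltnW.
  by rewrite expr_div_n; field; exact: expf_neq0.
have [r [v [v0 er]]] := half_normal good_tensor good_specl tinl_inj tinr_inj ch fgB nA io_inj iw fr.
have [r' [u [u0 er']]] := half_normal (tensor_sym good_tensor) good_specr tinr_inj tinl_inj ch fgA nB io_inj iw fr.
have nz (C : comPzRingType) (i : {rmorphism C -> R}) t : injective i -> t <> 0 -> io (i t) != 0.
  by move=> ii t0; apply/eqP => h; apply: t0; apply: ii; apply: io_inj; rewrite h !rmorph0.
have e2 : tinl u * r = tinr v * r'.
  apply: io_inj; rewrite !rmorphM; move: er'; rewrite er => /(congr1 (fun t => t * io (tinr v) * io (tinl u))).
  rewrite divfK ?(nz _ _ _ tinr_inj)// mulrAC divfK ?(nz _ _ _ tinl_inj)// => e3.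
  by rewrite mulrC e3 mulrC.
have sep (a : A) : a <> 0 -> exists phi : {rmorphism A -> k}, (forall l, phi (kA l) = l) /\ invertible (phi a).
  move=> /sepA[z za]; exists (sval z); split; first exact: (svalP z).
  by exists (sval z a)^-1; rewrite mulfV//; exact/eqP.
have [q eq] := tp_divides good_tensor sep dA u0 e2.
exists q; apply: io_inj; rewrite rmorphM.
have <- : io x / io y = io q; last by rewrite divfK.
by rewrite er eq rmorphM mulrAC mulfV ?mul1r// (nz _ _ _ tinr_inj).
Qed.

End GoodTensor.

(** * Extension of fractions over a normal noetherian domain *)

Section Hartogs.
Variables (R : comPzRingType) (F : fieldType) (io : {rmorphism R -> F}).
Hypotheses (noe : noetherian R) (nR : integrally_closed_domain R)
  (io_inj : injective io) (fr : forall z : F, exists a b, b <> 0 /\ z = io a / io b).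
Implicit Types (P Q : set R) (s t : F).

Definition loc_in Q s := exists a v, ~ Q v /\ s * io v = io a.

Let io0 v : v <> 0 -> io v != 0.
Proof. by move=> v0; apply/eqP => h; apply: v0; apply: io_inj; rewrite h rmorph0. Qed.

Lemma loc_in_sring Q : prime_ideal Q -> subring_set (loc_in Q).
Proof.
move=> [hQ Q1 pr]; split.
- by exists 1, 1; rewrite mul1r.
- move=> s t [a [v [nv e]]] [a' [v' [nv' e']]]; exists (a * v' - a' * v), (v * v').
  split; first by move=> /pr[].
  by rewrite rmorphB !rmorphM -e -e'; ring.
- move=> s t [a [v [nv e]]] [a' [v' [nv' e']]]; exists (a * a'), (v * v').
  split; first by move=> /pr[].
  by rewrite !rmorphM -e -e'; ring.
Qed.

Lemma loc_in_io Q a : prime_ideal Q -> loc_in Q (io a).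
Proof. by move=> [_ Q1 _]; exists a, 1; rewrite rmorph1 mulr1. Qed.

Lemma loc_in_unit Q v s : prime_ideal Q -> ~ Q v -> loc_in Q (io v * s) -> loc_in Q s.
Proof.
move=> [_ _ pr] nv [a [w [nw e]]]; exists a, (v * w); split; first by move=> /pr[].
by rewrite rmorphM -e; ring.
Qed.

(** The [x i] form an eigenvector, with eigenvalue [t], of a matrix over [R], whose characteristic
    polynomial is monic. *)
Lemma determinant_trick n (x : 'I_n -> F) (c : 'I_n -> 'I_n -> R) t :
  (exists i, x i != 0) -> (forall i, t * x i = \sum_j io (c i j) * x j) ->
  intover (range io) t.
Proof.
move=> [i0 xi0] h.
have hS : subring_set (range io).
  split.
  - by exists 1; rewrite ?rmorph1.
  - by move=> _ _ [a _ <-] [b _ <-]; exists (a - b); rewrite ?rmorphB.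
  - by move=> _ _ [a _ <-] [b _ <-]; exists (a * b); rewrite ?rmorphM.
have ex i j : exists y : sring hS, val y = io (c i j) by apply: sring_ex; exists (c i j).
have [m mP] : exists m : 'I_n -> 'I_n -> sring hS, forall i j, val (m i j) = io (c i j).
  by exists (fun i j => projT1 (cid (ex i j))) => i j; case: cid.
pose M : 'M[sring hS]_n := \matrix_(i, j) m j i.
apply/(intover_integral hS).
exists (char_poly M); first exact: char_poly_monic.
rewrite (map_char_poly [the {rmorphism sring hS -> F} of val]) -eigenvalue_root_char.
apply/eigenvalueP; exists (\row_j x j).
  apply/rowP => i; rewrite !mxE h; apply: eq_bigr => j _.
  by rewrite !mxE -mP mulrC.
by apply/eqP => /rowP/(_ i0); rewrite !mxE; exact/eqP.
Qed.

(* A maximal denominator ideal P of s is an associated prime of (R + s R) / R,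
   and normality makes it locally principal. *)
Lemma hartogs Q s : prime_ideal Q -> ~ loc_in Q s ->
  exists P, [/\ prime_ideal P, P `<=` Q, ~ loc_in P s &
    exists p, [/\ P p, p <> 0 & forall q, P q -> exists c v, ~ P v /\ v * q = c * p]].
Proof.
move=> pQ ns; have hS := loc_in_sring pQ; have [hQ Q1 prQ] := pQ.
pose J b : set R := [set r | loc_in Q (io r * (io b * s))].
have hJ b : is_ideal (J b).
  split.
  - by rewrite /J/= rmorph0 mul0r; exact: sring0.
  - by move=> r r' Jr Jr'; rewrite /J/= rmorphD mulrDl; exact: sringD.
  - by move=> r r' Jr; rewrite /J/= rmorphM -mulrA; apply: sringM => //; exact: loc_in_io.
pose fam : set (set R) := [set I | exists b, ~ loc_in Q (io b * s) /\ I = J b].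
have fam_ideal I : fam I -> is_ideal I by move=> [b [_ ->]].
have fam0 : fam !=set0 by exists (J 1), 1; rewrite rmorph1 mul1r.
have [P [[b [nb eP]] maxP]] := noetherian_max noe fam_ideal fam0.
have PQ : P `<=` Q.
  by move=> r; rewrite eP => Jr; apply: contrapT => nr; apply: nb; exact: loc_in_unit Jr.
have hP : is_ideal P by rewrite eP.
have P1 : ~ P 1 by move=> /PQ.
have pP : prime_ideal P.
  split=> // r r' Prr; apply: contrapT => /not_orP[nr nr'].
  have nb' : ~ loc_in Q (io (r' * b) * s).
    by move=> h; apply: nr'; rewrite eP /J/= mulrA -rmorphM.
  apply: nr; apply: (maxP (J (r' * b))); first by exists (r' * b).
    move=> q; rewrite eP /J/= => Jq; rewrite rmorphM -mulrA mulrCA.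
    by apply: sringM => //; exact: loc_in_io.
  by move: Prr; rewrite eP /J/= !rmorphM -!mulrA.
have [n [x ePx]] := noetherian_fg noe hP.
have Px i : P (x i) by rewrite ePx; exact: ideal_gen_in.
(* One denominator outside [Q] serves for the finitely many generators of [P]; the rescaled fraction
   [t] multiplies all of [P] into [R]. *)
have [v [nv hv]] : exists v, ~ Q v /\ forall i, exists a, io v * (io b * s) * io (x i) = io a.
  have : forall m, (m <= n)%N -> exists v, ~ Q v /\ forall i : 'I_n, (i < m)%N ->
      exists a, io v * (io b * s) * io (x i) = io a.
    elim=> [_|m IH mn]; first by exists 1; split=> // -[].
    have [v [nv hv]] := IH (ltnW mn).
    have [a [v' [nv' e]]] : loc_in Q (io (x (Ordinal mn)) * (io b * s)).
      by have := Px (Ordinal mn); rewrite eP.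
    exists (v * v'); split; first by move=> /prQ[].
    move=> i; rewrite ltnS leq_eqVlt => /orP[/eqP ei|im].
      exists (v * a); rewrite (_ : i = Ordinal mn); last exact: val_inj.
      by rewrite !rmorphM -e; ring.
    have [a' ea'] := hv i im; exists (a' * v'); rewrite !rmorphM -ea'; ring.
  by move=> /(_ n (leqnn n))[v [nv hv]]; exists v; split=> // i; exact: hv.
set t := io v * (io b * s) in hv.
have nt : ~ loc_in Q t by move=> h; apply: nb; exact: loc_in_unit h.
have tP p : P p -> exists a, t * io p = io a.
  rewrite ePx => -[c ->].
  exists (\sum_i c i * projT1 (cid (hv i))); rewrite !rmorph_sum mulr_sumr; apply: eq_bigr => i _.
  by case: cid => a /= ea; rewrite !rmorphM -ea; ring.
have [p0 [Pp0 p0n]] : exists p, P p /\ p <> 0.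
  have [a [d [d0 et]]] := fr (io b * s); exists d; split=> //.
  by rewrite eP /J/= et mulrC divfK ?io0//; exact: loc_in_io.
exists P; split=> //.
  move=> [a [w [nw e]]]; apply: nw; rewrite eP /J/=.
  have -> : io w * (io b * s) = io (b * a) by rewrite rmorphM -e; ring.
  exact: loc_in_io.
(* If [t] carries some [p] in [P] outside [P], then [p] generates [P] locally. Otherwise [t] maps
   [P] into itself, is integral by the determinant trick, and lies in [R] by normality, contrary to
   [nt]. *)
have [[p [a [Pp na ea]]]|no] := pselect (exists p a, [/\ P p, ~ P a & t * io p = io a]).
  exists p; split=> //.
    move=> p00; apply: na; have : a = 0 by apply: io_inj; rewrite -ea p00 rmorph0 mulr0.
    by move=> ->; exact: ideal0.
  move=> q Pq; have [a' ea'] := tP q Pq; exists a', a; split=> //.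
  by apply: io_inj; rewrite !rmorphM -ea -ea'; ring.
case: nt; have tPP i : exists c : 'I_n -> R, t * io (x i) = \sum_j io (c j) * io (x j).
  have [a ea] := tP (x i) (Px i).
  have : P a by apply: contrapT => na; apply: no; exists (x i), a.
  rewrite ePx => -[c ec]; exists c; rewrite ea ec rmorph_sum.
  by apply: eq_bigr => j _; rewrite rmorphM.
have it : intover (range io) t.
  apply: (@determinant_trick n (io \o x) (fun i => projT1 (cid (tPP i)))) => [|i]; last by case: cid.
  apply: contrapT => h; apply: p0n; move: Pp0; rewrite ePx => -[c ->].
  apply: big1 => i _; have -> : x i = 0; last by rewrite mulr0.
  by apply: contrapT => /io0 xi; apply: h; exists i.
have [d [c [hc ec]]] := intover_eqP it.
have [a [w [w0 et]]] := fr t.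
have exg i : exists z, io z = c i by have [z _ <-] := hc i; exists z.
pose g i := projT1 (cid (exg i)).
have gP i : io (g i) = c i by rewrite /g; case: cid.
have [|q eq] := nR.2 a w w0.
  exists d, (fun i => g i); apply: io_inj; rewrite rmorph0 rmorphD rmorphXn rmorph_sum.
  transitivity (io w ^+ d * (t ^+ d + \sum_(i < d) c i * t ^+ i)); last by rewrite ec mulr0.
  rewrite mulrDr et expr_div_n mulrCA mulfV ?mulr1 ?expf_neq0 ?io0//; congr (_ + _).
  rewrite mulr_sumr; apply: eq_bigr => i _; rewrite -gP !rmorphM !rmorphXn expr_div_n.
  have -> : io w ^+ d = io w ^+ i * io w ^+ (d - i) by rewrite -exprD subnKC// ltnW.
  by field; rewrite expf_neq0// io0.
by rewrite et eq rmorphM mulfK ?io0//; exact: loc_in_io.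
Qed.

End Hartogs.

Lemma loc_lift (R B C : comPzRingType) (loc : {rmorphism R -> B}) (z : set R)
    (g : {rmorphism R -> C}) : prime_ideal z -> is_loc_at loc z ->
  (forall v, ~ z v -> invertible (g v)) ->
  exists G : {rmorphism B -> C}, forall r, G (loc r) = g r.
Proof.
move=> pz L gu.
pose T b c := exists a v, [/\ ~ z v, loc v * b = loc a & g v * c = g a].
have Tex b : exists c, T b c.
  have [a [v [nv e]]] := la_frac L b; have [w vw] := gu v nv.
  by exists (w * g a), a, v; rewrite mulrA vw mul1r.
have Tuniq b c c' : T b c -> T b c' -> c = c'.
  move=> [a [v [nv e1 e2]]] [a' [v' [nv' e1' e2']]].
  apply: (invertible_cancel (gu _ (notz_mul pz nv nv'))); rewrite rmorphM.
  have e3 : v' * a = v * a'.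
    by apply: (la_inj L); rewrite !rmorphM -e1 -e1'; ring.
  have e4 : g v' * g a = g v * g a' by rewrite -!rmorphM e3.
  rewrite (_ : g v * g v' * c = g v' * (g v * c)); last by ring.
  by rewrite -[in RHS]mulrA e2 e2' e4.
pose d b := projT1 (cid (Tex b)).
have dP b : T b (d b) by rewrite /d; case: cid.
have dB : zmod_morphism d.
  move=> b b'; apply: (Tuniq (b - b')) => //.
  have [a [v [nv e1 e2]]] := dP b; have [a' [v' [nv' e1' e2']]] := dP b'.
  exists (v' * a - v * a'), (v * v'); split; first exact: (notz_mul pz).
    by rewrite rmorphB !rmorphM -e1 -e1'; ring.
  by rewrite rmorphB !rmorphM -e2 -e2'; ring.
have dM : monoid_morphism d.
  split.
    apply: (Tuniq 1) => //; exists 1, 1; rewrite !mulr1 !rmorph1.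
    by split=> //; exact: notz1.
  move=> b b'; apply: (Tuniq (b * b')) => //.
  have [a [v [nv e1 e2]]] := dP b; have [a' [v' [nv' e1' e2']]] := dP b'.
  exists (a * a'), (v * v'); split; first exact: (notz_mul pz).
    by rewrite !rmorphM -e1 -e1'; ring.
  by rewrite !rmorphM -e2 -e2'; ring.
pose G : {rmorphism B -> C} := HB.pack d
    (GRing.isZmodMorphism.Build _ _ _ dB) (GRing.isMonoidMorphism.Build _ _ _ dM).
exists G => r; apply: (Tuniq (loc r)); first exact: dP.
by exists r, 1; rewrite !rmorph1 !mul1r; split=> //; exact: notz1.
Qed.

(** * The diagonal ideal at its generic point and at closed points *)

(** The action is a bare function, so that one notion covers derivations of [A] into itself, with
    [*%R], and into sections of [Omega]. *)
Definition kderivation (k A : comPzRingType) (kA : {rmorphism k -> A}) (M : zmodType)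
    (act : A -> M -> M) (del : A -> M) :=
  [/\ zmod_morphism del, forall a b, del (a * b) = act a (del b) + act b (del a) &
      forall c, del (kA c) = 0].

Lemma addg_skip (C : comPzRingType) (J : set C) (y : nat -> C) n j i : is_ideal J ->
  (j < n)%N -> (i < n)%N -> i != j -> addg J (y \o bump j) n.-1 (y i).
Proof.
move=> hJ jn ni ij; rewrite -(@unbumpK j i ij).
apply: (addg_gen (y \o bump j) hJ); rewrite /unbump; move: ij; case: ltnP => /=; lia.
Qed.

Lemma sum_unit_coef (C : comPzRingType) (K : set C) (y c : nat -> C) n j : is_ideal K ->
  (j < n)%N -> invertible (c j) -> (forall i, (i < n)%N -> i != j -> K (y i)) ->
  K (\sum_(i < n) c i * y i) -> K (y j).
Proof.
move=> hK jn [w cw] Ky; rewrite (bigD1 (Ordinal jn))//= => Ks.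
have : K (c j * y j).
  apply: (idealDl hK) Ks; apply: ideal_sum => // i ij.
  by apply: idealMl => //; apply: Ky => //; move: ij; rewrite -val_eqE.
by move=> /(idealMl w hK); rewrite mulrA (mulrC w) cw mul1r.
Qed.

Section DiagonalIdeal.
Variables (k A R : comPzRingType) (kA : {rmorphism k -> A})
    (i1 i2 : {rmorphism A -> R}) (eps : {rmorphism R -> A}).
Hypothesis T : is_tensor kA kA i1 i2.
Hypotheses (eps1 : forall a, eps (i1 a) = a) (eps2 : forall a, eps (i2 a) = a).

Definition diag_ideal : set R := [set r | eps r = 0].

Lemma diag_ideal_ideal : is_ideal diag_ideal.
Proof.
split; rewrite /diag_ideal /mkset; first by rewrite rmorph0.
  by move=> a b ea eb; rewrite rmorphD ea eb addr0.
by move=> a b eb; rewrite rmorphM eb mulr0.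
Qed.

Lemma diag_ideal_prime : is_domain A -> prime_ideal diag_ideal.
Proof.
move=> [o dom]; split; first exact: diag_ideal_ideal.
  by rewrite /diag_ideal /mkset rmorph1.
by move=> a b; rewrite /diag_ideal /mkset rmorphM => /dom.
Qed.

Lemma diag_diff a : diag_ideal (i1 a - i2 a).
Proof. by rewrite /diag_ideal /mkset rmorphB eps1 eps2 subrr. Qed.

Lemma eps_span (s : seq (A * A)) :
  eps (\sum_(p <- s) i1 p.1 * i2 p.2) = \sum_(p <- s) p.1 * p.2.
Proof. by rewrite rmorph_sum; apply: eq_bigr => p _; rewrite rmorphM eps1 eps2. Qed.

(** The products [p.1 * p.2] sum to zero for an element of the ideal, and subtracting the image of
    this sum under [i1] leaves only differences. *)
Lemma diag_span (s : seq (A * A)) : diag_ideal (\sum_(p <- s) i1 p.1 * i2 p.2) ->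
  \sum_(p <- s) i1 p.1 * i2 p.2 = - \sum_(p <- s) i1 p.1 * (i1 p.2 - i2 p.2).
Proof.
rewrite /diag_ideal /mkset eps_span => e.
have e1 : \sum_(p <- s) i1 p.1 * i1 p.2 = 0.
  rewrite -[RHS](rmorph0 i1) -e rmorph_sum; apply: eq_bigr => p _.
  by rewrite rmorphM.
have -> : \sum_(p <- s) i1 p.1 * (i1 p.2 - i2 p.2) =
    \sum_(p <- s) i1 p.1 * i1 p.2 - \sum_(p <- s) i1 p.1 * i2 p.2.
  by rewrite -sumrB; apply: eq_bigr => p _; rewrite mulrBr.
by rewrite e1 sub0r opprK.
Qed.

Lemma diag_sub (K : set R) : is_ideal K -> (forall a, K (i1 a - i2 a)) ->
  diag_ideal `<=` K.
Proof.
move=> hK h r; have [s ->] := tp_span T r => /diag_span ->.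
by apply: idealN => //; apply: ideal_sum => // p _; exact: idealMl.
Qed.

(** [Phi] is a derivation along [eps]: on a product of two elements of the diagonal ideal both terms
    of its Leibniz rule vanish, and on multiples of one such element it is linear. *)
Lemma derivation_lift (M : zmodType) (act : A -> M -> M) (del : A -> M) :
  kderivation kA act del ->
  (forall a, zmod_morphism (act a)) -> (forall m, zmod_morphism (act^~ m)) ->
  (forall a b m, act (a * b) m = act a (act b m)) ->
  exists Phi : R -> M, [/\ zmod_morphism Phi, forall a b, Phi (i1 a * i2 b) = act a (del b),
    forall r r', Phi (r * r') = act (eps r) (Phi r') + act (eps r') (Phi r) &
    forall r, iprod diag_ideal diag_ideal r -> Phi r = 0].
Proof.
move=> [dB dM dk] actB actB' actM.
have [|||Phi [PB PE]] := tp_lift T (beta := fun a b => act a (del b)).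
- by move=> b x y; exact: actB'.
- by move=> a x y; rewrite dB; exact: actB.
- move=> c a b; rewrite dM dk (zmod_morph0 (actB b)) addr0.
  by rewrite mulrC actM.
have PM r r' : Phi (r * r') = act (eps r) (Phi r') + act (eps r') (Phi r).
  elim/(tp_ind T): r => [a b||x y hx hy]; last first.
  - rewrite mulrDl !(zmod_morphD _ _ PB) hx hy rmorphD.
    rewrite (zmod_morphD _ _ (actB' _)) (zmod_morphD _ _ (actB _)).
    by rewrite addrACA.
  - rewrite mul0r (zmod_morph0 PB) rmorph0 (zmod_morph0 (actB' _)) (zmod_morph0 (actB _)).
    by rewrite addr0.
  elim/(tp_ind T): r' => [a' b'||x y hx hy]; last first.
  - rewrite mulrDr !(zmod_morphD _ _ PB) hx hy rmorphD.
    rewrite (zmod_morphD _ _ (actB' _)) (zmod_morphD _ _ (actB _)).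
    by rewrite addrACA.
  - rewrite mulr0 (zmod_morph0 PB) rmorph0 (zmod_morph0 (actB' _)) (zmod_morph0 (actB _)).
    by rewrite addr0.
  rewrite mulrACA -!rmorphM !PE !rmorphM !eps1 !eps2 dM.
  rewrite (zmod_morphD _ _ (actB _)) -!actM.
  by congr (act _ _ + act _ _); ring.
exists Phi; split=> // r.
have hK : is_ideal [set r | diag_ideal r /\ Phi r = 0].
  split.
  - by split; [exact: ideal0 diag_ideal_ideal|exact: zmod_morph0].
  - move=> x y [Ix Px] [Iy Py]; split; first exact: (idealD diag_ideal_ideal).
    by rewrite (zmod_morphD _ _ PB) Px Py addr0.
  - move=> x y [Iy Py]; split; first exact: (idealMl _ diag_ideal_ideal).
    by rewrite PM Py Iy (zmod_morph0 (actB _)) (zmod_morph0 (actB' _)) addr0.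
move=> /(@iprod_sub _ _ _ [set r | diag_ideal r /\ Phi r = 0] hK)[]// x y Ix Iy.
split; first exact: (idealMl _ diag_ideal_ideal).
by rewrite PM Ix Iy !(zmod_morph0 (actB' _)) addr0.
Qed.

End DiagonalIdeal.

Section Generic.
Variables (k : closedFieldType) (A R : comPzRingType) (kA : {rmorphism k -> A})
    (i1 i2 : {rmorphism A -> R}) (eps : {rmorphism R -> A}).
Hypothesis T : is_tensor kA kA i1 i2.
Hypotheses (eps1 : forall a, eps (i1 a) = a) (eps2 : forall a, eps (i2 a) = a).
Hypotheses (fgA : finitely_generated_algebra kA) (dA : is_domain A).
Hypothesis noe : noetherian R.
Hypothesis char0 : forall n, n.+1%:R != 0 :> k.
Local Notation I := (diag_ideal eps).
Let hI := diag_ideal_ideal eps.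
Let pI := diag_ideal_prime eps dA.
Variables (D : comPzRingType) (loc : {rmorphism R -> D}).
Hypothesis L : is_loc_at loc I.

Let noeD := la_noetherian L noe.
Let locD := la_local pI L.
Let M : set D := nonunits (A := D).
Let eM : M = ext loc I I := la_nonunits L.
Let hM : is_ideal M. Proof. exact: locD. Qed.
Let xi (t : nat -> A) i := loc (i1 (t i) - i2 (t i)).

Let gens_exist : exists n t, M = addg [set 0] (xi t) n.
Proof.
have [N [u hu]] := fgA; have [t ht] := ord_fun_ext 0 u.
exists N, t; have hX := addg_ideal (xi t) N (@zero_ideal D).
apply/seteqP; split; last first.
  apply: addg_sub => //; first by move=> _ ->; exact: ideal0.
  move=> i _; rewrite eM; rewrite /xi; apply: (ext_loc loc pI (I := I)); exact: diag_diff.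
rewrite eM => b [r [v [Ir nv e]]].
have [w vw] := la_unit L nv.
rewrite (_ : b = w * loc r); last by rewrite -e mulrA (mulrC w) vw mul1r.
apply: (idealMl _ hX).
have hK : is_ideal [set r | addg [set 0] (xi t) N (loc r)].
  split; rewrite /mkset; first by rewrite rmorph0; exact: ideal0.
    by move=> x y *; rewrite rmorphD; exact: idealD.
  by move=> x y *; rewrite rmorphM; exact: idealMl.
apply: (diag_sub T eps1 eps2 hK _ Ir) => a.
apply: (hu [set a | addg [set 0] (xi t) N (loc (i1 a - i2 a))]); rewrite /mkset.
- by move=> c; rewrite (tp_k T) subrr rmorph0; exact: ideal0.
- by move=> i; rewrite -ht; exact: (addg_gen (xi t) (@zero_ideal D)).
- move=> x y hx hy; rewrite (_ : loc _ = loc (i1 x - i2 x) - loc (i1 y - i2 y)); last by rewrite !rmorphB; ring.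
  exact: idealB.
- move=> x y hx hy.
  rewrite (_ : loc _ = loc (i1 x) * loc (i1 y - i2 y) + loc (i2 y) * loc (i1 x - i2 x)).
    by apply: idealD => //; exact: idealMl.
  by rewrite !(rmorphB, rmorphM); ring.
Qed.

(** In a system of least length, a relation modulo M^2 has no unit coefficient, since Nakayama would
    then drop a generator. *)
Let system_exists : exists n t, M = addg [set 0] (xi t) n /\
  forall c : nat -> D, iprod M M (\sum_(i < n) c i * xi t i) -> forall i, (i < n)%N -> M (c i).
Proof.
have z0 := @zero_ideal D.
pose G n := `[< exists t, M = addg [set 0] (xi t) n >].
have exG : exists n, G n.
  by have [n [t e]] := gens_exist; exists n; apply/asboolP; exists t.
case: (ex_minnP exG) => n /asboolP[t et] minn; exists n, t; split=> // c hc j jn.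
apply: contrapT => /(nonunitsN) cj.
have : (n <= n.-1)%N; last by lia.
apply: minn; apply/asboolP; exists (t \o bump j).
have exi : xi (t \o bump j) = xi t \o bump j by [].
have hA := addg_ideal (xi (t \o bump j)) n.-1 z0.
apply/seteqP; split.
  apply: (nakayama_local noeD (nonunits_prime locD) (@nonunitsN D)) => //.
  have hK : is_ideal (isum (addg [set 0] (xi (t \o bump j)) n.-1) (iprod M M)).
    by apply: isum_ideal => //; exact: iprod_ideal.
  rewrite {1}et; apply: addg_sub => //; first by move=> _ ->; exact: ideal0.
  have hi i : (i < n)%N -> i != j ->
      isum (addg [set 0] (xi (t \o bump j)) n.-1) (iprod M M) (xi t i).
    move=> ni ij; apply: isuml; first exact: iprod_ideal.
    by rewrite exi; exact: addg_skip.
  move=> i ni; have [->|ij] := eqVneq i j; last exact: hi.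
  by apply: (sum_unit_coef hK jn cj hi); apply: isumr.
apply: addg_sub => //; first by move=> _ ->; exact: ideal0.
move=> i _; rewrite eM /xi; apply: (ext_loc loc pI (I := I)); exact: diag_diff.
Qed.

(** The [xi t i] form a basis of M / M^2, so the coefficients of [i1 u - i2 u], read in Frac A, are
    the partial derivatives of [u]. A common denominator [h] of their values at generators of [A]
    turns them into derivations of [A] itself. *)
Lemma generic_system : exists n t (del : nat -> A -> A) h, [/\ h <> 0,
  M = addg [set 0] (xi t) n, forall i, kderivation kA *%R (del i),
  forall i j, (i < n)%N -> (j < n)%N -> del i (t j) = h * (i == j)%:R &
  forall s, I (\sum_(p <- s) i1 p.1 * i2 p.2) ->
    (forall i, (i < n)%N -> \sum_(p <- s) p.1 * del i p.2 = 0) ->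
    iprod M M (loc (\sum_(p <- s) i1 p.1 * i2 p.2))].
Proof.
have [n [t [et indep]]] := system_exists.
have [K [iK [iK_inj fr]]] := frac_exists dA.
(* [G] is reduction modulo [M], with the residue field embedded in Frac A. *)
have [G GE] : exists G : {rmorphism D -> K}, forall r, G (loc r) = iK (eps r).
  apply: (loc_lift (g := [the {rmorphism R -> K} of iK \o eps]) pI L) => v nv.
  exists (iK (eps v))^-1; apply: mulfV; apply/eqP => e; apply: nv.
  have e' : iK (eps v) = 0 by [].
  by apply: iK_inj; rewrite e' rmorph0.
have GM b : M b -> G b = 0.
  rewrite eM => -[r [v [Ir nv e]]]; have := congr1 G e; rewrite rmorphM !GE Ir rmorph0.
  move=> /eqP; rewrite mulf_eq0 => /orP[/eqP h|/eqP//].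
  by case: nv; apply: iK_inj; rewrite h rmorph0.
have MG b : G b = 0 -> M b.
  move=> e; move=> [w bw]; have := congr1 G bw; rewrite rmorphM e mul0r rmorph1 => /eqP.
  by rewrite eq_sym oner_eq0.
have exc u : exists c : nat -> D, loc (i1 u - i2 u) = \sum_(i < n) c i * xi t i.
  have : M (loc (i1 u - i2 u)) by rewrite eM; apply: (ext_loc loc pI (I := I)); exact: diag_diff.
  by rewrite et => -[j [c [-> ->]]]; exists c; rewrite add0r.
pose c u := projT1 (cid (exc u)).
have cP u : loc (i1 u - i2 u) = \sum_(i < n) c u i * xi t i by rewrite /c; case: cid.
clearbody c.
pose pd i u := G (c u i).
(* By independence the coefficients are determined modulo [M]; additivity and the Leibniz rule of
   [pd] follow by exhibiting coefficients. *)
have uniq (c' : nat -> D) u i : (i < n)%N -> iprod M M (loc (i1 u - i2 u) - \sum_(i < n) c' i * xi t i) ->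
    G (c' i) = pd i u.
  move=> ni; rewrite cP -sumrB.
  rewrite (eq_bigr (fun i : 'I_n => (c u i - c' i) * xi t i)); last by move=> j _; rewrite mulrBl.
  move=> /(indep (fun i => c u i - c' i))/(_ i ni)/GM; rewrite rmorphB => /eqP.
  by rewrite subr_eq0 => /eqP e; rewrite /pd e.
have pd_eq (c' : nat -> D) u i : (i < n)%N -> loc (i1 u - i2 u) = \sum_(i < n) c' i * xi t i ->
    G (c' i) = pd i u.
  by move=> ni e; apply: uniq => //; rewrite e subrr; exact: ideal0 (@iprod_ideal _ _ _).
have pdB i u u' : (i < n)%N -> pd i (u - u') = pd i u - pd i u'.
  move=> ni; rewrite -rmorphB -(pd_eq (fun i => c u i - c u' i))//.
  rewrite (_ : loc _ = loc (i1 u - i2 u) - loc (i1 u' - i2 u')); last by rewrite !rmorphB; ring.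
  by rewrite !cP -sumrB; apply: eq_bigr => j _; rewrite mulrBl.
have pdM i u u' : (i < n)%N -> pd i (u * u') = iK u * pd i u' + iK u' * pd i u.
  move=> ni; have -> : iK u * pd i u' + iK u' * pd i u =
      G (loc (i1 u) * c u' i + loc (i2 u') * c u i) by rewrite rmorphD !rmorphM !GE eps1 eps2.
  rewrite -(pd_eq (fun i => loc (i1 u) * c u' i + loc (i2 u') * c u i))//.
  rewrite (_ : loc _ = loc (i1 u) * loc (i1 u' - i2 u') + loc (i2 u') * loc (i1 u - i2 u)).
    rewrite !cP !mulr_sumr -big_split; apply: eq_bigr => j _ /=; ring.
  by rewrite !(rmorphB, rmorphM); ring.
have pdk i a : (i < n)%N -> pd i (kA a) = 0.
  move=> ni; rewrite -(rmorph0 G) -(pd_eq (fun _ => 0))// (tp_k T) subrr rmorph0 big1// => j _.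
  by rewrite mul0r.
have pdt i j : (i < n)%N -> (j < n)%N -> pd i (t j) = (i == j)%:R.
  move=> ni nj; rewrite -(rmorph_nat G) -(pd_eq (fun i => (i == j)%:R))//.
  rewrite (bigD1 (Ordinal nj))//= eqxx mul1r big1 ?addr0// => l.
  by rewrite -val_eqE /= => /negbTE ->; rewrite mul0r.
have [h [h0 hh]] : exists h, h <> 0 /\ forall i u, (i < n)%N -> exists a, iK a = iK h * pd i u.
  have [N [g hg]] := fgA.
  have den (s : seq K) : exists h, h <> 0 /\ forall z, z \in s -> exists a, iK a = iK h * z.
    elim: s => [|z s [h [h0 hs]]]; first by exists 1; split=> //; case: dA.
    have [a [b [b0 ez]]] := fr z; exists (h * b); split; first by case: dA => _ dom /dom[].
    have b0' : iK b != 0 by apply/eqP => e; apply: b0; apply: iK_inj; rewrite e rmorph0.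
    move=> z'; rewrite inE => /orP[/eqP ->|/hs[a' e]].
      by exists (h * a); rewrite ez !rmorphM /=; field.
    by exists (a' * b); rewrite !rmorphM e; ring.
  have [h [h0 hs]] := den [seq pd i (g l) | l <- enum 'I_N, i <- iota 0 n].
  exists h; split=> // i u ni.
  apply: (hg [set u | exists a, iK a = iK h * pd i u]) => [x|l|x y [a ea] [b eb]|x y [a ea] [b eb]].
  - by exists 0; rewrite pdk// mulr0 rmorph0.
  - apply: hs; apply/allpairsP; exists (l, i); rewrite mem_enum mem_iota.
    by split.
  - by exists (a - b); rewrite rmorphB ea eb pdB// mulrBr.
  - by exists (x * b + y * a); rewrite rmorphD !rmorphM ea eb pdM//; ring.
(* Beyond [n] the value is 0, so that [del i] is a derivation for every [i]. *)
have exd i u : exists a, iK a = if (i < n)%N then iK h * pd i u else 0.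
  by case: ltnP => [/hh//|_]; exists 0; rewrite rmorph0.
pose del i u := projT1 (cid (exd i u)).
have delP i u : iK (del i u) = if (i < n)%N then iK h * pd i u else 0 by rewrite /del; case: cid.
clearbody del.
exists n, t, del, h; split=> //.
- move=> i; split.
  + move=> u u'; apply: iK_inj; rewrite rmorphB !delP; case: ltnP => ni; last by rewrite subrr.
    by rewrite pdB// mulrBr.
  + move=> u u'; apply: iK_inj; rewrite rmorphD !rmorphM !delP; case: ltnP => ni; last by rewrite !mulr0 addr0.
    by rewrite pdM//; ring.
  + by move=> a; apply: iK_inj; rewrite delP rmorph0; case: ltnP => ni//; rewrite pdk// mulr0.
- by move=> i j ni nj; apply: iK_inj; rewrite delP ni pdt// rmorphM rmorph_nat.
move=> s Is hs; rewrite (diag_span eps1 eps2 Is) rmorphN.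
apply: (idealN (iprod_ideal M M)).
have -> : loc (\sum_(p <- s) i1 p.1 * (i1 p.2 - i2 p.2)) =
    \sum_(i < n) (\sum_(p <- s) loc (i1 p.1) * c p.2 i) * xi t i.
  rewrite rmorph_sum.
  under [RHS]eq_bigr do rewrite mulr_suml.
  rewrite exchange_big; apply: eq_bigr => p _; rewrite rmorphM cP mulr_sumr.
  by apply: eq_bigr => i _; rewrite mulrA.
apply: (@ideal_sum _ (iprod M M)) => [|i _]; first exact: iprod_ideal.
apply: iprodM.
  apply: MG; rewrite rmorph_sum; have := hs i (ltn_ord i) => /(congr1 iK).
  rewrite rmorph0 rmorph_sum.
  rewrite (eq_bigr (fun p => iK h * (iK p.1 * pd i p.2))); last first.
    by move=> p _; rewrite rmorphM delP ltn_ord; ring.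
  rewrite -mulr_sumr => /eqP; rewrite mulf_eq0 => /orP[/eqP e|/eqP e].
    by case: h0; apply: iK_inj; rewrite e rmorph0.
  by rewrite -[RHS]e; apply: eq_bigr => p _; rewrite rmorphM GE eps1.
by rewrite et; apply: (addg_gen (xi t) (@zero_ideal D)).
Qed.

(** Each [del i] acts on the first factor of [R] and extends to the localization. There [h] is a
    unit, and after division by it the derivations are dual to the generators [xi t i]. *)
Lemma generic_regular : regular_local D.
Proof.
have [n [t [del [h [h0 et dd dt _]]]]] := generic_system.
have eh : ~ I (i1 h) by rewrite /diag_ideal /mkset eps1.
have [w hw] := la_unit L eh.
have exd i : exists d : D -> D, [/\ zmod_morphism d,
    forall a b, d (a * b) = a * d b + b * d a &
    forall a b, d (loc (i1 a * i2 b)) = loc (i1 (del i a) * i2 b)].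
  have [dB dM dk] := dd i.
  have [|||d [d1 dE]] := tp_lift T (beta := fun a b => i1 (del i a) * i2 b).
  - by move=> b x y; rewrite dB rmorphB mulrBl.
  - by move=> a x y; rewrite rmorphB mulrBr.
  - by move=> l a b; rewrite dM dk mulr0 addr0 !rmorphM (tp_k T); ring.
  have d2 a b : d (a * b) = a * d b + b * d a.
    elim/(tp_ind T): a => [x y||x y hx hy]; last first.
    - by rewrite mulrDl !(zmod_morphD _ _ d1) hx hy; ring.
    - by rewrite !mul0r (zmod_morph0 d1) mulr0 addr0.
    elim/(tp_ind T): b => [x' y'||x' y' hx hy]; last first.
    - by rewrite mulrDr !(zmod_morphD _ _ d1) hx hy; ring.
    - by rewrite !mulr0 (zmod_morph0 d1) mulr0 mul0r addr0.
    rewrite mulrACA -!rmorphM !dE dM; rewrite !(rmorphD, rmorphM) /=; ring.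
  have [d' [h1 h2 h3]] := derivation_loc pI L d1 d2.
  by exists d'; split=> // a b; rewrite h3 dE.
pose d i := projT1 (cid (exd i)).
have dP i : [/\ zmod_morphism (d i), forall a b, d i (a * b) = a * d i b + b * d i a &
    forall a b, d i (loc (i1 a * i2 b)) = loc (i1 (del i a) * i2 b)] by rewrite /d; case: cid.
apply: (@regular_of_derivations D noeD locD n (xi t) (fun i b => w * d i b)) => //.
- by move=> i a b; case: (dP i) => -> _ _; rewrite mulrBr.
- by move=> i a b; case: (dP i) => _ -> _; ring.
- move=> i j ni nj; have [d1 d2 dE] := dP i; have [dB dM dk] := dd i.
  rewrite /xi rmorphB d1.
  have := dE (t j) 1; rewrite rmorph1 !mulr1 => ->.
  have := dE 1 (t j); rewrite rmorph1 !mul1r => ->.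
  have -> : del i 1 = 0 by rewrite -(rmorph1 kA) dk.
  rewrite rmorph0 mul0r rmorph0 subr0 dt// !rmorphM mulrA (mulrC w) hw mul1r.
  by rewrite !rmorph_nat.
- move=> N; exists (loc (i1 (kA (N.+1%:R)^-1))).
  by rewrite -(rmorph_nat [the {rmorphism k -> D} of loc \o (i1 \o kA)]) /= -!rmorphM mulfV ?rmorph1// char0.
Qed.

(** Among all derivations, the finitely many of [generic_system] already detect membership in the
    square at the generic point of the diagonal. *)
Lemma generic_square (r : R) : I r ->
  (forall (del : A -> A) (Phi : R -> A), kderivation kA *%R del -> zmod_morphism Phi ->
     (forall a b, Phi (i1 a * i2 b) = a * del b) -> Phi r = 0) ->
  exists v, ~ I v /\ iprod I I (v * r).
Proof.
move=> Ir hr; have [n [t [del [h [h0 et dd dt sq]]]]] := generic_system.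
have [s es] := tp_span T r; apply: (ext_locE L).
apply: (ext_prod pI L) => //; rewrite -eM es; apply: sq; first by rewrite -es.
move=> i ni; have [|||Phi [PB PE _ _]] := derivation_lift T eps1 eps2 (dd i).
- by move=> a x y; rewrite mulrBr.
- by move=> m x y; rewrite mulrBl.
- by move=> a b m; rewrite mulrA.
- have := hr (del i) Phi (dd i) PB PE; rewrite es (zmod_morph_sum _ _ PB) => e.
  by rewrite -[RHS]e; apply: eq_bigr => p _; rewrite PE.
Qed.

End Generic.

Lemma iprod_addg (C : comPzRingType) (K : set C) (y : nat -> C) n w : is_ideal K ->
  iprod K (addg [set 0] y n) w ->
  exists g : nat -> C, (forall i, K (g i)) /\ w = \sum_(i < n) g i * y i.
Proof.
move=> hK; pose S w := exists g : nat -> C, (forall i, K (g i)) /\ w = \sum_(i < n) g i * y i.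
have hS : is_ideal S.
  split.
  - exists (fun _ => 0); split=> [i|]; first exact: ideal0.
    by rewrite big1// => i _; rewrite mul0r.
  - move=> _ _ [g [Kg ->]] [g' [Kg' ->]]; exists (fun i => g i + g' i).
    split=> [i|]; first exact: idealD.
    by rewrite -big_split; apply: eq_bigr => i _; rewrite mulrDl.
  - move=> a _ [g [Kg ->]]; exists (fun i => a * g i); split=> [i|]; first exact: idealMl.
    by rewrite mulr_sumr; apply: eq_bigr => i _; rewrite mulrA.
move=> h; apply: (@iprod_sub _ _ _ S hS _ _ h) => a b Ka [_ [c [-> ->]]].
exists (fun i => a * c i); split=> [i|]; first exact: idealMr.
by rewrite add0r mulr_sumr; apply: eq_bigr => i _; rewrite mulrA.
Qed.

(** * Parameters at a closed point and the diagonal ideal there *)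

Section PointSystem.
Variables (k : fieldType) (A : comPzRingType) (kA : {rmorphism k -> A}).

(** For a least number of generators modulo the square, a relation with constant coefficients is
    trivial: a nonzero constant is invertible and would drop a generator. *)
Lemma point_system (p : set A) : noetherian A -> is_ideal p ->
  exists e (x : nat -> A), [/\ forall i, p (x i), p `<=` addg (iprod p p) x e &
    forall c : nat -> k, iprod p p (\sum_(i < e) kA (c i) * x i) ->
      forall i, (i < e)%N -> c i = 0].
Proof.
move=> noe hp; have hpp := iprod_ideal p p.
pose G n := `[< exists x, (forall i, p (x i)) /\ p `<=` addg (iprod p p) x n >].
have exG : exists n, G n.
  have [n [u eu]] := noetherian_fg noe hp; have [x ex] := ord_fun_ext 0 u.
  exists n; apply/asboolP; exists (fun i => if (i < n)%N then x i else 0); split.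
    move=> i; case: ltnP => ni; last exact: ideal0.
    by rewrite eu -[i]/(val (Ordinal ni)) ex; exact: ideal_gen_in.
  rewrite {1}eu; apply: ideal_gen_sub; first exact: addg_ideal.
  move=> i; rewrite -ex.
  have := addg_gen (fun i => if (i < n)%N then x i else 0) hpp (ltn_ord i).
  by rewrite ltn_ord.
case: (ex_minnP exG) => n /asboolP[x [px sp]] minn; exists n, x; split=> // c hc j jn.
apply: contrapT => /eqP cj.
have : (n <= n.-1)%N; last by lia.
apply: minn; apply/asboolP; exists (x \o bump j); split=> [i|]; first exact: px.
have hA := addg_ideal (x \o bump j) n.-1 hpp.
have hi i : (i < n)%N -> i != j -> addg (iprod p p) (x \o bump j) n.-1 (x i).
  by move=> ni ij; exact: addg_skip.
apply: (subset_trans sp); apply: addg_sub => //; first exact: sub_addg.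
move=> i ni; have [->|ij] := eqVneq i j; last exact: hi.
have cj' : invertible (kA (c j)) by exists (kA (c j)^-1); rewrite -rmorphM mulfV// rmorph1.
by apply: (sum_unit_coef (c := fun i => kA (c i)) hA jn cj' hi); exact: sub_addg.
Qed.

(* More than d elements of a d-generated ideal are linearly dependent modulo
   the square. *)
Lemma regular_chain (rho : {rmorphism A -> k}) n (y : nat -> A) : regular_local A ->
  (forall c, rho (kA c) = c) -> (forall a, rho a = 0 -> ~ invertible a) ->
  nonunits (A := A) = addg [set 0] y n ->
  (forall c : nat -> k, iprod (nonunits (A := A)) (nonunits (A := A)) (\sum_(i < n) kA (c i) * y i) ->
      forall i, (i < n)%N -> c i = 0) ->
  exists P, chain_in [set 0] (nonunits (A := A)) n P.
Proof.
move=> [noe loc [d [[[P chP] _] [u eu]]]] rhok rho0 ey indep.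
have [P' chP'] := chain_to_top loc chP.
suff dn : d = n by exists P'; rewrite -dn.
apply/eqP; rewrite eqn_leq (krull_local noe (@zero_ideal A) chP' ey) /= leqNgt; apply/negP => dn.
have exb (j : 'I_n) : exists b : 'I_d -> A, y j = \sum_l b l * u l.
  have : nonunits (A := A) (y j) by rewrite ey; apply: (addg_gen y (@zero_ideal A)).
  by rewrite eu.
pose b j := projT1 (cid (exb j)).
have bP (j : 'I_n) : y j = \sum_l b j l * u l by rewrite /b; case: cid.
(* The coordinates of the [y j] in the generators [u], reduced modulo the maximal ideal; as [d < n]
   the rows are dependent. *)
pose Mx : 'M[k]_(n, d) := \matrix_(j, l) rho (b j l).
have : kermx Mx != 0.
  rewrite -mxrank_eq0 mxrank_ker -lt0n subn_gt0.
  by apply: (leq_ltn_trans (rank_leq_col _)).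
move=> /eqP; apply; apply/row_matrixP => r; rewrite row0.
have := mulmx_ker Mx => /(congr1 (row r)); rewrite row_mul row0.
move: (row r _) => v /rowP vM; apply/rowP => j; rewrite [RHS]mxE.
have [c ec] := ord_fun_ext 0 (v 0).
rewrite -ec; apply: indep => //.
have -> : \sum_(i < n) kA (c i) * y i = \sum_l (\sum_(i < n) kA (c i) * b i l) * u l.
  under [RHS]eq_bigr do rewrite mulr_suml.
  rewrite exchange_big; apply: eq_bigr => i _; rewrite bP mulr_sumr.
  by apply: eq_bigr => l _; rewrite mulrA.
apply: (@ideal_sum _ (iprod (nonunits (A:=A)) (nonunits (A:=A)))) => [|l _]; first exact: iprod_ideal.
apply: iprodM; last by rewrite eu; exact: ideal_gen_in.
apply: rho0; have := vM l; rewrite mxE [RHS]mxE => vl; rewrite -[RHS]vl rmorph_sum.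
by apply: eq_bigr => i _; rewrite rmorphM rhok ec mxE.
Qed.

End PointSystem.

Section ClosedPoint.
Variables (k : fieldType) (A R : comPzRingType) (kA : {rmorphism k -> A})
    (i1 i2 : {rmorphism A -> R}) (eps : {rmorphism R -> A}).
Hypothesis T : is_tensor kA kA i1 i2.
Hypotheses (eps1 : forall a, eps (i1 a) = a) (eps2 : forall a, eps (i2 a) = a).
Hypotheses (dA : is_domain A) (noeR : noetherian R).
Variable phi : {rmorphism A -> k}.
Hypothesis phik : forall c, phi (kA c) = c.
Local Notation I := (diag_ideal eps).
Local Notation z := [set r : R | phi (eps r) = 0].
Variables (B : comPzRingType) (loc : {rmorphism R -> B}).
Hypothesis L : is_loc_at loc z.
Hypothesis regB : regular_local B.

Let hI := diag_ideal_ideal eps.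
Let pI := diag_ideal_prime eps dA.
Let p := [set a : A | phi a = 0].
Let m : set B := nonunits (A := B).

Let kernel_ideal' (C : comPzRingType) (f : {rmorphism C -> k}) : prime_ideal [set c | f c = 0].
Proof.
split; first split; rewrite /mkset.
- by rewrite rmorph0.
- by move=> a b ha hb; rewrite rmorphD ha hb addr0.
- by move=> a b hb; rewrite rmorphM hb mulr0.
- by rewrite rmorph1 => /eqP; rewrite oner_eq0.
- by move=> a b; rewrite rmorphM => /eqP; rewrite mulf_eq0 => /orP[]/eqP ->; [left|right].
Qed.

Let pz : prime_ideal z. Proof. exact: (kernel_ideal' [the {rmorphism R -> k} of phi \o eps]). Qed.
Let hz : is_ideal z := prime_ideal_ideal pz.
Let hp : is_ideal p := prime_ideal_ideal (kernel_ideal' phi).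
Let em : m = ext loc z z := la_nonunits L.
Let noeB : noetherian B. Proof. by case: regB. Qed.
Let hm : is_ideal m. Proof. by case: regB. Qed.
Let pm : prime_ideal m. Proof. exact: nonunits_prime. Qed.
Let mz r : z r -> m (loc r).
Proof. by move=> zr; rewrite em; apply: (ext_loc loc pz (I := z)). Qed.
Let p1 a : p a -> m (loc (i1 a)).
Proof. by move=> pa; apply: mz; rewrite /mkset eps1. Qed.
Let p2 a : p a -> m (loc (i2 a)).
Proof. by move=> pa; apply: mz; rewrite /mkset eps2. Qed.

Let noeA : noetherian A.
Proof. by apply: (noetherian_surj (f := eps) _ noeR) => a; exists (i1 a). Qed.

(** The values of the elementary tensors at the point sum to zero, and an elementary tensor minus
    its value is a combination of elements of [p] placed in one of the two factors. *)
Let z_span r : z r -> forall K : set R, is_ideal K ->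
  (forall a, p a -> K (i1 a)) -> (forall a, p a -> K (i2 a)) -> K r.
Proof.
move=> zr K hK K1 K2; have [s es] := tp_span T r.
have er : r = \sum_(q <- s) (i1 q.1 * i2 q.2 - i1 (kA (phi q.1 * phi q.2))).
  rewrite sumrB -es -rmorph_sum -rmorph_sum.
  rewrite (_ : \sum_(q <- s) _ = phi (eps r)); first by rewrite zr !rmorph0 subr0.
  rewrite es (eps_span eps1 eps2) rmorph_sum.
  by apply: eq_bigr => q _; rewrite rmorphM.
rewrite er; apply: ideal_sum => // -[a b] _ /=.
rewrite (_ : _ - _ = i1 (a - kA (phi a)) * i2 b + i1 (kA (phi a)) * i2 (b - kA (phi b))).
  apply: idealD => //; first by apply: idealMr => //; apply: K1; rewrite /p/mkset rmorphB phik subrr.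
  by apply: idealMl => //; apply: K2; rewrite /p/mkset rmorphB phik subrr.
by rewrite !(rmorphM, rmorphB) -(tp_k T); ring.
Qed.

(* [id (x) phi] and [phi (x) id] turn a relation modulo the square of the
   maximal ideal of R into one modulo the square of p. *)
Let side_relation (F : {rmorphism R -> A}) (c : nat -> k) n (x : nat -> A) r :
  (forall r, phi (F r) = phi (eps r)) -> (forall i, p (x i)) ->
  (forall c : nat -> k, iprod p p (\sum_(i < n) kA (c i) * x i) -> forall i, (i < n)%N -> c i = 0) ->
  F r = \sum_(i < n) kA (c i) * x i ->
  iprod m m (loc r) -> forall i, (i < n)%N -> c i = 0.
Proof.
move=> Fz px indep Fr; rewrite em => h; apply: indep; rewrite -Fr.
have hpp := iprod_ideal p p.
have [v [nv]] := ext_locE L (ext_prod pz L hz hz h).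
have hK : is_ideal [set r | iprod p p (F r)].
  split; rewrite /mkset; first by rewrite rmorph0; exact: ideal0.
    by move=> a b ha hb; rewrite rmorphD; exact: (idealD hpp).
  by move=> a b hb; rewrite rmorphM; exact: (idealMl _ hpp).
move=> h'.
have pF a : z a -> p (F a) by rewrite /p/mkset Fz.
have hv : iprod p p (F v * F r).
  rewrite -rmorphM; apply: (@iprod_sub _ _ _ _ hK _ _ h') => a b za zb.
  by rewrite /mkset rmorphM; apply: iprodM; exact: pF.
have pFr : p (F r).
  rewrite Fr; apply: ideal_sum => // i _; exact: idealMl.
have e : kA (phi (F v)) * F r = F v * F r - (F v - kA (phi (F v))) * F r by ring.
have : iprod p p (kA (phi (F v)) * F r).
  rewrite e; apply: (idealB hpp hv); apply: iprodM => //.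
  by rewrite /p/mkset rmorphB phik subrr.
move=> /(idealMl (kA (phi (F v))^-1) hpp); rewrite mulrA -rmorphM mulVf ?rmorph1 ?mul1r//.
by rewrite Fz; apply/eqP.
Qed.

(** The elements [xi] begin a regular system of parameters, so they generate a prime, which is the
    localized diagonal ideal, and the coefficients of a relation among them lie in that prime. Hence
    [v], which is outside it, can be cancelled. *)
Lemma closed_point_square t v : I t -> ~ I v -> iprod I I (v * t) ->
  exists v', ~ z v' /\ iprod I I (v' * t).
Proof.
move=> It nv sq.
have [e [x [px sp indep]]] := point_system kA noeA hp.
(* [F1] evaluates the second factor at the point and [F2] the first. *)
have [F1 [F11 F12]] := tp_ring_lift T (f := [the {rmorphism A -> A} of idfun]) (g := [the {rmorphism A -> A} of kA \o phi]) (fun c => esym (congr1 kA (phik c))).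
have [F2 [F21 F22]] := tp_ring_lift T (f := [the {rmorphism A -> A} of kA \o phi]) (g := [the {rmorphism A -> A} of idfun]) (fun c => congr1 kA (phik c)).
have Fz1 r : phi (F1 r) = phi (eps r).
  elim/(tp_ind T): r => [a b||r r' h h']; last by rewrite !rmorphD h h'.
    by rewrite !rmorphM F11 F12 eps1 eps2 phik.
  by rewrite !rmorph0.
have Fz2 r : phi (F2 r) = phi (eps r).
  elim/(tp_ind T): r => [a b||r r' h h']; last by rewrite !rmorphD h h'.
    by rewrite !rmorphM F21 F22 eps1 eps2 phik.
  by rewrite !rmorph0.
pose xi i := loc (i1 (x i) - i2 (x i)).
(* The differences come first, so that a prefix of the system generates the diagonal ideal; the
   coordinates of the first factor complete it to 2e elements. *)
pose y i := if (i < e)%N then xi i else loc (i1 (x (i - e)%N)).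
have z0 := @zero_ideal B.
have mxi i : m (xi i) by rewrite /xi rmorphB; apply: idealB => //; [exact: p1|exact: p2].
have hY := addg_ideal y (e + e) z0.
have Yxi i : (i < e)%N -> addg [set 0] y (e + e) (xi i).
  move=> ie; rewrite (_ : xi i = y i); last by rewrite /y ie.
  by apply: addg_gen => //; lia.
have Yx1 i : (i < e)%N -> addg [set 0] y (e + e) (loc (i1 (x i))).
  move=> ie; rewrite (_ : loc _ = y (e + i)%N); first by apply: addg_gen => //; lia.
  by rewrite /y ltnNge leq_addr addKn.
have ym : m = addg [set 0] y (e + e).
  apply/seteqP; split; last first.
    apply: addg_sub => //; first by move=> _ ->; exact: ideal0.
    by move=> i _; rewrite /y; case: ifP => _ //; exact: p1.
  apply: (nakayama_local noeB pm (@nonunitsN B)) => //.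
  pose K := isum (addg [set 0] y (e + e)) (iprod m m).
  have hmm := iprod_ideal m m.
  have hK : is_ideal K by exact: isum_ideal.
  rewrite em => b [r [w [zr nw ew]]].
  have [w' ww'] := la_unit L nw.
  rewrite (_ : b = w' * loc r); last by rewrite -ew mulrA (mulrC w') ww' mul1r.
  rewrite -em; apply: (idealMl _ hK).
  have side (i : {rmorphism A -> R}) : (forall a, p a -> m (loc (i a))) ->
      (forall j, (j < e)%N -> addg [set 0] y (e + e) (loc (i (x j)))) ->
      forall a, p a -> K (loc (i a)).
    move=> pi Yi a /sp; apply: (addg_sub (K := [set a | K (loc (i a))])).
    - split; rewrite /mkset; first by rewrite !rmorph0; exact: ideal0.
        by move=> c c' *; rewrite !rmorphD; exact: idealD.
      by move=> c c' *; rewrite !rmorphM; exact: idealMl.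
    - apply: iprod_sub.
        split; rewrite /mkset; first by rewrite !rmorph0; exact: ideal0.
          by move=> c c' *; rewrite !rmorphD; exact: idealD.
        by move=> c c' *; rewrite !rmorphM; exact: idealMl.
      move=> c c' pc pc'; rewrite /mkset !rmorphM; apply: isumr => //.
      by apply: iprodM; exact: pi.
    - by move=> j je; apply: isuml => //; exact: Yi.
  have : [set r | K (loc r)] r; last by [].
  apply: (z_span zr).
  - split; rewrite /mkset; first by rewrite !rmorph0; exact: ideal0.
      by move=> c c' *; rewrite !rmorphD; exact: idealD.
    by move=> c c' *; rewrite !rmorphM; exact: idealMl.
  - exact: side.
  - apply: side => // j je; rewrite (_ : loc _ = loc (i1 (x j)) - xi j).
      by apply: idealB => //; [exact: Yx1|exact: Yxi].
    by rewrite /xi rmorphB opprB addrC subrK.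
have [rho rhoE] : exists rho : {rmorphism B -> k}, forall r, rho (loc r) = phi (eps r).
  apply: (loc_lift (g := [the {rmorphism R -> k} of phi \o eps]) pz L) => u nu.
  by exists (phi (eps u))^-1; apply: mulfV; apply/eqP.
pose kB := [the {rmorphism k -> B} of loc \o (i1 \o kA)].
have [P chP] : exists P, chain_in [set 0] m (e + e) P.
  apply: (regular_chain (kA := kB) (rho := rho) regB _ _ ym).
  - by move=> c; rewrite /= rhoE eps1 phik.
  - by move=> a ra [b ab]; have := congr1 rho ab; rewrite rmorphM ra mul0r rmorph1 => /eqP; rewrite eq_sym oner_eq0.
  move=> c hc.
  pose r := \sum_(i < e) i1 (kA (c i)) * (i1 (x i) - i2 (x i)) +
            \sum_(i < e) i1 (kA (c (e + i)%N)) * i1 (x i).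
  have er : loc r = \sum_(i < e + e) kB (c i) * y i.
    rewrite big_split_ord /= /r rmorphD !rmorph_sum; congr (_ + _); apply: eq_bigr => i _.
      by rewrite rmorphM /y ltn_ord.
    by rewrite rmorphM /y ltnNge leq_addr addKn.
  rewrite -er in hc.
  (* [F1] kills [i2 (x i)] and reads off [c i + c (e + i)]; [F2] kills [i1 (x i)] and reads off
     [- c i]. *)
  have h1 : forall i, (i < e)%N -> c i + c (e + i)%N = 0.
    apply: (side_relation (c := fun i => c i + c (e + i)%N) Fz1 px indep _ hc).
    rewrite /r rmorphD !rmorph_sum -big_split; apply: eq_bigr => i _ /=.
    by rewrite !rmorphM rmorphB F12 !F11 /= (px i) rmorph0 subr0 rmorphD mulrDl.
  have h2 : forall i, (i < e)%N -> - c i = 0.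
    apply: (side_relation (c := fun i => - c i) Fz2 px indep _ hc).
    rewrite /r rmorphD !rmorph_sum -big_split; apply: eq_bigr => i _ /=.
    by rewrite !rmorphM rmorphB F22 !F21 /= (px i) phik rmorph0 sub0r mulr0 addr0 rmorphN mulrN mulNr.
  move=> i ie; have [ie'|ei] := ltnP i e.
    by apply/eqP; rewrite -oppr_eq0 h2.
  have ie' : (i - e < e)%N by lia.
  have := h1 _ ie'; have /eqP := h2 _ ie'; rewrite oppr_eq0 => /eqP ->.
  by rewrite add0r subnKC.
have [pX _] := regular_prime noeB pm (@nonunitsN B) z0 chP ym (leq_addl e e).
have eX : addg [set 0] y e = addg [set 0] xi e.
  by apply/seteqP; split; (apply: addg_sub; [exact: addg_ideal|exact: sub_addg|]) => i ie;
    rewrite ?/y ?ie; [|rewrite (_ : xi i = y i); last by rewrite /y ie]; exact: addg_gen.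
have hX := addg_ideal xi e z0; rewrite -/xi eX in pX.
(* By Nakayama: for a product of two elements of [p], the difference lies in [m] times the diagonal
   ideal, so only the generators [x i] of [p] modulo its square matter. *)
have II : ext loc z I = addg [set 0] xi e.
  have hIB : is_ideal (ext loc z I) by exact: (ext_ideal pz L).
  apply/seteqP; split; last first.
    apply: addg_sub => //; first by move=> _ ->; exact: ideal0.
    by move=> i _; apply: (ext_loc loc pz (I := I)); exact: diag_diff.
  apply: (nakayama_local noeB pm (@nonunitsN B)) => //.
  have hmI := iprod_ideal m (ext loc z I).
  pose K := isum (addg [set 0] xi e) (iprod m (ext loc z I)).
  have hK : is_ideal K by exact: isum_ideal.
  have Id a : ext loc z I (loc (i1 a - i2 a)).
    by apply: (ext_loc loc pz (I := I)); exact: diag_diff.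
  have Ka a : K (loc (i1 a - i2 a)).
    have : p (a - kA (phi a)) by rewrite /p/mkset rmorphB phik subrr.
    rewrite (_ : i1 a - i2 a = i1 (a - kA (phi a)) - i2 (a - kA (phi a))); last first.
      by rewrite !rmorphB (tp_k T); ring.
    move: (a - _) => {}a pa; move: (sp _ pa).
    have hS : is_ideal [set q | p q /\ K (loc (i1 q - i2 q))].
      split.
      - by split; [exact: ideal0|rewrite !rmorph0 subrr rmorph0; exact: ideal0].
      - move=> c c' [pc Kc] [pc' Kc']; split; first exact: idealD.
        rewrite (_ : loc _ = loc (i1 c - i2 c) + loc (i1 c' - i2 c')); first exact: (idealD hK).
        by rewrite !(rmorphD, rmorphB); ring.
      - move=> c c' [pc' Kc']; split; first exact: idealMl.
        rewrite (_ : loc _ = loc (i1 c) * loc (i1 c' - i2 c') + loc (i2 c') * loc (i1 c - i2 c)).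
          apply: (idealD hK); first exact: (idealMl _ hK).
          by apply: isumr => //; apply: iprodM; [exact: p2|exact: Id].
        by rewrite !(rmorphM, rmorphB); ring.
    suff sS : addg (iprod p p) x e `<=` [set q | p q /\ K (loc (i1 q - i2 q))] by move=> /sS[].
    apply: addg_sub => //.
      apply: iprod_sub => // c c' pc pc'; split; first exact: idealMl.
      rewrite (_ : loc _ = loc (i1 c) * loc (i1 c' - i2 c') + loc (i2 c') * loc (i1 c - i2 c)).
        apply: (idealD hK); apply: isumr => //; apply: iprodM; try exact: Id.
          exact: p1.
        exact: p2.
      by rewrite !(rmorphM, rmorphB); ring.
    by move=> i ie; split=> //; apply: isuml => //; exact: addg_gen.
  move=> b [r [w [Ir nw ew]]]; have [w' ww'] := la_unit L nw.
  rewrite (_ : b = w' * loc r); last by rewrite -ew mulrA (mulrC w') ww' mul1r.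
  apply: (idealMl _ hK).
  have : [set r | K (loc r)] r; last by [].
  apply: (diag_sub T eps1 eps2 _ _ Ir) => //.
  split; rewrite /mkset; first by rewrite !rmorph0; exact: ideal0.
    by move=> c c' *; rewrite !rmorphD; exact: (idealD hK).
  by move=> c c' *; rewrite !rmorphM; exact: (idealMl _ hK).
have Xt : addg [set 0] xi e (loc t) by rewrite -II; exact: (ext_loc loc pz (I := I)).
have [_ [c [-> et]]] := Xt; rewrite add0r in et.
have nXv : ~ addg [set 0] xi e (loc v).
  rewrite -II => /(ext_locE L)[u [nu]]; case: pI => _ _ pr /pr[|//].
  by rewrite /diag_ideal /mkset => eu; apply: nu; rewrite /mkset eu rmorph0.
have : iprod (ext loc z I) (ext loc z I) (loc (v * t)) by exact: ext_prod_loc.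
rewrite II => /(iprod_addg hX)[g [Xg]].
rewrite rmorphM et mulr_sumr => /eqP; rewrite -subr_eq0 -sumrB => /eqP rel.
(* The relation puts [loc v * c i - g i] in the prime generated by [xi], to which [g i] belongs and
   [loc v] does not. *)
have Xc i : (i < e)%N -> addg [set 0] xi e (c i).
  move=> ie; have : addg [set 0] y e (loc v * c i - g i).
    apply: (regular_relation (g := fun i => loc v * c i - g i) noeB pm (@nonunitsN B) z0 chP ym (leq_addl e e)) => //.
    apply: etrans rel; apply: eq_bigr => j _; rewrite /y ltn_ord; ring.
  rewrite eX => h; have : addg [set 0] xi e (loc v * c i).
    by rewrite -(subrK (g i) (loc v * c i)); apply: idealD.
  by case: pX => _ _ pr /pr[].
apply: (ext_locE L); apply: (ext_prod pz L hI hI); rewrite II et.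
apply: (@ideal_sum _ (iprod _ _)) => [|i _]; first exact: iprod_ideal.
by apply: iprodM; [exact: Xc|apply: addg_gen].
Qed.
End ClosedPoint.

(** * Germs, morphisms and affine opens *)

Notation pull f U := (Defs.preim (@mor_cont _ _ _ f) U).

Lemma rmorph_ext (A B : pzSemiRingType) (f g : {rmorphism A -> B}) : f =1 g -> f = g.
Proof.
case: f => f [[f0] [f1]]; case: g => g [[g0] [g1]] /= e.
have {}e : f = g by apply/funext.
by subst g; rewrite (Prop_irrelevance f0 g0) (Prop_irrelevance f1 g1).
Qed.

Lemma open_local (T : topologicalType) (S : set T) :
  (forall y, S y -> exists N : opens T, N y /\ N `<=` S) -> open S.
Proof.
move=> h; rewrite openE => y /h[N [Ny NS]]; rewrite /interior nbhsE.
by exists N => //; split=> //; exact: oset_open.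
Qed.

Section Sections.
Variables (k : fieldType) (X : kringed k).
Implicit Types (U V W N : opens X) (x y : X).

Lemma res_irr U V (h h' : V `<=` U) (s : sec X U) : res h s = res h' s.
Proof. by rewrite (Prop_irrelevance h h'). Qed.

Lemma germ_irr x U (h h' : U x) (s : sec X U) : germ x h s = germ x h' s.
Proof. by rewrite (Prop_irrelevance h h'). Qed.

Lemma sec_eq U (s t : sec X U) :
  (forall x, U x -> exists W (WU : W `<=` U), W x /\ res WU s = res WU t) -> s = t.
Proof.
move=> h; pose J := {x | U x}.
have h' (j : J) : {W : opens X | exists WU : W `<=` U, W (sval j) /\ res WU s = res WU t}.
  by apply: cid; case: j => x Ux; exact: h.
pose W j := sval (h' j).
have WU j : W j `<=` U by have [WU _] := svalP (h' j).
have We j : res (WU j) s = res (WU j) t by have [WU' [_ e]] := svalP (h' j); rewrite !(res_irr _ WU').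
have cov x : U x -> exists j, W j x.
  by move=> Ux; exists (exist _ x Ux); have [? []] := svalP (h' (exist _ x Ux)).
have [|t' [_ ut]] := @sec_sheaf _ X U J W WU cov (fun j => res (WU j) t).
  by move=> i j N Ni Nj; rewrite !(res_res _ _ (subset_trans Ni (WU i))).
by rewrite -(ut s)// -(ut t).
Qed.

Lemma sec_eq_germs U (s t : sec X U) :
  (forall x (Ux : U x), germ x Ux s = germ x Ux t) -> s = t.
Proof.
move=> h; apply: sec_eq => x Ux; have /germ_eq[W [WU [WU' [Wx e]]]] := h x Ux.
by exists W, WU; split=> //; rewrite e (res_irr WU' WU).
Qed.

Lemma sec_glue U (gam : forall x, U x -> stalk x) :
  (forall x (Ux : U x), exists N (NU : N `<=` U) (t : sec X N), N x /\
     forall y (Ny : N y), germ y Ny t = gam y (NU y Ny)) ->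
  exists t : sec X U, forall x (Ux : U x), germ x Ux t = gam x Ux.
Proof.
move=> h; pose J := {x | U x}.
have h' (j : J) : {p : {N : opens X & sec X N} | exists NU : tag p `<=` U, tag p (sval j) /\
    forall y (Ny : tag p y), germ y Ny (tagged p) = gam y (NU y Ny)}.
  apply: cid; case: j => x Ux; have [N [NU [t H]]] := h x Ux.
  by exists (Tagged (fun N => sec X N : Type) t), NU.
pose V j := tag (sval (h' j)).
have VU j : V j `<=` U by have [VU _] := svalP (h' j).
have gV j y (Vy : V j y) : germ y Vy (tagged (sval (h' j))) = gam y (VU j y Vy).
  by have [VU' [_ ->]] := svalP (h' j); congr (gam y); exact: Prop_irrelevance.
have cov x : U x -> exists j, V j x.
  by move=> Ux; exists (exist _ x Ux); have [? []] := svalP (h' (exist _ x Ux)).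
have [|t [ht _]] := @sec_sheaf _ X U J V VU cov (fun j => tagged (sval (h' j))).
  move=> i j W Wi Wj; apply: sec_eq_germs => x Wx.
  rewrite (germ_res Wi Wx (Wi x Wx)) (germ_res Wj Wx (Wj x Wx)) !gV.
  by congr (gam x); exact: Prop_irrelevance.
exists t => x Ux; have [j Vx] := cov x Ux.
rewrite -(germ_res (VU j) Vx) ht gV; congr (gam x); exact: Prop_irrelevance.
Qed.

Lemma germ_unit_nbhd U (s : sec X U) x (Ux : U x) : invertible (germ x Ux s) ->
  exists W (WU : W `<=` U), W x /\ invertible (res WU s).
Proof.
case; elim/stalk_ind => N Nx t; have UNx : ocap U N x by [].
rewrite -(germ_res (@ocapl _ U N) UNx Ux s).
rewrite -(germ_res (@ocapr _ U N) UNx Nx t) -rmorphM.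
rewrite -(rmorph1 (germ x UNx)) => /germ_eq[W [W1 [W2 [Wx e]]]].
exists W, (subset_trans W1 (@ocapl _ U N)); split=> //.
exists (res (subset_trans W1 (@ocapr _ U N)) t).
rewrite -(res_res (@ocapl _ U N) W1) -(res_res (@ocapr _ U N) W1) -rmorphM.
by rewrite e rmorph1.
Qed.

Lemma rmorph_invertible (A B : comPzRingType) (f : {rmorphism A -> B}) a :
  invertible a -> invertible (f a).
Proof. by move=> [b ab]; exists (f b); rewrite -rmorphM ab rmorph1. Qed.

Lemma germ_unit U (s : sec X U) x (Ux : U x) : invertible s -> invertible (germ x Ux s).
Proof. exact: (rmorph_invertible [the {rmorphism sec X U -> stalk x} of germ x Ux]). Qed.

Definition unit_locus U (s : sec X U) : set X :=
  [set x | exists Ux : U x, invertible (germ x Ux s)].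

Lemma unit_locus_open U (s : sec X U) : open (unit_locus s).
Proof.
apply: open_local => x [Ux /germ_unit_nbhd[W [WU [Wx h]]]].
exists W; split=> // y Wy; exists (WU y Wy); rewrite -(germ_res WU Wy).
exact: rmorph_invertible.
Qed.

Definition unit_opens U (s : sec X U) : opens X := Opens (unit_locus_open s).

End Sections.

Section Morphisms.
Variables (k : fieldType).

(** Takes the place of the map induced on stalks: the germ of a pullback depends only on the germ
    pulled back. *)
Lemma comor_germ (X Y : kringed k) (f : mor X Y) x (U V : opens Y) (Ux : U (f x)) (Vx : V (f x))
    (s : sec Y U) (t : sec Y V) : germ (f x) Ux s = germ (f x) Vx t ->
  germ x (Ux : pull f U x) (comor f U s) =
  germ x (Vx : pull f V x) (comor f V t).
Proof.
move=> /germ_eq[W [WU [WV [Wx e]]]].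
pose WU' : pull f W `<=` pull f U := fun y h => WU _ h.
pose WV' : pull f W `<=` pull f V := fun y h => WV _ h.
rewrite -(germ_res WU' (Wx : pull f W x)).
rewrite -(germ_res WV' (Wx : pull f W x)).
by rewrite !comor_res e.
Qed.

Lemma comor_unit (X Y : kringed k) (f : mor X Y) x (U : opens Y) (Ux : U (f x)) (s : sec Y U) :
  invertible (germ x (Ux : pull f U x) (comor f U s)) <->
  invertible (germ (f x) Ux s).
Proof.
split; first exact: mor_local.
case; elim/stalk_ind => N Nx t; have UNx : ocap U N (f x) by [].
move=> e; exists (germ x (Nx : pull f N x) (comor f N t)).
rewrite -(comor_germ (germ_res (@ocapl _ U N) UNx Ux s)).
rewrite -(comor_germ (germ_res (@ocapr _ U N) UNx Nx t)).
have e' : germ (f x) UNx (res (@ocapl _ U N) s * res (@ocapr _ U N) t) =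
    germ (f x) (I : otop Y (f x)) 1.
  rewrite rmorphM /= (germ_res (@ocapl _ U N) UNx Ux s) (germ_res (@ocapr _ U N) UNx Nx t).
  by rewrite e rmorph1.
by have := comor_germ e'; rewrite !rmorphM !rmorph1.
Qed.

(** Germs are compared because the pullbacks of a section along [f] and [g] have different types
    until the underlying maps are identified. *)
Lemma mor_ext (X Y : kringed k) (f g : mor X Y) : f =1 g ->
  (forall x (U : opens Y) (Ux : U (f x)) (Ux' : U (g x)) s,
     germ x (Ux : pull f U x) (comor f U s) =
     germ x (Ux' : pull g U x) (comor g U s)) -> f = g.
Proof.
case: f => f cf mf rf kf lf; case: g => g cg mg rg kg lg /= /funext fg.
subst g; rewrite (Prop_irrelevance cg cf) in mg rg kg lg *.
move=> e; have {}e : mf = mg.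
  apply: functional_extensionality_dep => U; apply: rmorph_ext => s.
  by apply: sec_eq_germs => x Ux; exact: e.
subst mg; by rewrite (Prop_irrelevance rf rg) (Prop_irrelevance kf kg) (Prop_irrelevance lf lg).
Qed.

Lemma mor_eq_germ (X Y : kringed k) (f g : mor X Y) : f = g ->
  forall x (U : opens Y) (Ux : U (f x)) (Ux' : U (g x)) s,
     germ x (Ux : pull f U x) (comor f U s) =
     germ x (Ux' : pull g U x) (comor g U s).
Proof. by move=> -> x U Ux Ux' s; exact: germ_irr. Qed.

Lemma mor_comp_germ (X Y Z : kringed k) (g : mor Y Z) (f : mor X Y) x (U : opens Z)
    (Ux : U (g (f x))) s :
  germ x (Ux : pull (mor_comp g f) U x) (comor (mor_comp g f) U s) =
  germ x (Ux : pull f (pull g U) x) (comor f _ (comor g U s)).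
Proof. exact: germ_res. Qed.

(** Maps on stalks are easy to define when the germs are fractions; the last hypothesis, that the
    images of the germs of a section are locally the germs of one section, is what gluing needs. *)
Lemma mor_of_stalks (X Y : kringed k) (f : X -> Y) (cf : continuous f)
    (psi : forall x, {rmorphism stalk (f x) -> stalk x}) :
  (forall x a, invertible (psi x a) -> invertible a) ->
  (forall x (U : opens Y) (Ux : U (f x)) c,
     psi x (germ (f x) Ux (kst Y U c)) = germ x (Ux : Defs.preim cf U x) (kst X (Defs.preim cf U) c)) ->
  (forall (U : opens Y) (s : sec Y U) x (Ux : U (f x)),
     exists (N : opens X) (NU : N `<=` Defs.preim cf U) (t : sec X N), N x /\
       forall y (Ny : N y), germ y Ny t = psi y (germ (f y) (NU y Ny) s)) ->
  exists F : mor X Y, F =1 f /\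
    forall x (Fx : F x = f x) (U : opens Y) (Ux : U (F x)) (Ux' : U (f x)) s,
      germ x (Ux : pull F U x) (comor F U s) = psi x (germ (f x) Ux' s).
Proof.
move=> loc kk rep.
have ex (U : opens Y) (s : sec Y U) : exists t : sec X (Defs.preim cf U),
    forall x (Ux : U (f x)), germ x (Ux : Defs.preim cf U x) t = psi x (germ (f x) Ux s).
  apply: (@sec_glue _ _ (Defs.preim cf U) (fun x (Ux : U (f x)) => psi x (germ (f x) Ux s))).
  by move=> x Ux; have [N [NU [t []]]] := rep U s x Ux; exists N, NU, t.
pose c U s := sval (cid (ex U s)).
have cE (U : opens Y) s x (Ux : U (f x)) : germ x (Ux : Defs.preim cf U x) (c U s) = psi x (germ (f x) Ux s).
  by rewrite /c; case: cid.
have cu U (s t : sec X (Defs.preim cf U)) :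
   (forall x (Ux : U (f x)), germ x (Ux : Defs.preim cf U x) s = germ x (Ux : Defs.preim cf U x) t) -> s = t.
  by move=> h; apply: sec_eq_germs => x Ux; exact: h.
have cB U : zmod_morphism (c U).
  by move=> s t; apply: cu => x Ux; rewrite cE !rmorphB /= !cE.
have cM U : monoid_morphism (c U).
  split; first by apply: cu => x Ux; rewrite cE !rmorph1.
  by move=> s t; apply: cu => x Ux; rewrite cE !rmorphM /= !cE.
pose C U : {rmorphism sec Y U -> sec X (Defs.preim cf U)} :=
  HB.pack (c U) (GRing.isZmodMorphism.Build _ _ _ (cB U)) (GRing.isMonoidMorphism.Build _ _ _ (cM U)).
unshelve eexists (@Mor _ X Y f cf C _ _ _).
- move=> U V VU VU' s; apply: sec_eq_germs => x Vx.
  rewrite (germ_res VU' Vx (VU' x Vx)) !cE; congr (psi x _).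
  by rewrite (germ_res VU Vx (VU _ Vx)); exact: germ_irr.
- by move=> U a; apply: cu => x Ux; rewrite cE kk.
- by move=> x U Ux s; rewrite cE; exact: loc.
by split=> // x _ U Ux Ux' s; rewrite (Prop_irrelevance Ux' Ux); exact: cE.
Qed.

End Morphisms.

(** The prime of [R] at the point [y] of [W]. Phrased by [unit_locus], it takes no proof that [y] is
    in [W]; outside [W] it is all of [R]. *)
Definition pt (k : fieldType) (Y : kringed k) (W : opens Y) (R : comPzRingType)
    (psi : {rmorphism R -> sec Y W}) (y : Y) : set R := [set r | ~ unit_locus (psi r) y].

Section Affine.
Variables (k : fieldType) (X : kringed k) (U : opens X) (A : comPzRingType)
  (phi : X -> set A) (theta : {rmorphism A -> sec X U}).
Hypothesis bij : set_bij U (@prime_ideal A) phi.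
Hypothesis top : forall W : set X, W `<=` U ->
  open W <-> exists E : set A, W = [set x | U x /\ ~ (E `<=` phi x)].
Hypothesis loc : forall (f : A) (W : opens X) (WU : W `<=` U),
  W = [set x | U x /\ ~ phi x f] :> set X -> is_localization f (res WU \o theta).

Lemma aff_prime x : U x -> prime_ideal (phi x).
Proof. by case: bij => h _ _; exact: h. Qed.

Lemma aff_open f : open [set x | U x /\ ~ phi x f].
Proof.
apply/top; first by move=> x [].
exists [set f]; apply/seteqP; split=> x [Ux h]; split=> //.
  by move=> /(_ f erefl).
by move=> pf; apply: h => _ ->.
Qed.

Definition aff_D f : opens X := Opens (aff_open f).

Lemma aff_DU f : aff_D f `<=` U. Proof. by move=> x []. Qed.

Lemma aff_basis (N : opens X) x : U x -> N x -> exists f, aff_D f x /\ aff_D f `<=` N.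
Proof.
move=> Ux Nx; have sU : ocap N U `<=` U by move=> y [].
have /(top sU)[E EE] : open (ocap N U) by exact: oset_open.
have : ocap N U x by [].
rewrite /omem EE => -[_ /nonsubset[f [Ef nf]]]; exists f; split=> // y [Uy ny].
suff : ocap N U y by case.
by rewrite /omem EE; split=> // Ey; apply: ny; exact: Ey.
Qed.

Lemma aff_frac x (Ux : U x) (g : stalk x) :
  exists a f, ~ phi x f /\ germ x Ux (theta f) * g = germ x Ux (theta a).
Proof.
elim/stalk_ind: g => N Nx s; have [f [Dx DN]] := aff_basis Ux Nx.
have [_ h _] := loc (aff_DU (f := f)) erefl.
have [a [n e]] := h (res DN s); exists a, (f ^+ n); split.
  by move=> /(prime_expr (aff_prime Ux)); case: Dx.
rewrite -(germ_res DN Dx) -!(germ_res (aff_DU (f := f)) Dx) -rmorphM rmorphXn rmorphXn.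
by congr germ; exact: e.
Qed.

Lemma aff_unit x (Ux : U x) a : invertible (germ x Ux (theta a)) <-> ~ phi x a.
Proof.
split=> [ai pa|na]; last first.
  have [h _ _] := loc (aff_DU (f := a)) erefl.
  rewrite -(germ_res (aff_DU (f := a)) (conj Ux na : aff_D a x)).
  exact: germ_unit h.
have [hp p1 pr] := aff_prime Ux.
have [W [WU [Wx [t at1]]]] := germ_unit_nbhd ai.
have [f [Dx DW]] := aff_basis Ux Wx; have [_ nf] := Dx.
have [_ h hz] := loc (aff_DU (f := f)) erefl.
have [b [n e]] := h (res DW t).
(* On [aff_D f] the inverse is b / f^n, so a power of [f] is a multiple of [a], although [f] is
   outside the prime. *)
have [m] : exists m, f ^+ m * (a * b - f ^+ n) = 0.
  have {}e : res (aff_DU (f := f)) (theta f) ^+ n * res DW t = res (aff_DU (f := f)) (theta b) := e.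
  have := congr1 (res DW) at1; rewrite rmorph1 rmorphM (res_res WU DW (aff_DU (f := f))) => e1.
  apply: hz; change (res (aff_DU (f := f)) (theta (a * b - f ^+ n)) = 0).
  by rewrite !rmorphB !rmorphM !rmorphXn -e mulrCA e1 mulr1 subrr.
have pfm l : ~ phi x (f ^+ l) by move=> /(prime_expr (aff_prime Ux)).
move=> /eqP; rewrite mulrBr subr_eq0 -exprD => /eqP em.
by apply: (pfm (m + n)%N); rewrite -em mulrA; apply: idealMr => //; exact: idealMl.
Qed.

Lemma aff_local x (Ux : U x) : is_local (stalk x).
Proof.
have [hp p1 pr] := aff_prime Ux.
have key (g : stalk x) a f : ~ phi x f -> germ x Ux (theta f) * g = germ x Ux (theta a) ->
    nonunits g <-> phi x a.
  move=> nf e; split.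
    move=> ng; apply: contrapT => /(proj2 (aff_unit Ux _)); rewrite -e mulrC => /invertibleMl.
    exact: ng.
  move=> pa gi; have : invertible (germ x Ux (theta a)); last by move=> /(proj1 (aff_unit Ux _)).
  by rewrite -e; apply: invertibleM => //; apply/aff_unit.
split.
- by apply/(key _ 0 1) => //; [rewrite !rmorph0 mulr0|exact: ideal0].
- move=> g g'; have [a [f [nf e]]] := aff_frac Ux g; have [a' [f' [nf' e']]] := aff_frac Ux g'.
  move=> /(key _ _ _ nf e) pa /(key _ _ _ nf' e') pa'.
  apply/(key _ (a * f' + a' * f) (f * f')).
  + by move=> /pr[].
  + by rewrite !(rmorphM, rmorphD) /= -e -e'; ring.
  + by apply: idealD => //; exact: idealMr.
- move=> g g'; have [a [f [nf e]]] := aff_frac Ux g; have [a' [f' [nf' e']]] := aff_frac Ux g'.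
  move=> /(key _ _ _ nf' e') pa'.
  apply/(key _ (a * a') (f * f')).
  + by move=> /pr[].
  + by rewrite !rmorphM /= -e -e'; ring.
  + exact: idealMl.
Qed.

Lemma aff_bij s : exists a, theta a = s.
Proof.
have eU : U = [set x | U x /\ ~ phi x 1] :> set X.
  by apply/seteqP; split=> [x Ux|x []//]; split=> //; case: (aff_prime Ux).
have [_ h _] := loc (fun _ h => h) eU; have [a [n e]] := h s; exists a.
have {}e : res (fun _ h => h : U _) (theta 1) ^+ n * s = res (fun _ h => h : U _) (theta a) := e.
by move: e; rewrite !rmorph1 expr1n mul1r res_id.
Qed.

Lemma aff_phi x : U x -> phi x = [set a | ~ unit_locus (theta a) x].
Proof.
move=> Ux; apply/seteqP; split=> a.
  by move=> pa [Ux' /aff_unit].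
by move=> na; apply: contrapT => /(proj2 (aff_unit Ux _)) h; apply: na; exists Ux.
Qed.

End Affine.

(** Provides a basis of affine opens. The coordinate ring of [D] is [sec X D] itself, and the prime
    of a point consists of the sections that are not units there. *)
Lemma affine_distinguished (k : fieldType) (X : kringed k) (U : opens X) x (N : opens X) :
  affine_open U -> U x -> N x -> exists D : opens X, [/\ affine_open D, D x & D `<=` N].
Proof.
move=> [A [phi [theta [bij top loc]]]] Ux Nx.
have [a [Dx DN]] := aff_basis top Ux Nx.
pose D := aff_D top a; have DU : D `<=` U := @aff_DU _ _ _ _ _ top a.
exists D; split=> //.
pose phi' (y : X) : set (sec X D) := [set s | ~ unit_locus s y].
have [la lf lz] := loc a D DU erefl.
have {}la : invertible (res DU (theta a)) := la.
have {}lf s : exists b n, res DU (theta a) ^+ n * s = res DU (theta b) := lf s.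
have {}lz s : res DU (theta s) = 0 -> exists n, a ^+ n * s = 0 := @lz s.
have nu y (Dy : D y) s : ~ phi' y s <-> invertible (germ y Dy s).
  split; last by move=> h; apply; exists Dy.
  by move=> /contrapT[Dy']; rewrite (germ_irr Dy' Dy).
have nphi y (Dy : D y) b : ~ phi y b <-> ~ phi' y (res DU (theta b)).
  rewrite (nu y Dy) (germ_res DU Dy (DU y Dy)); split.
    by move/(aff_unit bij top loc (DU y Dy)).
  by move=> h; apply/(aff_unit bij top loc (DU y Dy)).
have prime' y (Dy : D y) : prime_ideal (phi' y).
  have := nonunits_prime (aff_local bij top loc (DU y Dy)) => -[[h0 hD hM] h1 pr].
  have E s : phi' y s <-> nonunits (germ y Dy s).
    split; first by move=> h1' i; apply: h1'; exists Dy.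
    by move=> h1'; apply: contrapT => /(nu y Dy).
  split; first split.
  - by apply/E; rewrite rmorph0.
  - by move=> s t /E hs /E ht; apply/E; rewrite rmorphD; exact: hD.
  - by move=> s t /E ht; apply/E; rewrite rmorphM; exact: hM.
  - by move=> /E; rewrite rmorph1; exact: h1.
  - by move=> s t /E; rewrite rmorphM => /pr[] h; [left|right]; apply/E.
exists (sec X D), phi', [the {rmorphism sec X D -> sec X D} of idfun]; split.
- split.
  + by move=> y; exact: prime'.
  + move=> y y' /set_mem Dy /set_mem Dy' e.
    have [_ inj _] := bij; apply: inj; [exact/mem_set/DU|exact/mem_set/DU|].
    apply/seteqP; split=> b; apply: contraPP.
      by move=> /(nphi y' Dy'); rewrite -e => /(nphi y Dy).
    by move=> /(nphi y Dy); rewrite e => /(nphi y' Dy').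
  + move=> P pP; have [hP P1 Ppr] := pP.
    pose Q := [set b | P (res DU (theta b))].
    have pQ : prime_ideal Q.
      split; first split; rewrite /Q /mkset.
      - by rewrite !rmorph0; exact: ideal0.
      - by move=> b c *; rewrite !rmorphD; exact: idealD.
      - by move=> b c *; rewrite !rmorphM; exact: idealMl.
      - by rewrite !rmorph1.
      - by move=> b c; rewrite !rmorphM => /Ppr.
    have uP u : invertible u -> ~ P u by move=> [v uv] Pu; apply: P1; rewrite -uv; exact: idealMr.
    have [_ _ /(_ Q pQ)[y Uy eQ]] := bij.
    have Dy : D y by split=> //; rewrite eQ; exact: uP.
    exists y => //; have py := prime' y Dy; apply/seteqP; split=> s.
      have [b [n e]] := lf s => ps.
      have : P (res DU (theta b)).
        suff : Q b by []; rewrite -eQ; apply: contrapT => /(nphi y Dy); apply.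
        by rewrite -e; exact: (idealMl _ (prime_ideal_ideal py)).
      rewrite -e => /Ppr[/(prime_expr pP) h|//]; by case: (uP _ la h).
    have [b [n e]] := lf s => Ps.
    have : phi' y (res DU (theta b)).
      apply: contrapT => /(nphi y Dy); rewrite eQ; apply; rewrite /Q /mkset -e.
      exact: (idealMl _ hP).
    rewrite -e; have [_ _ pr] := py => /pr[/(prime_expr py)|//].
    by move=> []; exists Dy; exact: germ_unit.
- move=> W WD; split.
    move=> /(top W (subset_trans WD DU))[E EE].
    exists [set res DU (theta b) | b in E]; rewrite EE; apply/seteqP; split=> y.
      move=> [Uy nE]; have Dy : D y by apply: WD; rewrite EE.
      split=> // h; apply: nE => b Eb; apply: contrapT => /(nphi y Dy); apply; apply: h.
      by exists b.
    move=> [Dy nE]; split; first exact: (DU y).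
    by move=> h; apply: nE => _ [b Eb <-]; apply: contrapT => /(nphi y Dy); apply; exact: h.
  move=> [E EE]; apply: open_local => y; rewrite EE => -[Dy /nonsubset[s [Es]]].
  move=> /(nu y Dy) hs; exists (unit_opens s); split; first by exists Dy.
  move=> y' [Dy' h]; split=> // hE; have := hE _ Es; apply; by exists Dy'.
move=> g W WD eW.
have [b [n e]] := lf g.
(* As [g] is b / a^n on [D], its distinguished open in [D] is that of [a * b] in [U]; the
   localization for [g] is deduced from the one for [a * b]. *)
have Wab : W = [set y | U y /\ ~ phi y (a * b)] :> set X.
  rewrite eW; apply/seteqP; split=> y.
    move=> [Dy ng]; split; first exact: (DU y).
    have [_ _ pr] := aff_prime bij (DU y Dy) => /pr[]; first by case: Dy.
    move=> pb; have : ~ phi' y (res DU (theta b)).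
      rewrite -e; have [_ _ pr'] := prime' y Dy => /pr'[]//.
      by move=> /(prime_expr (prime' y Dy)) []; exists Dy; exact: germ_unit.
    by move=> /(nphi y Dy).
  have hy := prime_ideal_ideal (aff_prime bij _).
  move=> [Uy nab]; have Dy : D y.
    by split=> // pa; apply: nab; apply: (idealMr b (hy y Uy)).
  split=> // pg; apply: nab; apply: (idealMl a (hy y Uy)).
  apply: contrapT => /(nphi y Dy); apply; rewrite -e.
  exact: (idealMl _ (prime_ideal_ideal (prime' y Dy))).
have [ga gf gz] := loc (a * b) W (subset_trans WD DU) Wab.
have r2 c : res (subset_trans WD DU) (theta c) = res WD (res DU (theta c)) by rewrite (res_res _ _ (subset_trans WD DU)).
have {}ga : invertible (res WD (res DU (theta (a * b)))) by rewrite -r2; exact: ga.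
have {}gf s : exists c m, res WD (res DU (theta (a * b))) ^+ m * s = res WD (res DU (theta c)).
  by have [c [m h]] := gf s; exists c, m; rewrite -!r2; exact: h.
have {}gz s : res WD (res DU (theta s)) = 0 -> exists m, (a * b) ^+ m * s = 0.
  by rewrite -r2; exact: gz.
have eg : res DU (theta (a * b)) = res DU (theta a) ^+ n.+1 * g.
  by rewrite exprS -mulrA e !rmorphM.
split=> /=.
- have : invertible (res WD (res DU (theta (a * b)))) by [].
  by rewrite eg mulrC rmorphM => /invertibleMl.
- move=> s; have [c [m h]] := gf s; have [w aw] := la.
  exists (w ^+ (n.+1 * m) * res DU (theta c)), m; rewrite rmorphM -h eg.
  have hw : res WD w ^+ (n.+1 * m) * res WD (res DU (theta a)) ^+ (n.+1 * m) = 1.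
    by rewrite -exprMn -rmorphM (mulrC w) aw rmorph1 expr1n.
  by rewrite rmorphXn (rmorphM (res WD) _ g) rmorphXn exprMn -exprM !mulrA hw mul1r.
- move=> s s0; have [c [m h]] := lf s; have [w aw] := la.
  have [|l hl] := gz c; first by rewrite -h rmorphM s0 mulr0.
  exists l; have : res DU (theta ((a * b) ^+ l * c)) = 0 by rewrite hl !rmorph0.
  rewrite !rmorphM /= !rmorphXn /= eg -h exprMn -exprM.
  set th := res DU (theta a) in aw *; move=> h0.
  have -> : g ^+ l * s = w ^+ m * w ^+ (n.+1 * l) * (th ^+ (n.+1 * l) * g ^+ l * (th ^+ m * s)).
    transitivity ((th * w) ^+ m * (th * w) ^+ (n.+1 * l) * (g ^+ l * s)).
      by rewrite aw !expr1n !mul1r.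
    by rewrite !exprMn; ring.
  by rewrite h0 mulr0.
Qed.

Lemma scheme_basis (k : fieldType) (X : scheme k) x (N : opens X) : N x ->
  exists D : opens X, [/\ affine_open D, D x & D `<=` N].
Proof. by move=> Nx; have [U [Ux aU]] := locally_affine x; exact: (affine_distinguished aU Ux Nx). Qed.

Lemma scheme_local (k : fieldType) (X : scheme k) (x : X) : is_local (stalk x).
Proof.
have [U [Ux [A [phi [theta [bij top loc]]]]]] := locally_affine x.
exact: (aff_local bij top loc Ux).
Qed.

Lemma pt_unit (k : fieldType) (Y : kringed k) (W : opens Y) (R : comPzRingType)
    (psi : {rmorphism R -> sec Y W}) y (Wy : W y) r :
  ~ pt psi y r <-> invertible (germ y Wy (psi r)).
Proof.
split; first by move=> /contrapT[Wy']; rewrite (germ_irr Wy' Wy).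
by move=> h; apply; exists Wy.
Qed.

Lemma pt_prime (k : fieldType) (Y : kringed k) (W : opens Y) (R : comPzRingType)
    (psi : {rmorphism R -> sec Y W}) y : W y -> is_local (stalk y) -> prime_ideal (pt psi y).
Proof.
move=> Wy /nonunits_prime[[h0 hD hM] h1 pr].
have E s : pt psi y s <-> nonunits (germ y Wy (psi s)).
  by split=> [h i|h]; [apply: h; exists Wy|apply: contrapT => /(pt_unit _ Wy)].
split; first split.
- by apply/E; rewrite !rmorph0.
- by move=> s t /E hs /E ht; apply/E; rewrite !rmorphD; exact: hD.
- by move=> s t /E ht; apply/E; rewrite !rmorphM; exact: hM.
- by move=> /E; rewrite !rmorph1; exact: h1.
- by move=> s t /E; rewrite !rmorphM => /pr[] h; [left|right]; apply/E.
Qed.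

(* A chart exhibits W as the spectrum of R: pt psi y is the prime at y. *)
Record chart (k : fieldType) (Y : kringed k) (W : opens Y) (R : comPzRingType)
    (psi : {rmorphism R -> sec Y W}) : Prop := Chart {
  ch_loc : forall y (Wy : W y),
    is_loc_at [the {rmorphism R -> stalk y} of germ y Wy \o psi] (pt psi y);
  ch_prime : forall y, W y -> prime_ideal (pt psi y);
  ch_inj : forall y y', W y -> W y' -> pt psi y = pt psi y' -> y = y';
  ch_surj : forall P, prime_ideal P -> exists y, W y /\ pt psi y = P;
  ch_basis : forall (N : opens Y) y, W y -> N y ->
    exists f, ~ pt psi y f /\ forall y', W y' -> ~ pt psi y' f -> N y' }.

Lemma affine_chart (k : fieldType) (X : kringed k) (U : opens X) :
  affine_open U -> is_domain (sec X U) ->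
  chart (R := sec X U) [the {rmorphism sec X U -> sec X U} of idfun].
Proof.
move=> [A [phi [theta [bij top loc]]]] [o dom].
set psi := [the {rmorphism sec X U -> sec X U} of idfun].
have ptE x (Ux : U x) a : pt psi x (theta a) <-> phi x a by rewrite (aff_phi bij top loc Ux).
have lx x (Ux : U x) := aff_local bij top loc Ux.
split=> [x Ux|x Ux|x y Ux Uy e|P pP|N x Ux Nx].
- split=> [v /(pt_unit psi Ux)//|b|s t|v pv i].
  + have [a [f [nf e]]] := aff_frac bij top loc Ux b.
    by exists (theta a), (theta f); split=> // /(ptE x Ux).
  + move=> /= /eqP; rewrite -subr_eq0 -rmorphB => /eqP.
    rewrite -[0](rmorph0 (germ x Ux)) => /germ_eq[W [WU [WU' [Wx]]]].
    have [b eb] := aff_bij bij loc (s - t); rewrite -eb rmorph0.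
    have [f [Dx DW]] := aff_basis top Ux Wx.
    have [_ _ hz] := loc f _ (aff_DU (f := f)) erefl.
    move=> /(congr1 (res DW)); rewrite rmorph0 (res_res _ _ (aff_DU (top := top) (f := f))) => /hz[n].
    move=> /(congr1 theta); rewrite rmorphM rmorph0 eb => /dom[] h; last first.
      by move: h => /eqP; rewrite subr_eq0 => /eqP.
    have /(aff_unit bij top loc Ux) : ~ phi x (f ^+ n).
      by move=> /(prime_expr (aff_prime bij Ux)); case: Dx.
    by rewrite h rmorph0; have [h0 _ _] := lx x Ux.
  + by move/(pt_unit psi Ux): i.
- exact: pt_prime (lx x Ux).
- have [_ inj _] := bij; apply: inj; [exact: mem_set|exact: mem_set|].
  apply/seteqP; split=> a; first by move=> /(ptE x Ux); rewrite e => /(ptE y Uy).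
  by move=> /(ptE y Uy); rewrite -e => /(ptE x Ux).
- pose Q := [set b | P (theta b)].
  have [hP P1 Ppr] := pP.
  have pQ : prime_ideal Q.
    split; first split; rewrite /Q /mkset.
    + by rewrite rmorph0; exact: ideal0.
    + by move=> b c *; rewrite rmorphD; exact: idealD.
    + by move=> b c *; rewrite rmorphM; exact: idealMl.
    + by rewrite rmorph1.
    + by move=> b c; rewrite rmorphM => /Ppr.
  have [_ _ /(_ Q pQ)[y Uy eQ]] := bij; exists y; split=> //.
  apply/seteqP; split=> s; have [a <-] := aff_bij bij loc s.
    by move=> /(ptE y Uy); rewrite eQ.
  by move=> Pa; apply/(ptE y Uy); rewrite eQ.
- have [f [Dx DN]] := aff_basis top Ux Nx; exists (theta f); split.
    by move=> /(ptE x Ux); case: Dx.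
  by move=> y Uy nf; apply: DN; split=> // pf; apply: nf; exact/(ptE y Uy).
Qed.

Section Chart.
Variables (k : fieldType) (Y : kringed k) (W : opens Y) (R : comPzRingType)
  (psi : {rmorphism R -> sec Y W}).
Hypotheses (ch : chart psi) (dR : is_domain R).
Variables (K : fieldType) (io : {rmorphism R -> K}).
Hypotheses (io_inj : injective io).

Let stK_ex y (Wy : W y) : exists g : {rmorphism stalk y -> K},
  forall r, g (germ y Wy (psi r)) = io r.
Proof.
apply: (loc_lift (g := io) (ch_prime ch Wy) (ch_loc ch Wy)) => v nv.
exists (io v)^-1; apply: mulfV; apply/eqP => e; apply: nv.
rewrite (_ : v = 0); first exact: ideal0 (prime_ideal_ideal (ch_prime ch Wy)).
by apply: io_inj; rewrite e rmorph0.
Qed.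

(** All stalks over a chart are compared inside one field containing [R], so that a section becomes
    a single element of this field. *)
Definition stK y (Wy : W y) : {rmorphism stalk y -> K} := projT1 (cid (stK_ex Wy)).

Lemma stKE y (Wy : W y) r : stK Wy (germ y Wy (psi r)) = io r.
Proof. by rewrite /stK; case: cid. Qed.

Let io0 v y (Wy : W y) : ~ pt psi y v -> io v != 0.
Proof.
move=> nv; apply/eqP => e; apply: nv.
rewrite (_ : v = 0); first exact: ideal0 (prime_ideal_ideal (ch_prime ch Wy)).
by apply: io_inj; rewrite e rmorph0.
Qed.

Lemma stK_inj y (Wy : W y) : injective (stK Wy).
Proof.
apply: raddf_inj => b e; have [a [v [nv]]] := la_frac (ch_loc ch Wy) b.
move=> /= ea; have := congr1 (stK Wy) ea; rewrite rmorphM e mulr0 stKE => a0.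
have u := la_unit (ch_loc ch Wy) nv; apply: (invertible_cancel u); rewrite /= ea mulr0.
by rewrite (_ : a = 0) ?rmorph0//; apply: io_inj; rewrite -a0 rmorph0.
Qed.

Lemma stK_loc_in y (Wy : W y) b : loc_in io (pt psi y) (stK Wy b).
Proof.
have [a [v [nv /= ea]]] := la_frac (ch_loc ch Wy) b; exists a, v; split=> //.
by rewrite -(stKE Wy v) -(stKE Wy a) -ea rmorphM mulrC.
Qed.

Lemma stK_surj y (Wy : W y) c : loc_in io (pt psi y) c -> exists b, stK Wy b = c.
Proof.
move=> [a [v [nv e]]]; have [w vw] := la_unit (ch_loc ch Wy) nv.
exists (w * germ y Wy (psi a)); apply: (mulfI (io0 Wy nv)).
have := congr1 (stK Wy) vw; rewrite rmorphM /= stKE rmorph1 => e1.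
rewrite rmorphM /= stKE -e [LHS](_ : _ = (io v * stK Wy w) * (io v * c)); last by ring.
by rewrite e1 mul1r.
Qed.

Lemma generic_point : exists y, W y /\ pt psi y = [set 0].
Proof.
apply: (ch_surj ch); case: dR => o dom; split=> //; first exact: zero_ideal.
Qed.

Lemma generic_mem y (N : opens Y) z : W y -> pt psi y = [set 0] -> W z -> N z -> N y.
Proof.
move=> Wy ey Wz Nz; have [f [nf h]] := ch_basis ch Wz Nz; apply: h => //.
rewrite ey => f0; apply: nf; rewrite f0.
exact: ideal0 (prime_ideal_ideal (ch_prime ch Wz)).
Qed.

(** A germ is represented by a fraction on a neighbourhood, and every nonempty open of the chart
    contains its generic point; the value at any point is thus the value at the generic one. *)
Lemma stK_const (N : opens Y) (NW : N `<=` W) (s : sec Y N) y z (Ny : N y) (Nz : N z) :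
  stK (NW y Ny) (germ y Ny s) = stK (NW z Nz) (germ z Nz s).
Proof.
have [e [We ee]] := generic_point.
have Ne y' : N y' -> N e by move=> Ny'; exact: (generic_mem We ee (NW _ Ny') Ny').
suff H y' (Ny' : N y') : stK (NW y' Ny') (germ y' Ny' s) = stK (NW e (Ne y Ny)) (germ e (Ne y Ny) s).
  by rewrite !H.
have Wy' := NW _ Ny'; have [a [v [nv]]] := la_frac (ch_loc ch Wy') (germ y' Ny' s).
move=> /= ea; have : germ y' Ny' (res NW (psi v) * s) = germ y' Ny' (res NW (psi a)).
  by rewrite rmorphM /= !(germ_res NW Ny' Wy').
move=> /germ_eq[W' [W1 [W2 [Wy1 h]]]].
have We' : W' e by exact: (generic_mem We ee Wy').
have key x (Wx : W' x) : stK (NW x (W1 x Wx)) (germ x (W1 x Wx) s) = io a / io v.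
  apply: (canRL (mulfK (io0 Wy' nv))); rewrite mulrC.
  have := congr1 (germ x Wx) h; rewrite !(germ_res _ Wx (W1 x Wx)) !rmorphM /=.
  rewrite !(germ_res NW (W1 x Wx) (NW x (W1 x Wx))) => /(congr1 (stK (NW x (W1 x Wx)))).
  by rewrite rmorphM !stKE.
have := key y' Wy1; rewrite -(key e We').
by rewrite (Prop_irrelevance (W1 y' Wy1) Ny') (Prop_irrelevance (W1 e We') (Ne y Ny)).
Qed.

(** Sections over [N] are the elements common to the local rings at its points: local
    representatives have the same constant value and therefore glue. *)
Lemma stK_glue (N : opens Y) (NW : N `<=` W) c : (forall y, N y -> loc_in io (pt psi y) c) ->
  exists t : sec Y N, forall y (Ny : N y), stK (NW y Ny) (germ y Ny t) = c.
Proof.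
move=> h; pose gam y (Ny : N y) := projT1 (cid (stK_surj (NW y Ny) (h y Ny))).
have gamE y (Ny : N y) : stK (NW y Ny) (gam y Ny) = c by rewrite /gam; case: cid.
have [y Ny|t tE] := @sec_glue _ _ N gam; last by exists t => y Ny; rewrite tE.
have : exists g, g = gam y Ny by exists (gam y Ny).
move=> [g]; elim/stalk_ind: g => N' N'y s eg.
have sub : ocap N N' `<=` W by move=> x [/NW].
have y2 : ocap N N' y by [].
exists (ocap N N'), (@ocapl _ _ _), (res (@ocapr _ _ _) s); split=> // x Nx.
apply: (@stK_inj x (NW x (ocapl Nx))); rewrite gamE.
have := @stK_const (ocap N N') sub (res (@ocapr _ _ _) s) x y Nx y2.
rewrite (Prop_irrelevance (sub x Nx) (NW x (ocapl Nx))) => ->.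
rewrite (germ_res (@ocapr _ N N') y2 N'y) eg.
by rewrite (Prop_irrelevance (sub y y2) (NW y Ny)) gamE.
Qed.

Lemma stK_eq (N : opens Y) (NW : N `<=` W) (s t : sec Y N) y (Ny : N y) :
  stK (NW y Ny) (germ y Ny s) = stK (NW y Ny) (germ y Ny t) -> s = t.
Proof.
move=> e; apply: sec_eq_germs => x Nx; apply: (@stK_inj x (NW x Nx)).
by rewrite !(stK_const NW _ Nx Ny).
Qed.

End Chart.

(** * The spectrum of a noetherian domain *)

Lemma radical_avoiding (C : comPzRingType) (J : set C) f : noetherian C -> is_ideal J ->
  (forall n, ~ J (f ^+ n)) -> exists P, [/\ prime_ideal P, J `<=` P & ~ P f].
Proof.
move=> noe hJ nJ.
pose F : set (set C) := [set I | [/\ is_ideal I, J `<=` I & forall n, ~ I (f ^+ n)]].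
have [||I [[hI JI nI] mx]] := @noetherian_max C F noe.
- by move=> I [].
- by exists J; split.
have pw a : ~ I a -> exists n, isum I (pgen a) (f ^+ n).
  move=> na; apply: contrapT => no.
  have h : F (isum I (pgen a)).
    split; first by apply: isum_ideal => //; exact: pgen_ideal.
      by apply: (subset_trans JI) => b; apply: isuml; exact: pgen_ideal.
    by move=> n h; apply: no; exists n.
  apply: na; apply: (mx _ h).
    by move=> b; apply: isuml; exact: pgen_ideal.
  by apply: isumr => //; exact: pgen_id.
exists I; split=> //; last by move=> If; apply: (nI 1%N); rewrite expr1.
split=> //; first by move: (nI 0%N); rewrite expr0.
move=> a b Iab; apply: contrapT => /not_orP[/pw[n [i [_ [Ii [c ->] en]]]] /pw[m [j [_ [Ij [d ->] em]]]]].
apply: (nI (n + m)%N); rewrite exprD en em.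
rewrite (_ : _ * _ = (j + d * b) * i + c * a * j + c * d * (a * b)); last by ring.
by apply: (idealD hI); [apply: (idealD hI)|]; exact: idealMl.
Qed.

Section Spec.
Variables (k : fieldType) (R : comPzRingType) (kR : {rmorphism k -> R}).
Variables (K : fieldType) (io : {rmorphism R -> K}).
Hypotheses (io_inj : injective io) (dR : is_domain R) (noe : noetherian R).

Definition spec : Type := {P : set R | prime_ideal P}.
HB.instance Definition _ := gen_eqMixin spec.
HB.instance Definition _ := gen_choiceMixin spec.

Definition spec_op : set_system spec := [set S | exists E : set R, S = [set P | ~ E `<=` sval P]].

Lemma spec_opT : spec_op setT.
Proof.
exists [set 1]; apply/seteqP; split=> // P _ h.
by case: (svalP P) => _ P1 _; apply: P1; exact: h.
Qed.
Lemma spec_opI : setI_closed spec_op.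
Proof.
move=> _ _ [E ->] [E' ->]; exists [set c | exists a b, [/\ E a, E' b & c = a * b]].
apply/seteqP; split=> P.
  move=> [/nonsubset[a [Ea na]] /nonsubset[b [Eb nb]]] h.
  by have [_ _ pr] := svalP P; have /pr[] : sval P (a * b) by apply: h; exists a, b.
move=> /nonsubset[_ [[a [b [Ea Eb ->]]] n]].
have hP := prime_ideal_ideal (svalP P); split=> h; apply: n.
  by apply: (idealMr _ hP); exact: h.
by apply: (idealMl _ hP); exact: h.
Qed.
Lemma spec_op_bigU (I : Type) (f : I -> set spec) : (forall i, spec_op (f i)) ->
  spec_op (\bigcup_i f i).
Proof.
move=> h; exists [set a | exists i E, f i = [set P | ~ E `<=` sval P] /\ E a].
apply/seteqP; split=> P.
  move=> [i _ fP] hP; have [E eE] := h i; move: fP; rewrite eE; apply=> a Ea.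
  by apply: hP; exists i, E.
by move=> /nonsubset[a [[i [E [eE Ea]]] na]]; exists i => //; rewrite eE => /(_ a Ea).
Qed.
HB.instance Definition _ := isOpenTopological.Build spec spec_opT spec_opI spec_op_bigU.

(** As [R] is a domain, sections over a nonempty [U] are the elements of [K] in the local rings at
    all points of [U]. Encoding them as constant functions on [U] makes the ring over the empty set
    zero. *)
Definition spec_pred (U : opens spec) : {pred ({P : spec | U P} -> K)} :=
  fun s => `[< (forall x y, s x = s y) /\ forall x, loc_in io (sval (sval x)) (s x) >].

Arguments spec_pred : clear implicits.

Lemma spec_predP (U : opens spec) s : reflect ((forall x y, s x = s y) /\ forall x, loc_in io (sval (sval x)) (s x))
  (s \in spec_pred U).
Proof. exact: asboolP. Qed.

Lemma spec_subring (U : opens spec) : subring_closed (spec_pred U).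
Proof.
have S (x : {P : spec | U P}) := loc_in_sring io (svalP (sval x)).
split.
- apply/spec_predP; split=> // x; exact: sring1 (S x).
- move=> s t /spec_predP[cs ls] /spec_predP[ct lt]; apply/spec_predP; split.
    by move=> x y; change (s x - t x = s y - t y); rewrite (cs x y) (ct x y).
  by move=> x; change (loc_in io (sval (sval x)) (s x - t x)); exact: (sringB (S x)).
- move=> s t /spec_predP[cs ls] /spec_predP[ct lt]; apply/spec_predP; split.
    by move=> x y; change (s x * t x = s y * t y); rewrite (cs x y) (ct x y).
  by move=> x; change (loc_in io (sval (sval x)) (s x * t x)); exact: (sringM (S x)).
Qed.
HB.instance Definition _ (U : opens spec) := GRing.isSubringClosed.Build _ (spec_pred U) (spec_subring U).

Record spec_sec (U : opens spec) := SpecSec { spec_val : {P : spec | U P} -> K;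
  _ : spec_val \in spec_pred U }.
HB.instance Definition _ (U : opens spec) := [isSub for (@spec_val U)].
HB.instance Definition _ (U : opens spec) := [Choice of spec_sec U by <:].
HB.instance Definition _ (U : opens spec) :=
  GRing.SubChoice_isSubComPzRing.Build _ _ (spec_sec U) (subringClosedP _).

Definition spec_incl (U V : opens spec) (VU : V `<=` U) (x : {P : spec | V P}) : {P : spec | U P} :=
  exist _ (sval x) (VU _ (svalP x)).

Lemma spec_res_subproof (U V : opens spec) (VU : V `<=` U) (s : spec_sec U) :
  spec_val s \o spec_incl VU \in spec_pred V.
Proof.
case: s => s /= /spec_predP[cs ls]; apply/spec_predP; split=> [x y|x]; first exact: cs.
exact: (ls (spec_incl VU x)).
Qed.
Definition spec_res (U V : opens spec) (VU : V `<=` U) (s : spec_sec U) : spec_sec V :=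
  SpecSec (spec_res_subproof VU s).
Lemma spec_res_additive (U V : opens spec) (VU : V `<=` U) : zmod_morphism (spec_res VU).
Proof. by move=> s t; apply/val_inj/funext. Qed.
Lemma spec_res_mult (U V : opens spec) (VU : V `<=` U) : monoid_morphism (spec_res VU).
Proof. by split=> [|s t]; apply/val_inj/funext. Qed.
HB.instance Definition _ U V VU :=
  GRing.isZmodMorphism.Build (spec_sec U) (spec_sec V) (@spec_res U V VU) (@spec_res_additive U V VU).
HB.instance Definition _ U V VU :=
  GRing.isMonoidMorphism.Build (spec_sec U) (spec_sec V) (@spec_res U V VU) (@spec_res_mult U V VU).

Lemma spec_cst_subproof (U : opens spec) r : (fun _ => io r) \in spec_pred U.
Proof. by apply/spec_predP; split=> // x; exact: loc_in_io (svalP (sval x)). Qed.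
Definition spec_cst (U : opens spec) (r : R) : spec_sec U := SpecSec (spec_cst_subproof U r).
Lemma spec_cst_additive U : zmod_morphism (spec_cst U).
Proof. by move=> r t; apply/val_inj/funext => x; rewrite /= rmorphB. Qed.
Lemma spec_cst_mult U : monoid_morphism (spec_cst U).
Proof. by split=> [|r t]; apply/val_inj/funext => x; rewrite /= ?rmorph1 ?rmorphM. Qed.
HB.instance Definition _ U :=
  GRing.isZmodMorphism.Build R (spec_sec U) (spec_cst U) (spec_cst_additive U).
HB.instance Definition _ U :=
  GRing.isMonoidMorphism.Build R (spec_sec U) (spec_cst U) (spec_cst_mult U).

Let eta : spec := exist _ [set 0] (let: conj o dom := dR in And3 (@zero_ideal R) o dom).

Lemma spec_eta (U : opens spec) P : U P -> U eta.
Proof.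
have [E eE] := oset_open U; rewrite /omem eE => /nonsubset[a [Ea na]] /(_ a Ea)/= a0.
by apply: na; rewrite a0; exact: ideal0 (prime_ideal_ideal (svalP P)).
Qed.

Lemma spec_sec_sheaf : sheaf_axiom (fun U V VU => @spec_res U V VU).
Proof.
move=> U J V VU cov s comp.
(* Any two nonempty members of the cover share the generic point, so all the constants agree. *)
have [c hc] : exists c, forall j (x : {P : spec | V j P}), spec_val (s j) x = c.
  have [[j [P VP]]|no] := pselect (exists j P, V j P); last first.
    by exists 0 => j [P VP]; case: no; exists j, P.
  exists (spec_val (s j) (exist _ eta (spec_eta VP))) => i [Q VQ].
  have := comp i j (ocap (V i) (V j)) (@ocapl _ _ _) (@ocapr _ _ _).
  have Ve : ocap (V i) (V j) eta by split; [exact: spec_eta VQ|exact: spec_eta VP].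
  move=> /(congr1 (fun t => spec_val t (exist _ eta Ve))) /= e.
  have /spec_predP[ci _] := valP (s i); have /spec_predP[cj _] := valP (s j).
  by apply: etrans (ci _ _) (etrans e (cj _ _)).
have ht : (fun _ => c) \in spec_pred U.
  apply/spec_predP; split=> // -[P UP]; have [j VP] := cov P UP.
  by have /spec_predP[_ /(_ (exist _ P VP)) l] := valP (s j); rewrite -(hc j (exist _ P VP)).
exists (SpecSec ht); split.
  by move=> j; apply/val_inj/funext => x /=; rewrite hc.
move=> t et; apply/val_inj/funext => -[P UP] /=; have [j VP] := cov P UP.
rewrite -(hc j (exist _ P VP)) -et /=; congr (spec_val t _).
by rewrite /spec_incl /=; congr (exist _ _ _); exact: Prop_irrelevance.
Qed.

Definition spec_kringed : kringed k.
Proof.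
unshelve refine (@KRinged k spec (fun U => spec_sec U : comPzRingType)
  (fun U V VU => [the {rmorphism spec_sec U -> spec_sec V} of spec_res VU])
  (fun U => [the {rmorphism k -> spec_sec U} of spec_cst U \o kR]) _ _ _ spec_sec_sheaf).
- move=> U UU s; apply/val_inj/funext => -[P UP] /=; congr (spec_val s _).
  by rewrite /spec_incl /=; congr (exist _ _ _); exact: Prop_irrelevance.
- move=> U V W VU WV WU s; apply/val_inj/funext => -[P UP] /=; congr (spec_val s _).
  by rewrite /spec_incl /=; congr (exist _ _ _); exact: Prop_irrelevance.
- by move=> U V VU c; apply/val_inj/funext.
Defined.

Definition spec_unit : {rmorphism R -> sec spec_kringed (otop spec_kringed)} :=
  [the {rmorphism R -> spec_sec (otop spec)} of spec_cst (otop spec)].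

Lemma spec_affine_data : [/\ set_bij (otop spec_kringed) (@prime_ideal R) (fun P : spec => sval P),
  (forall W : set spec_kringed, W `<=` otop spec_kringed ->
    open W <-> exists E : set R, W = [set x : spec | otop spec_kringed x /\ ~ (E `<=` sval x)]) &
  (forall (f : R) (W : opens spec_kringed) (WU : W `<=` otop spec_kringed),
    W = [set x : spec | otop spec_kringed x /\ ~ sval x f] :> set spec ->
    is_localization f (res WU \o spec_unit))].
Proof.
split.
- split=> [P _|P Q _ _ e|P pP].
  + exact: svalP.
  + by case: P Q e => P pP [Q pQ] /= e; subst Q; rewrite (Prop_irrelevance pP pQ).
  + by exists (exist _ P pP).
- move=> W _; change (spec_op W <-> exists E : set R, W = [set x | otop spec x /\ ~ E `<=` sval x]).
  have e (E : set R) : [set x | otop spec x /\ ~ E `<=` sval x] = [set P | ~ E `<=` sval P].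
    by apply/seteqP; split=> P; [case|move=> nE; split].
  by split=> -[E ->]; exists E; rewrite e.
- move=> f W WU eW.
  have WE P : W P <-> ~ sval P f.
    by rewrite /omem eW; split=> [[]//|h]; split.
  have ne (P : spec) : W P -> io f != 0.
    move=> /WE nf; apply/eqP => e; apply: nf; rewrite (_ : f = 0); last by apply: io_inj; rewrite e rmorph0.
    exact: ideal0 (prime_ideal_ideal (svalP P)).
  split.
  + have h : (fun _ => (io f)^-1) \in spec_pred W.
      apply/spec_predP; split=> // -[P WP]; exists 1, f; split; first exact/WE.
      by rewrite rmorph1 mulVf// (ne P).
    by exists (SpecSec h); apply/val_inj/funext => -[P WP]; apply: mulfV; exact: ne WP.
  + move=> b; have /spec_predP[cb lb] := valP b.
    have [c hc] : exists c, forall x, spec_val b x = c.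
      have [[P WP]|no] := pselect (exists P, W P); first by exists (spec_val b (exist _ P WP)) => x; exact: cb.
      by exists 0 => -[P WP]; case: no; exists P.
    (* The ideal of denominators of [c] lies in no prime of [W]; since [R] is noetherian,
       [radical_avoiding] then yields a power of [f] in it. *)
    pose D := [set v | exists a, c * io v = io a].
    have hD : is_ideal D.
      split; first by exists 0; rewrite rmorph0 mulr0.
        by move=> u v [a ea] [a' ea']; exists (a + a'); rewrite !rmorphD mulrDr ea ea'.
      by move=> u v [a ea]; exists (u * a); rewrite !rmorphM mulrCA ea.
    have [n [a e]] : exists n, D (f ^+ n).
      apply: contrapT => no; have [|P [pP DP nf]] := @radical_avoiding R D f noe hD.
        by move=> n h; apply: no; exists n.
      have WP : W (exist _ P pP) by apply/WE.
      have [a [v [nv e]]] := lb (exist _ _ WP).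
      by apply: nv; apply: DP; exists a; rewrite -(hc (exist _ _ WP)).
    exists a, n; rewrite -rmorphXn; apply/val_inj/funext => x.
    by change (io (f ^+ n) * spec_val b x = io a); rewrite hc mulrC.
  + move=> a a0; have [->|/eqP na] := eqVneq a 0; first by exists 0%N; rewrite mulr0.
    (* A nonzero [a] can only vanish on an empty [W], one that misses even the generic point, and
       then [f] is zero. *)
    exists 1%N; rewrite expr1 (_ : f = 0) ?mul0r//.
    apply: contrapT => f0; have We : W eta by apply/WE.
    have := congr1 (fun t => spec_val t (exist _ eta We)) a0 => e.
    have {}e : io a = 0 by exact: e.
    by apply: na; apply: io_inj; rewrite e rmorph0.
Qed.

Lemma spec_affine : affine_open (otop spec_kringed).
Proof. by exists R, (fun P : spec => sval P), spec_unit; exact: spec_affine_data. Qed.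

Definition spec_scheme : scheme k := @Scheme k spec_kringed (fun x =>
  ex_intro (fun U : opens spec_kringed => U x /\ affine_open U) (otop spec_kringed) (conj I spec_affine)).

Lemma spec_unit_bij s : exists r, spec_unit r = s.
Proof. by have [bij _ loc] := spec_affine_data; exact: (aff_bij bij loc). Qed.

Lemma spec_pt (P : spec_kringed) r : sval P r <-> ~ unit_locus (spec_unit r) P.
Proof. by have [bij top loc] := spec_affine_data; rewrite (aff_phi bij top loc (I : otop spec_kringed P)). Qed.

Lemma spec_unit_inj : injective spec_unit.
Proof.
move=> r t /(congr1 (fun s : spec_sec (otop spec) => spec_val s (exist _ eta I))) e; exact: io_inj.
Qed.

Lemma spec_domain : is_domain (sec spec_kringed (otop spec_kringed)).
Proof.
have [o dom] := dR; split.
  by rewrite -(rmorph1 spec_unit) -(rmorph0 spec_unit) => /spec_unit_inj.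
move=> a b; have [r <-] := spec_unit_bij a; have [t <-] := spec_unit_bij b.
rewrite -rmorphM -(rmorph0 spec_unit) => /spec_unit_inj/dom[] ->; by [left|right].
Qed.

Lemma spec_chart : chart (R := sec spec_kringed (otop spec_kringed))
  [the {rmorphism sec spec_kringed (otop spec_kringed) -> sec spec_kringed (otop spec_kringed)} of idfun].
Proof. exact: affine_chart spec_affine spec_domain. Qed.

End Spec.

(** * Charts of the fibre product *)

Section ToAffine.
Variables (k : fieldType) (Y Z : kringed k) (U : opens Z).
Local Notation psiU := [the {rmorphism sec Z U -> sec Z U} of idfun].
Hypothesis ch : chart (R := sec Z U) psiU.

(** The pulled back functions on [U] determine which of them are units at each point, hence the map
    on points; every other germ is a fraction of such functions. *)
Lemma mor_ext_affine (F G : mor Y Z) (FU : forall y, U (F y)) (GU : forall y, U (G y)) :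
  (forall y a, germ y (FU y : pull F U y) (comor F U a) = germ y (GU y : pull G U y) (comor G U a)) ->
  F = G.
Proof.
move=> e; have FG : F =1 G.
  move=> y; apply: (ch_inj ch) => //; apply/seteqP; split=> a h; apply: contrapT.
    move=> /(pt_unit psiU (GU y)) /= u.
    suff /(pt_unit psiU (FU y)) : invertible (germ (F y) (FU y) a) by [].
    by apply/comor_unit; rewrite e; apply/comor_unit.
  move=> /(pt_unit psiU (FU y)) /= u.
  suff /(pt_unit psiU (GU y)) : invertible (germ (G y) (GU y) a) by [].
  by apply/comor_unit; rewrite -e; apply/comor_unit.
apply: mor_ext => // y V Vy Vy' s.
have [r [v [nv /= er]]] := la_frac (ch_loc ch (FU y)) (germ (F y) Vy s).
have : germ (F y) (conj (FU y) Vy : ocap U V (F y)) (res (@ocapl _ U V) v * res (@ocapr _ U V) s)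
    = germ (F y) (FU y) r.
  by rewrite rmorphM /= (germ_res (@ocapl _ U V) _ (FU y)) (germ_res (@ocapr _ U V) _ Vy).
move=> /germ_eq[N [N1 [N2 [Ny eN]]]].
have Ny' : N (G y) by rewrite -FG.
have key (H : mor Y Z) (UH : U (H y)) (VH : V (H y)) (NH : N (H y)) :
    germ y (UH : pull H U y) (comor H U v) * germ y (VH : pull H V y) (comor H V s) =
    germ y (UH : pull H U y) (comor H U r).
  have := congr1 (fun t => germ y (NH : pull H N y) (comor H N t)) eN.
  rewrite rmorphM !(res_res _ _ (subset_trans N1 (@ocapl _ U V)))
    !(res_res _ _ (subset_trans N1 (@ocapr _ U V))) => e1.
  rewrite -(comor_germ (germ_res N2 NH UH r)) -e1 !rmorphM; congr (_ * _).
    exact: (comor_germ (esym (germ_res (subset_trans N1 (@ocapl _ U V)) NH UH v))).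
  exact: (comor_germ (esym (germ_res (subset_trans N1 (@ocapr _ U V)) NH VH s))).
have u : invertible (germ y (FU y : pull F U y) (comor F U v)).
  by apply/comor_unit; exact/(pt_unit psiU (FU y)).
apply: (invertible_cancel u); rewrite (key F (FU y) Vy Ny) !e.
by rewrite (key G (GU y) Vy' Ny').
Qed.

(** The image of [y] is the point whose prime consists of the functions pulled back to non-units at
    [y]; the maps on stalks come from the universal property of localization. *)
Lemma mor_to_affine (f : {rmorphism sec Z U -> sec Y (otop Y)}) :
  (forall y : Y, is_local (stalk y)) -> (forall c, f (kst Z U c) = kst Y (otop Y) c) ->
  exists F : mor Y Z, (forall y, U (F y)) /\
    forall y (Uy : U (F y)) a, germ y (Uy : pull F U y) (comor F U a) = germ y (I : otop Y y) (f a).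
Proof.
move=> loc fk.
have exF (y : Y) : exists z, U z /\ pt psiU z = pt f y.
  by apply: (ch_surj ch); exact: (pt_prime f (I : otop Y y) (loc y)).
pose F y := projT1 (cid (exF y)).
have FU y : U (F y) by rewrite /F; case: cid => ? [].
have Fpt y : pt psiU (F y) = pt f y by rewrite /F; case: cid => ? [].
have exp (y : Y) : exists p : {rmorphism stalk (F y) -> stalk y},
    forall a, p (germ (F y) (FU y) a) = germ y (I : otop Y y) (f a).
  have [|p pE] := @loc_lift _ _ (stalk y) _ _
    [the {rmorphism sec Z U -> stalk y} of germ y (I : otop Y y) \o f]
    (ch_prime ch (FU y)) (ch_loc ch (FU y)); last by exists p.
  by move=> v; rewrite Fpt => /(pt_unit f (I : otop Y y)).
pose psi y := projT1 (cid (exp y)).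
have psiE y a : psi y (germ (F y) (FU y) a) = germ y (I : otop Y y) (f a) by rewrite /psi; case: cid.
have unitE y v : ~ pt psiU (F y) v -> invertible (germ y (I : otop Y y) (f v)).
  by rewrite Fpt => /(pt_unit f (I : otop Y y)).
have cF : continuous F.
  apply/continuousP => S oS; apply: open_local => y Sy.
  have [v [nv hv]] := ch_basis ch (N := Opens oS) (FU y) Sy.
  exists (unit_opens (f v)); split; first by exists I; exact: unitE.
  move=> y' hy'; apply: (hv (F y') (FU y')); rewrite Fpt; exact.
clearbody psi F.
have [|||M [MF ME]] := mor_of_stalks (cf := cF) (psi := psi).
- move=> y b u; have [r [v [nv /= er]]] := la_frac (ch_loc ch (FU y)) b.
  have nr : ~ pt psiU (F y) r.
    have := congr1 (psi y) er; rewrite rmorphM !psiE => e; rewrite Fpt.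
    by apply/(pt_unit f (I : otop Y y)); rewrite -e; apply: invertibleM => //; exact: unitE.
  have /= := la_unit (ch_loc ch (FU y)) nr; rewrite -er mulrC; exact: invertibleMl.
- move=> y V Vy c.
  rewrite (_ : germ (F y) Vy (kst Z V c) = germ (F y) (FU y) (kst Z U c)).
    rewrite psiE fk; apply/germ_eq; exists (Defs.preim cF V), (fun _ _ => I), (fun _ h => h).
    by split=> //; rewrite !res_kst.
  by apply/germ_eq; exists (ocap V U), (@ocapl _ _ _), (@ocapr _ _ _); rewrite !res_kst; split=> //; split=> //; exact: FU.
- move=> V s y Vy.
  have [r [v [nv /= er]]] := la_frac (ch_loc ch (FU y)) (germ (F y) Vy s).
  have : germ (F y) (conj (FU y) Vy : ocap U V (F y)) (res (@ocapl _ U V) v * res (@ocapr _ U V) s)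
      = germ (F y) (FU y) r.
    by rewrite rmorphM /= (germ_res (@ocapl _ U V) _ (FU y)) (germ_res (@ocapr _ U V) _ Vy).
  move=> /germ_eq[N [N1 [N2 [Ny eN]]]].
  have [N' [N'top [N'y [w vw]]]] := germ_unit_nbhd (unitE y v nv).
  pose N0 := ocap (Defs.preim cF N) N'.
  have N0V : N0 `<=` Defs.preim cF V by move=> y' [/N1[]].
  have N0t : N0 `<=` otop Y by [].
  exists N0, N0V, (res (@ocapr _ _ _) w * res N0t (f r)); split=> // y' Ny'.
  have Ny2 : N (F y') by case: Ny'.
  have N'y2 : N' y' by case: Ny'.
  have vw' : germ y' (I : otop Y y') (f v) * germ y' N'y2 w = 1.
    by rewrite -(germ_res N'top N'y2) -rmorphM vw rmorph1.
  have uv : invertible (germ y' (I : otop Y y') (f v)) by exists (germ y' N'y2 w).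
  apply: (invertible_cancel uv).
  rewrite rmorphM /= (germ_res (@ocapr _ _ _) Ny' N'y2) (germ_res N0t Ny' I) mulrA vw' mul1r.
  rewrite -!psiE -rmorphM; congr (psi y' _).
  have := congr1 (germ (F y') Ny2) eN.
  rewrite (germ_res N2 Ny2 (FU y')) (germ_res N1 Ny2 (conj (FU y') (N0V y' Ny') : ocap U V (F y'))).
  rewrite rmorphM /= (germ_res (@ocapl _ U V) _ (FU y')) (germ_res (@ocapr _ U V) _ (N0V y' Ny')).
  by move=> ->.
exists M; split; first by move=> y; rewrite MF.
by move=> y Uy a; rewrite (ME y (MF y) U Uy (FU y)) psiE.
Qed.

End ToAffine.

(** * Open subschemes *)

Section OpenSub.
Variables (k : fieldType) (Y : scheme k) (W : opens Y).

Definition osub : Type := {y : Y | W y}.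
HB.instance Definition _ := gen_eqMixin osub.
HB.instance Definition _ := gen_choiceMixin osub.

Definition osub_image (S : set osub) : set Y := [set y | exists w : W y, S (exist _ y w)].

Lemma osub_imageP (S : set osub) t : osub_image S (sval t) <-> S t.
Proof.
case: t => y w; split; last by exists w.
by move=> [w']; rewrite (Prop_irrelevance w' w).
Qed.

(** Opens are defined by their images in [Y], so that the sections over an open of the subscheme are
    the sections of [Y] over its image. *)
Definition osub_op : set_system osub := [set S | open (osub_image S)].

Lemma osub_opT : osub_op setT.
Proof.
rewrite /osub_op /mkset (_ : osub_image _ = W); first exact: oset_open.
by apply/seteqP; split=> y; [case|move=> Wy; exists Wy].
Qed.
Lemma osub_opI : setI_closed osub_op.
Proof.
move=> S T oS oT; rewrite /osub_op /mkset (_ : osub_image _ = osub_image S `&` osub_image T).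
  exact: openI.
apply/seteqP; split=> y; first by case=> w [? ?]; split; exists w.
by case=> -[w Sy] [w' Ty]; exists w; split=> //; rewrite (Prop_irrelevance w w').
Qed.
Lemma osub_op_bigU (I : Type) (f : I -> set osub) : (forall i, osub_op (f i)) ->
  osub_op (\bigcup_i f i).
Proof.
move=> h; rewrite /osub_op /mkset (_ : osub_image _ = \bigcup_i osub_image (f i)).
  by apply: bigcup_open => i _; exact: h.
apply/seteqP; split=> y; first by case=> w [i _ ?]; exists i => //; exists w.
by case=> i _ [w ?]; exists w, i.
Qed.
HB.instance Definition _ := isOpenTopological.Build osub osub_opT osub_opI osub_op_bigU.

Definition osub_img (V : opens osub) : opens Y :=
  Opens (oset_open V : open (osub_image V)).

Lemma osub_img_mono (U V : opens osub) : V `<=` U -> osub_img V `<=` osub_img U.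
Proof. by move=> VU y [w Vy]; exists w; exact: VU. Qed.

Lemma osub_sheaf : sheaf_axiom (fun (U V : opens osub) (VU : V `<=` U) =>
  res (osub_img_mono VU)).
Proof.
move=> U J V VU cov s comp.
have [||t [ht ut]] := @sec_sheaf _ Y (osub_img U) J (fun j => osub_img (V j))
  (fun j => osub_img_mono (VU j)) _ s; last by exists t.
- by move=> y [w Uy]; have [j Vy] := cov _ Uy; exists j, w.
move=> i j N Ni Nj; apply: sec_eq => y Ny.
have WN : osub_image [set t | N (sval t)] = N.
  apply/seteqP; split=> x; first by case.
  by move=> Nx; have [w _] := Ni x Nx; exists w.
have oN : open ([set t : osub | N (sval t)] : set osub).
  by change (open (osub_image [set t | N (sval t)])); rewrite WN; exact: oset_open.
have iN : (osub_img (Opens oN)) `<=` N by rewrite /osub_img /= => x; rewrite /omem /= WN.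
have Ni' : Opens oN `<=` V i by move=> t Nt; apply/osub_imageP; exact: Ni.
have Nj' : Opens oN `<=` V j by move=> t Nt; apply/osub_imageP; exact: Nj.
exists (osub_img (Opens oN)), iN; split; first by rewrite /omem /= WN.
rewrite (res_res Ni iN (osub_img_mono Ni')) (res_res Nj iN (osub_img_mono Nj')).
exact: comp.
Qed.

Definition osub_kringed : kringed k.
Proof.
unshelve refine (@KRinged k osub (fun U => sec Y (osub_img U))
  (fun U V VU => res (osub_img_mono VU)) (fun U => kst Y (osub_img U)) _ _ _ osub_sheaf).
- by move=> U UU s; exact: res_id.
- by move=> U V N VU NV NU s; exact: res_res.
- by move=> U V VU c; exact: res_kst.
Defined.

Lemma osub_val_continuous : continuous (fun t : osub_kringed => sval t : Y).
Proof.
apply/continuousP => S oS; change (open (osub_image [set t | S (sval t)])).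
rewrite (_ : osub_image _ = W `&` S); first by apply: openI => //; exact: oset_open.
by apply/seteqP; split=> y; case=> w Sy //; exists w.
Qed.

Lemma osub_pull (U : opens Y) : osub_img (Defs.preim osub_val_continuous U) `<=` U.
Proof. by move=> y [w Uy]. Qed.

Lemma osub_unit (t : osub_kringed) (V : opens osub_kringed) (Vt : V t) (s : sec osub_kringed V) 
   (Vt' : osub_img V (sval t)) :
  invertible (germ t Vt s) -> invertible (germ (sval t) Vt' (s : sec Y (osub_img V))).
Proof.
move=> /germ_unit_nbhd[N [NV [Nt u]]].
have Nt' : osub_img N (sval t) by apply/osub_imageP.
have u' : invertible (res (osub_img_mono NV) (s : sec Y (osub_img V))) := u.
rewrite -(germ_res (osub_img_mono NV) Nt' Vt'); exact: germ_unit u'.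
Qed.

Definition osub_incl : mor osub_kringed Y.
Proof.
unshelve refine (@Mor k osub_kringed Y (fun t => sval t) osub_val_continuous
  (fun U => res (@osub_pull U)) _ _ _).
- by move=> U V VU VU' s; rewrite /= !(res_res _ _ (subset_trans (@osub_pull V) VU)).
- by move=> U c; exact: (res_kst (@osub_pull U) c).
- move=> t U Ut s /osub_unit h.
  have Ut' : osub_img (Defs.preim osub_val_continuous U) (sval t) by apply/osub_imageP.
  by have := h Ut'; rewrite (germ_res (@osub_pull U) Ut' Ut).
Defined.

Lemma osub_incl_inj (t : osub_kringed) (U V : opens Y) (Ut : U (sval t)) (Vt : V (sval t)) s s' :
  germ t (Ut : pull osub_incl U t) (comor osub_incl U s) =
  germ t (Vt : pull osub_incl V t) (comor osub_incl V s') -> germ (sval t) Ut s = germ (sval t) Vt s'.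
Proof.
move=> /germ_eq[N [NU [NV [Nt e]]]].
have Nt' : osub_img N (sval t) by apply/osub_imageP.
apply/germ_eq; exists (osub_img N), (subset_trans (osub_img_mono NU) (@osub_pull U)),
  (subset_trans (osub_img_mono NV) (@osub_pull V)); split=> //.
rewrite -(res_res (@osub_pull U) (osub_img_mono NU)) -(res_res (@osub_pull V) (osub_img_mono NV)).
exact: e.
Qed.

Lemma osub_affine (t : osub_kringed) : exists U : opens osub_kringed, U t /\ affine_open U.
Proof.
have [D [aD Dt DW]] := scheme_basis (svalP t : W (sval t)).
pose DT := Defs.preim osub_val_continuous D; exists DT; split=> //.
have DTD := @osub_pull D; have imE : osub_image DT = D.
  by apply/seteqP; split=> y; [case|move=> Dy; exists (DW y Dy)].
have [A [phi [theta [[bij1 bij2 bij3] top loc]]]] := aD.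
exists A, (fun t => phi (sval t)), [the {rmorphism A -> sec osub_kringed DT} of res DTD \o theta]; split.
- split=> [y Dy|y y' Dy Dy' e|P pP].
  + exact: bij1.
  + have e' : sval y = sval y' by apply: bij2.
    by case: y y' e' {Dy Dy' e} => y w [y' w'] /= e'; subst y'; rewrite (Prop_irrelevance w w').
  + by have [y Dy e] := bij3 P pP; exists (exist _ y (DW y Dy)).
- move=> S SD; change (open (osub_image S) <-> exists E : set A, S = [set x | DT x /\ ~ E `<=` phi (sval x)]).
  have SD' : osub_image S `<=` D by move=> y [w /SD].
  split.
    move=> /(top _ SD')[E eE]; exists E; apply/seteqP; split=> x.
      by move=> /osub_imageP; rewrite eE.
    by move=> h; apply/osub_imageP; rewrite eE.
  move=> [E eE]; apply/(top _ SD'); exists E; apply/seteqP; split=> x.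
    by move=> [w]; rewrite eE.
  by move=> [Dx nE]; exists (DW x Dx); rewrite eE.
- move=> f N ND eN.
  have ND' : osub_img N `<=` D by exact: subset_trans (osub_img_mono ND) DTD.
  have eN' : osub_img N = [set x | D x /\ ~ phi x f] :> set Y.
    apply/seteqP; split=> x.
      by move=> [w]; rewrite eN.
    by move=> [Dx nE]; exists (DW x Dx); rewrite eN.
  have [l1 l2 l3] := loc f (osub_img N) ND' eN'.
  have e a : (res ND \o (res DTD \o theta)) a = (res ND' \o theta) a by exact: (res_res DTD (osub_img_mono ND) ND' (theta a)).
  split; first by rewrite e.
    by move=> b; have [a [n h]] := l2 b; exists a, n; rewrite !e.
  by move=> a; rewrite e; exact: l3.
Qed.

Definition osub_scheme : scheme k := Scheme osub_affine.

End OpenSub.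

Section ProductChart.
Variables (k : fieldType) (X XX : scheme k) (p1 p2 : mor XX X).
Hypothesis prodXX : is_fibre_product p1 p2.
Variables (U1 U2 : opens X).
Local Notation A1 := (sec X U1).
Local Notation A2 := (sec X U2).
Hypotheses (ch1 : chart (R := A1) [the {rmorphism A1 -> A1} of idfun])
           (ch2 : chart (R := A2) [the {rmorphism A2 -> A2} of idfun]).
Variables (R : comPzRingType) (i1 : {rmorphism A1 -> R}) (i2 : {rmorphism A2 -> R}).
Hypothesis T : is_tensor (kst X U1) (kst X U2) i1 i2.
Hypotheses (dR : is_domain R) (noe : noetherian R).

Definition prod_opens : opens XX := ocap (pull p1 U1) (pull p2 U2).
Local Notation W := prod_opens.
Variable psi : {rmorphism R -> sec XX W}.
Hypotheses (psi1 : forall a, psi (i1 a) = res (@ocapl _ _ _) (comor p1 U1 a))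
           (psi2 : forall b, psi (i2 b) = res (@ocapr _ _ _) (comor p2 U2 b)).

(** Spec R maps to [XX] by the universal property, and [W] maps to Spec R by [psi]. That these maps
    are inverse on points and compatible on germs is enough to transport the chart of Spec R to
    [W]. *)
Lemma product_chart : chart psi.
Proof.
have [K [io [io_inj _]]] := frac_exists dR.
pose kR := [the {rmorphism k -> R} of i1 \o kst X U1].
pose S := spec_scheme kR io_inj dR noe.
pose un : {rmorphism R -> sec S (otop S)} := spec_unit kR io dR.
have [||f1 [f1U f1E]] := @mor_to_affine k S X U1 ch1 [the {rmorphism A1 -> sec S (otop S)} of un \o i1].
- exact: scheme_local.
- by move=> c; apply/val_inj/funext.
have [||f2 [f2U f2E]] := @mor_to_affine k S X U2 ch2 [the {rmorphism A2 -> sec S (otop S)} of un \o i2].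
- exact: scheme_local.
- by move=> c; apply/val_inj/funext => x /=; rewrite -(tp_k T).
have [h [[h1 h2] _]] := prodXX f1 f2.
have hU1 P : U1 (p1 (h P)) by have := f1U P; rewrite -h1.
have hU2 P : U2 (p2 (h P)) by have := f2U P; rewrite -h2.
have hW P : W (h P) by split; [exact: hU1|exact: hU2].
have h1E P a : germ P (hU1 P : pull h (pull p1 U1) P) (comor h _ (comor p1 U1 a)) = germ P (I : otop S P) (un (i1 a)).
  rewrite -(@mor_comp_germ _ _ _ _ p1 h P U1 (hU1 P) a) (mor_eq_germ h1 (hU1 P) (f1U P)).
  exact: f1E.
have h2E P a : germ P (hU2 P : pull h (pull p2 U2) P) (comor h _ (comor p2 U2 a)) = germ P (I : otop S P) (un (i2 a)).
  rewrite -(@mor_comp_germ _ _ _ _ p2 h P U2 (hU2 P) a) (mor_eq_germ h2 (hU2 P) (f2U P)).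
  exact: f2E.
have hpsi P r : germ P (hW P : pull h W P) (comor h W (psi r)) = germ P (I : otop S P) (un r).
  elim/(tp_ind T): r => [a b||r r' e e']; last 2 first.
  - by rewrite !rmorph0.
  - by rewrite !rmorphD /= e e'.
  rewrite !rmorphM /= -h1E -h2E psi1 psi2; congr (_ * _).
    exact: (comor_germ (germ_res (@ocapl _ _ _) (hW P) (hU1 P) _)).
  exact: (comor_germ (germ_res (@ocapr _ _ _) (hW P) (hU2 P) _)).
pose inv s := projT1 (cid (@spec_unit_bij k R kR K io io_inj dR noe s)).
have invK s : un (inv s) = s by rewrite /inv; case: cid.
have un_inj : injective un by exact: spec_unit_inj.
have invB : zmod_morphism inv by move=> s t; apply: un_inj; rewrite rmorphB !invK.
have invM : monoid_morphism inv.
  by split=> [|s t]; apply: un_inj; rewrite ?rmorphM ?rmorph1 !invK.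
pose invR : {rmorphism sec S (otop S) -> R} :=
  HB.pack inv (GRing.isZmodMorphism.Build _ _ _ invB) (GRing.isMonoidMorphism.Build _ _ _ invM).
have invuK r : invR (un r) = r by apply: un_inj; exact: invK.
pose TT := osub_scheme W; pose iota : mor TT XX := osub_incl W.
have topW : osub_img (otop TT) `<=` W by move=> y [].
pose psiT : {rmorphism R -> sec TT (otop TT)} := [the {rmorphism R -> sec XX (osub_img (otop TT))} of res topW \o psi].
have chS := @spec_chart k R kR K io io_inj dR noe.
have [||g [gU gE]] := @mor_to_affine k TT S (otop S) chS [the {rmorphism sec S (otop S) -> sec TT (otop TT)} of psiT \o invR].
- exact: scheme_local.
- move=> c; have e : invR (kst S (otop S) c) = kR c.
    by apply: un_inj; rewrite [LHS]invK; apply/val_inj/funext.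
  change (res topW (psi (invR (kst S (otop S) c))) = kst XX (osub_img (otop TT)) c).
  rewrite e; change (res topW (psi (i1 (kst X U1 c))) = kst XX (osub_img (otop TT)) c).
  by rewrite psi1 comor_kst !res_kst.
have gE' t r : germ t (I : pull g (otop S) t) (comor g (otop S) (un r)) = germ t (I : otop TT t) (psiT r).
  by rewrite gE; change (germ t (I : otop TT t) (psiT (invR (un r))) = germ t (I : otop TT t) (psiT r)); rewrite invuK.
have iW t : W (iota t) by case: t.
have iE t r : germ t (iW t : pull iota W t) (comor iota W (psi r)) = germ t (I : otop TT t) (psiT r).
  apply/germ_eq; exists (otop TT), (fun t _ => iW t), (fun _ h => h); split=> //.
  by rewrite res_id; exact: (res_res (@osub_pull _ _ W W) _ topW (psi r)).
(* Both morphisms have the same two projections, since their targets [U1] and [U2] are affine and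
   the functions agree; uniqueness for the fibre product identifies them. *)
have hg : mor_comp h g = iota.
  have [u [_ uu]] := prodXX (mor_comp p1 iota) (mor_comp p2 iota).
  transitivity u; last by apply: uu.
  symmetry; apply: uu; split.
    refine (@mor_ext_affine k TT X U1 ch1 (mor_comp p1 (mor_comp h g)) (mor_comp p1 iota) (fun t => hU1 (g t)) (fun t => (iW t).1) _) => t a.
    rewrite (@mor_comp_germ _ _ _ _ p1 (mor_comp h g) t U1 (hU1 (g t)) a).
    rewrite (@mor_comp_germ _ _ _ _ h g t (pull p1 U1) (hU1 (g t)) (comor p1 U1 a)).
    rewrite (comor_germ (h1E (g t) a)) gE'.
    rewrite (@mor_comp_germ _ _ _ _ p1 iota t U1 (iW t).1 a).
    rewrite -iE psi1.
    exact: (comor_germ (germ_res (@ocapl _ _ _) (iW t) (iW t).1 _)).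
  refine (@mor_ext_affine k TT X U2 ch2 (mor_comp p2 (mor_comp h g)) (mor_comp p2 iota) (fun t => hU2 (g t)) (fun t => (iW t).2) _) => t a.
  rewrite (@mor_comp_germ _ _ _ _ p2 (mor_comp h g) t U2 (hU2 (g t)) a).
  rewrite (@mor_comp_germ _ _ _ _ h g t (pull p2 U2) (hU2 (g t)) (comor p2 U2 a)).
  rewrite (comor_germ (h2E (g t) a)) gE'.
  rewrite (@mor_comp_germ _ _ _ _ p2 iota t U2 (iW t).2 a).
  rewrite -iE psi2.
  exact: (comor_germ (germ_res (@ocapr _ _ _) (iW t) (iW t).2 _)).
have hgt t : h (g t) = sval t by exact: (congr1 (fun m : mor TT XX => m t) hg).
(* For the other composite a statement about points suffices: the prime of [h P] is [P]. *)
have pth P : pt psi (h P) = sval P.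
  apply/seteqP; split=> r.
    move=> n; apply/(@spec_pt k R kR K io io_inj dR noe _ _) => -[Pt].
    rewrite (germ_irr Pt I) -hpsi => /comor_unit; exact/pt_unit.
  move=> /(@spec_pt k R kR K io io_inj dR noe _ _) n; apply: contrapT => /(pt_unit psi (hW P)) /comor_unit.
  by rewrite hpsi => u; apply: n; exists I.
pose lift y (Wy : W y) : TT := exist _ y Wy.
have hl y (Wy : W y) : h (g (lift y Wy)) = y by rewrite hgt.
have ptl y (Wy : W y) : pt psi y = sval (g (lift y Wy)) by rewrite -{1}(hl y Wy) pth.
split.
- move=> y Wy; split.
  + by move=> v /(pt_unit psi Wy).
  (* The germ is pulled back to Spec R along [h], written there as a fraction, and the equation is
     brought back along [g], the composite being the inclusion. *)
  + move=> b; elim/stalk_ind: b => N Ny s.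
    set P := g (lift y Wy); have Nh : N (h P) by rewrite hl.
    have [a' [v' [nv' /= ea]]] := la_frac (ch_loc chS (I : otop S P)) (germ P (Nh : pull h N P) (comor h N s)).
    rewrite -(invK v') -(invK a') in nv' ea; move: (inv v') (inv a') nv' ea => v a nv ea.
    have nPv : ~ sval P v by move=> /(@spec_pt k R kR K io io_inj dR noe _ _).
    exists a, v; split; first by rewrite (ptl y Wy).
    pose N0 := ocap W N; pose s0 : sec XX N0 := res (@ocapl _ _ _) (psi v) * res (@ocapr _ _ _) s.
    have N0h : N0 (h P) by split=> //; exact: hW.
    have N0y : N0 y by [].
    have e1 : germ P (N0h : pull h N0 P) (comor h N0 s0) = germ P (hW P : pull h W P) (comor h W (psi a)).
      rewrite hpsi -ea -hpsi !rmorphM; congr (_ * _).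
        exact: (comor_germ (germ_res (@ocapl _ _ _) N0h (hW P) _)).
      exact: (comor_germ (germ_res (@ocapr _ _ _) N0h Nh _)).
    have e2 : germ y N0y s0 = germ y Wy (psi a).
      apply: (@osub_incl_inj k XX W (lift y Wy) N0 W N0y Wy).
      have iE2 (M : opens XX) (My : M y) (Mh : M (h P)) m :
          germ (lift y Wy) (My : pull iota M (lift y Wy)) (comor iota M m) =
          germ (lift y Wy) (Mh : pull g (pull h M) (lift y Wy)) (comor g (pull h M) (comor h M m)).
        rewrite -(@mor_comp_germ _ _ _ _ h g (lift y Wy) M Mh m).
        by rewrite (mor_eq_germ hg Mh My).
      by rewrite (iE2 N0 N0y N0h) (iE2 W Wy (hW P)); exact: comor_germ.
    rewrite /= -e2 /s0 rmorphM /=.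
    by rewrite (germ_res (@ocapl _ _ _) N0y Wy) (germ_res (@ocapr _ _ _) N0y Ny).
  + apply: raddf_inj => r /= r0.
    have key z (Wz : W z) P : h P = z -> germ z Wz (psi r) = 0 -> r = 0.
      move=> e; subst z; rewrite -(rmorph0 (germ (h P) Wz)) => /comor_germ.
      rewrite (germ_irr (Wz : pull h W P) (hW P)) hpsi !rmorph0 => e.
      apply: un_inj; rewrite rmorph0; apply: (la_inj (ch_loc chS (I : otop S P))).
      by rewrite /= e rmorph0.
    exact: (key y Wy _ (hl y Wy)).
  + by move=> v pv u; apply: pv; exists Wy.
- by move=> y Wy; rewrite (ptl y Wy); exact: svalP.
- move=> y y' Wy Wy'; rewrite (ptl y Wy) (ptl y' Wy') => e.
  rewrite -(hl y Wy) -(hl y' Wy'); congr (h _); move: e.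
  case: (g _) (g _) => P pP [Q pQ] /= e; subst Q; by rewrite (Prop_irrelevance pP pQ).
- by move=> P pP; exists (h (exist _ P pP)); split; [exact: hW|exact: pth].
- move=> N y Wy Ny.
  have oN : open (pull h N : set S) by exact: oset_open.
  have [E eE] := oN : spec_op _.
  have : pull h N (g (lift y Wy)) by rewrite /omem /= /preimage /= hl.
  rewrite /omem eE => /nonsubset[f [Ef nf]]; exists f; split; first by rewrite (ptl y Wy).
  move=> y' Wy' nf'; rewrite -(hl y' Wy').
  suff : pull h N (g (lift y' Wy')) by [].
  by rewrite /omem eE => /(_ f Ef); rewrite -(ptl y' Wy').
Qed.
End ProductChart.

(** * Skyscraper sheaves and generators of the Kähler differentials *)

Section Skyscraper.
Variables (k : fieldType) (X : kringed k) (x : X) (Q : zmodType).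
Variable act : stalk x -> Q -> Q.
Hypotheses (actDr : forall a q q', act a (q + q') = act a q + act a q')
  (actDl : forall q a b, act (a + b) q = act a q + act b q)
  (actM : forall a b q, act (a * b) q = act a (act b q)) (act1 : forall q, act 1 q = q).

(** A function on proofs of membership: a copy of [Q] when [x] is in [U], and a single element
    otherwise, with no case distinction. *)
Definition sky_sec (U : opens X) : Type := U x -> Q.
HB.instance Definition _ (U : opens X) := GRing.Zmodule.copy (sky_sec U) (U x -> Q).

Definition sky_scale (U : opens X) (a : sec X U) (m : sky_sec U) : sky_sec U :=
  fun Ux => act (germ x Ux a) (m Ux).
Lemma sky_scaleA U (a b : sec X U) (m : sky_sec U) :
  sky_scale a (sky_scale b m) = sky_scale (a * b) m.
Proof. by apply/funext => Ux; rewrite /sky_scale rmorphM actM. Qed.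
Lemma sky_scale1 U : left_id 1 (@sky_scale U).
Proof. by move=> m; apply/funext => Ux; rewrite /sky_scale rmorph1 act1. Qed.
Lemma sky_scaleDr U : right_distributive (@sky_scale U) +%R.
Proof. by move=> a m m'; apply/funext => Ux; exact: actDr. Qed.
Lemma sky_scaleDl U (m : sky_sec U) : {morph (@sky_scale U)^~ m : a b / a + b}.
Proof. by move=> a b; apply/funext => Ux; rewrite /sky_scale rmorphD actDl. Qed.
HB.instance Definition _ (U : opens X) := GRing.Zmodule_isLmodule.Build (sec X U) (sky_sec U)
  (@sky_scaleA U) (@sky_scale1 U) (@sky_scaleDr U) (@sky_scaleDl U).

Definition sky_res (U V : opens X) (VU : V `<=` U) (m : sky_sec U) : sky_sec V :=
  fun Vx => m (VU x Vx).
Lemma sky_res_additive U V VU : zmod_morphism (@sky_res U V VU).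
Proof. by move=> m m'; apply/funext. Qed.
HB.instance Definition _ U V VU :=
  GRing.isZmodMorphism.Build (sky_sec U) (sky_sec V) (@sky_res U V VU) (@sky_res_additive U V VU).

Definition skyscraper : omod X.
Proof.
unshelve refine (@OMod k X (fun U => sky_sec U : lmodType (sec X U))
  (fun U V VU => [the {additive sky_sec U -> sky_sec V} of @sky_res U V VU]) _ _ _ _).
- move=> U V VU a m; apply/funext => Vx; change (act (germ x (VU x Vx) a) (m (VU x Vx)) = act (germ x Vx (res VU a)) (m (VU x Vx))).
  by rewrite (germ_res VU Vx (VU x Vx)).
- by move=> U UU m; apply/funext => Ux; rewrite /= /sky_res (Prop_irrelevance (UU x Ux) Ux).
- move=> U V W VU WV WU m; apply/funext => Wx; rewrite /= /sky_res.
  by congr (m _); exact: Prop_irrelevance.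
- move=> U J V VU cov s comp.
  pose t : sky_sec U := fun Ux => let: exist j Vx := cid (cov x Ux) in s j Vx.
  have tE j (Vx : V j x) Ux : t Ux = s j Vx.
    rewrite /t; case: cid => i Vix /=.
    have := comp i j (ocap (V i) (V j)) (@ocapl _ _ _) (@ocapr _ _ _).
    have Ox : ocap (V i) (V j) x by [].
    move=> /(congr1 (fun m : sky_sec (ocap (V i) (V j)) => m Ox)) /= e.
    rewrite (Prop_irrelevance Vix (ocapl Ox)) (Prop_irrelevance Vx (ocapr Ox)); exact: e.
  exists t; split; first by move=> j; apply/funext => Vx; exact: tE.
  move=> t' et; apply/funext => Ux; have [j Vx] := cov x Ux.
  rewrite (tE j Vx) -et; by rewrite /= /sky_res; congr (t' _); exact: Prop_irrelevance.
Defined.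

Variable D : stalk x -> Q.
Hypotheses (DB : zmod_morphism D) (DM : forall a b, D (a * b) = act a (D b) + act b (D a))
  (Dk : forall c, D (germ x (I : otop X x) (kst X (otop X) c)) = 0).

Definition sky_der (U : opens X) (a : sec X U) : sky_sec U := fun Ux => D (germ x Ux a).
Lemma sky_der_additive U : zmod_morphism (@sky_der U).
Proof. by move=> a b; apply/funext => Ux; rewrite /sky_der rmorphB DB. Qed.
HB.instance Definition _ U :=
  GRing.isZmodMorphism.Build (sec X U) (sky_sec U) (@sky_der U) (@sky_der_additive U).

Definition sky_derivation : derivation skyscraper.
Proof.
unshelve refine (@Derivation k X skyscraper (fun U => [the {additive sec X U -> sky_sec U} of @sky_der U]) _ _ _).
- by move=> U a b; apply/funext => Ux; rewrite /= /sky_der rmorphM DM.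
- move=> U c; apply/funext => Ux; rewrite /= /sky_der -[RHS](Dk c); congr D.
  by apply/germ_eq; exists U, (fun _ h => h), (fun _ _ => I); rewrite !res_kst.
- by move=> U V VU a; apply/funext => Vx; rewrite /= /sky_res /sky_der (germ_res VU Vx (VU x Vx)).
Defined.

(** A derivation of the stalk at [x] becomes a derivation into the skyscraper sheaf; universality
    turns it into a linear map on sections of [Om] near [x], which allows computation without a
    description of the stalk of [Om]. *)
Lemma kahler_at (Om : omod X) (d : derivation Om) : is_kahler d ->
  exists lam : forall U : opens X, U x -> msec Om U -> Q,
  [/\ forall U Ux, zmod_morphism (lam U Ux),
      forall U Ux a m, lam U Ux (a *: m) = act (germ x Ux a) (lam U Ux m),
      forall (U V : opens X) (VU : V `<=` U) Ux Vx m, lam V Vx (mres Om VU m) = lam U Ux m &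
      forall U Ux a, lam U Ux (dapp d U a) = D (germ x Ux a)].
Proof.
move=> kah; have [phi [hphi _]] := kah skyscraper sky_derivation.
pose top (U : opens X) : U `<=` otop X := fun _ _ => I.
exists (fun U Ux m => (happ phi (top U) m : sky_sec U) Ux); split.
- by move=> U Ux m m'; rewrite linearB.
- by move=> U Ux a m; rewrite linearZ.
- move=> U V VU Ux Vx m; rewrite -(happ_res phi (top U) (top V) VU m) /= /sky_res.
  by congr (happ phi (top U) m _); exact: Prop_irrelevance.
- by move=> U Ux a; rewrite hphi.
Qed.

End Skyscraper.

Definition frac_open (k : fieldType) (X : kringed k) (U : opens X) := forall x (Ux : U x) (g : stalk x),
  exists a v, invertible (germ x Ux v) /\ germ x Ux v * g = germ x Ux a.

(** * Sections of the Kähler sheaf are locally generated by differentials *)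

Section LocallyGenerated.
Variables (k : fieldType) (X : kringed k) (Om : omod X) (d : derivation Om).
Hypothesis kah : is_kahler d.

Definition dgen (U : opens X) (s : seq (sec X U * sec X U)) : msec Om U :=
  \sum_(p <- s) p.1 *: dapp d U p.2.

Lemma dgen_cat U (s t : seq (sec X U * sec X U)) : dgen (s ++ t) = dgen s + dgen t.
Proof. exact: big_cat. Qed.

Lemma dgen_scale U c (s : seq (sec X U * sec X U)) :
  dgen [seq (c * p.1, p.2) | p <- s] = c *: dgen s.
Proof. by rewrite /dgen big_map scaler_sumr; apply: eq_bigr => p _; rewrite scalerA. Qed.

(** The condition ranges over every [frac_open] neighbourhood [U], so that numerators, denominators
    and differentials can be taken over whichever chart is in use. *)
Definition locgen (N : opens X) (m : msec Om N) := forall x, N x ->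
  forall U : opens X, frac_open U -> U x ->
  exists (W : opens X) (WN : W `<=` N) (WU : W `<=` U) f s,
  [/\ W x, invertible (res WU f) & res WU f *: mres Om WN m = mres Om WU (dgen s)].

Lemma frac_nbhd x (U N : opens X) (Ux : U x) (Nx : N x) (a : sec X N) : frac_open U ->
  exists (W : opens X) (WN : W `<=` N) (WU : W `<=` U) r v,
    [/\ W x, invertible (res WU v) & res WU v * res WN a = res WU r].
Proof.
move=> fr; have [r [v [u e]]] := fr x Ux (germ x Nx a).
have [W2 [W2U [W2x u2]]] := germ_unit_nbhd u.
have Ox : ocap U N x by [].
have : germ x Ox (res (@ocapl _ U N) v * res (@ocapr _ U N) a) = germ x Ux r.
  by rewrite rmorphM /= (germ_res (@ocapl _ U N) Ox Ux) (germ_res (@ocapr _ U N) Ox Nx).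
move=> /germ_eq[W1 [W1O [W1U [W1x e1]]]].
pose W := ocap W1 W2; have WW1 : W `<=` W1 := @ocapl _ _ _; have WW2 : W `<=` W2 := @ocapr _ _ _.
have WU := subset_trans WW2 W2U.
exists W, (subset_trans WW1 (subset_trans W1O (@ocapr _ _ _))), WU, r, v; split=> //.
  by rewrite -(res_res W2U WW2); exact: (rmorph_invertible (res WW2) u2).
have := congr1 (res WW1) e1; rewrite (res_res W1U WW1 WU) rmorphM rmorphM => <-.
congr (_ * _); rewrite ?(res_res W1O WW1 (subset_trans WW1 W1O)).
  by rewrite (res_res _ _ WU).
by rewrite (res_res _ _ (subset_trans WW1 (subset_trans W1O (@ocapr _ U N)))).
Qed.

Lemma locgen0 N : locgen (0 : msec Om N).
Proof.
move=> x Nx U _ Ux; exists (ocap N U), (@ocapl _ _ _), (@ocapr _ _ _), 1, [::]; split=> //.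
  by rewrite rmorph1; exists 1; rewrite mulr1.
by rewrite /dgen big_nil !raddf0.
Qed.

Lemma locgen_lin N a (m m' : msec Om N) : locgen m -> locgen m' -> locgen (a *: m + m').
Proof.
move=> g g' x Nx U fr Ux.
have [W [WN [WU [f [s [Wx uf e]]]]]] := g x Nx U fr Ux.
have [W' [WN' [WU' [f' [s' [Wx' uf' e']]]]]] := g' x Nx U fr Ux.
have [W1 [W1N [W1U [r [v [W1x uv e1]]]]]] := frac_nbhd Ux Nx a fr.
pose Z := ocap (ocap W W') W1.
have ZW : Z `<=` W by move=> y [[]].
have ZW' : Z `<=` W' by move=> y [[]].
have ZW1 : Z `<=` W1 by move=> y [].
have ZU := subset_trans ZW WU; have ZN := subset_trans ZW WN.
exists Z, ZN, ZU, (v * f * f'), ([seq (f' * r * p.1, p.2) | p <- s] ++ [seq (v * f * p.1, p.2) | p <- s']).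
have uf1 : invertible (res ZU f) by rewrite -(res_res WU ZW); exact: (rmorph_invertible (res ZW) uf).
have uf1' : invertible (res ZU f') by rewrite -(res_res WU' ZW'); exact: (rmorph_invertible (res ZW') uf').
have uv1 : invertible (res ZU v) by rewrite -(res_res W1U ZW1); exact: (rmorph_invertible (res ZW1) uv).
split=> //; first by rewrite !rmorphM; do 2![apply: invertibleM => //].
rewrite dgen_cat !dgen_scale !raddfD /= !mres_scale.
have E : res ZU f *: mres Om ZN m = mres Om ZU (dgen s).
  have := congr1 (mres Om ZW) e; rewrite mres_scale (res_res WU ZW ZU).
  by rewrite (mres_mres WN ZW ZN) (mres_mres WU ZW ZU).
have E' : res ZU f' *: mres Om ZN m' = mres Om ZU (dgen s').
  have := congr1 (mres Om ZW') e'; rewrite mres_scale (res_res WU' ZW' ZU).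
  by rewrite (mres_mres WN' ZW' ZN) (mres_mres WU' ZW' ZU).
have E1 : res ZU v * res ZN a = res ZU r.
  have := congr1 (res ZW1) e1; rewrite rmorphM (res_res W1U ZW1 ZU) (res_res W1U ZW1 ZU).
  by rewrite (res_res W1N ZW1 ZN).
rewrite -E -E' !rmorphM -E1 ?scalerDr !scalerA; congr (_ *: _ + _).
by ring.
Qed.

Lemma locgen_res (N N' : opens X) (N'N : N' `<=` N) (m : msec Om N) :
  locgen m -> locgen (mres Om N'N m).
Proof.
move=> g x Nx U fr Ux; have [W [WN [WU [f [s [Wx uf e]]]]]] := g x (N'N _ Nx) U fr Ux.
pose Z := ocap W N'; have ZW : Z `<=` W := @ocapl _ _ _; have ZN' : Z `<=` N' := @ocapr _ _ _.
have ZU := subset_trans ZW WU.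
exists Z, ZN', ZU, f, s; split=> //; first by rewrite -(res_res WU ZW); exact: (rmorph_invertible (res ZW) uf).
have := congr1 (mres Om ZW) e; rewrite mres_scale (res_res WU ZW ZU) (mres_mres WU ZW ZU).
by rewrite !(mres_mres _ _ (subset_trans ZN' N'N)).
Qed.

Lemma locgen_local (N : opens X) (m : msec Om N) :
  (forall x, N x -> exists (W : opens X) (WN : W `<=` N), W x /\ locgen (mres Om WN m)) -> locgen m.
Proof.
move=> h x Nx U fr Ux; have [W [WN [Wx g]]] := h x Nx.
have [Z [ZW [ZU [f [s [Zx uf e]]]]]] := g x Wx U fr Ux.
exists Z, (subset_trans ZW WN), ZU, f, s; split=> //.
by rewrite -e (mres_mres _ _ (subset_trans ZW WN)).
Qed.

Lemma locgen_d N (a : sec X N) : locgen (dapp d N a).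
Proof.
move=> x Nx U fr Ux; have [W [WN [WU [r [v [Wx uv e]]]]]] := frac_nbhd Ux Nx a fr.
exists W, WN, WU, (v * v), [:: (v, r); (- r, v)]; split=> //.
  by rewrite rmorphM; exact: invertibleM.
rewrite /dgen big_cons big_seq1 /= raddfD /= !mres_scale !dapp_res -e dapp_leibniz !rmorphM rmorphN -e.
rewrite ?scalerDr !scalerA scaleNr.
by rewrite addrK.
Qed.

Definition locgen_pred (N : opens X) : {pred msec Om N} := fun m => `[< locgen m >].
Arguments locgen_pred : clear implicits.

Lemma locgen_predP (N : opens X) m : reflect (locgen m) (m \in locgen_pred N).
Proof. exact: asboolP. Qed.

Lemma locgen_submod (N : opens X) : submod_closed (locgen_pred N).
Proof.
split; first by apply/locgen_predP; exact: locgen0.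
by move=> a m m' /locgen_predP g /locgen_predP g'; apply/locgen_predP; exact: locgen_lin.
Qed.
HB.instance Definition _ (N : opens X) :=
  GRing.isSubmodClosed.Build _ _ (locgen_pred N) (locgen_submod N).

Record lgsec (N : opens X) := LgSec { lgval : msec Om N; _ : lgval \in locgen_pred N }.
HB.instance Definition _ (N : opens X) := [isSub for (@lgval N)].
HB.instance Definition _ (N : opens X) := [Choice of lgsec N by <:].
HB.instance Definition _ (N : opens X) :=
  GRing.SubChoice_isSubLmodule.Build _ _ _ (lgsec N) (submodClosedP _).

Lemma lgsecP N (m : lgsec N) : locgen (val m).
Proof. by apply/locgen_predP; exact: valP. Qed.

Lemma lgres_subproof (U V : opens X) (VU : V `<=` U) (m : lgsec U) :
  mres Om VU (val m) \in locgen_pred V.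
Proof. by apply/locgen_predP/locgen_res/lgsecP. Qed.
Definition lgres (U V : opens X) (VU : V `<=` U) (m : lgsec U) : lgsec V :=
  LgSec (lgres_subproof VU m).
Lemma lgres_additive U V VU : zmod_morphism (@lgres U V VU).
Proof. by move=> m m'; apply/val_inj; rewrite /= raddfB. Qed.
HB.instance Definition _ U V VU :=
  GRing.isZmodMorphism.Build (lgsec U) (lgsec V) (@lgres U V VU) (@lgres_additive U V VU).

Definition lg_omod : omod X.
Proof.
unshelve refine (@OMod k X (fun U => lgsec U : lmodType (sec X U))
  (fun U V VU => [the {additive lgsec U -> lgsec V} of @lgres U V VU]) _ _ _ _).
- by move=> U V VU a m; apply/val_inj; rewrite /= mres_scale.
- by move=> U UU m; apply/val_inj; rewrite /= mres_id.
- by move=> U V W VU WV WU m; apply/val_inj; rewrite /= (mres_mres VU WV WU).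
- move=> U J V VU cov s comp.
  have [|t [ht ut]] := @msec_sheaf _ _ Om U J V VU cov (fun j => val (s j)).
    by move=> i j W Wi Wj; exact: (congr1 val (comp i j W Wi Wj)).
  have lt : t \in locgen_pred U.
    apply/locgen_predP/locgen_local => x Ux; have [j Vx] := cov x Ux.
    by exists (V j), (VU j); split=> //; rewrite ht; exact: lgsecP.
  exists (LgSec lt); split; first by move=> j; apply/val_inj; exact: ht.
  by move=> t' et; apply/val_inj; apply: ut => j; rewrite -et.
Defined.

Definition lgd (U : opens X) (a : sec X U) : lgsec U := LgSec (introT (locgen_predP _) (@locgen_d U a)).
Lemma lgd_additive U : zmod_morphism (@lgd U).
Proof. by move=> m m'; apply/val_inj; rewrite /= raddfB. Qed.
HB.instance Definition _ U :=
  GRing.isZmodMorphism.Build (sec X U) (lgsec U) (@lgd U) (@lgd_additive U).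

Definition lg_derivation : derivation lg_omod.
Proof.
unshelve refine (@Derivation k X lg_omod (fun U => [the {additive sec X U -> lgsec U} of @lgd U]) _ _ _).
- by move=> U a b; apply/val_inj; rewrite /= dapp_leibniz.
- by move=> U c; apply/val_inj; rewrite /= dapp_kst.
- by move=> U V VU a; apply/val_inj; rewrite /= dapp_res.
Defined.

(** Locally generated sections form a subsheaf through which [d] factors. Universality maps [Om] to
    this subsheaf, and the composite with the inclusion fixes all differentials, so it is the
    identity. *)
Lemma kahler_locgen (N : opens X) (m : msec Om N) : locgen m.
Proof.
have [phi [hphi _]] := kah lg_derivation.
have [u [_ uu]] := kah d.
pose idh : omod_hom Om Om (otop X) := @OModHom k X Om Om (otop X)
  (fun W _ => [the {linear msec Om W -> msec Om W} of idfun]) (fun W W' WU WU' W'W m => erefl).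
have cr (W W' : opens X) (WU : W `<=` otop X) (WU' : W' `<=` otop X) (W'W : W' `<=` W) n :
   mres Om W'W (val (happ phi WU n)) = val (happ phi WU' (mres Om W'W n)).
  exact: (congr1 val (happ_res phi WU WU' W'W n)).
pose comph : omod_hom Om Om (otop X) := @OModHom k X Om Om (otop X)
  (fun W WU => [the {linear msec Om W -> msec Om W} of (fun m : lgsec W => val m) \o happ phi WU]) cr.
have e : idh = comph.
  transitivity u; [symmetry|]; apply: uu => U UX a //=.
  by rewrite hphi.
pose NX : N `<=` otop X := fun _ _ => I.
have := congr1 (fun h : omod_hom Om Om (otop X) => happ h NX m) e => /= ->.
exact: lgsecP.
Qed.

End LocallyGenerated.

(** * Torsion differentials and the square of the diagonal ideal *)

Lemma zmod_quotient (B : zmodType) (J : set B) : J 0 -> (forall a b, J a -> J b -> J (a - b)) ->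
  exists (Q : zmodType) (pi : B -> Q), [/\ zmod_morphism pi, forall q, exists b, pi b = q &
    forall b, pi b = 0 <-> J b].
Proof.
move=> J0 JB; pose P : {pred B} := fun b => `[< J b >].
have hP : zmod_closed P.
  by split=> [|a b /asboolP Ja /asboolP Jb]; apply/asboolP => //; exact: JB.
pose I : zmodClosed B := HB.pack P (GRing.isZmodClosed.Build B P hP).
exists (Quotient.quot I), (\pi_(Quotient.quot I))%qT; split.
- exact: raddfB.
- by move=> q; exists (repr q); exact: reprK.
- move=> b; have E : (b \in I) = ((\pi_(Quotient.quot I) b)%qT == 0).
    by rewrite -[in LHS](subr0 b) Quotient.idealrBE raddf0.
  split; first by move=> e; apply/asboolP; change (b \in I); rewrite E e.
  by move=> Jb; apply/eqP; rewrite -E; exact/asboolP.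
Qed.

Lemma msec_eq (k : fieldType) (X : kringed k) (F : omod X) (N : opens X) (m m' : msec F N) :
  (forall x, N x -> exists (W : opens X) (WN : W `<=` N), W x /\ mres F WN m = mres F WN m') ->
  m = m'.
Proof.
move=> h; pose J := {x | N x}.
have h' (j : J) : {W : opens X | exists WN : W `<=` N, W (sval j) /\ mres F WN m = mres F WN m'}.
  by apply: cid; case: j => x Nx; exact: h.
pose W j := sval (h' j).
have WN j : W j `<=` N by have [WN _] := svalP (h' j).
have We j : mres F (WN j) m = mres F (WN j) m'.
  by have [WN' [_ e]] := svalP (h' j); rewrite (Prop_irrelevance (WN j) WN').
have cov x : N x -> exists j, W j x.
  by move=> Nx; exists (exist _ x Nx); have [? []] := svalP (h' (exist _ x Nx)).
have [|t [_ ut]] := @msec_sheaf _ _ F N J W WN cov (fun j => mres F (WN j) m).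
  by move=> i j V Vi Vj; rewrite !(mres_mres _ _ (subset_trans Vi (WN i))).
by rewrite -(ut m)// -(ut m').
Qed.

Section GoodOpens.
Variables (k : closedFieldType) (X : scheme k).
Hypothesis intX : integral_scheme X.

Definition good_open (U : opens X) := [/\ affine_open U, finitely_generated_algebra (kst X U) & U !=set0].

Lemma good_open_exists x : finite_type X -> exists U : opens X, U x /\ good_open U.
Proof.
move=> [n [U [cov h]]]; have [i Ux] := cov x; have [a f] := h i.
by exists (U i); split=> //; split=> //; exists x.
Qed.

Variable U : opens X.
Hypothesis gU : good_open U.
Local Notation A := (sec X U).
Local Notation psiU := [the {rmorphism A -> A} of idfun].

Lemma good_open_domain : is_domain A.
Proof. by case: gU => _ _; case: intX => _; exact. Qed.

Lemma good_open_chart : chart (R := A) psiU.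
Proof. by case: gU => a _ _; apply: affine_chart => //; exact: good_open_domain. Qed.

Lemma good_open_fg : finitely_generated_algebra (kst X U). Proof. by case: gU. Qed.

Lemma good_open_noetherian : noetherian A.
Proof. exact: fin_gen_alg_noetherian good_open_fg. Qed.

Lemma good_open_frac : frac_open U.
Proof.
move=> x Ux g; have [a [v [nv e]]] := la_frac (ch_loc good_open_chart Ux) g.
by exists a, v; split=> //; exact/(pt_unit psiU Ux).
Qed.

Lemma good_germ_inj x (Ux : U x) : injective (germ x Ux).
Proof. by move=> a b e; apply: (la_inj (ch_loc good_open_chart Ux)). Qed.

(** The stalks being integrally closed, at every prime the fraction has a denominator outside that
    prime; so the ideal of denominators is the whole ring. *)
Lemma good_open_normal : normal_scheme X -> integrally_closed_domain A.
Proof.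
move=> nX; split; first exact: good_open_domain.
move=> a b b0 [n [c e]]; pose J := [set v | exists q, v * a = q * b].
have hJ : is_ideal J.
  split; first by exists 0; rewrite !mul0r.
    by move=> u v [q h] [q' h']; exists (q + q'); rewrite !mulrDl h h'.
  by move=> u v [q h]; exists (u * q); rewrite -!mulrA h.
suff [q h] : J 1 by exists q; rewrite -h mul1r.
apply: contrapT => nJ; have [|P [pP JP _]] := @radical_avoiding A J 1 good_open_noetherian hJ.
  by move=> m; rewrite expr1n.
have ch := good_open_chart; have [x [Ux eP]] := ch_surj ch pP.
have [||q hq] := proj2 (nX x) (germ x Ux a) (germ x Ux b).
- by rewrite -(rmorph0 (germ x Ux)) => /good_germ_inj.
- exists n, (fun i => germ x Ux (c i)); rewrite -[RHS](rmorph0 (germ x Ux)) -e rmorphD rmorphXn rmorph_sum.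
  by congr (_ + _); apply: eq_bigr => i _; rewrite !rmorphM !rmorphXn.
have [r [v [nv /= er]]] := la_frac (ch_loc ch Ux) q.
apply: nv; rewrite eP; apply: JP; exists r; apply: (@good_germ_inj x Ux).
by rewrite !rmorphM /= hq mulrA er.
Qed.

End GoodOpens.

(** * Extension from the non-singular locus and passage to the diagonal *)

Section Extend.
Variables (k : fieldType) (Y : kringed k) (W : opens Y) (R : comPzRingType)
  (psi : {rmorphism R -> sec Y W}).
Hypotheses (ch : chart psi) (dR : is_domain R) (noe : noetherian R).

Lemma chart_generic_regular y : W y -> pt psi y = [set 0] -> regular_local (stalk y).
Proof.
move=> Wy e; have L := ch_loc ch Wy; have pz := ch_prime ch Wy.
apply: (regular_field (la_noetherian L noe) (la_local pz L)) => b.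
rewrite (la_nonunits L) e => -[a [v [-> nv]]]; rewrite rmorph0 => eb.
have u : invertible (germ y Wy (psi v)) by apply/(pt_unit psi Wy); rewrite e.
by apply: (invertible_cancel u); rewrite mulr0.
Qed.

(** The section is an element [c] of the fraction field. Were it missing from the local ring at a
    point of [N], [hartogs] would give a prime below with a principal maximal ideal and still not
    containing [c] in its local ring; but that point is non-singular, hence in [V]. *)
Lemma chart_extend (V N : opens Y) (NW : N `<=` W) (s : sec Y (ocap N V)) :
  integrally_closed_domain R -> (forall y, regular_local (stalk y) -> V y) ->
  exists t : sec Y N, res (@ocapl _ N V) t = s.
Proof.
move=> nR hV; have [K [io [io_inj fr]]] := frac_exists dR.
have [[z Nz]|no] := pselect (exists z, N z); last first.
  exists 0; apply: sec_eq_germs => x Nx; case: no; exists x; exact: (ocapl Nx).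
have [e [We ee]] := generic_point ch dR.
have Ne : N e by exact: (generic_mem ch We ee (NW _ Nz) Nz).
have MW : ocap N V `<=` W := subset_trans (@ocapl _ N V) NW.
have Me : ocap N V e by split=> //; apply: hV; exact: chart_generic_regular.
pose c := stK ch io_inj (MW e Me) (germ e Me s).
have cE y (My : ocap N V y) : stK ch io_inj (MW y My) (germ y My s) = c.
  exact: (stK_const ch dR io_inj MW).
have [y Ny|t tE] := @stK_glue _ _ _ _ _ ch dR _ _ io_inj N NW c; last first.
  exists t; apply: (stK_eq (ch := ch) dR (io_inj := io_inj) (NW := MW) (y := e) (Ny := Me)).
  rewrite cE -(tE e Ne) (germ_res (@ocapl _ N V) Me Ne).
  by rewrite (Prop_irrelevance (MW e Me) (NW e Ne)).
apply: contrapT => nl.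
have [P [pP Py nP [p [Pp p0 hp]]]] := hartogs noe nR io_inj fr (ch_prime ch (NW _ Ny)) nl.
have [x [Wx ex]] := ch_surj ch pP; have L := ch_loc ch Wx; have pz := ch_prime ch Wx.
have Nx : N x.
  have [f [nf h]] := ch_basis ch (NW _ Ny) Ny; apply: h => //; rewrite ex => Pf.
  by apply: nf; exact: Py.
have Mx : ocap N V x.
  split=> //; apply: hV.
  apply: (regular_dvr (la_noetherian L noe) (la_local pz L) (la_domain L dR) (p := germ x Wx (psi p))).
    by rewrite -(rmorph0 (germ x Wx)) -(rmorph0 psi) => /(la_inj L).
  rewrite (la_nonunits L); apply/seteqP; split; last first.
    apply: pgen_sub; first exact: ext_ideal (prime_ideal_ideal pz).
    by apply: (ext_loc _ pz (I := pt psi x)); rewrite ex.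
  move=> b [q [v [Pq nv eb]]]; rewrite ex in Pq; have [c' [w [nw ew]]] := hp q Pq.
  have nvw : ~ pt psi x (w * v).
    by case: pz => _ _ pr /pr[]//; rewrite ex.
  have [u hu] := la_unit L nvw.
  exists (u * germ x Wx (psi c')); apply: (invertible_cancel (la_unit L nvw)).
  by rewrite !mulrA hu mul1r rmorphM -mulrA eb -rmorphM ew rmorphM.
apply: nP; rewrite -ex -(cE x Mx) (Prop_irrelevance (MW x Mx) Wx); exact: stK_loc_in.
Qed.

End Extend.

Section ProductPsi.
Variables (k : closedFieldType) (char0 : [pchar k]%R =i pred0) (X XX : scheme k) (p1 p2 : mor XX X).
Hypotheses (prodXX : is_fibre_product p1 p2) (intX : integral_scheme X) (nX : normal_scheme X).
Variables (U1 U2 : opens X) (g1 : good_open U1) (g2 : good_open U2).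
Local Notation R := (tensor (kst X U1) (kst X U2)).
Let d1 := good_open_domain intX g1.
Let d2 := good_open_domain intX g2.
Let f1 := good_open_fg g1.
Let f2 := good_open_fg g2.

Lemma product_psi : exists psi : {rmorphism R -> sec XX (prod_opens p1 p2 U1 U2)},
  [/\ forall a, psi (tinl _ _ a) = res (@ocapl _ _ _) (comor p1 U1 a),
      forall b, psi (tinr _ _ b) = res (@ocapr _ _ _) (comor p2 U2 b) & chart psi].
Proof.
have T := good_tensor f1 f2 d1 d2.
have [|psi [psi1 psi2]] := tp_ring_lift T
  (f := [the {rmorphism sec X U1 -> sec XX (prod_opens p1 p2 U1 U2)} of res (@ocapl _ _ _) \o comor p1 U1])
  (g := [the {rmorphism sec X U2 -> sec XX (prod_opens p1 p2 U1 U2)} of res (@ocapr _ _ _) \o comor p2 U2]).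
  by move=> c; rewrite /= !comor_kst !res_kst.
exists psi; split=> //.
apply: (product_chart prodXX (good_open_chart intX g1) (good_open_chart intX g2) T) => //.
- exact: good_domain.
- exact: good_noetherian.
Qed.

Lemma product_noetherian : noetherian R. Proof. exact: good_noetherian. Qed.
Lemma product_domain : is_domain R. Proof. exact: good_domain. Qed.
Lemma product_normal : integrally_closed_domain R.
Proof. by apply: good_normal => //; apply: good_open_normal. Qed.

End ProductPsi.

Section Diagonal.
Variables (k : closedFieldType) (X XX : scheme k) (p1 p2 : mor XX X).
Variables (Delta : mor X XX).
Hypotheses (diagD : is_diagonal p1 p2 Delta) (intX : integral_scheme X).
Variables (U : opens X) (gU : good_open U).
Local Notation A := (sec X U).
Local Notation R := (tensor (kst X U) (kst X U)).
Local Notation W := (prod_opens p1 p2 U U).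
Local Notation i1 := (tinl (kst X U) (kst X U)).
Local Notation i2 := (tinr (kst X U) (kst X U)).
Variable psi : {rmorphism R -> sec XX W}.
Hypotheses (psi1 : forall a, psi (i1 a) = res (@ocapl _ _ _) (comor p1 U a))
  (psi2 : forall b, psi (i2 b) = res (@ocapr _ _ _) (comor p2 U b)) (ch : chart psi).
Variable eps : {rmorphism R -> A}.
Hypotheses (eps1 : forall a, eps (i1 a) = a) (eps2 : forall a, eps (i2 a) = a).
Local Notation I := (diag_ideal eps).
Let dA := good_open_domain intX gU.
Let T := good_tensor (good_open_fg gU) (good_open_fg gU) dA dA.
Let hI := diag_ideal_ideal eps.

Lemma diag_fst x : p1 (Delta x) = x.
Proof. by have [h _] := diagD; exact: (congr1 (fun f : mor X X => f x) h). Qed.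
Lemma diag_snd x : p2 (Delta x) = x.
Proof. by have [_ h] := diagD; exact: (congr1 (fun f : mor X X => f x) h). Qed.

Lemma diag_mem x : U x -> W (Delta x).
Proof. by move=> Ux; split; rewrite /omem /= /preimage /= ?diag_fst ?diag_snd. Qed.
Lemma diag_mem_inv x : W (Delta x) -> U x.
Proof. by case; rewrite /omem /= /preimage /= diag_fst. Qed.

Lemma diag_psi x (Ux : U x) (Wx : W (Delta x)) r :
  germ x (Wx : pull Delta W x) (comor Delta W (psi r)) = germ x Ux (eps r).
Proof.
have [h1 h2] := diagD.
have [Wx1 Wx2] := Wx.
elim/(tp_ind T): r => [a b||r r' e e']; last 2 first.
- by rewrite !rmorph0.
- by rewrite !rmorphD /= e e'.
rewrite !rmorphM eps1 eps2 psi1 psi2; congr (_ * _).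
  apply: etrans (comor_germ (germ_res (@ocapl _ _ _) Wx Wx1 (comor p1 U a))) _.
  rewrite -(@mor_comp_germ _ _ _ _ p1 Delta x U Wx1 a) (mor_eq_germ h1 Wx1 Ux).
  exact: germ_res.
apply: etrans (comor_germ (germ_res (@ocapr _ _ _) Wx Wx2 (comor p2 U b))) _.
rewrite -(@mor_comp_germ _ _ _ _ p2 Delta x U Wx2 b) (mor_eq_germ h2 Wx2 Ux).
exact: germ_res.
Qed.

Lemma diag_pt x (Ux : U x) r : ~ pt psi (Delta x) r <-> invertible (germ x Ux (eps r)).
Proof.
have Wx := diag_mem Ux; rewrite (pt_unit psi Wx) -(diag_psi Ux Wx).
exact: iff_sym (comor_unit _ _).
Qed.

Lemma diag_sub_pt x : U x -> I `<=` pt psi (Delta x).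
Proof.
move=> Ux r Ir; apply: contrapT => /(diag_pt Ux); rewrite Ir rmorph0.
by have [h0 _ _] := scheme_local x.
Qed.

Lemma diag_kernel r : I r -> kernel_ideal Delta (psi r).
Proof.
move=> Ir; apply: sec_eq_germs => x Wx; rewrite (diag_psi (diag_mem_inv Wx)) Ir.
by rewrite !rmorph0.
Qed.

Local Notation loc Wy := [the {rmorphism R -> stalk _} of germ _ Wy \o psi].

(** With [ext_of_square], the dictionary between the sheaf [ideal_square] and the localized square
    of the ideal of [R]: a fraction at a point is spread out to a neighbourhood. *)
Lemma square_of_ext (N : opens XX) (NW : N `<=` W) (t : sec XX N) y (Ny : N y) (Wy : W y) :
  ext (loc Wy) (pt psi y) (iprod I I) (germ y Ny t) ->
  exists (W' : opens XX) (WN : W' `<=` N) n (a b : 'I_n -> sec XX W'),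
    [/\ W' y, forall i, kernel_ideal Delta (a i), forall i, kernel_ideal Delta (b i) &
       res WN t = \sum_i a i * b i].
Proof.
move=> [r [v [Ir nv /= e]]].
have [W2 [W2W [W2y [w vw]]]] := germ_unit_nbhd (proj1 (pt_unit psi Wy v) nv).
have : germ y Ny (res NW (psi v) * t) = germ y Wy (psi r).
  by rewrite rmorphM /= (germ_res NW Ny Wy).
move=> /germ_eq[W1 [W1N [W1W [W1y e1]]]].
pose W' := ocap W1 W2; have W'1 : W' `<=` W1 := @ocapl _ _ _; have W'2 : W' `<=` W2 := @ocapr _ _ _.
have W'N := subset_trans W'1 W1N; have W'W := subset_trans W'2 W2W.
have kp q : I q -> kernel_ideal Delta (res W'W (psi q)).
  move=> /diag_kernel h; rewrite /kernel_ideal /mkset.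
  have s : pull Delta W' `<=` pull Delta W by move=> x h'; apply: W'W.
  by rewrite -(comor_res W'W s) h rmorph0.
have et : res W'N t = res W'2 w * res W'W (psi r).
  have := congr1 (res W'1) e1; rewrite (res_res W1W W'1 W'W) => <-.
  rewrite rmorphM rmorphM (res_res W1N W'1 W'N) (res_res W1N W'1 W'N) (res_res NW W'N W'W).
  have := congr1 (res W'2) vw; rewrite rmorphM (res_res W2W W'2 W'W) rmorph1 => e2.
  by rewrite mulrA (mulrC (res W'2 w)) e2 mul1r.
have [n [b [c [hb hc er]]]] := proj1 (iprodE r hI hI) Ir.
exists W', W'N, n, (fun i => res W'2 w * res W'W (psi (b i))), (fun i => res W'W (psi (c i))).
split=> // [i|i|]; [|exact: kp|].
  by rewrite /kernel_ideal /mkset rmorphM (kp _ (hb i)) mulr0.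
rewrite et er !rmorph_sum mulr_sumr; apply: eq_bigr => i _.
by rewrite !rmorphM mulrA.
Qed.

(** Near [Delta x] a section of the kernel is a fraction whose numerator pulls back to zero in the
    stalk at [x]; as [A] embeds in that stalk, the numerator lies in the diagonal ideal. *)
Lemma ext_of_square (N : opens XX) (t : sec XX N) x (Nx : N (Delta x)) (Ux : U x) (Wx : W (Delta x)) :
  ideal_square (kernel_ideal Delta) t ->
  ext (loc Wx) (pt psi (Delta x)) (iprod I I) (germ (Delta x) Nx t).
Proof.
move=> sq; have [W' [WN [n [a [b [W'x ka kb e]]]]]] := sq (Delta x) Nx.
have L := ch_loc ch Wx; have pz := ch_prime ch Wx.
have hE := ext_ideal pz L (iprod_ideal I I).
rewrite -(germ_res WN W'x Nx) e rmorph_sum; apply: ideal_sum => // i _.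
have key c : kernel_ideal Delta c -> ext (loc Wx) (pt psi (Delta x)) I (germ (Delta x) W'x c).
  move=> kc; have [r [v [nv /= ev]]] := la_frac L (germ (Delta x) W'x c).
  exists r, v; split=> //.
  have Ox : ocap W W' (Delta x) by [].
  have : germ (Delta x) Ox (res (@ocapl _ W W') (psi v) * res (@ocapr _ W W') c) =
      germ (Delta x) Wx (psi r).
    by rewrite rmorphM /= (germ_res (@ocapl _ W W') Ox Wx) (germ_res (@ocapr _ W W') Ox W'x).
  move=> /comor_germ; rewrite (diag_psi Ux Wx) !rmorphM /=.
  have -> : germ x (Ox : pull Delta (ocap W W') x) (comor Delta (ocap W W') (res (@ocapr _ W W') c)) = 0.
    rewrite (comor_germ (germ_res (@ocapr _ W W') Ox W'x c)) kc; exact: rmorph0.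
  by rewrite mulr0 -(rmorph0 (germ x Ux)) => /(good_germ_inj intX gU)/esym.
by rewrite rmorphM; apply: (ext_prod pz L hI hI); apply: iprodM; exact: key.
Qed.

End Diagonal.

Lemma kernel_ideal_res (k : fieldType) (X Y : kringed k) (f : mor X Y) (U V : opens Y)
    (VU : V `<=` U) (s : sec Y U) : kernel_ideal f s -> kernel_ideal f (res VU s).
Proof.
rewrite /kernel_ideal /mkset => h.
have VU' : pull f V `<=` pull f U by move=> x; exact: VU.
by rewrite -(comor_res VU VU') h rmorph0.
Qed.

Lemma ideal_square_res (k : fieldType) (X Y : kringed k) (f : mor X Y) (U V : opens Y)
    (VU : V `<=` U) (s : sec Y U) :
  ideal_square (kernel_ideal f) s -> ideal_square (kernel_ideal f) (res VU s).
Proof.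
move=> h x Vx; have [W [WU [n [a [b [Wx ka kb e]]]]]] := h x (VU x Vx).
have OW := @ocapl _ W V; exists (ocap W V), (@ocapr _ W V), n, (fun i => res OW (a i)), (fun i => res OW (b i)).
split=> // [i|i|]; try exact: kernel_ideal_res.
rewrite (res_res _ _ (subset_trans OW WU)) -(res_res WU OW) e rmorph_sum.
by apply: eq_bigr => i _; rewrite rmorphM.
Qed.

(** * From torsion-freeness to surjectivity *)

Section Forward.
Variables (k : closedFieldType) (X XX : scheme k) (p1 p2 : mor XX X).
Variables (Delta : mor X XX).
Hypotheses (diagD : is_diagonal p1 p2 Delta) (intX : integral_scheme X).
Variables (U : opens X) (gU : good_open U).
Local Notation A := (sec X U).
Local Notation R := (tensor (kst X U) (kst X U)).
Local Notation W := (prod_opens p1 p2 U U).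
Local Notation i1 := (tinl (kst X U) (kst X U)).
Local Notation i2 := (tinr (kst X U) (kst X U)).
Variable psi : {rmorphism R -> sec XX W}.
Hypotheses (psi1 : forall a, psi (i1 a) = res (@ocapl _ _ _) (comor p1 U a))
  (psi2 : forall b, psi (i2 b) = res (@ocapr _ _ _) (comor p2 U b)) (ch : chart psi).
Variable eps : {rmorphism R -> A}.
Hypotheses (eps1 : forall a, eps (i1 a) = a) (eps2 : forall a, eps (i2 a) = a).
Local Notation I := (diag_ideal eps).
Let dA := good_open_domain intX gU.
Let T := good_tensor (good_open_fg gU) (good_open_fg gU) dA dA.
Let hI := diag_ideal_ideal eps.

Local Notation loc Wy := [the {rmorphism R -> stalk _} of germ _ Wy \o psi].
Local Notation idA := [the {rmorphism A -> A} of idfun].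
Variables (Omega : omod X) (der : derivation Omega).
Hypothesis kah : is_kahler der.

(** The difference of the two pullbacks of a function is a derivation into the stalk of [XX] modulo
    the square. The functional it induces sends the differential of [s] to the class of minus the
    sum, so a vanishing differential puts the sum in the square. *)
Lemma kahler_detects x (Ux : U x) (Wx : W (Delta x)) (s : seq (A * A)) :
  I (\sum_(p <- s) i1 p.1 * i2 p.2) -> dgen der s = 0 ->
  ext (loc Wx) (pt psi (Delta x)) (iprod I I) (germ (Delta x) Wx (psi (\sum_(p <- s) i1 p.1 * i2 p.2))).
Proof.
move=> Iu s0; set u := \sum_(p <- s) _ in Iu *.
have L := ch_loc ch Wx; have pz := ch_prime ch Wx.
set J := ext _ _ _; have hJ : is_ideal J := ext_ideal pz L (iprod_ideal I I).
have hIB : is_ideal (ext (loc Wx) (pt psi (Delta x)) I) := ext_ideal pz L hI.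
have [Q [pi [piB sur ker]]] := zmod_quotient (ideal0 hJ) (fun a b => @idealB _ J a b hJ).
have piD := zmod_morphD _ _ piB.
pose rep q := projT1 (cid (sur q)); have repK q : pi (rep q) = q by rewrite /rep; case: cid.
clearbody rep.
have pi_eq b b' : J (b - b') -> pi b = pi b'.
  by move=> /ker; rewrite piB => /eqP; rewrite subr_eq0 => /eqP.
have pi_eqP b b' : pi b = pi b' -> J (b - b').
  by move=> e; apply/ker; rewrite piB e subrr.
have LA := ch_loc (good_open_chart intX gU) Ux; have pA := ch_prime (good_open_chart intX gU) Ux.
(* A function that is a unit at [x] stays a unit at [Delta x] under either embedding, so the
   embeddings extend to stalks. *)
have lift (i : {rmorphism A -> R}) : (forall a, eps (i a) = a) ->
    exists j : {rmorphism stalk x -> stalk (Delta x)}, forall a, j (germ x Ux a) = germ (Delta x) Wx (psi (i a)).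
  move=> epsi.
  have [v /(pt_unit idA Ux) nv|j jE] := @loc_lift _ _ (stalk (Delta x)) _ _ [the {rmorphism A -> stalk (Delta x)} of loc Wx \o i] pA LA.
    by apply/(pt_unit psi Wx)/(diag_pt diagD intX gU psi1 psi2 eps1 eps2 Ux); rewrite epsi.
  by exists j => a; rewrite (jE a).
have [j1 j1E] := lift i1 eps1; have [j2 j2E] := lift i2 eps2.
have jI g : ext (loc Wx) (pt psi (Delta x)) I (j1 g - j2 g).
  have [a [v [nv /= e]]] := la_frac LA g.
  have u1 : invertible (germ (Delta x) Wx (psi (i1 v))).
    rewrite -j1E; apply: rmorph_invertible; exact/(pt_unit idA Ux).
  have Id b : ext (loc Wx) (pt psi (Delta x)) I (germ (Delta x) Wx (psi (i1 b)) - germ (Delta x) Wx (psi (i2 b))).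
    rewrite -rmorphB -rmorphB; apply: (ext_loc (loc Wx) pz (I := I)); exact: diag_diff.
  have [w hw] := u1.
  have e1 := congr1 j1 e; have e2 := congr1 j2 e; rewrite !rmorphM !j1E in e1; rewrite !rmorphM !j2E in e2.
  rewrite (_ : j1 g - j2 g = w * ((germ (Delta x) Wx (psi (i1 a)) - germ (Delta x) Wx (psi (i2 a))) -
     j2 g * (germ (Delta x) Wx (psi (i1 v)) - germ (Delta x) Wx (psi (i2 v))))).
    by apply: (idealMl _ hIB); apply: (idealB hIB) => //; apply: (idealMl _ hIB).
  rewrite -e1 -e2; set V1 := germ _ _ _ in hw *; set V2 := germ _ _ _.
  transitivity ((V1 * w) * (j1 g - j2 g)); first by rewrite hw mul1r.
  by ring.
pose act g q := pi (j1 g * rep q).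
have actE g b : act g (pi b) = pi (j1 g * b).
  by apply: pi_eq; rewrite -mulrBr; apply: (idealMl _ hJ); apply: pi_eqP; rewrite repK.
have actDr a q q' : act a (q + q') = act a q + act a q'.
  by rewrite -(repK q) -(repK q') -piD !actE mulrDr piD.
have actDl q a b : act (a + b) q = act a q + act b q.
  by rewrite -(repK q) !actE rmorphD mulrDl piD.
have actM a b q : act (a * b) q = act a (act b q).
  by rewrite -(repK q) !actE rmorphM mulrA.
have act1 q : act 1 q = q by rewrite -(repK q) actE rmorph1 mul1r.
pose D g := pi (j1 g - j2 g).
have DB : zmod_morphism D.
  by move=> g g'; rewrite /D -piB !rmorphB; congr pi; ring.
have DM g g' : D (g * g') = act g (D g') + act g' (D g).
  rewrite /D !actE -piD; apply: pi_eq; rewrite !rmorphM.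
  (* The Leibniz rule fails only by a product of two differences, which is zero modulo the
     square. *)
  rewrite (_ : _ - _ = - ((j1 g - j2 g) * (j1 g' - j2 g'))); last by ring.
  by apply: (idealN hJ); apply: (ext_prod pz L hI hI); apply: iprodM.
have Dk c : D (germ x (Logic.I : otop X x) (kst X (otop X) c)) = 0.
  have -> : germ x (Logic.I : otop X x) (kst X (otop X) c) = germ x Ux (kst X U c).
    by apply/germ_eq; exists U, (fun _ _ => Logic.I), (fun _ h => h); rewrite !res_kst.
  by rewrite /D j1E j2E (tp_k T) subrr (zmod_morph0 piB).
have [lam [lamB lamZ lamR lamd]] := kahler_at actDr actDl actM act1 DB DM Dk kah.
have := congr1 (lam U Ux) s0; rewrite (zmod_morph0 (lamB U Ux)) /dgen (zmod_morph_sum _ _ (lamB U Ux)).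
rewrite (eq_bigr (fun p => pi (loc Wx (i1 p.1 * (i1 p.2 - i2 p.2))))); last first.
  move=> p _; rewrite lamZ lamd /D actE j1E; congr pi.
  by rewrite !j1E !j2E !(rmorphM, rmorphB).
rewrite -(zmod_morph_sum _ _ piB) -rmorph_sum => /ker h.
have := idealN hJ h; rewrite -rmorphN -(diag_span eps1 eps2 Iu). exact.
Qed.

Hypotheses (nX : normal_scheme X) (char0 : [pchar k]%R =i pred0).
Variables (V : opens XX).
Hypothesis V_nonsing : V = nonsingular_locus XX :> set XX.
Let noeR := product_noetherian intX gU gU.

Lemma diag_generic : exists e, [/\ U e, pt idA e = [set 0] & pt psi (Delta e) = I].
Proof.
have [e [Ue ee]] := generic_point (good_open_chart intX gU) dA; exists e; split=> //.
have E r : pt psi (Delta e) r <-> pt idA e (eps r).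
  split=> h; apply: contrapT.
    by move=> /(pt_unit idA Ue)/(diag_pt diagD intX gU psi1 psi2 eps1 eps2 Ue).
  by move=> /(diag_pt diagD intX gU psi1 psi2 eps1 eps2 Ue)/(pt_unit idA Ue).
by apply/seteqP; split=> r; rewrite E ee.
Qed.

Lemma regular_V y : regular_local (stalk y) -> V y.
Proof. by move=> h; rewrite /omem V_nonsing. Qed.

Lemma diag_generic_V e : U e -> pt psi (Delta e) = I -> V (Delta e).
Proof.
move=> Ue ee; apply: regular_V; have L := ch_loc ch (diag_mem diagD Ue); rewrite ee in L.
exact: (generic_regular T eps1 eps2 (good_open_fg gU) dA noeR (closed_char0 char0) L).
Qed.

Lemma forward_diag (U' : opens XX) (s : sec XX (ocap U' V)) x : torsion_free Omega ->
  ideal_square (kernel_ideal Delta) s -> U x -> U' (Delta x) ->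
  exists (W' : opens XX) (_ : W' `<=` U') (WVUV : ocap W' V `<=` ocap U' V) (t : sec XX W'),
    [/\ W' (Delta x), ideal_square (kernel_ideal Delta) t & res (@ocapl _ W' V) t = res WVUV s].
Proof.
move=> tf hs Ux U'x; have Wx := diag_mem diagD Ux.
pose N := ocap U' W; have NW : N `<=` W := @ocapr _ _ _; have Nx : N (Delta x) by [].
have MU : ocap N V `<=` ocap U' V by move=> y [[]].
have [t ht] := chart_extend ch (product_domain intX gU gU) noeR NW (res MU s)
   (product_normal char0 intX nX gU gU) regular_V.
have hs' := ideal_square_res MU hs.
have [e [Ue ee eI]] := diag_generic; have We := diag_mem diagD Ue.
have pI := diag_ideal_prime eps dA.
have Ne : N (Delta e).
  have [f [nf h]] := ch_basis ch Wx Nx; apply: h => //; rewrite eI => If; apply: nf.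
  exact: (diag_sub_pt diagD intX gU psi1 psi2 eps1 eps2 Ux If).
have Me : ocap N V (Delta e) by split=> //; exact: diag_generic_V.
have L := ch_loc ch Wx; have pz := ch_prime ch Wx.
have Le := ch_loc ch We; have pze := ch_prime ch We.
have [u [v [nv /= euv]]] := la_frac L (germ (Delta x) Nx t).
(* The fraction u / v found at [Delta x] represents [t] at the generic point of the diagonal too,
   because [t] has one value in the fraction field. *)
have euv' : germ (Delta e) We (psi v) * germ (Delta e) Ne t = germ (Delta e) We (psi u).
  have [K [io [io_inj _]]] := frac_exists (product_domain intX gU gU).
  have := congr1 (stK ch io_inj Wx) euv; rewrite rmorphM !stKE.
  have cst := stK_const ch (product_domain intX gU gU) io_inj NW t Nx Ne.
  rewrite (Prop_irrelevance (NW _ Nx) Wx) (Prop_irrelevance (NW _ Ne) We) in cst.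
  rewrite cst => e1; apply: (@stK_inj _ _ _ _ _ ch _ _ io_inj _ We).
  by rewrite rmorphM !stKE.
have Eu : ext (loc We) (pt psi (Delta e)) (iprod I I) (loc We u).
  have := ext_of_square diagD intX gU psi1 psi2 ch eps1 eps2 Me Ue We hs'.
  rewrite -ht (germ_res (@ocapl _ N V) Me Ne) => h.
  by rewrite /= -euv'; apply: (idealMl _ (ext_ideal pze Le (iprod_ideal I I))).
have [w [nw sq]] := ext_locE Le Eu; rewrite eI in nw.
have Iu : I u.
  have : I (w * u).
    by apply: (@iprod_sub _ _ _ I hI _ _ sq) => a b Ia Ib; exact: (idealMl _ hI).
  by case: pI => _ _ pr /pr[].
have [su esu] := tp_span T u.
have kder : kderivation (kst X U) (fun a (m : msec Omega U) => a *: m) (dapp der U).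
  by split; [exact: raddfB|exact: dapp_leibniz|exact: dapp_kst].
have [|||Phi [PB PE PM Psq]] := derivation_lift T eps1 eps2 kder.
- by move=> a m m'; rewrite scalerBr.
- by move=> m a b; rewrite scalerBl.
- by move=> a b m; rewrite scalerA.
have Pu : Phi u = dgen der su.
  by rewrite esu (zmod_morph_sum _ _ PB); apply: eq_bigr => p _; rewrite PE.
have wm : eps w *: dgen der su = 0.
  by have := PM w u; rewrite (Psq _ sq) Iu scale0r addr0 Pu.
(* The function [eps w] is nonzero and kills the differential. Functionals take values in domains
   over nonempty opens, so they all vanish on it: it is torsion. *)
have m0 : dgen der su = 0.
  apply: tf => W2 W2U phi.
  have e1 : res W2U (eps w) * happ phi (fun _ h => h) (mres Omega W2U (dgen der su)) = 0.
    have := congr1 (fun m => happ phi (fun _ h => h) (mres Omega W2U m)) wm.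
    by rewrite mres_scale linearZ !raddf0.
  have [[y W2y]|no] := pselect (exists y, W2 y); last first.
    by apply: sec_eq_germs => y W2y; case: no; exists y.
  have [_ dom] : is_domain (sec X W2) by case: intX => _; apply; exists y.
  have [h|//] := dom _ _ e1; case: nw; apply: (good_germ_inj intX gU (Ux := W2U y W2y)).
  by rewrite -(germ_res W2U W2y) h !rmorph0.
have Su := kahler_detects Ux Wx (s := su); rewrite -esu in Su; have {}Su := Su Iu m0.
have St : ext (loc Wx) (pt psi (Delta x)) (iprod I I) (germ (Delta x) Nx t).
  have [v' hv] := la_unit L nv.
  rewrite (_ : germ (Delta x) Nx t = v' * germ (Delta x) Wx (psi u)).
    by apply: (idealMl _ (ext_ideal pz L (iprod_ideal I I))).
  by rewrite -euv mulrA (mulrC v') hv mul1r.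
have [W' [WN [n [a [b [W'x ka kb et]]]]]] := square_of_ext diagD intX gU psi1 psi2 eps1 eps2 NW St.
have W'U : W' `<=` U' by move=> y /WN[].
have WVUV : ocap W' V `<=` ocap U' V by move=> y [/W'U].
exists W', W'U, WVUV, (res WN t); split=> //.
  by move=> y W'y; exists W', (fun _ h => h), n, a, b; rewrite res_id.
have W'M : ocap W' V `<=` ocap N V by move=> y [/WN].
by rewrite -(res_res MU W'M) -ht !(res_res _ _ (subset_trans W'M (@ocapl _ N V))).
Qed.

End Forward.

(** * From surjectivity to torsion-freeness *)

Section TorsionDerivation.
Variables (k : closedFieldType) (X : scheme k) (intX : integral_scheme X).
Variables (U : opens X) (gU : good_open U).
Local Notation A := (sec X U).
Local Notation idA := [the {rmorphism A -> A} of idfun].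
Variables (Omega : omod X) (der : derivation Omega).
Hypothesis kah : is_kahler der.
Variable del : A -> A.
Hypothesis kdel : kderivation (kst X U) *%R del.
Let dA := good_open_domain intX gU.
Let chU := good_open_chart intX gU.

(** A derivation of [A] must be made into a member of the dual over [N], for only those are known to
    kill torsion. It acts first on the generic stalk through [kahler_at], and its values there are
    shown to come from sections over each smaller open. *)
Lemma torsion_del (N : opens X) (NU : N `<=` U) (n : msec Omega N) (f : A) (s : seq (A * A)) z :
  torsion n -> N z -> invertible (res NU f) ->
  res NU f *: n = mres Omega NU (dgen der s) -> \sum_(p <- s) p.1 * del p.2 = 0.
Proof.
move=> tn Nz uf es; have [e [Ue ee]] := generic_point chU dA.
have mem (M : opens X) y : M `<=` U -> M y -> M e.
  by move=> MU My; exact: (generic_mem chU Ue ee (MU _ My) My).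
have L := ch_loc chU Ue; have pz := ch_prime chU Ue.
have [delB delM delk] := kdel.
have [D [DB DM DE]] := derivation_loc pz L delB delM.
have Dk c : D (germ e (I : otop X e) (kst X (otop X) c)) = 0.
  have -> : germ e (I : otop X e) (kst X (otop X) c) = germ e Ue (kst X U c).
    by apply/germ_eq; exists U, (fun _ _ => I), (fun _ h => h); rewrite !res_kst.
  by have := DE (kst X U c); rewrite /= delk rmorph0.
have [lam [lamB lamZ lamR lamd]] := @kahler_at _ X e (stalk e) *%R
  (fun a q q' => mulrDr a q q') (fun q a b => mulrDl a b q) (fun a b q => esym (mulrA a b q)) (@mul1r _)
  D DB DM Dk _ der kah.
have lam_gen t : lam U Ue (dgen der t) = germ e Ue (\sum_(p <- t) p.1 * del p.2).
  rewrite /dgen (zmod_morph_sum _ _ (lamB U Ue)) rmorph_sum; apply: eq_bigr => p _.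
  by rewrite lamZ lamd rmorphM; congr (_ * _); exact: (DE p.2).
have [K [io [io_inj _]]] := frac_exists dA.
have uniq (M : opens X) (MU : M `<=` U) (t t' : sec X M) :
    (forall Me : M e, germ e Me t = germ e Me t') -> t = t'.
  move=> h; apply: sec_eq => x Mx; exists M, (fun _ h => h); split=> //; rewrite !res_id.
  have Me := mem M x MU Mx.
  by apply: (stK_eq (ch := chU) dA (io_inj := io_inj) (NW := MU) (y := e) (Ny := Me)); rewrite h.
(* At every point of [M], local generators express the value with a denominator that is a unit
   there; so the value lies in all the local rings and glues. *)
have exh (M : opens X) (MU : M `<=` U) (m : msec Omega M) :
    exists t : sec X M, forall Me : M e, germ e Me t = lam M Me m.
  have [[x Mx]|no] := pselect (exists x, M x); last by exists 0 => Me; case: no; exists e.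
  have Me := mem M x MU Mx; pose c := stK chU io_inj (MU e Me) (lam M Me m).
  have [y My|t tE] := @stK_glue _ _ _ _ _ chU dA _ _ io_inj M MU c; last first.
    exists t => Me'; rewrite (Prop_irrelevance Me' Me).
    by apply: (@stK_inj _ _ _ _ _ chU _ _ io_inj _ (MU e Me)); rewrite tE.
  have [W [WM [WU [f' [s' [Wy uf' es']]]]]] := kahler_locgen kah m My (good_open_frac intX gU) (MU y My).
  have We := mem W y WU Wy.
  exists (\sum_(p <- s') p.1 * del p.2), f'; split.
    by apply/(pt_unit idA (WU y Wy)); rewrite /= -(germ_res WU Wy); exact: germ_unit.
  have := congr1 (lam W We) es'; rewrite lamZ (lamR _ _ WM Me) (lamR _ _ WU Ue) (germ_res WU We Ue).
  rewrite lam_gen => /(congr1 (stK chU io_inj Ue)); rewrite rmorphM.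
  rewrite (stKE chU io_inj Ue f') (stKE chU io_inj Ue (\sum_(p <- s') _)) => <-.
  by rewrite mulrC /c (Prop_irrelevance (MU e Me) Ue).
pose h (M : opens X) (MN : M `<=` N) m := projT1 (cid (exh M (subset_trans MN NU) m)).
have hE (M : opens X) (MN : M `<=` N) m Me : germ e Me (h M MN m) = lam M Me m by rewrite /h; case: cid.
clearbody h.
have hlin (M : opens X) (MN : M `<=` N) : linear (h M MN : msec Omega M -> (sec X M)^o).
  move=> a m m'; apply: (uniq M (subset_trans MN NU)) => Me.
  change (germ e Me (h M MN (a *: m + m')) = germ e Me (a * h M MN m + h M MN m')).
  rewrite hE (zmod_morphD _ _ (lamB M Me)) lamZ rmorphD rmorphM /=.
  by rewrite !hE.
pose H (M : opens X) (MN : M `<=` N) : {linear msec Omega M -> msec (structure_omod X) M} :=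
  HB.pack (h M MN : msec Omega M -> (sec X M)^o) (GRing.isLinear.Build _ _ _ _ (h M MN : msec Omega M -> (sec X M)^o) (hlin M MN)).
have Hres (M M' : opens X) (MN : M `<=` N) (MN' : M' `<=` N) (MM : M' `<=` M) m :
    mres (structure_omod X) MM (H M MN m) = H M' MN' (mres Omega MM m).
  apply: (uniq M' (subset_trans MN' NU)) => Me.
  change (germ e Me (res MM (h M MN m)) = germ e Me (h M' MN' (mres Omega MM m))).
  by rewrite (germ_res MM Me (MM e Me)) !hE (lamR _ _ MM (MM e Me)).
pose phi : dual Omega N := @OModHom k X Omega (structure_omod X) N H Hres.
have t0 : h N (fun _ h => h) (mres Omega (fun _ h => h) n) = 0 := tn N (fun _ h => h) phi.
have Ne := mem N z NU Nz.
have l0 : lam N Ne n = 0.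
  by rewrite -(lamR N N (fun _ h => h) Ne Ne n) -(hE N (fun _ h => h)) t0 rmorph0.
apply: (good_germ_inj intX gU (Ux := Ue)); rewrite rmorph0 -lam_gen.
by rewrite -(lamR _ _ NU Ue Ne) -es lamZ l0 mulr0.
Qed.

End TorsionDerivation.
Section Backward.
Variables (k : closedFieldType) (X XX : scheme k) (p1 p2 : mor XX X).
Variables (Delta : mor X XX).
Hypotheses (diagD : is_diagonal p1 p2 Delta) (intX : integral_scheme X).
Variables (U : opens X) (gU : good_open U).
Local Notation A := (sec X U).
Local Notation R := (tensor (kst X U) (kst X U)).
Local Notation W := (prod_opens p1 p2 U U).
Local Notation i1 := (tinl (kst X U) (kst X U)).
Local Notation i2 := (tinr (kst X U) (kst X U)).
Variable psi : {rmorphism R -> sec XX W}.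
Hypotheses (psi1 : forall a, psi (i1 a) = res (@ocapl _ _ _) (comor p1 U a))
  (psi2 : forall b, psi (i2 b) = res (@ocapr _ _ _) (comor p2 U b)) (ch : chart psi).
Variable eps : {rmorphism R -> A}.
Hypotheses (eps1 : forall a, eps (i1 a) = a) (eps2 : forall a, eps (i2 a) = a).
Local Notation I := (diag_ideal eps).
Let dA := good_open_domain intX gU.
Let T := good_tensor (good_open_fg gU) (good_open_fg gU) dA dA.
Let hI := diag_ideal_ideal eps.

Local Notation loc Wy := [the {rmorphism R -> stalk _} of germ _ Wy \o psi].
Local Notation idA := [the {rmorphism A -> A} of idfun].
Variables (Omega : omod X) (der : derivation Omega).
Hypothesis kah : is_kahler der.


Hypothesis char0 : [pchar k]%R =i pred0.
Variables (V : opens XX).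
Hypothesis V_nonsing : V = nonsingular_locus XX :> set XX.
Let noeR := product_noetherian intX gU gU.
Let dR := product_domain intX gU gU.

Lemma square_on_V u v y (Wy : W y) : I u -> ~ I v -> iprod I I (v * u) -> V y ->
  exists v', ~ pt psi y v' /\ iprod I I (v' * u).
Proof.
move=> Iu nv sq Vy; have py := ch_prime ch Wy; have hy := prime_ideal_ideal py.
(* Off the diagonal some [g] in the ideal is a unit at [y], and [g * g] multiplies every [u] of the
   ideal into the square. *)
have [sI|/nonsubset[g [Ig ng]]] := pselect (I `<=` pt psi y); last first.
  exists (g * g); split; first by case: py => _ _ pr /pr[].
  by rewrite -mulrA; apply: iprodM => //; exact: (idealMl _ hI).
apply: contrapT => no.
have cP c : iprod I I (c * u) -> pt psi y c by move=> h; apply: contrapT => nc; apply: no; exists c.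
have epsP r : pt psi y r <-> pt psi y (i1 (eps r)).
  have h : pt psi y (r - i1 (eps r)) by apply: sI; rewrite /diag_ideal /mkset rmorphB eps1 subrr.
  split=> h'; first by rewrite -(subKr r (i1 (eps r))); apply: (idealB hy).
  by rewrite -(subrK (i1 (eps r)) r); apply: (idealD hy).
pose P := [set a | pt psi y (i1 a)].
have pP : prime_ideal P.
  have [_ y1 pr] := py; split; first split; rewrite /P /mkset.
  - by rewrite rmorph0; exact: (ideal0 hy).
  - by move=> a b *; rewrite rmorphD; exact: (idealD hy).
  - by move=> a b *; rewrite rmorphM; exact: (idealMl _ hy).
  - by rewrite rmorph1.
  - by move=> a b; rewrite rmorphM => /pr.
(* A closed point of the diagonal specializing [y] is sought where [f0] is nonzero, which keeps it
   in [V]. A multiplier outside its prime is then outside the prime of [y] as well. *)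
have [f0 [nf0 hV]] := ch_basis ch Wy Vy.
have nPf : ~ P (eps f0) by move=> /(proj2 (epsP f0)).
have [phi [phik phiP phif]] := nullstellensatz (good_open_fg gU) pP nPf.
pose z := [set r : R | phi (eps r) = 0].
have pz : prime_ideal z.
  split; first split; rewrite /z /mkset.
  - by rewrite !rmorph0.
  - by move=> a b ha hb; rewrite !rmorphD ha hb addr0.
  - by move=> a b hb; rewrite !rmorphM hb mulr0.
  - by rewrite !rmorph1 => /eqP; rewrite oner_eq0.
  - by move=> a b; rewrite !rmorphM => /eqP; rewrite mulf_eq0 => /orP[]/eqP ->; [left|right].
have [y' [Wy' ey']] := ch_surj ch pz.
have Vy' : V y' by apply: hV => //; rewrite ey' /z /mkset; exact/eqP.
have L := ch_loc ch Wy'; rewrite ey' in L.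
have reg : regular_local (stalk y') by move: Vy'; rewrite /omem V_nonsing.
have [v' [nv' sq']] := closed_point_square T eps1 eps2 dA noeR phik L reg Iu nv sq.
by apply: nv'; rewrite /mkset; apply: phiP; exact: (proj1 (epsP v') (cP _ sq')).
Qed.

Lemma backward_diag x (N0 : opens X) (m : msec Omega N0) :
  unit_surjective V (ideal_square (kernel_ideal Delta)) -> torsion m -> N0 x -> U x ->
  exists (N : opens X) (NN : N `<=` N0), N x /\ mres Omega NN m = 0.
Proof.
move=> surj tm N0x Ux; have Wx := diag_mem diagD Ux.
have [N [NN [NU [f [s [Nx uf es]]]]]] := kahler_locgen kah m N0x (good_open_frac intX gU) Ux.
have tn : torsion (mres Omega NN m).
  move=> M MN phi; have := tm M (subset_trans MN NN) phi.
  by rewrite (mres_mres NN MN (subset_trans MN NN)).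
(* The correction by [i1] puts the lift into the diagonal ideal; its image under [Phi] is unchanged,
   since derivations kill 1. *)
pose u := \sum_(p <- s) i1 p.1 * i2 p.2 - i1 (\sum_(p <- s) p.1 * p.2).
have Iu : I u by rewrite /diag_ideal /mkset /u rmorphB (eps_span eps1 eps2) eps1 subrr.
have liftE (M : zmodType) (act : A -> M -> M) (del : A -> M) (Phi : R -> M) :
    (forall a, zmod_morphism (act a)) -> kderivation (kst X U) act del -> zmod_morphism Phi ->
    (forall a b, Phi (i1 a * i2 b) = act a (del b)) -> Phi u = \sum_(p <- s) act p.1 (del p.2).
  move=> actB [_ _ dk] PB PE; rewrite /u PB (zmod_morph_sum _ _ PB).
  rewrite -[i1 (\sum_(p <- s) _)]mulr1 -(rmorph1 i2) PE.
  rewrite -(rmorph1 (kst X U)) dk (zmod_morph0 (actB _)) subr0.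
  by apply: eq_bigr => p _; rewrite PE.
have [v [nv sq]] : exists v, ~ I v /\ iprod I I (v * u).
  have [e [Ue ee eI]] := diag_generic diagD intX gU psi1 psi2 eps1 eps2.
  have L := ch_loc ch (diag_mem diagD Ue); rewrite eI in L.
  apply: (generic_square T eps1 eps2 (good_open_fg gU) dA noeR L Iu) => del Phi kdel PB PE.
  rewrite (liftE _ _ _ _ _ kdel PB PE); last by move=> a b c; rewrite mulrBr.
  exact: (torsion_del intX gU kah kdel tn Nx uf es).
pose s0 : sec XX (ocap W V) := res (@ocapl _ W V) (psi u).
have hs0 : ideal_square (kernel_ideal Delta) s0.
  move=> y [Wy Vy]; have [v' [nv' sq']] := square_on_V Wy Iu nv sq Vy.
  have Oy : ocap W V y by [].
  apply: (square_of_ext diagD intX gU psi1 psi2 eps1 eps2 (@ocapl _ W V) (Ny := Oy) (Wy := Wy)).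
  exists (v' * u), v'; split=> //.
  by rewrite (germ_res (@ocapl _ W V) Oy Wy) rmorphM.
have [W' [W'W [WVWV [t [W'x ht et]]]]] := surj W s0 hs0 (Delta x) Wx.
have Su := ext_of_square diagD intX gU psi1 psi2 ch eps1 eps2 W'x Ux Wx ht.
(* The two sections agree on [V], which contains the generic point of the chart, and a section is
   determined by its value there. *)
have etu : t = res W'W (psi u).
  have [K [io [io_inj _]]] := frac_exists dR.
  have [e [We ee]] := generic_point ch dR.
  have W'e : W' e by exact: (generic_mem ch We ee Wx W'x).
  have Ve : V e by rewrite /omem V_nonsing; exact: (chart_generic_regular ch noeR We ee).
  have Oe : ocap W' V e by [].
  apply: (stK_eq (ch := ch) dR (io_inj := io_inj) (NW := W'W) (y := e) (Ny := W'e)); congr (stK _ _ _ _).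
  rewrite -(germ_res (@ocapl _ W' V) Oe W'e) et /s0.
  by rewrite (res_res _ _ (subset_trans (@ocapl _ W' V) W'W)) (germ_res _ Oe We) (germ_res W'W W'e We).
rewrite etu (germ_res W'W W'x Wx) in Su.
have [w [nw sqw]] := ext_locE (ch_loc ch Wx) Su.
have kder : kderivation (kst X U) (fun a (m : msec Omega U) => a *: m) (dapp der U).
  by split; [exact: raddfB|exact: dapp_leibniz|exact: dapp_kst].
have actB a : zmod_morphism (fun m : msec Omega U => a *: m) by move=> m1 m2; rewrite scalerBr.
have [|||Phi [PB PE PM Psq]] := derivation_lift T eps1 eps2 kder.
- exact: actB.
- by move=> m' a b; rewrite scalerBl.
- by move=> a b m'; rewrite scalerA.
have wm : eps w *: dgen der s = 0.
  by have := PM w u; rewrite (Psq _ sqw) Iu scale0r addr0 (liftE _ _ _ _ actB kder PB PE).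
(* [w] is outside the prime of [Delta x], so [eps w] is a unit near [x]; together with the unit [f]
   it can be cancelled from the vanishing differential. *)
have /germ_unit_nbhd[M [MU [Mx uw]]] : invertible (germ x Ux (eps w)).
  exact/(diag_pt diagD intX gU psi1 psi2 eps1 eps2 Ux).
pose Z := ocap N M; have ZN : Z `<=` N := @ocapl _ _ _; have ZM : Z `<=` M := @ocapr _ _ _.
exists Z, (subset_trans ZN NN); split=> //.
have unitZ (C : comPzRingType) (F : lmodType C) (c : C) (q : F) : invertible c -> c *: q = 0 -> q = 0.
  by move=> [b cb] e; rewrite -(scale1r q) -cb mulrC -scalerA e scaler0.
have uf' : invertible (res (subset_trans ZN NU) f).
  by rewrite -(res_res NU ZN); exact: (rmorph_invertible (res ZN) uf).
have uw' : invertible (res (subset_trans ZN NU) (eps w)).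
  rewrite (res_irr _ (subset_trans ZM MU)) -(res_res MU ZM); exact: (rmorph_invertible (res ZM) uw).
apply: (unitZ _ _ _ _ uf'); apply: (unitZ _ _ _ _ uw').
have := congr1 (mres Omega ZN) es; rewrite mres_scale (res_res NU ZN (subset_trans ZN NU)).
rewrite (mres_mres NN ZN (subset_trans ZN NN)) (mres_mres NU ZN (subset_trans ZN NU)) => ->.
by rewrite -mres_scale wm raddf0.
Qed.

End Backward.

(** Over the complement of the diagonal every section pulls back to zero along [Delta], the pullback
    living over the empty set. Hence any extension [t], written as [t * 1], is a product of two
    sections of the ideal. *)
Lemma off_diagonal_extend (k : closedFieldType) (char0 : [pchar k]%R =i pred0) (X XX : scheme k)
    (p1 p2 : mor XX X) (prodXX : is_fibre_product p1 p2) (intX : integral_scheme X)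
    (nX : normal_scheme X) (ftX : finite_type X) (Delta : mor X XX)
    (cD : closed (Delta @` setT)) (V : opens XX) (V_nonsing : V = nonsingular_locus XX :> set XX)
    (U' : opens XX) (s : sec XX (ocap U' V)) y : U' y -> ~ (Delta @` setT) y ->
  exists (W' : opens XX) (_ : W' `<=` U') (WVUV : ocap W' V `<=` ocap U' V) (t : sec XX W'),
    [/\ W' y, ideal_square (kernel_ideal Delta) t & res (@ocapl _ W' V) t = res WVUV s].
Proof.
move=> U'y ny.
have [U1 [U1y g1]] := good_open_exists (p1 y) ftX; have [U2 [U2y g2]] := good_open_exists (p2 y) ftX.
have [psi [_ _ ch]] := product_psi prodXX intX g1 g2.
set W := prod_opens p1 p2 U1 U2 in psi ch.
pose N := ocap U' W; have NW : N `<=` W := @ocapr _ _ _.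
have MU : ocap N V `<=` ocap U' V by move=> z [[]].
have rV z : regular_local (stalk z) -> V z by move=> h; rewrite /omem V_nonsing.
have [t ht] := chart_extend ch (product_domain intX g1 g2) (product_noetherian intX g1 g2) NW (res MU s)
   (product_normal char0 intX nX g1 g2) rV.
have oC : open (~` (Delta @` setT)) by rewrite openC.
pose W' := ocap N (Opens oC); have W'N : W' `<=` N := @ocapl _ _ _.
have W'U : W' `<=` U' by move=> z [[]].
have WVUV : ocap W' V `<=` ocap U' V by move=> z [/W'U].
exists W', W'U, WVUV, (res W'N t); split=> //.
  move=> z W'z; exists W', (fun _ h => h), 1%N, (fun _ => res W'N t), (fun _ => 1).
  have kz (c : sec XX W') : kernel_ideal Delta c.
    by apply: sec_eq_germs => x Wx; case: Wx => _ []; exists x.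
  by split=> //; rewrite big_ord1 mulr1 res_id.
have W'M : ocap W' V `<=` ocap N V by move=> z [/W'N].
by rewrite -(res_res MU W'M) -ht !(res_res _ _ (subset_trans W'M (@ocapl _ N V))).
Qed.

Theorem theorem1p1 (k : closedFieldType) (char0 : [pchar k]%R =i pred0)
    (X : scheme k) (varX : variety X) (normalX : normal_scheme X)
    (XX : scheme k) (p1 p2 : mor XX X) (prodXX : is_fibre_product p1 p2)
    (Delta : mor X XX) (diagDelta : is_diagonal p1 p2 Delta)
    (V : opens XX) (V_nonsing : V = nonsingular_locus XX :> set XX)
    (Omega : omod X) (d : derivation Omega) (kahlerOmega : is_kahler d) :
  torsion_free Omega <->
  unit_surjective V (ideal_square (kernel_ideal Delta)).
Proof.
have [intX sepX ftX] := varX.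
have diag_lift (U : opens X) : good_open U -> exists eps : {rmorphism tensor (kst X U) (kst X U) -> sec X U},
    (forall a, eps (tinl _ _ a) = a) /\ (forall a, eps (tinr _ _ a) = a).
  move=> gU; have dA := good_open_domain intX gU; have fg := good_open_fg gU.
  exact: (tp_ring_lift (good_tensor fg fg dA dA) (f := [the {rmorphism sec X U -> sec X U} of idfun])
    (g := [the {rmorphism sec X U -> sec X U} of idfun]) (fun _ => erefl)).
split=> [tf U' s hs y U'y|surj U0 m tm].
  have [[x _ exy]|ny] := pselect ((Delta @` setT) y); last first.
    have [_ cD _] := sepX XX p1 p2 Delta prodXX diagDelta.
    by apply: (off_diagonal_extend char0 prodXX) => //; apply: cD; exact: closedT.
  subst y; have [U [Ux gU]] := good_open_exists x ftX.
  have [psi [psi1 psi2 ch]] := product_psi prodXX intX gU gU.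
  have [eps [eps1 eps2]] := diag_lift U gU.
  exact: (forward_diag diagDelta intX gU psi1 psi2 ch eps1 eps2 kahlerOmega normalX char0 V_nonsing tf hs Ux).
apply: msec_eq => x Ux0; have [U [Ux gU]] := good_open_exists x ftX.
have [psi [psi1 psi2 ch]] := product_psi prodXX intX gU gU.
have [eps [eps1 eps2]] := diag_lift U gU.
have [N [NU0 [Nx e]]] :=
  backward_diag diagDelta intX gU psi1 psi2 ch eps1 eps2 kahlerOmega V_nonsing surj tm Ux0 Ux.
by exists N, NU0; split=> //; rewrite e raddf0.
Qed.
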